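(* Let $M$ be a compact convex $m$-dimensional Riemannian manifold with constant non-positive sectional curvature. Then $$\Phi(M)\geq\frac{1}{m+1},$$ where $\Phi(M)=\max_{x\in M}\ \min_{v\in T_x^1M}\ \frac{\operatorname{vol} H(x,v)}{\operatorname{vol} M}$ is the fair-cut index of $M$.
   Context: Riemannian manifolds are allowed to have boundary. A Riemannian manifold $M$ is \emph{convex} if any two points $p,q\in M$ are joined by a unique geodesic arc $[p,q]$, whose interior is disjoint from the boundary of $M$. $T^1_xM$ denotes the set of unit vectors in $T_xM$. For $x\in M$ and $v\in T^1_xM$, the \emph{half-space} $H(x,v)$ consists of all $y\in M$ such that the geodesic $[x,y]$ makes an angle $\leq\frac{\pi}{2}$ with $v$ at $x$ (the point $y=x$ is counted as belonging to $H(x,v)$). Volumes are Riemannian volumes. *)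

(* Defs.v *)
From HB Require Import structures.
From mathcomp Require Import all_boot all_order all_algebra.
From mathcomp Require Import all_classical all_reals all_analysis.

Set Implicit Arguments.
Unset Strict Implicit.
Unset Printing Implicit Defensive.

Import Order.TTheory GRing.Theory Num.Theory.
Import numFieldNormedType.Exports.

Local Open Scope classical_set_scope.
Local Open Scope ring_scope.

Section Calculus.
Context {R : realType} {m : nat}.

Definition partial {V : normedModType R} (i : 'I_m) (f : 'rV[R]_m -> V) :
    'rV[R]_m -> V :=
  'D_(delta_mx ord0 i) f.

(* [O] is meant to be open. *)
Fixpoint Ck_on {V : normedModType R} (k : nat) (O : set 'rV[R]_m)
    (f : 'rV[R]_m -> V) : Prop :=
  if k is k'.+1 then
    (forall x, O x -> differentiable f x) /\
    (forall i, Ck_on k' O (partial i f))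
  else forall x, O x -> {for x, continuous f}.

Definition smooth_on {V : normedModType R} (O : set 'rV[R]_m)
    (f : 'rV[R]_m -> V) : Prop :=
  forall k, Ck_on k O f.

(* {y | 0 <= y_0}, the model space of manifolds with boundary; the coordinate
   of index 0 is unique when 0 < m. *)
Definition model_halfspace : set 'rV[R]_m :=
  [set y | forall i : 'I_m, i = 0%N :> nat -> 0 <= y ord0 i].

End Calculus.

(* [tau] is a smooth local extension, on the neighbourhood [W] of [phi x] in
   R^m, of the change of coordinates from [phi] to [psi] on the domain [D]. *)
Definition transition_near (R : realType) (m : nat) (M : Type) (D : set M)
    (phi psi : M -> 'rV[R]_m) (x : M)
    (W : set 'rV[R]_m) (tau : 'rV[R]_m -> 'rV[R]_m) : Prop :=
  [/\ open W, W (phi x), smooth_on W tau &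
    forall y, D y -> W (phi y) -> psi y = tau (phi y)].

(* A smooth m-dimensional manifold with (possibly empty) boundary.
   The chart [c] is a homeomorphism from the open set [dom c] onto the
   relatively open subset [img c `&` model_halfspace] of the half-space, with
   inverse [param c]; the values of [chart_map c] off [dom c] and of [param c] off
   this set are irrelevant.  The transition maps are smooth in the usual sense
   for subsets of the half-space: they locally extend to smooth maps on open
   subsets of R^m. *)
Record smooth_atlas (R : realType) (m : nat) (M : topologicalType) := SmoothAtlas {
  chart : Type ;
  dom : chart -> set M ;
  img : chart -> set 'rV[R]_m ;
  chart_map : chart -> M -> 'rV[R]_m ;
  param : chart -> 'rV[R]_m -> M ;
  chart_at : M -> chart ;
  atlas_hausdorff : hausdorff_space M ;
  atlas_second_countable : @second_countable M ;
  chart_atP : forall x, dom (chart_at x) x ;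
  dom_open : forall c, open (dom c) ;
  img_open : forall c, open (img c) ;
  chart_map_img : forall c x, dom c x -> (img c `&` model_halfspace) (chart_map c x) ;
  param_dom : forall c y, (img c `&` model_halfspace) y -> dom c (param c y) ;
  chart_mapK : forall c x, dom c x -> param c (chart_map c x) = x ;
  paramK : forall c y, (img c `&` model_halfspace) y -> chart_map c (param c y) = y ;
  chart_map_continuous : forall c, {within dom c, continuous (chart_map c)} ;
  param_continuous :
    forall c, {within img c `&` model_halfspace, continuous (param c)} ;
  transition_smooth : forall c d x, dom c x -> dom d x ->
    exists W tau, transition_near (dom c `&` dom d) (chart_map c) (chart_map d) x W tau }.

Section Atlas.
Context {R : realType} {m : nat} {M : topologicalType} (A : smooth_atlas R m M).

Definition manifold_boundary : set M :=
  [set x | exists c : chart A, dom c x /\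
    exists2 i : 'I_m, i = 0%N :> nat & chart_map c x ord0 i = 0].

End Atlas.

(* The metric in the chart [c] is the Gram matrix field [metric c]: the inner
   product of the vectors with coordinate rows u, v at [chart_map c x] is
   u *m metric c (chart_map c x) *m v^T.  Its values at points of [img c] outside
   the half-space only serve as a smooth extension, so that derivatives at
   boundary points (which do not depend on the extension) can be taken as
   ordinary ones.  The Jacobian 'J f a acts on rows from the right:
   'D_v f a = v *m 'J f a. *)
Record riemannian_manifold (R : realType) (m : nat) (M : topologicalType) :=
  RiemannianManifold {
  atlas :> smooth_atlas R m M ;
  metric : chart atlas -> 'rV[R]_m -> 'M[R]_m ;
  metric_smooth : forall c, smooth_on (img c) (metric c) ;
  metric_sym : forall c y, (img c `&` model_halfspace) y ->
    (metric c y)^T = metric c y ;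
  metric_pos : forall c y, (img c `&` model_halfspace) y ->
    forall u : 'rV[R]_m, u != 0 -> 0 < (u *m metric c y *m u^T) ord0 ord0 ;
  metric_compat : forall c d x, dom c x -> dom d x ->
    forall W tau,
    transition_near (dom c `&` dom d) (chart_map c) (chart_map d) x W tau ->
      metric c (chart_map c x) =
        'J tau (chart_map c x) *m metric d (chart_map d x) *m ('J tau (chart_map c x))^T }.

Section Curvature.
Context {R : realType} {m : nat}.
Variable g : 'rV[R]_m -> 'M[R]_m.
Implicit Types (y u v : 'rV[R]_m) (i j k l : 'I_m).

Definition gdot y u v : R := (u *m g y *m v^T) ord0 ord0.

(* Gamma^k_{ij} *)
Definition christoffel k i j y : R :=
  2^-1 * \sum_l invmx (g y) k l *
    (partial i (fun z => g z j l) y + partial j (fun z => g z i l) y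
     - partial l (fun z => g z i j) y).

(* The component of R(d_i, d_j) d_k along d_l, for the sign convention
   R(X, Y) = [nabla_X, nabla_Y] - nabla_[X, Y]. *)
Definition riemann l k i j y : R :=
  partial i (christoffel l j k) y - partial j (christoffel l i k) y
  + \sum_s (christoffel l i s y * christoffel s j k y
            - christoffel l j s y * christoffel s i k y).

(* R(u, v) v *)
Definition curvature_vec y u v : 'rV[R]_m :=
  \row_l \sum_i \sum_j \sum_k
    u ord0 i * v ord0 j * v ord0 k * riemann l k i j y.

Definition sectional_curvature y u v : R :=
  gdot y (curvature_vec y u v) u /
  (gdot y u u * gdot y v v - gdot y u v ^+ 2).

End Curvature.

Section Geometry.
Context {R : realType} {m : nat} {M : topologicalType}.
Variable G : riemannian_manifold R m M.

Definition constant_sectional_curvature (K : R) : Prop :=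
  forall (c : chart G) x, dom c x ->
  forall u v : 'rV[R]_m, free [:: u; v] ->
    sectional_curvature (metric c) (chart_map c x) u v = K.

(* A geodesic parametrized by [0, 1] with constant speed; [gamma] is irrelevant
   off [0, 1].  In coordinates it is locally the restriction of a twice
   differentiable curve [xi], which makes derivatives at the endpoints
   ordinary. *)
Definition geodesic_arc (gamma : R -> M) (p q : M) : Prop :=
  [/\ gamma 0 = p, gamma 1 = q &
    forall (c : chart G) (t : R), 0 <= t <= 1 -> dom c (gamma t) ->
    exists xi : R -> 'rV[R]_m, \forall s \near t,
      [/\ derivable xi s 1, derivable (derive1 xi) s 1 &
        0 <= s <= 1 ->
        [/\ dom c (gamma s), chart_map c (gamma s) = xi s &
          forall k, (derive1n 2 xi s) ord0 k +
            \sum_i \sum_j christoffel (metric c) k i j (xi s) *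
              (derive1 xi s) ord0 i * (derive1 xi s) ord0 j = 0]]].

Definition convex_manifold : Prop :=
  forall p q : M, p <> q ->
  [/\ exists gamma, geodesic_arc gamma p q,
      forall gamma1 gamma2, geodesic_arc gamma1 p q -> geodesic_arc gamma2 p q ->
        forall t, 0 <= t <= 1 -> gamma1 t = gamma2 t &
      forall gamma, geodesic_arc gamma p q ->
        forall t, 0 < t < 1 -> ~ manifold_boundary G (gamma t)].

(* T_x M is represented by 'rV[R]_m through the coordinates of [chart_at G x]. *)
Definition tangent_dot (x : M) (u v : 'rV[R]_m) : R :=
  gdot (metric (chart_at G x)) (chart_map (chart_at G x) x) u v.

Definition tangent_norm (x : M) (u : 'rV[R]_m) : R :=
  Num.sqrt (tangent_dot x u u).

Definition unit_tangent (x : M) : set 'rV[R]_m := [set v | tangent_norm x v = 1].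

Definition tangent_angle (x : M) (u v : 'rV[R]_m) : R :=
  acos (tangent_dot x u v / (tangent_norm x u * tangent_norm x v)).

Definition initial_velocity (gamma : R -> M) (w : 'rV[R]_m) : Prop :=
  let c := chart_at G (gamma 0) in
  t^-1 *: (chart_map c (gamma t) - chart_map c (gamma 0)) @[t --> 0^'+] --> w.

Definition half_space (x : M) (v : 'rV[R]_m) : set M :=
  [set y | y = x \/ exists gamma w,
    [/\ geodesic_arc gamma x y, initial_velocity gamma w &
        tangent_angle x w v <= pi / 2]].

End Geometry.

Notation borel T := (g_sigma_algebraType (@open T)).

(* Lebesgue measure on the Borel sets of R^m is the unique measure that gives
   every box its elementary volume. *)
Definition is_lebesgue (R : realType) (m : nat)
    (lambda : {measure set (borel 'rV[R]_m) -> \bar R}) : Prop :=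
  forall a b : 'rV[R]_m, (forall i, a ord0 i <= b ord0 i) ->
    lambda [set y : 'rV[R]_m | forall i, a ord0 i <= y ord0 i <= b ord0 i] =
    (\prod_i (b ord0 i - a ord0 i))%:E.

(* The Riemannian volume is the unique Borel measure with density
   sqrt (det g) with respect to Lebesgue measure in every chart. *)
Definition is_riemannian_volume (R : realType) (m : nat) (M : ptopologicalType)
    (G : riemannian_manifold R m M)
    (vol : {measure set (borel M) -> \bar R}) : Prop :=
  exists2 lambda : {measure set (borel 'rV[R]_m) -> \bar R},
    is_lebesgue lambda &
    forall (c : chart G) (B : set (borel M)), measurable B -> B `<=` dom c ->
      vol B = (\int[lambda]_(y in chart_map c @` B)
                 (Num.sqrt (\det (metric c y)))%:E)%E.

Section FairCut.
Context {R : realType} {m : nat} {M : ptopologicalType}.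
Variables (G : riemannian_manifold R m M).
Variable vol : {measure set (borel M) -> \bar R}.

Definition is_minimum (S : set R) (a : R) : Prop := S a /\ lbound S a.
Definition is_maximum (S : set R) (a : R) : Prop := S a /\ ubound S a.

Definition cut_ratio (x : M) (v : 'rV[R]_m) : R :=
  fine (vol (half_space G x v)) / fine (vol [set: M]).

(* [phi] is the maximum over x of the minimum over v of the cut ratio, both
   extrema being attained; [f x] is the minimum at x. *)
Definition is_fair_cut_index (phi : R) : Prop :=
  exists f : M -> R,
    (forall x, is_minimum [set cut_ratio x v | v in unit_tangent G x] (f x)) /\
    is_maximum (range f) phi.

End FairCut.

(* Main.v *)
Require Import Defs.
From mathcomp Require Import all_boot all_order all_algebra.
From HB Require Import structures.
From mathcomp Require Import all_classical all_reals all_analysis.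
From mathcomp Require Import measurable_realfun ring lra.
Import Order.TTheory GRing.Theory Num.Theory.
Import numFieldNormedType.Exports.
Local Open Scope classical_set_scope.
Local Open Scope ring_scope.
Set Implicit Arguments.
Unset Strict Implicit.
Unset Printing Implicit Defensive.

(* Constant curvature K <= 0 says exactly that the linear system Hess f = - K f g is integrable.
   In a chart its solutions are described by parallel frames, and gluing them along the geodesics
   issued from an interior point gives a developing map F of M into the model space, realised in
   R^(1+m) as a piece of an affine hyperplane (K = 0) or of a hyperboloid sheet (K < 0).
   F sends geodesics to lines or hyperbolas, so half-spaces become sets { l o F >= 0 } with l
   linear, and by convexity of M the positive cone over F(M) is convex.  Radon's argument on that
   cone is Helly's theorem for half-spaces with Helly number m + 1.  Any m + 1 half-spaces of
   relative volume greater than m / (m + 1) meet, so by Helly and compactness all of them have a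
   common point x; a half-space at x of relative volume less than 1 / (m + 1) would have a
   slightly tilted complement among them that misses x.
   The extrema are attained because the volume of { l o F >= 0 } is continuous in l != 0, the
   hypersurfaces { l o F = 0 } being null. *)

(** * Differential calculus on the half-space *)

(** Two obstacles shape the proof. First, the identities of the metric hold on the half-space only,
    so at boundary points they are differentiated through [partial_vanish]; the parallel frames,
    though, are transported over a full ball of R^m and are differentiable in the ordinary sense
    even at boundary points. Second, geodesics are not obtained from a nonlinear flow: only linear
    equations are solved. The map F is defined outright as the model exponential of the initial
    velocity of [x0, y]; geodesics to nearby points are found by pulling hyperbolas back through a
    local inverse of F, and the uniqueness in convexity identifies them with the given arcs.
    Continuous dependence of [x0, y] on y is thus a conclusion. The local inverse exists around
    interior points only; boundary points are reached afterwards, as limits along arcs. The cases K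
    = 0 and K < 0 share all formulas because the form b = diag(1, K g0) may degenerate: at K = 0 the
    equation X b X^T = 1 with positive first coordinate is that of the affine hyperplane. *)

Section Calculus.
Context {R : realType} {m : nat}.
Implicit Types (f g : 'rV[R]_m -> R) (y v : 'rV[R]_m) (O : set 'rV[R]_m).

Lemma derive_partialE (W : normedModType R) (f : 'rV[R]_m -> W) y v :
  differentiable f y -> 'D_v f y = \sum_i v ord0 i *: partial i f y.
Proof.
move=> df; rewrite deriveE// {1}(row_sum_delta v) linear_sum.
by apply: eq_bigr => i _; rewrite linearZ /partial deriveE.
Qed.

Lemma ler_coord (v : 'rV[R]_m) i : `|v ord0 i| <= `|v|.
Proof.
rewrite [leRHS]/Num.Def.normr/= mx_normrE.
exact: (le_bigmax _ (fun i : 'I_1 * 'I_m => `|v i.1 i.2|) (ord0, i)).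
Qed.

Lemma normr_ball (y z : 'rV[R]_m) (r : R) : ball y r z = (`|y - z| < r).
Proof. by rewrite -ball_normE. Qed.

Lemma sum_coord_le (G : 'I_m -> R) v (e : R) : (forall i, `|G i| <= e) ->
  `|\sum_i v ord0 i * G i| <= m%:R * e * `|v|.
Proof.
move=> Ge; apply: le_trans (ler_norm_sum _ _ _) _.
rewrite -mulrA mulr_natl -[X in _ *+ X](card_ord m) -sumr_const.
apply: ler_sum => i _; rewrite normrM mulrC.
by apply: ler_pM => //; exact: ler_coord.
Qed.

(** The candidate differential, packaged as a linear map so that uniqueness of the differential
    applies. *)
Definition lin_form (G : 'I_m -> R) (v : 'rV[R]_m) : R := \sum_i v ord0 i * G i.

Lemma lin_form_is_linear G : linear (lin_form G).
Proof.
move=> a u v; rewrite /lin_form scaler_sumr -big_split/=.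
by apply: eq_bigr => i _; rewrite !mxE mulrDl scalerAl.
Qed.
HB.instance Definition _ G :=
  GRing.isLinear.Build R 'rV[R]_m R _ (lin_form G) (lin_form_is_linear G).

Lemma lin_form_continuous G : continuous (lin_form G : 'rV[R]_m -> R).
Proof.
pose e := \sum_i `|G i|.
have Ge i : `|G i| <= e by rewrite /e (bigD1 i)//= lerDl sumr_ge0.
apply/linear_bounded_continuous/bounded_funP => r; exists (m%:R * e * r) => x xr.
apply: le_trans (sum_coord_le x Ge) _; apply: ler_wpM2l => //.
by rewrite mulr_ge0// sumr_ge0.
Qed.

(** Differentiability with prescribed partial derivatives becomes a single increment estimate; the
    transported frames satisfy such an estimate before anything else is known about their
    regularity. *)
Lemma differentiable_incr f y (G : 'I_m -> R) :
  (differentiable f y /\ forall i, partial i f y = G i) <->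
  (forall e : R, 0 < e -> \forall v \near (0 : 'rV[R]_m),
    `|f (y + v) - f y - \sum_i v ord0 i * G i| <= e * `|v|).
Proof.
split=> [[df pf] e e0|H].
  have /eqaddoP/(_ _ e0) := diff_locally df; apply: filterS => v /=.
  have E : 'd f y v = \sum_i v ord0 i * G i.
    by rewrite -deriveE// derive_partialE//; apply: eq_bigr => i _; rewrite pf.
  by rewrite !fctE/= E opprD addrA [v + y]addrC.
have dE : 'd f y = lin_form G :> ('rV[R]_m -> R).
  apply: diff_unique; first exact: lin_form_continuous.
  apply/eqaddoP => e e0; have := H e e0; apply: filterS => v /=.
  by rewrite /lin_form !fctE/= opprD addrA [v + y]addrC.
have df : differentiable f y.
  apply/diff_locallyP; split; first by rewrite dE; exact: lin_form_continuous.
  apply/eqaddoP => e e0; have := H e e0; apply: filterS => v /=.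
  by rewrite dE /lin_form !fctE/= opprD addrA [v + y]addrC.
split => // i; rewrite /partial deriveE// dE /lin_form (bigD1 i)//= !mxE !eqxx mul1r.
by rewrite big1 ?addr0// => j /negPf ji; rewrite mxE ji andbF mul0r.
Qed.

Lemma near_translate (V : normedModType R) (P : V -> Prop) (x : V) :
  (\forall z \near x, P z) -> \forall v \near (0 : V), P (x + v).
Proof.
move=> Px; have : (x + v) @[v --> (0 : V)] --> x.
  by rewrite -[X in _ --> X]addr0; apply: cvgD; [exact: cvg_cst|exact: cvg_id].
exact.
Qed.

Lemma near0_norm_le (V : normedModType R) (e : R) : 0 < e ->
  \forall v \near (0 : V), `|v| <= e.
Proof.
move=> e0; apply/nbhs_ballP; exists e => //= v.
by rewrite -ball_normE/= sub0r normrN => /ltW.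
Qed.

Lemma near_eq_differentiable f g y :
  (\forall x \near y, f x = g x) -> differentiable f y -> differentiable g y.
Proof.
move=> fg df.
have /differentiable_incr H : differentiable f y /\ forall i, partial i f y = partial i f y by [].
suff [] : differentiable g y /\ forall i, partial i g y = partial i f y by [].
apply/differentiable_incr => e e0; near=> v.
rewrite -(nbhs_singleton fg); have <- : f (y + v) = g (y + v).
  by near: v; exact: (near_translate fg).
by near: v; exact: H.
Unshelve. all: by end_near. Qed.

Lemma is_derive_line f y v (s : R) : differentiable f (y + s *: v) ->
  is_derive s 1 (fun s => f (y + s *: v)) ('D_v f (y + s *: v)).
Proof.
move=> df.
have dl : is_diff s (fun s : R => y + s *: v) (fun h => 0 + h *: v).
  exact: is_diffD.
have dc : is_diff s (f \o (fun s : R => y + s *: v))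
    ('d f (y + s *: v) \o (fun h => 0 + h *: v)).
  by apply: is_diff_comp; exact/differentiableP.
apply: DeriveDef; first by apply/derivable1_diffP; exact: ex_diff.
rewrite deriveE; last exact: ex_diff.
by rewrite (@diff_val _ _ _ _ _ _ _ dc)/= add0r scale1r deriveE.
Qed.

Lemma is_derive_chain f (xi : R -> 'rV[R]_m) (t : R) :
  differentiable f (xi t) -> derivable xi t 1 ->
  is_derive t 1 (fun s => f (xi s)) (\sum_i (derive1 xi t) ord0 i * partial i f (xi t)).
Proof.
move=> df dx; have dx' : differentiable xi t by apply/derivable1_diffP.
have dc : is_diff t (f \o xi) ('d f (xi t) \o 'd xi t).
  by apply: is_diff_comp; exact/differentiableP.
apply: DeriveDef; first by apply/derivable1_diffP; exact: ex_diff.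
rewrite deriveE; last exact: ex_diff.
rewrite (@diff_val _ _ _ _ _ _ _ dc)/= -[in LHS]deriveE// derive_partialE//.
by rewrite derive1E deriveE.
Qed.

Lemma mvt_cc (f df : R -> R) (a b : R) : a < b ->
  (forall s, a <= s <= b -> is_derive s 1 f (df s)) ->
  exists2 c, a < c < b & f b - f a = df c * (b - a).
Proof.
move=> ab fdf; have [||c] := @MVT R f df a b ab.
- move=> s; rewrite in_itv/= => /andP[sa sb].
  by apply: fdf; rewrite !ltW.
- apply/continuous_in_subspaceT => s; rewrite inE/= in_itv/= => sab.
  by apply/differentiable_continuous/derivable1_diffP; case: (fdf s sab).
- by rewrite in_itv/= => cab ->; exists c.
Qed.

Lemma mvt_line f y v :
  (forall s : R, 0 <= s <= 1 -> differentiable f (y + s *: v)) ->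
  exists2 c : R, 0 < c < 1 & f (y + v) - f y = \sum_i v ord0 i * partial i f (y + c *: v).
Proof.
move=> df.
have [|c c01] := @mvt_cc (fun s => f (y + s *: v)) (fun s => 'D_v f (y + s *: v)) 0 1 ltr01.
  by move=> s s01; apply: is_derive_line; exact: df.
rewrite scale1r scale0r addr0 subr0 mulr1 => ->.
exists c => //; rewrite derive_partialE//; apply: df.
by case/andP: c01 => c0 c1; rewrite !ltW.
Qed.

End Calculus.

Section CkClosure.
Context {R : realType} {m : nat}.
Implicit Types (f g : 'rV[R]_m -> R) (y v : 'rV[R]_m) (O : set 'rV[R]_m).

Lemma partial_ext f g O i : open O -> (forall x, O x -> f x = g x) ->
  forall x, O x -> partial i f x = partial i g x.
Proof.
move=> oO fg x Ox; apply: near_eq_derive; near=> z; apply: fg; near: z.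
exact: open_nbhs_nbhs.
Unshelve. all: by end_near. Qed.

(** [Ck_on] recurses through partial derivatives as functions on the whole space, whereas the rules
    for computing them hold on [O] only; the closure lemmas below pass from one to the other
    here. *)
Lemma Ck_ext k O f g : open O -> (forall x, O x -> f x = g x) ->
  Ck_on k O f -> Ck_on k O g.
Proof.
move=> oO; elim: k f g => [|k IH] f g fg /=.
  move=> cf x Ox; rewrite /prop_for/continuous_at -fg//.
  apply: cvg_trans (cf x Ox); apply: (@near_eq_cvg _ _ (nbhs x)).
  by apply: filterS (open_nbhs_nbhs (conj oO Ox)) => z; exact: fg.
move=> [df pf]; split=> [x Ox|i]; last exact: IH (partial_ext i oO fg) (pf i).
apply: near_eq_differentiable (df x Ox); near=> z; apply/fg; near: z.
exact: open_nbhs_nbhs.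
Unshelve. all: by end_near. Qed.

Lemma CkW k O f : Ck_on k.+1 O f -> Ck_on k O f.
Proof.
elim: k f => [|k IH] f [df pf]; last by split=> // i; exact: IH.
by move=> x Ox; apply/differentiable_continuous/df.
Qed.

Lemma Ck_cst k O (a : R) : open O -> Ck_on k O (fun _ : 'rV[R]_m => a).
Proof.
move=> oO; elim: k a => [|k IH] a; first by move=> x _; exact: cst_continuous.
split=> // i; apply: Ck_ext (IH 0) => // x _; rewrite /partial.
by have := derive_cst a x (delta_mx ord0 i) => ->.
Qed.

Lemma CkD k O f g : open O -> Ck_on k O f -> Ck_on k O g -> Ck_on k O (fun x => f x + g x).
Proof.
move=> oO; elim: k f g => [|k IH] f g.
  by move=> cf cg x Ox; exact: cvgD (cf x Ox) (cg x Ox).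
move=> [df pf] [dg pg]; split=> [x Ox|i]; first by apply: differentiableD; [exact: df|exact: dg].
apply: Ck_ext (IH _ _ (pf i) (pg i)) => // x Ox.
by rewrite /partial -deriveD//; apply/diff_derivable; [exact: df|exact: dg].
Qed.

Lemma CkM k O f g : open O -> Ck_on k O f -> Ck_on k O g -> Ck_on k O (fun x => f x * g x).
Proof.
move=> oO; elim: k f g => [|k IH] f g.
  by move=> cf cg x Ox; exact: cvgM (cf x Ox) (cg x Ox).
move=> Hf Hg; case: (Hf) (Hg) => [df pf] [dg pg].
split=> [x Ox|i]; first by apply: differentiableM; [exact: df|exact: dg].
apply: Ck_ext (CkD oO (IH _ _ (CkW Hf) (pg i)) (IH _ _ (CkW Hg) (pf i))) => // x Ox.
by rewrite /partial -deriveM//; apply/diff_derivable; [exact: df|exact: dg].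
Qed.

Lemma Ck_sum k O (I : Type) (r : seq I) (P : pred I) (F : I -> 'rV[R]_m -> R) :
  open O -> (forall i, Ck_on k O (F i)) -> Ck_on k O (fun x => \sum_(i <- r | P i) F i x).
Proof.
move=> oO FO; elim: r => [|i r IH].
  by apply: Ck_ext (Ck_cst k 0 oO) => // x _; rewrite big_nil.
case Pi : (P i); last by apply: Ck_ext IH => // x _; rewrite big_cons Pi.
by apply: Ck_ext (CkD oO (FO i) IH) => // x _; rewrite big_cons Pi.
Qed.

Lemma Ck_prod k O (I : Type) (r : seq I) (P : pred I) (F : I -> 'rV[R]_m -> R) :
  open O -> (forall i, Ck_on k O (F i)) -> Ck_on k O (fun x => \prod_(i <- r | P i) F i x).
Proof.
move=> oO FO; elim: r => [|i r IH].
  by apply: Ck_ext (Ck_cst k 1 oO) => // x _; rewrite big_nil.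
case Pi : (P i); last by apply: Ck_ext IH => // x _; rewrite big_cons Pi.
by apply: Ck_ext (CkM oO (FO i) IH) => // x _; rewrite big_cons Pi.
Qed.

Lemma CkN k O f : open O -> Ck_on k O f -> Ck_on k O (fun x => - f x).
Proof.
move=> oO Hf; apply: Ck_ext (CkM oO (Ck_cst k (-1) oO) Hf) => // x _.
by rewrite mulN1r.
Qed.

Lemma CkV k O f : open O -> (forall x, O x -> f x != 0) ->
  Ck_on k O f -> Ck_on k O (fun x => (f x)^-1).
Proof.
move=> oO f0; elim: k => [|k IH] Hf.
  by move=> x Ox; exact: cvgV (f0 x Ox) (Hf x Ox).
case: (Hf) => df pf; split=> [x Ox|i].
  by apply: differentiableV; [exact: df|exact: f0].
have Vk := IH (CkW Hf).
apply: Ck_ext (CkN oO (CkM oO (CkM oO Vk Vk) (pf i))) => // x Ox.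
rewrite /partial [RHS](deriveV (f0 x Ox)) ?scaleNr; last exact/diff_derivable/df.
by rewrite -exprVn expr2.
Qed.

Lemma Ck_entry p q k O (M : 'rV[R]_m -> 'M[R]_(p, q)) i j : open O ->
  Ck_on k O M -> Ck_on k O (fun x => M x i j).
Proof.
move=> oO; elim: k M => [|k IH] M.
  move=> cM x Ox; apply: (@cvg_comp _ _ _ M (fun N : 'M[R]_(p, q) => N i j)) (cM x Ox) _.
  exact: coord_continuous.
move=> [dM pM]; split=> [x Ox|l].
  by apply: (@differentiable_comp _ _ _ _ M (fun N : 'M[R]_(p, q) => N i j));
    [exact: dM|exact: differentiable_coord].
apply: Ck_ext (IH _ (pM l)) => // x Ox.
by rewrite /partial derive_mx ?mxE//; exact/diff_derivable/dM.
Qed.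

Lemma Ck_det n k O (M : 'rV[R]_m -> 'M[R]_n) : open O ->
  (forall i j, Ck_on k O (fun x => M x i j)) -> Ck_on k O (fun x => \det (M x)).
Proof.
move=> oO HM; apply: Ck_sum => // s.
by apply: CkM => //; [exact: Ck_cst|apply: Ck_prod].
Qed.

Lemma Ck_invmx n k O (M : 'rV[R]_m -> 'M[R]_n) i j : open O ->
  (forall x, O x -> M x \in unitmx) ->
  (forall i j, Ck_on k O (fun x => M x i j)) -> Ck_on k O (fun x => invmx (M x) i j).
Proof.
move=> oO uM HM.
have H : Ck_on k O (fun x => (\det (M x))^-1 * cofactor (M x) j i).
  apply: CkM => //.
    apply: CkV => //; last exact: Ck_det.
    by move=> x /uM; rewrite unitmxE unitfE.
  apply: CkM => //; first exact: Ck_cst.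
  apply: Ck_det => // a b; apply: Ck_ext (HM (lift j a) (lift i b)) => // x _.
  by rewrite !mxE.
by apply: Ck_ext H => // x Ox; rewrite /invmx uM// !mxE.
Qed.

End CkClosure.

Section SecondOrder.
Context {R : realType} {m : nat}.
Implicit Types (f g : 'rV[R]_m -> R) (y v : 'rV[R]_m) (O : set 'rV[R]_m).

Lemma sum_delta (h : R) (i : 'I_m) (G : 'I_m -> R) :
  \sum_k (h *: delta_mx ord0 i : 'rV[R]_m) ord0 k * G k = h * G i.
Proof.
rewrite (bigD1 i)//= !mxE !eqxx mulr1 big1 ?addr0// => k /negPf ki.
by rewrite !mxE ki mulr0 mul0r.
Qed.

Lemma norm_delta (i : 'I_m) : `|delta_mx ord0 i : 'rV[R]_m| <= 1.
Proof.
rewrite [leLHS]/Num.Def.normr/= mx_normrE; apply: bigmax_le => // -[a b] _ /=.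
by rewrite !mxE; case: (_ && _); rewrite ?normr1 ?normr0.
Qed.

(** The mean value theorem along e_j for f(. + h e_i) - f, then along e_i for the partial derivative
    in e_j. The left side is symmetric in [i] and [j], which is the point. *)
Lemma second_difference f O y i j (h r : R) : open O -> Ck_on 2 O f ->
  0 < h -> 2 * h < r -> ball y r `<=` O ->
  exists2 z : 'rV[R]_m, `|z - y| <= 2 * h &
    f (y + h *: delta_mx ord0 i + h *: delta_mx ord0 j) - f (y + h *: delta_mx ord0 i)
    - f (y + h *: delta_mx ord0 j) + f y = h ^+ 2 * partial i (partial j f) z.
Proof.
move=> oO [df pf] h0 hr yrO.
set ei := delta_mx ord0 i; set ej := delta_mx ord0 j.
have le2h (s t : R) : 0 <= s <= 1 -> 0 <= t <= 1 ->
    `|s *: (h *: ei) + t *: (h *: ej)| <= 2 * h.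
  move=> /andP[s0 s1] /andP[t0 t1]; apply: le_trans (ler_normD _ _) _.
  rewrite mulr_natl mulr2n; apply: lerD; rewrite !normrZ.
    rewrite (ger0_norm s0) (gtr0_norm h0) mulrA -[leRHS]mulr1.
    by apply: ler_pM; rewrite ?norm_delta ?mulr_ge0 ?(ltW h0)// ler_piMl ?(ltW h0).
  rewrite (ger0_norm t0) (gtr0_norm h0) mulrA -[leRHS]mulr1.
  by apply: ler_pM; rewrite ?norm_delta ?mulr_ge0 ?(ltW h0)// ler_piMl ?(ltW h0).
have inO (s t : R) : 0 <= s <= 1 -> 0 <= t <= 1 ->
    O (y + s *: (h *: ei) + t *: (h *: ej)).
  move=> s01 t01; apply: yrO; rewrite normr_ball distrC -[y + _ + _]addrA [y + _]addrC addrK.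
  exact: le_lt_trans (le2h _ _ s01 t01) hr.
have I0 : 0 <= (0 : R) <= 1 by rewrite lexx ler01.
have I1 : 0 <= (1 : R) <= 1 by rewrite lexx ler01.
have dphi (s : R) : 0 <= s <= 1 -> is_derive s 1
    (fun s => f (y + h *: ei + s *: (h *: ej)) - f (y + s *: (h *: ej)))
    (h * (partial j f (y + h *: ei + s *: (h *: ej)) - partial j f (y + s *: (h *: ej)))).
  move=> s01.
  have O1 : O (y + h *: ei + s *: (h *: ej)) by have := inO _ _ I1 s01; rewrite scale1r.
  have O0 : O (y + s *: (h *: ej)) by have := inO _ _ I0 s01; rewrite scale0r addr0.
  have := is_deriveB (is_derive_line (df _ O1)) (is_derive_line (df _ O0)).
  rewrite !derive_partialE; [|exact: df|exact: df].
  by rewrite !(sum_delta h j) mulrBr.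
have [s /andP[s0 s1]] := mvt_cc ltr01 dphi; have s01 : 0 <= s <= 1 by rewrite !ltW.
rewrite subr0 mulr1 !scale1r !scale0r !addr0 => E.
have [|c /andP[c0 c1]] := @mvt_line R m (partial j f) (y + s *: (h *: ej)) (h *: ei).
  move=> t t01; have := inO _ _ t01 s01; rewrite addrAC => /((pf j).1).
  exact.
have c01 : 0 <= c <= 1 by rewrite !ltW.
rewrite sum_delta => Ec.
exists (y + s *: (h *: ej) + c *: (h *: ei)).
  by rewrite -[y + _ + _]addrA [y + _]addrC addrK [_ *: (h *: ej) + _]addrC; exact: le2h.
rewrite expr2 -mulrA -Ec [y + s *: _ + h *: ei]addrAC -E.
by move: (f (y + _ + _)) (f (y + _)) (f (y + _)) (f y) => A B C D /=; clear; ring.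
Qed.

(** By symmetry of the second difference the two mixed partials take a common value at points
    arbitrarily near [y]; continuity then excludes a gap between them at [y]. *)
Lemma partialC f O y i j : open O -> Ck_on 2 O f -> O y ->
  partial i (partial j f) y = partial j (partial i f) y.
Proof.
move=> oO Cf Oy; apply/eqP/negPn/negP => neq.
pose a : R := partial i (partial j f) y; pose b : R := partial j (partial i f) y.
have e0 : 0 < `|a - b| / 2 by rewrite divr_gt0// normr_gt0 subr_eq0.
have ca : {for y, continuous (partial i (partial j f))} by apply: (Cf.2 j).2.
have cb : {for y, continuous (partial j (partial i f))} by apply: (Cf.2 i).2.
have h1 : \forall z \near y, O z by exact: open_nbhs_nbhs.
have h2 : \forall z \near y, `|a - partial i (partial j f) z| < `|a - b| / 2.
  by move/cvgrPdist_lt : ca; apply.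
have h3 : \forall z \near y, `|b - partial j (partial i f) z| < `|a - b| / 2.
  by move/cvgrPdist_lt : cb; apply.
have [r /= r0 rP] := (nbhs_ballP _ _).1 (filterI h1 (filterI h2 h3)).
have h0 : 0 < r / 4 by rewrite divr_gt0.
have hr : 2 * (r / 4) < r by move: r0; clear; lra.
have yrO : ball y r `<=` O by move=> z /rP[].
have [z1 z1h E1] := second_difference i j oO Cf h0 hr yrO.
have [z2 z2h E2] := second_difference j i oO Cf h0 hr yrO.
have E : partial i (partial j f) z1 = partial j (partial i f) z2.
  have h2' : (r / 4) ^+ 2 != 0 by rewrite expf_neq0// gt_eqF.
  suff : (r / 4) ^+ 2 * partial i (partial j f) z1 = (r / 4) ^+ 2 * partial j (partial i f) z2.
    exact: (mulfI h2').
  apply: etrans (esym E1) _; apply: etrans _ E2; rewrite (addrAC y).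
  move: (f (y + _ + _)) (f (y + _)) (f (y + _)) (f y) => /= A B C D.
  by rewrite [A - B - C]addrAC.
have B1 : ball y r z1 by rewrite normr_ball distrC; exact: le_lt_trans hr.
have B2 : ball y r z2 by rewrite normr_ball distrC; exact: le_lt_trans hr.
have [_ [+ _]] := rP _ B1; have [_ [_ +]] := rP _ B2.
rewrite E; move: (partial j (partial i f) z2 : R) => /= c; clear => H2 H1.
have := ler_normB (a - c) (b - c); rewrite opprB addrA subrK => H3.
by have := le_lt_trans H3 (ltrD H1 H2); rewrite -splitr ltxx.
Qed.

Lemma pos_shift_halfspace y i (s : R) : model_halfspace y -> 0 <= s ->
  model_halfspace (y + s *: delta_mx ord0 i).
Proof.
move=> Hy s0 k k0; rewrite !mxE addr_ge0 ?Hy ?mulr_ge0// ler0n.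
Qed.

(* The coordinate directions point into the half-space, so one-sided difference
   quotients suffice. *)
Lemma partial_vanish f g O y i : open O -> O y -> model_halfspace y ->
  (forall x, O x -> model_halfspace x -> f x = g x) ->
  differentiable f y -> differentiable g y -> partial i f y = partial i g y.
Proof.
move=> oO Oy Hy fg df dg.
set v : 'rV[R]_m := delta_mx ord0 i.
have H (h : 'rV[R]_m -> R) : differentiable h y ->
    (s^-1 *: (h (s *: v + y) - h y)) @[s --> 0^'+] --> partial i h y.
  move=> dh; have /cvg_ex[l hl] : derivable h y v by exact: diff_derivable.
  have -> : partial i h y = l by exact/cvg_lim.
  apply: cvg_trans hl; apply: cvg_app; apply: within_subset => s /=.
  by move=> s0; rewrite gt_eqF.
have Hg : (s^-1 *: (f (s *: v + y) - f y)) @[s --> 0^'+] --> partial i g y.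
  apply: cvg_trans (H g dg); apply: near_eq_cvg.
  have c0 : (s *: v + y) @[s --> (0 : R)] --> y.
    rewrite -[X in _ --> X]add0r -(scale0r v); apply: cvgD; last exact: cvg_cst.
    by apply: cvgZr_tmp; exact: cvg_id.
  have /c0 Os : nbhs y O by exact: open_nbhs_nbhs.
  have {}Os : \forall s \near 0^'+, O (s *: v + y) 
    by apply: (@filterS _ (nbhs (0 : R)) _ _ _ _ Os).
  near=> s.
  have Osv : O (s *: v + y) by near: s.
  have Hsv : model_halfspace (s *: v + y).
    by rewrite addrC; apply: pos_shift_halfspace => //; apply: ltW; near: s; exact: nbhs_right_gt.
  by rewrite !fg.
exact: cvg_unique (H f df) Hg.
Unshelve. all: by end_near. Qed.

Lemma partial_cst (a : R) y i : partial i (fun _ : 'rV[R]_m => a) y = 0.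
Proof. exact: derive_cst. Qed.

Lemma partialZ (a : R) f y i : differentiable f y ->
  partial i (fun z => a * f z) y = a * partial i f y.
Proof. by move=> df; apply: deriveZ; exact: diff_derivable. Qed.

Lemma differentiable_sumM (n : nat) (a b : 'I_n -> 'rV[R]_m -> R) y :
  (forall s, differentiable (a s) y) -> (forall s, differentiable (b s) y) ->
  differentiable (fun z => \sum_s a s z * b s z) y.
Proof.
move=> da db.
have -> : (fun z => \sum_s a s z * b s z) = \sum_s (fun z => a s z * b s z).
  by apply/funext => z; rewrite fct_sumE.
by apply: differentiable_sum => s; exact: differentiableM.
Qed.

Lemma partial_sumM (n : nat) (a b : 'I_n -> 'rV[R]_m -> R) y i :
  (forall s, differentiable (a s) y) -> (forall s, differentiable (b s) y) ->
  partial i (fun z => \sum_s a s z * b s z) y =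
  \sum_s (partial i (a s) y * b s y + a s y * partial i (b s) y).
Proof.
move=> da db.
have -> : (fun z => \sum_s a s z * b s z) = \sum_s (fun z => a s z * b s z).
  by apply/funext => z; rewrite fct_sumE.
rewrite /partial derive_sum; last first.
  by move=> s; apply: diff_derivable; exact: differentiableM.
apply: eq_bigr => s _; rewrite [LHS]deriveM; try exact: diff_derivable.
by rewrite addrC; congr (_ + _); exact: mulrC.
Qed.

Lemma partialD f g y i : differentiable f y -> differentiable g y ->
  partial i (fun z => f z + g z) y = partial i f y + partial i g y.
Proof. by move=> df dg; apply: deriveD; exact: diff_derivable. Qed.

End SecondOrder.

(** * Algebraic curvature tensors *)

Section CurvatureTensor.
Context {R : realType} {m : nat}.
Variable T : 'I_m -> 'I_m -> 'I_m -> 'I_m -> R.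
Hypothesis T12 : forall i j k l, T j i k l = - T i j k l.
Hypothesis T34 : forall i j k l, T i j l k = - T i j k l.
Hypothesis bianchi : forall i j k l, T i j k l + T j k i l + T k i j l = 0.
Hypothesis Tuv : forall u v : 'I_m -> R,
  \sum_i \sum_j \sum_k \sum_l u i * v j * v k * u l * T i j k l = 0.

(** The classical octahedron argument: the four cyclic identities are combined with the two
    antisymmetries. *)
Lemma curvature_pair_sym i j k l : T i j k l = T k l i j.
Proof.
have b1 := bianchi i j k l; have b2 := bianchi j k l i.
have b3 := bianchi k l i j; have b4 := bianchi l i j k.
have e1 := T34 j k i l; have e2 := T34 k l i j; have e3 := T34 j l i k.
have e4 := T34 i j k l; have e5 := T12 i k l j; have e6 := T34 k i j l.
have e7 := T34 l i j k; have e8 := T12 j l k i.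
by move: b1 b2 b3 b4 e1 e2 e3 e4 e5 e6 e7 e8; lra.
Qed.

Lemma sum_two (a d : 'I_m) (F : 'I_m -> R) :
  \sum_i ((i == a)%:R + (i == d)%:R) * F i = F a + F d.
Proof.
under eq_bigr do rewrite mulrDl.
rewrite big_split/= (bigD1 a)//= eqxx mul1r big1 ?addr0; last first.
  by move=> i /negPf ->; rewrite mul0r.
rewrite (bigD1 d)//= eqxx mul1r big1 ?addr0//.
by move=> i /negPf ->; rewrite mul0r.
Qed.

(** The hypothesis [Tuv] at u = e_a + e_d and v = e_b + e_c. Repeating indices later isolates
    smaller groups of its terms. *)
Lemma curvature_polar a d b c :
  T a b b a + T a b b d + (T a b c a + T a b c d) + (T a c b a + T a c b d + (T a c c a + T a c c d)) +
  (T d b b a + T d b b d + (T d b c a + T d b c d) + (T d c b a + T d c b d + (T d c c a + T d c c d))) = 0.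
Proof.
rewrite -[RHS](Tuv (fun i => (i == a)%:R + (i == d)%:R) (fun i => (i == b)%:R + (i == c)%:R)).
have E i j k : \sum_l ((i == a)%:R + (i == d)%:R) * ((j == b)%:R + (j == c)%:R) *
    ((k == b)%:R + (k == c)%:R) * ((l == a)%:R + (l == d)%:R) * T i j k l =
    ((i == a)%:R + (i == d)%:R) * (((j == b)%:R + (j == c)%:R) *
    (((k == b)%:R + (k == c)%:R) * (T i j k a + T i j k d))).
  by rewrite -(sum_two a d) !mulr_sumr; apply: eq_bigr => l _; ring.
under eq_bigr => i _ do under eq_bigr => j _ do under eq_bigr => k _ do rewrite E.
under eq_bigr => i _ do under eq_bigr => j _ do rewrite -!mulr_sumr sum_two.
under eq_bigr => i _ do rewrite -!mulr_sumr sum_two.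
by rewrite sum_two.
Qed.

Lemma curvature_diag x y : T x y y x = 0.
Proof. by have := curvature_polar x x y y; lra. Qed.

(** With one index repeated, polarization shows that T x y z x and T x y y z vanish. In the full
    identity four terms survive, and pair symmetry merges them two by two. *)
Lemma curvature_swap23 a b c d : T a b c d = - T a c b d.
Proof.
have H x y z : T x y z x = 0.
  have := curvature_polar x x y z; have := curvature_pair_sym x z y x.
  have := T12 x y x z; have := T34 x y x z.
  by have := curvature_diag x y; have := curvature_diag x z; lra.
have H' x y z : T x y y z = 0.
  have e1 := curvature_polar x z y y; have := curvature_pair_sym x y y z.
  have := T12 y z x y; have := T34 z y x y.
  have := curvature_diag x y; have := curvature_diag z y.
  by move: e1; lra.
have := curvature_polar a d b c.
rewrite !H !H'.
have := curvature_pair_sym d c b a; have := T12 a b d c; have := T34 a b c d.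
have := curvature_pair_sym d b c a; have := T12 a c d b; have := T34 a c b d.
by lra.
Qed.

(** [T] is now antisymmetric in its first three indices, so its cyclic sum is 3 T. *)
Lemma curvature_tensor_eq0 a b c d : T a b c d = 0.
Proof.
have := bianchi a b c d; have := curvature_swap23 b c a d; have := T12 a b c d.
by have := curvature_swap23 a c b d; have := T12 a c b d; lra.
Qed.

End CurvatureTensor.

Lemma addmxE (V : nmodType) p q (A B : 'M[V]_(p, q)) i j : (A + B) i j = A i j + B i j.
Proof. by rewrite mxE. Qed.

Lemma oppmxE (V : zmodType) p q (A : 'M[V]_(p, q)) i j : (- A) i j = - A i j.
Proof. by rewrite mxE. Qed.

(** The first Bianchi identity of a torsion-free connection: [D] stands for the derivatives of the
    Christoffel symbols, and symmetry of the lower indices makes all terms cancel in pairs. *)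
Lemma bianchi_sum (R : comNzRingType) n (D : 'I_n -> 'I_n -> 'I_n -> R) (C : 'I_n -> 'I_n -> R)
    (B : 'I_n -> 'I_n -> 'I_n -> R) i j k :
  (forall a b c, D a b c = D a c b) -> (forall a b c, B a b c = B a c b) ->
  D i j k - D j i k + \sum_s (C i s * B s j k - C j s * B s i k) +
  (D j k i - D k j i + \sum_s (C j s * B s k i - C k s * B s j i)) +
  (D k i j - D i k j + \sum_s (C k s * B s i j - C i s * B s k j)) = 0.
Proof.
move=> Ds Bs; rewrite !sumrB (Ds j k i) (Ds k j i) (Ds i k j).
have E a b c : \sum_s C a s * B s b c = \sum_s C a s * B s c b.
  by apply: eq_bigr => s _; rewrite Bs.
by rewrite (E j k i) (E k j i) (E i k j); ring.
Qed.

Lemma quartic_gram (R : comNzRingType) n (u v : 'I_n -> R) (g : 'I_n -> 'I_n -> R) :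
  \sum_i \sum_j \sum_k \sum_l u i * v j * v k * u l * (g j k * g i l - g i k * g j l) =
  (\sum_i u i * \sum_l g i l * u l) * (\sum_j v j * \sum_k g j k * v k) -
  (\sum_i u i * \sum_k g i k * v k) * (\sum_j v j * \sum_l g j l * u l).
Proof.
rewrite !big_distrlr/= -sumrB; apply: eq_bigr => i _; rewrite -sumrB; apply: eq_bigr => j _.
rewrite [RHS](_ : _ = u i * v j * ((\sum_k g j k * v k) * (\sum_l g i l * u l) -
  (\sum_k g i k * v k) * (\sum_l g j l * u l))); last by ring.
rewrite !big_distrlr/= -sumrB mulr_sumr; apply: eq_bigr => k _.
rewrite -sumrB mulr_sumr; apply: eq_bigr => l _; ring.
Qed.

Lemma quartic_lower (R : comNzRingType) n (u v : 'I_n -> R) (g : 'I_n -> 'I_n -> R)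
    (r : 'I_n -> 'I_n -> 'I_n -> 'I_n -> R) :
  \sum_i \sum_j \sum_k \sum_l u i * v j * v k * u l * (\sum_s r s k i j * g s l) =
  \sum_l (\sum_s (\sum_i \sum_j \sum_k u i * v j * v k * r s k i j) * g s l) * u l.
Proof.
pose t i j k l s := u i * v j * v k * r s k i j * g s l * u l.
transitivity (\sum_i \sum_j \sum_k \sum_l \sum_s t i j k l s).
  apply: eq_bigr => i _; apply: eq_bigr => j _; apply: eq_bigr => k _.
  apply: eq_bigr => l _; rewrite mulr_sumr; apply: eq_bigr => s _; rewrite /t; ring.
transitivity (\sum_l \sum_s \sum_i \sum_j \sum_k t i j k l s); last first.
  apply: eq_bigr => l _; rewrite mulr_suml; apply: eq_bigr => s _.
  rewrite !mulr_suml; apply: eq_bigr => i _; rewrite !mulr_suml; apply: eq_bigr => j _.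
  by rewrite !mulr_suml.
transitivity (\sum_i \sum_j \sum_l \sum_k \sum_s t i j k l s).
  by apply: eq_bigr => i _; apply: eq_bigr => j _; rewrite exchange_big.
transitivity (\sum_i \sum_l \sum_j \sum_k \sum_s t i j k l s).
  by apply: eq_bigr => i _; rewrite exchange_big.
rewrite exchange_big; apply: eq_bigr => l _ /=.
transitivity (\sum_i \sum_j \sum_s \sum_k t i j k l s).
  by apply: eq_bigr => i _; apply: eq_bigr => j _; rewrite exchange_big.
transitivity (\sum_i \sum_s \sum_j \sum_k t i j k l s).
  by apply: eq_bigr => i _; rewrite exchange_big.
by rewrite exchange_big.
Qed.

Lemma quartic_split (R : comNzRingType) n (u v : 'I_n -> R) (K : R)
    (p q : 'I_n -> 'I_n -> 'I_n -> 'I_n -> R) :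
  \sum_i \sum_j \sum_k \sum_l u i * v j * v k * u l * (p i j k l - K * q i j k l) =
  \sum_i \sum_j \sum_k \sum_l u i * v j * v k * u l * p i j k l -
  K * \sum_i \sum_j \sum_k \sum_l u i * v j * v k * u l * q i j k l.
Proof.
do 4! [rewrite mulr_sumr -sumrB; apply: eq_bigr => ? _].
by ring.
Qed.

(** Sectional curvature says nothing about dependent vectors; there the quartic form vanishes by
    antisymmetry in the first pair alone. *)
Lemma quartic_dependent (R : realFieldType) n (u v : 'I_n -> R) (a : R)
    (T : 'I_n -> 'I_n -> 'I_n -> 'I_n -> R) :
  (forall i j k l, T j i k l = - T i j k l) -> (forall i, u i = a * v i) ->
  \sum_i \sum_j \sum_k \sum_l u i * v j * v k * u l * T i j k l = 0.
Proof.
move=> T12 uv; set S := LHS; suff : S = - S by lra.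
rewrite {1}/S exchange_big -sumrN; apply: eq_bigr => i _ /=.
rewrite -sumrN; apply: eq_bigr => j _; rewrite -sumrN; apply: eq_bigr => k _.
by rewrite -sumrN; apply: eq_bigr => l _; rewrite T12 !uv; ring.
Qed.

Lemma sub4AC (V : zmodType) (A B C D : V) : A - C + D - B = A - B - (C - D).
Proof.
rewrite opprB -!addrA; congr (_ + _); rewrite addrCA [RHS]addrCA; congr (_ + _).
exact: addrC.
Qed.

Lemma add5AC (V : zmodType) (A X Y Z W : V) :
  A + (- X + Y) + (Z - W) = A + Y - W + (- X + Z).
Proof.
rewrite -!addrA; congr (_ + _); rewrite addrCA; congr (_ + _).
by rewrite [Z - W]addrC addrCA.
Qed.

(* The defect of parallelism of [1 + A_v] between the rays towards z and z + v
   is quadratic in v because its linear part is the curvature. *)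
Lemma transport_defect (R : comNzRingType) n (A1 A2 B1 B2 D1 D2 : 'M[R]_n) (t : R) :
  D1 - D2 + A1 *m B1 - B1 *m A1 = 0 ->
  (A2 + B2) *m (1%:M + t *: B1) - (B1 + t *: D2) - (1%:M + t *: B1) *m A1 =
  (A2 - A1 - t *: D1) + (B2 - B1) + t *: ((A2 - A1) *m B1) + t *: (B2 *m B1).
Proof.
rewrite !mulmxDr !mulmxDl !mulmx1 mul1mx mulNmx -!scalemxAr -!scalemxAl.
move: (A1 *m B1) (B1 *m A1) (A2 *m B1) (B2 *m B1) => P Q S T /matrixP E.
apply/matrixP => i j; move: (E i j); rewrite !mxE => {}E.
have -> : D2 i j = D1 i j + P i j - Q i j.
  by rewrite -[RHS]subr0 -E; ring.
by ring.
Qed.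

Lemma conn_blocks (R : comNzRingType) m (X1 X2 g1 g2 : 'cV[R]_m) (e1 e2 : 'rV[R]_m)
    (P Q G1 G2 : 'M[R]_m) :
  block_mx (0 : 'M[R]_1) 0 X1 P - block_mx (0 : 'M[R]_1) 0 X2 Q +
  block_mx (0 : 'M[R]_1) e2 g2 G2 *m block_mx (0 : 'M[R]_1) e1 g1 G1 -
  block_mx (0 : 'M[R]_1) e1 g1 G1 *m block_mx (0 : 'M[R]_1) e2 g2 G2 =
  block_mx (e2 *m g1 - e1 *m g2) (e2 *m G1 - e1 *m G2)
    (X1 - X2 + G2 *m g1 - G1 *m g2) (P - Q + (g2 *m e1 + G2 *m G1) - (g1 *m e2 + G1 *m G2)).
Proof.
rewrite !mulmx_block !opp_block_mx !add_block_mx; congr block_mx;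
  by rewrite ?mul0mx ?mulmx0 ?subrr ?add0r ?subr0 ?addr0.
Qed.

(** The hypothesis equates the two expansions of a mixed second derivative of [G] that follow from
    dG = A G + G A^T; what remains after cancellation says that the curvature is skew for [G]. *)
Lemma curvature_mx_antisym (R : realFieldType) m (A B P Q G : 'M[R]_m) : G^T = G ->
  P *m G + B *m (A *m G + G *m A^T) + (A *m G + G *m A^T) *m B^T + G *m P^T =
  Q *m G + A *m (B *m G + G *m B^T) + (B *m G + G *m B^T) *m A^T + G *m Q^T ->
  (P - Q + B *m A - A *m B) *m G = - ((P - Q + B *m A - A *m B) *m G)^T.
Proof.
move=> GT E; apply/eqP; rewrite -addr_eq0; apply/eqP.
have trD (X Y : 'M[R]_m) : (X + Y)^T = X^T + Y^T by apply/matrixP => i j; rewrite !mxE.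
have trN (X : 'M[R]_m) : (- X)^T = - X^T by apply/matrixP => i j; rewrite !mxE.
rewrite trmx_mul GT !trD !trN !trmx_mul.
move: E; rewrite !(mulmxDr, mulmxDl, mulNmx, mulmxN, mulmxA).
move=> /matrixP E; apply/matrixP => k l; move: (E k l); rewrite !(addmxE, oppmxE) => {}E.
by rewrite [RHS]mxE; lra.
Qed.

(** * The Levi-Civita connection and the flat connection of constant curvature *)

Section LeviCivita.
Context {R : realType} {m : nat}.
Variables (g : 'rV[R]_m -> 'M[R]_m) (O : set 'rV[R]_m).
Hypothesis oO : open O.
Hypothesis gC : forall k i j, Ck_on k O (fun x => g x i j).
Hypothesis gU : forall x, O x -> g x \in unitmx.
Hypothesis gS : forall x, O x -> model_halfspace x -> (g x)^T = g x.
Implicit Types (x y u v : 'rV[R]_m) (i j k l : 'I_m).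

(** Row j holds the coordinates of the covariant derivative of d_j along d_i, so that compatibility
    with the metric reads dg = Gam g + g Gam^T. *)
Definition Gam i y : 'M[R]_m := \matrix_(j, k) christoffel g k i j y.
Definition dmetric i y : 'M[R]_m := \matrix_(j, l) partial i (fun z => g z j l) y.
(** Christoffel symbols of the first kind. *)
Definition Gam_low i y : 'M[R]_m := \matrix_(j, l) (2^-1 *
  (partial i (fun z => g z j l) y + partial j (fun z => g z i l) y
     - partial l (fun z => g z i j) y)).

Lemma christoffel_Ck (n : nat) a b c : Ck_on n O (christoffel g a b c).
Proof.
apply: CkM => //; first exact: Ck_cst.
apply: Ck_sum => // l; apply: CkM => //; first exact: Ck_invmx.
apply: CkD => //; last by apply: CkN => //; exact: (gC n.+1 b c).2.
by apply: CkD => //; [exact: (gC n.+1 c l).2|exact: (gC n.+1 b l).2].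
Qed.

Lemma metricC x i j : O x -> model_halfspace x -> g x i j = g x j i.
Proof. by move=> Ox Hx; rewrite -{1}(gS Ox Hx) mxE. Qed.

(** Symmetry of [g] is known on the half-space only, so at a boundary point it is differentiated
    through one-sided difference quotients and not by rewriting the function. *)
Lemma dmetricC x l i j : O x -> model_halfspace x ->
  partial l (fun z => g z i j) x = partial l (fun z => g z j i) x.
Proof.
move=> Ox Hx; apply: (partial_vanish _ oO) => //.
- by move=> z Oz Hz; exact: metricC.
- exact: (gC 1 i j).1.
- exact: (gC 1 j i).1.
Qed.

Lemma Gam_metric x i : O x -> model_halfspace x -> Gam i x *m g x = Gam_low i x.
Proof.
move=> Ox Hx.
have -> : Gam i x = Gam_low i x *m (invmx (g x))^T.
  apply/matrixP => j k; rewrite !mxE /christoffel mulr_sumr; apply: eq_bigr => l _.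
  by rewrite mulrCA mulrC [(invmx (g x))^T l k]mxE /Gam_low [in RHS]mxE.
by rewrite -[X in _ *m X](gS Ox Hx) -mulmxA -trmx_mul mulmxV ?gU// trmx1 mulmx1.
Qed.

Lemma metric_compatible x i : O x -> model_halfspace x ->
  dmetric i x = Gam i x *m g x + g x *m (Gam i x)^T.
Proof.
move=> Ox Hx; rewrite -[X in X *m _^T](gS Ox Hx) -trmx_mul Gam_metric//.
apply/matrixP => j l; rewrite !mxE (dmetricC i l j Ox Hx) -mulrDr.
by field.
Qed.

Lemma christoffelC x k i j : O x -> model_halfspace x ->
  christoffel g k i j x = christoffel g k j i x.
Proof.
move=> Ox Hx; rewrite /christoffel; congr (_ * _); apply: eq_bigr => l _.
rewrite (dmetricC l i j Ox Hx); congr (_ * _); congr (_ - _); exact: addrC.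
Qed.

(** The difference of the two connections, lowered by [g], is symmetric in its first two indices and
    skew in the last two, hence zero. Its use is the transformation law of the Christoffel symbols
    under a change of chart. *)
Lemma levi_civita_unique x (D : 'I_m -> 'M[R]_m) : O x -> model_halfspace x ->
  (forall i j k, D i j k = D j i k) ->
  (forall i, dmetric i x = D i *m g x + g x *m (D i)^T) -> forall i, D i = Gam i x.
Proof.
move=> Ox Hx Dsym Dm.
pose E i := (D i - Gam i x) *m g x.
have Es i j s : (D i - Gam i x) j s = (D j - Gam j x) i s.
  rewrite [LHS]mxE [RHS]mxE Dsym; congr (_ + _).
  by rewrite [LHS]mxE [RHS]mxE [in LHS]mxE [in RHS]mxE (christoffelC s i j Ox Hx).
have E1 i j k : E i j k = E j i k.
  by rewrite /E [LHS]mxE [RHS]mxE; apply: eq_bigr => s _; rewrite Es.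
have E2 i j k : E i j k = - E i k j.
  have : E i + (E i)^T = 0.
    rewrite /E trmx_mul (gS Ox Hx) linearB/= mulmxBl mulmxBr addrACA -opprD.
    by rewrite -metric_compatible// -Dm subrr.
  by move/matrixP/(_ j k); rewrite !mxE => /eqP; rewrite addr_eq0 => /eqP.
have E0 i j k : E i j k = 0.
  have e1 := E1 i j k; have e2 := E2 j i k; have e3 := E1 j k i; have e4 := E2 k j i.
  have e5 := E1 k i j; have e6 := E2 i k j.
  by move: e1 e2 e3 e4 e5 e6; clear; lra.
move=> i; apply/eqP; rewrite -subr_eq0; apply/eqP.
have Ei : E i = 0 by apply/matrixP => j k; rewrite E0 mxE.
by rewrite -[LHS](mulmxK (gU Ox)) -/(E i) Ei mul0mx.
Qed.

Lemma dchristoffelC x l k i j : O x -> model_halfspace x ->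
  partial l (christoffel g k i j) x = partial l (christoffel g k j i) x.
Proof.
move=> Ox Hx; apply: (partial_vanish _ oO) => //.
- by move=> z Oz Hz; exact: christoffelC.
- exact: (christoffel_Ck 1 k i j).1.
- exact: (christoffel_Ck 1 k j i).1.
Qed.

Definition dGam i j y : 'M[R]_m := \matrix_(k, l) partial i (christoffel g l j k) y.
Definition Rmx i j y : 'M[R]_m := \matrix_(k, l) riemann g l k i j y.

Lemma RmxE i j y :
  Rmx i j y = dGam i j y - dGam j i y + Gam j y *m Gam i y - Gam i y *m Gam j y.
Proof.
apply/matrixP => k l; rewrite [LHS]mxE /riemann sumrB addrA.
rewrite [RHS]mxE [in RHS]mxE [in RHS]mxE; congr (_ + _ + _ + _).
- by rewrite mxE.
- by rewrite !mxE.
- by rewrite mxE; apply: eq_bigr => s _; rewrite !mxE mulrC.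
- by rewrite !mxE; congr (- _); apply: eq_bigr => s _; rewrite !mxE mulrC.
Qed.

Definition ddmetric i j y : 'M[R]_m :=
  \matrix_(k, l) partial i (partial j (fun z => g z k l)) y.

Lemma ddmetricE x i j : O x -> model_halfspace x ->
  ddmetric i j x = dGam i j x *m g x + Gam j x *m dmetric i x
    + dmetric i x *m (Gam j x)^T + g x *m (dGam i j x)^T.
Proof.
move=> Ox Hx; apply/matrixP => k l.
pose h z := \sum_s christoffel g s j k z * g z s l + \sum_s g z k s * christoffel g s j l z.
have dc a b c : differentiable (christoffel g a b c) x by exact: (christoffel_Ck 1 a b c).1.
have dg a b : differentiable (fun z => g z a b) x by exact: (gC 1 a b).1.
have -> : ddmetric i j x k l = partial i h x.
  rewrite mxE; apply: (partial_vanish _ oO) => //.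
  - move=> z Oz Hz; have /matrixP/(_ k l) := metric_compatible j Oz Hz.
    rewrite mxE => ->; rewrite mxE; congr (_ + _); rewrite mxE; apply: eq_bigr => s _;
    by rewrite !mxE.
  - exact: ((gC 2 k l).2 j).1.
  - by apply: differentiableD; apply: differentiable_sumM.
rewrite /h partialD; [|exact: differentiable_sumM|exact: differentiable_sumM].
rewrite !partial_sumM// !big_split/= addrA.
rewrite [RHS]mxE [in RHS]mxE [in RHS]mxE; congr (_ + _ + _ + _);
  by rewrite [RHS]mxE; apply: eq_bigr => s _; rewrite !mxE.
Qed.

(** Second derivatives of [g] commute; expanding both orders through [metric_compatible] leaves
    exactly the skewness of the curvature. *)
Lemma Rmx_antisym x i j : O x -> model_halfspace x ->
  Rmx i j x *m g x = - (Rmx i j x *m g x)^T.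
Proof.
move=> Ox Hx; rewrite RmxE; apply: curvature_mx_antisym; first exact: gS.
have E1 := ddmetricE i j Ox Hx; have E2 := ddmetricE j i Ox Hx.
rewrite -(metric_compatible i Ox Hx) -(metric_compatible j Ox Hx).
apply: etrans (esym E1) (etrans _ E2).
apply/matrixP => k l; rewrite [LHS]mxE [RHS]mxE.
exact: partialC oO (gC 2 k l) Ox.
Qed.

Lemma riemann_antisym x l k i j : riemann g l k j i x = - riemann g l k i j x.
Proof.
have H (d1 d2 : R) (F1 F2 : 'I_m -> R) :
    d1 - d2 + \sum_s (F1 s - F2 s) = - (d2 - d1 + \sum_s (F2 s - F1 s)).
  by rewrite !sumrB; ring.
exact: H.
Qed.

Lemma riemann_bianchi x l i j k : O x -> model_halfspace x ->
  riemann g l k i j x + riemann g l i j k x + riemann g l j k i x = 0.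
Proof.
move=> Ox Hx.
apply: (@bianchi_sum _ _ (fun i j k => partial i (christoffel g l j k) x)
  (fun i s => christoffel g l i s x) (fun s i j => christoffel g s i j x)).
- by move=> a b c; exact: dchristoffelC.
- by move=> a b c; exact: christoffelC.
Qed.

Hypothesis gP : forall x, O x -> model_halfspace x ->
  forall u, u != 0 -> 0 < (u *m g x *m u^T) ord0 ord0.

Lemma gdotE x u v : gdot g x u v = \sum_i u ord0 i * \sum_j g x i j * v ord0 j.
Proof.
rewrite /gdot -mulmxA mxE; apply: eq_bigr => i _; congr (_ * _).
by rewrite mxE; apply: eq_bigr => j _; congr (_ * _); rewrite mxE.
Qed.

Lemma gdotC x u v : O x -> model_halfspace x -> gdot g x u v = gdot g x v u.
Proof.
move=> Ox Hx; rewrite /gdot -[in LHS](trmxK (u *m g x)) -trmx_mul mxE.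
by rewrite trmx_mul gS// mulmxA.
Qed.

Lemma gdotDl x a b u v w : gdot g x (a *: u + b *: v) w = a * gdot g x u w + b * gdot g x v w.
Proof. by rewrite /gdot !mulmxDl -!scalemxAl !mxE. Qed.

Lemma gdot_ge0 x u : O x -> model_halfspace x -> 0 <= gdot g x u u.
Proof.
move=> Ox Hx; have [->|/(gP Ox Hx)/ltW//] := eqVneq u 0.
by rewrite /gdot mul0mx mul0mx mxE.
Qed.

Lemma gram_identity x u v : O x -> model_halfspace x ->
  let w := gdot g x v v *: u + (- gdot g x u v) *: v in
  gdot g x w w = gdot g x v v * (gdot g x u u * gdot g x v v - gdot g x u v ^+ 2).
Proof.
move=> Ox Hx w; rewrite /w gdotDl !(gdotC _ (_ + _) Ox Hx) !gdotDl (gdotC v u Ox Hx).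
move: (gdot g x u u) (gdot g x u v) (gdot g x v v) => a b c; ring.
Qed.

Lemma free2P u v : ~~ free [:: u; v] -> v = 0 \/ exists a, u = a *: v.
Proof.
rewrite free_cons seq1_free span_seq1 negb_and !negbK => /orP[|/eqP]; last by left.
by case/vlineP => a ->; right; exists a.
Qed.

Lemma gram_gt0 x u v : O x -> model_halfspace x -> free [:: u; v] ->
  0 < gdot g x u u * gdot g x v v - gdot g x u v ^+ 2.
Proof.
move=> Ox Hx fr.
have v0 : v != 0 by move: fr; rewrite free_cons seq1_free => /andP[].
have vv : 0 < gdot g x v v by exact: gP.
rewrite -(pmulr_rgt0 _ vv) -gram_identity//; apply: gP => //.
apply/eqP => /eqP; rewrite scaleNr subr_eq0 => /eqP E.
move: fr; rewrite free_cons span_seq1 => /andP[/vlineP[]].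
exists ((gdot g x v v)^-1 * gdot g x u v).
by rewrite -scalerA -E scalerA mulVf ?scale1r ?gt_eqF.
Qed.

Variable K : R.
Hypothesis gK : forall x, O x -> model_halfspace x ->
  forall u v, free [:: u; v] -> sectional_curvature g x u v = K.

(** The lowered curvature minus its constant curvature model has the symmetries of a curvature
    tensor and a vanishing quartic form, so it is zero: sectional curvature gives the whole
    tensor. *)
Lemma curvature_form x i j k l : O x -> model_halfspace x ->
  \sum_s riemann g s k i j x * g x s l = K * (g x j k * g x i l - g x i k * g x j l).
Proof.
move=> Ox Hx; apply/eqP; rewrite -subr_eq0; apply/eqP.
pose L i j k l := \sum_s riemann g s k i j x * g x s l.
pose T i j k l := L i j k l -
  K * (g x j k * g x i l - g x i k * g x j l).
have gs a b : g x a b = g x b a by exact: metricC.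
have L34 a b c d : \sum_s riemann g s d a b x * g x s c = - \sum_s riemann g s c a b x * g x s d.
  have /matrixP/(_ c d) := Rmx_antisym a b Ox Hx; rewrite [RHS]oppmxE [X in - X]mxE.
  rewrite [LHS]mxE [X in - X]mxE.
  under eq_bigr do rewrite mxE; under [X in - X]eq_bigr do rewrite mxE.
  by move=> ->; rewrite opprK.
apply: (@curvature_tensor_eq0 _ _ T).
- move=> a b c d; rewrite /T /L.
  rewrite (eq_bigr (fun s => - (riemann g s c a b x * g x s d))); last first.
    by move=> s _; rewrite riemann_antisym mulNr.
  by rewrite sumrN; ring.
- by move=> a b c d; rewrite /T /L L34; ring.
- move=> a b c d; rewrite /T.
  have B : L a b c d + L b c a d + L c a b d = 0.
    rewrite /L -!big_split/=; apply: big1 => s _.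
    by rewrite -!mulrDl riemann_bianchi// mul0r.
  move: (L a b c d) (L b c a d) (L c a b d) B => X Y Z B.
  rewrite (gs c b) (gs c a) (gs b a) -[RHS]B; ring.
- move=> u v; rewrite /T /L.
  pose U := \row_i u i; pose V := \row_i v i.
  have uE a : U ord0 a = u a by rewrite mxE.
  have vE a : V ord0 a = v a by rewrite mxE.
  have [fr|/free2P UV] := boolP (free [:: U; V]); last first.
    have T12 a b c d : T b a c d = - T a b c d.
      rewrite /T /L (eq_bigr (fun s => - (riemann g s c a b x * g x s d))); last first.
        by move=> s _; rewrite riemann_antisym mulNr.
      by rewrite sumrN; ring.
    case: UV => [V0|[a Ua]]; last first.
      by apply: (quartic_dependent (a := a) T12) => i0; rewrite -uE -vE Ua mxE.
    have v0 a : v a = 0 by rewrite -vE V0 mxE.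
    by do 4! [apply: big1 => ? _]; rewrite !v0 mulr0 !mul0r.
  have g0 := gram_gt0 Ox Hx fr.
  rewrite (quartic_split u v K (fun i j k l => \sum_s riemann g s k i j x * g x s l)).
  rewrite (quartic_lower u v (g x) (fun s k i j => riemann g s k i j x)) quartic_gram.
  have E := gK Ox Hx fr.
  have gE (W Z : 'I_m -> R) : gdot g x (\row_i W i) (\row_i Z i) = \sum_i W i * \sum_j g x i j * Z j.
    rewrite gdotE; apply: eq_bigr => a _; rewrite mxE; congr (_ * _).
    by apply: eq_bigr => b _; rewrite mxE.
  rewrite -!gE -/U -/V (gdotC V U Ox Hx) -expr2.
  rewrite -{1}E /sectional_curvature divfK ?gt_eqF//.
  apply/eqP; rewrite subr_eq0; apply/eqP.
  rewrite /gdot mxE; apply: eq_bigr => a _; rewrite !mxE; congr (_ * _).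
  apply: eq_bigr => s _; rewrite !mxE; congr (_ * _).
  by do 3! [apply: eq_bigr => ? _]; rewrite !mxE.
Qed.

(* On rows (f, d_1 f, .., d_m f) the system Hess f = - K f g reads
   d_i F = conn i *m F; it is satisfied by the coordinate functions of the
   projective model. *)
Definition conn i y : 'M[R]_(1 + m) :=
  block_mx (0 : 'M[R]_1) (delta_mx ord0 i) (- K *: col i (g y)) (Gam i y).

(** For a frame with rows F, d_1 F, .., d_m F, the equation Th b Th^T = [frame_form] says that F
    lies on the quadric X b X^T = 1, is orthogonal to its derivatives and pulls b back to K g. *)
Definition frame_form y : 'M[R]_(1 + m) := block_mx (1%:M : 'M[R]_1) 0 0 (K *: g y).

Lemma conn_Ck (n : nat) i a b : Ck_on n O (fun y => conn i y a b).
Proof.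
case: (split_ordP a) => a' ->; case: (split_ordP b) => b' ->.
- by apply: Ck_ext (Ck_cst n (0 : R) oO) => // x _; rewrite block_mxEul mxE.
- apply: Ck_ext (Ck_cst n ((delta_mx ord0 i : 'rV[R]_m) a' b') oO) => // x _.
  by rewrite block_mxEur.
- apply: Ck_ext (CkM oO (Ck_cst n (- K) oO) (gC n a' i)) => // x _.
  by rewrite block_mxEdl !mxE.
- apply: Ck_ext (christoffel_Ck n b' i a') => // x _.
  by rewrite block_mxEdr mxE.
Qed.

(** By metric compatibility each side is [g] times a column of Christoffel symbols, symmetric in [i]
    and [j]. This is the Codazzi-type block of [conn_flat]. *)
Lemma Gam_col x i j : O x -> model_halfspace x ->
  dmetric i x *m delta_mx j (ord0 : 'I_1) - Gam i x *m col j (g x) =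
  dmetric j x *m delta_mx i (ord0 : 'I_1) - Gam j x *m col i (g x).
Proof.
move=> Ox Hx.
have H k l : dmetric k x *m delta_mx l (ord0 : 'I_1) - Gam k x *m col l (g x) =
    g x *m (Gam k x)^T *m delta_mx l (ord0 : 'I_1).
  rewrite (metric_compatible k Ox Hx) mulmxDl -mulmxA -colE.
  by rewrite addrC addrA addNr add0r.
rewrite !H -!mulmxA; congr (_ *m _); apply/matrixP => s t.
by rewrite -!colE !mxE; exact: christoffelC.
Qed.

Lemma Rmx_form x i j : O x -> model_halfspace x ->
  Rmx i j x = K *: (col j (g x) *m delta_mx ord0 i - col i (g x) *m delta_mx ord0 j).
Proof.
move=> Ox Hx; rewrite -[LHS](mulmxK (gU Ox)) -[RHS](mulmxK (gU Ox)); congr (_ *m _).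
apply/matrixP => k l; rewrite mxE (eq_bigr (fun s => riemann g s k i j x * g x s l)); last first.
  by move=> s _; rewrite mxE.
rewrite curvature_form// -scalemxAl mulmxBl -!mulmxA -!rowE mxE; congr (_ * _).
rewrite addmxE oppmxE !mxE !big_ord1 !mxE.
by rewrite (metricC j k)// (metricC i k).
Qed.

Definition dconn i j x : 'M[R]_(1 + m) :=
  \matrix_(a, b) partial i (fun y => conn j y a b) x.

Lemma dconnE x i j : O x -> dconn i j x =
  block_mx (0 : 'M[R]_1) 0 (- K *: (dmetric i x *m delta_mx j ord0)) (dGam i j x).
Proof.
move=> Ox; apply/matrixP => a b; rewrite mxE.
case: (split_ordP a) => a' ->; case: (split_ordP b) => b' ->.
- rewrite block_mxEul mxE (partial_ext (g := fun=> 0) i oO _ Ox).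
    exact: partial_cst.
  by move=> z _; rewrite block_mxEul mxE.
- rewrite block_mxEur mxE (partial_ext (g := fun=> (delta_mx ord0 j : 'rV[R]_m) a' b') i oO _ Ox).
    by rewrite partial_cst.
  by move=> z _; rewrite block_mxEur.
- rewrite block_mxEdl (partial_ext (g := fun z => - K * g z a' j) i oO _ Ox); last first.
    by move=> z _; rewrite block_mxEdl !mxE.
  rewrite -colE [RHS]mxE [in RHS]mxE [in RHS]mxE.
  by rewrite partialZ//; exact: (gC 1 a' j).1.
- rewrite block_mxEdr mxE; apply: (partial_ext i oO _ Ox) => z _.
  by rewrite block_mxEdr mxE.
Qed.

(** Integrability block by block: symmetry of [g], symmetry of the Christoffel symbols, [Gam_col],
    and constant curvature through [Rmx_form]. *)
Lemma conn_flat x i j : O x -> model_halfspace x ->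
  dconn i j x - dconn j i x + conn j x *m conn i x - conn i x *m conn j x = 0.
Proof.
move=> Ox Hx; rewrite (dconnE i j Ox) (dconnE j i Ox) /conn conn_blocks.
rewrite -[RHS](block_mx0 R 1 m 1 m); congr block_mx.
- rewrite -!scalemxAr -scalerBr -!rowE.
  by apply/matrixP => a b; rewrite !mxE (metricC i j)// subrr mulr0.
- rewrite -!rowE; apply/matrixP => a b; rewrite !mxE (christoffelC _ i j Ox Hx); exact: subrr.
- rewrite -!scalemxAr -!scalerBr -scalerDr -scalerBr.
  have := Gam_col i j Ox Hx => /eqP; rewrite -subr_eq0 => /eqP E.
  by rewrite sub4AC E scaler0.
- have := Rmx_form i j Ox Hx; rewrite RmxE => /eqP; rewrite -subr_eq0 => /eqP <-.
  rewrite -!scalemxAl !scaleNr scalerBr !opprD !opprK.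
  exact: add5AC.
Qed.

Definition dframe_form i x : 'M[R]_(1 + m) :=
  \matrix_(a, b) partial i (fun y => frame_form y a b) x.

(** The form is parallel for [conn]. This is what later carries Th b Th^T = [frame_form] from one
    point to a neighbourhood. *)
Lemma dframe_formE x i : O x -> model_halfspace x ->
  dframe_form i x =
  conn i x *m frame_form x + frame_form x *m (conn i x)^T.
Proof.
move=> Ox Hx.
have -> : dframe_form i x =
    block_mx (0 : 'M[R]_1) 0 0 (K *: dmetric i x).
  apply/matrixP => a b; rewrite mxE.
  case: (split_ordP a) => a' ->; case: (split_ordP b) => b' ->.
  - rewrite block_mxEul mxE (partial_ext (g := fun=> (1%:M : 'M[R]_1) a' b') i oO _ Ox).
      exact: partial_cst.
    by move=> z _; rewrite block_mxEul.
  - rewrite block_mxEur mxE (partial_ext (g := fun=> 0) i oO _ Ox).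
      exact: partial_cst.
    by move=> z _; rewrite block_mxEur mxE.
  - rewrite block_mxEdl mxE (partial_ext (g := fun=> 0) i oO _ Ox).
      exact: partial_cst.
    by move=> z _; rewrite block_mxEdl mxE.
  - rewrite block_mxEdr (partial_ext (g := fun z => K * g z a' b') i oO _ Ox); last first.
      by move=> z _; rewrite block_mxEdr mxE.
    by rewrite mxE mxE partialZ//; exact: (gC 1 a' b').1.
rewrite tr_block_mx !mulmx_block add_block_mx trmx0.
rewrite !mul0mx !mulmx0 !mul1mx !mulmx1 !add0r !addr0; congr block_mx.
- rewrite -scalemxAr -rowE; apply/matrixP => a b; rewrite !mxE (metricC i b)//; ring.
- rewrite -scalemxAl trmx_delta -colE; apply/matrixP => a b; rewrite !mxE; ring.
- by rewrite (metric_compatible i Ox Hx) scalerDr -scalemxAr -scalemxAl.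
Qed.

End LeviCivita.

(** * Linear differential equations for matrix curves *)

Section MatrixCurves.
Context {R : realType}.

Lemma ler_mxentry p q (A : 'M[R]_(p, q)) i j : `|A i j| <= `|A|.
Proof.
rewrite [leRHS]/Num.Def.normr/= mx_normrE.
exact: (le_bigmax _ (fun i : 'I_p * 'I_q => `|A i.1 i.2|) (i, j)).
Qed.

Lemma mxnorm_le p q (A : 'M[R]_(p, q)) (e : R) : 0 <= e ->
  (forall i j, `|A i j| <= e) -> `|A| <= e.
Proof.
move=> e0 Ae; rewrite [leLHS]/Num.Def.normr/= mx_normrE.
by apply: bigmax_le => // -[i j] _; exact: Ae.
Qed.

Lemma mxnorm_mul p n q (A : 'M[R]_(p, n)) (B : 'M[R]_(n, q)) :
  `|A *m B| <= n%:R * `|A| * `|B|.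
Proof.
apply: mxnorm_le => [|i j]; first by rewrite !mulr_ge0.
rewrite mxE; apply: le_trans (ler_norm_sum _ _ _) _.
rewrite -mulrA mulr_natl -[X in _ *+ X](card_ord n) -sumr_const.
by apply: ler_sum => k _; rewrite normrM; apply: ler_pM => //; exact: ler_mxentry.
Qed.

Lemma is_derive_mxP p q (X : R -> 'M[R]_(p, q)) (t : R) (D : 'M[R]_(p, q)) :
  is_derive t 1 X D <-> forall i j, is_derive t 1 (fun s => X s i j) (D i j).
Proof.
split=> [[dX XD] i j|H].
  apply: DeriveDef; first by move/derivable_mxP : dX; apply.
  by rewrite -XD derive_mx// mxE.
have dX : derivable X t 1 by apply/derivable_mxP => i j; case: (H i j).
apply: DeriveDef => //; rewrite derive_mx//; apply/matrixP => i j; rewrite mxE.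
by case: (H i j).
Qed.

Lemma is_derive_mulmx p n q (X : R -> 'M[R]_(p, n)) (Y : R -> 'M[R]_(n, q)) (t : R) DX DY :
  is_derive t 1 X DX -> is_derive t 1 Y DY ->
  is_derive t 1 (fun s => X s *m Y s) (DX *m Y t + X t *m DY).
Proof.
move=> /is_derive_mxP dX /is_derive_mxP dY; apply/is_derive_mxP => i j.
have -> : (fun s => (X s *m Y s) i j) = \sum_k (fun s => X s i k * Y s k j).
  by apply/funext => s; rewrite fct_sumE mxE.
have := is_derive_sum (fun k => is_deriveM (dX i k) (dY k j)).
move=> /is_derive_eq; apply; rewrite !mxE -big_split/=; apply: eq_bigr => k _.
by rewrite addrC; congr (_ + _); exact: mulrC.
Qed.

Lemma continuous_sumr (T : topologicalType) (V : normedModType R) (I : Type)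
    (r : seq I) (P : pred I) (F : I -> T -> V) t :
  (forall i, {for t, continuous (F i)}) ->
  {for t, continuous (\sum_(i <- r | P i) F i)}.
Proof.
move=> cF; elim/big_ind : _ => //; first exact: cst_continuous.
by move=> f g cf cg; exact: cvgD cf cg.
Qed.

Lemma mxcurve_continuous (T : topologicalType) p q (X : T -> 'M[R]_(p, q)) (t : T) :
  (forall i j, {for t, continuous (fun s => X s i j)}) -> {for t, continuous X}.
Proof.
move=> cX; apply/cvgrPdist_le => e e0; near=> s; apply: mxnorm_le; first exact: ltW.
move=> i j; move: i j; near: s.
apply: filter_forall => i; apply: filter_forall => j.
have /cvgrPdist_le/(_ e e0) := cX i j.
by apply: filterS => s; rewrite !mxE.
Unshelve. all: by end_near. Qed.

Lemma mxcurve_entry_continuous p q (X : R -> 'M[R]_(p, q)) (t : R) i j :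
  {for t, continuous X} -> {for t, continuous (fun s => X s i j)}.
Proof.
move=> cX; apply: (@cvg_comp _ _ _ X (fun N : 'M[R]_(p, q) => N i j)) cX _.
exact: coord_continuous.
Qed.

(** The order of [a] and [b] is left free, since primitives based at 0 are estimated on both sides
    of 0. *)
Lemma mxcurve_mvt p q (X D : R -> 'M[R]_(p, q)) (a b c : R) : 0 <= c ->
  (forall s, Num.min a b <= s <= Num.max a b -> is_derive s 1 X (D s)) ->
  (forall s, Num.min a b <= s <= Num.max a b -> `|D s| <= c) ->
  `|X b - X a| <= c * `|b - a|.
Proof.
move=> c0 XD Dc; apply: mxnorm_le => [|i j]; first by rewrite mulr_ge0.
rewrite addmxE oppmxE.
have dX s : Num.min a b <= s <= Num.max a b -> is_derive s 1 (fun s => X s i j) (D s i j).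
  by move=> /XD/is_derive_mxP/(_ i j).
have H s : Num.min a b <= s <= Num.max a b -> `|D s i j| <= c.
  by move=> sab; exact: le_trans (ler_mxentry _ _ _) (Dc _ sab).
have [ab|ba|->] := ltgtP a b; last by rewrite !subrr normr0 mulr0.
- rewrite min_l ?max_r ?(ltW ab)// in dX H.
  have [s /andP[sa sb] ->] := mvt_cc ab dX.
  by rewrite normrM ler_wpM2r// H// !ltW.
- rewrite min_r ?max_l ?(ltW ba)// in dX H.
  have [s /andP[sa sb] E] := mvt_cc ba dX.
  by rewrite distrC E normrM [`|b - a|]distrC ler_wpM2r// H// !ltW.
Qed.

Lemma small_gronwall p q (E D : R -> 'M[R]_(p, q)) (rho : R) :
  (forall t : R, 0 <= t <= 1 -> is_derive t 1 E (D t)) ->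
  (forall t : R, 0 <= t <= 1 -> `|D t| <= 2^-1 * `|E t| + rho) -> E 0 = 0 ->
  forall t : R, 0 <= t <= 1 -> `|E t| <= 2 * rho.
Proof.
move=> ED Dle E0.
have [|c] := @EVT_max R (fun t => `|E t|) 0 1 ler01.
  apply/continuous_in_subspaceT => t; rewrite inE/= in_itv/= => t01.
  apply: (@continuous_comp _ _ _ E (fun x => `|x|)); last exact: norm_continuous.
  by apply/differentiable_continuous/derivable1_diffP; case: (ED _ t01).
rewrite in_itv/= => c01 Ec; set M := `|E c|.
have M0 : 0 <= M by exact: normr_ge0.
have h0 : 0 <= 2^-1 * M + rho.
  by apply: le_trans (Dle c c01); exact: normr_ge0.
have MM : M <= 2^-1 * M + rho.
  have : `|E c - E 0| <= (2^-1 * M + rho) * `|c - 0|.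
    case/andP: (c01) => c0 c1.
    apply: (mxcurve_mvt (D := D)) => // s; rewrite min_l ?max_r// => /andP[s0 sc].
      by apply: ED; rewrite s0 (le_trans sc).
    have s01 : 0 <= s <= 1 by rewrite s0 (le_trans sc).
    by apply: le_trans (Dle _ s01) _; rewrite lerD2r ler_wpM2l// Ec// in_itv.
  rewrite E0 !subr0 => /le_trans; apply; case/andP: (c01) => c0 c1.
  by rewrite ger0_norm// ler_piMr.
move=> t t01; apply: le_trans (Ec t _) _; first by rewrite in_itv.
by rewrite -/M; move: MM; clear; lra.
Qed.

(** The sequences u_n - 2 / 2^n and u_n + 2 / 2^n are monotone and enclose each other; the limit is
    the supremum of the lower one. *)
Lemma geometric_limit (u : nat -> R) : (forall n, `|u n.+1 - u n| <= 2^-1 ^+ n) ->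
  exists l, forall n, `|u n - l| <= 2 * 2^-1 ^+ n.
Proof.
move=> du; pose e n : R := 2^-1 ^+ n.
have eS n : e n.+1 = 2^-1 * e n by rewrite /e exprS.
have e0 n : 0 <= e n by rewrite exprn_ge0.
pose a n := u n - 2 * e n; pose b n := u n + 2 * e n.
have aS n : a n <= a n.+1.
  have := du n; rewrite ler_norml => /andP[+ _]; rewrite -/(e n) /a eS; lra.
have bS n : b n.+1 <= b n.
  have := du n; rewrite ler_norml => /andP[_]; rewrite -/(e n) /b eS; lra.
have am k n : a n <= a (n + k)%N.
  by elim: k => [|k IH]; rewrite ?addn0// addnS (le_trans IH).
have bm k n : b (n + k)%N <= b n.
  by elim: k => [|k IH]; rewrite ?addn0// addnS (le_trans _ IH).
have ab n k : a n <= b k.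
  apply: le_trans (am k n) _; apply: le_trans (bm n k); rewrite addnC /a /b.
  by have := e0 (k + n)%N; lra.
have ha : has_ubound (range a) by exists (b 0%N) => _ [n _ <-].
exists (sup (range a)) => n; rewrite ler_norml -/(e n).
have h1 : a n <= sup (range a) by apply: ub_le_sup => //; exists n.
have h2 : sup (range a) <= b n.
  by apply: ge_sup; [exists (a 0%N); exists 0%N|move=> _ [k _ <-]].
by move: h1 h2; rewrite /a /b; clear; lra.
Qed.

End MatrixCurves.

Section LinearODE.
Context {R : realType}.

(** The interval (-2, 3) leaves a margin around [-1, 2], the range of [clamp], which itself leaves
    one around [0, 1]; derivatives at end points are then ordinary ones. *)
Lemma primitive_exists (f : R -> R) : continuous f ->
  exists2 F : R -> R, F 0 = 0 & forall t : R, -2 < t < 3 -> is_derive t 1 F (f t).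
Proof.
move=> cf; pose G x := (\int[lebesgue_measure]_(t in [set` `[(-2 : R), x]]) (f t))%R.
have dG (t : R) : -2 < t < 3 -> is_derive t 1 G (f t).
  move=> /andP[t2 t3].
  have [|dG GE] := @continuous_FTC1_closed R f (-2) t 3 t3 _ t2 (cf t).
    apply: continuous_compact_integrable; first exact: segment_compact.
    by apply: continuous_subspaceT => x; exact: cf.
  apply: DeriveDef; first exact: dG.
  by rewrite -derive1E; exact: GE.
exists (fun x => G x - G 0); first by rewrite subrr.
move=> t /dG H; have := is_deriveB H (is_derive_cst (G 0) t 1).
by rewrite subr0.
Qed.

Definition primitive (f : R -> R) : R -> R :=
  get [set F : R -> R | F 0 = 0 /\ forall t : R, -2 < t < 3 -> is_derive t 1 F (f t)].

Lemma primitiveP f : continuous f ->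
  primitive f 0 = 0 /\ forall t : R, -2 < t < 3 -> is_derive t 1 (primitive f) (f t).
Proof.
move=> /primitive_exists[F F0 FD].
by rewrite /primitive; case: xgetP => [G _ //|/(_ F)[]].
Qed.

(** Freezing primitives outside [-1, 2] keeps the Picard iterates continuous and bounded on the
    whole line. *)
Definition clamp (t : R) : R := Num.max (-1) (Num.min t 2).

Lemma clamp_itv t : -1 <= clamp t <= 2.
Proof.
rewrite /clamp le_max lexx ge_max ge_min lexx orbT andbT; lra.
Qed.

Lemma clamp_id t : -1 <= t <= 2 -> clamp t = t.
Proof. by move=> /andP[t1 t2]; rewrite /clamp min_l// max_r. Qed.

Lemma clamp_continuous : continuous clamp.
Proof.
move=> t; apply: (@continuous_max R R (fun=> -1) (fun s => Num.min s 2)).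
  exact: cst_continuous.
apply: (@continuous_min R R id (fun=> 2)); last exact: cst_continuous.
exact: cvg_id.
Qed.

Definition mxprimitive p q (X : R -> 'M[R]_(p, q)) (t : R) : 'M[R]_(p, q) :=
  \matrix_(i, j) primitive (fun s => X s i j) (clamp t).

Section Primitive.
Context {p q : nat}.
Variable X : R -> 'M[R]_(p, q).
Hypothesis cX : continuous X.

Let cXij i j : continuous (fun s => X s i j).
Proof. by move=> t; apply: mxcurve_entry_continuous; exact: cX. Qed.

Lemma mxprimitive0 : mxprimitive X 0 = 0.
Proof.
apply/matrixP => i j; rewrite !mxE clamp_id; last lra.
exact: (primitiveP (@cXij i j)).1.
Qed.

Lemma mxprimitive_derive (t : R) : -1 < t < 2 -> is_derive t 1 (mxprimitive X) (X t).
Proof.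
move=> t12; apply/is_derive_mxP => i j.
have t23 : -2 < t < 3 by move: t12; lra.
apply: (near_eq_is_derive _ ((primitiveP (@cXij i j)).2 t t23)).
have : t \in `]-1, 2[ by rewrite in_itv.
move=> /near_in_itvoo; apply: filterS => s; rewrite in_itv/= => /andP[s1 s2].
by rewrite mxE clamp_id// !ltW.
Qed.

Lemma mxprimitive_continuous : continuous (mxprimitive X).
Proof.
move=> t; apply: mxcurve_continuous => i j.
have -> : (fun s => mxprimitive X s i j) = primitive (fun s => X s i j) \o clamp.
  by apply/funext => s; rewrite mxE.
apply: continuous_comp; first exact: clamp_continuous.
apply/differentiable_continuous/derivable1_diffP.
have h : -2 < clamp t < 3 by have := clamp_itv t; lra.
by case: ((primitiveP (@cXij i j)).2 _ h).
Qed.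

Lemma mxprimitive_le (c : R) : (forall t, `|X t| <= c) -> forall t, `|mxprimitive X t| <= 2 * c.
Proof.
move=> Xc t; have c0 : 0 <= c by apply: le_trans (Xc 0); exact: normr_ge0.
apply: mxnorm_le => [|i j]; first by rewrite mulr_ge0.
rewrite mxE; have := clamp_itv t; set s := clamp t => /andP[s1 s2].
pose F : R -> 'M[R]_1 := fun u => (primitive (fun s => X s i j) u)%:M.
pose D : R -> 'M[R]_1 := fun u => (X u i j)%:M.
have : `|F s - F 0| <= c * `|s - 0|.
  apply: (mxcurve_mvt (D := D)) => // u /andP[].
    rewrite ge_min le_max => u1 u2.
    apply/is_derive_mxP => a b; rewrite !mxE.
    have -> : (fun u => F u a b) = primitive (fun s => X s i j).
      by apply/funext => v; rewrite mxE !ord1 mulr1n.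
    rewrite !ord1 mulr1n; apply: (primitiveP (@cXij i j)).2.
    by case/orP: u1; case/orP: u2; lra.
  move=> _ _; apply: mxnorm_le => // a b; rewrite !mxE !ord1 mulr1n.
  exact: le_trans (ler_mxentry _ _ _) (Xc u).
rewrite subr0 => H; apply: le_trans (le_trans _ H) _.
  apply: le_trans (ler_mxentry _ ord0 ord0); rewrite addmxE oppmxE !mxE !mulr1n.
  by rewrite (primitiveP (@cXij i j)).1 subr0.
rewrite mulrC ler_wpM2r// ler_norml; move: s1 s2; lra.
Qed.

End Primitive.

(** Picard iteration, written as a series of increments: a primitive from 0 within [-1, 2] costs a
    factor 2 and the product with B a factor 1/4, so the k-th increment is at most 2^-k. *)
Lemma linear_ode n (B : R -> 'M[R]_n) : continuous B ->
  (forall t, n%:R * `|B t| <= 4^-1) ->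
  exists2 X : R -> 'M[R]_n, X 0 = 1%:M &
    forall t : R, 0 <= t <= 1 -> is_derive t 1 X (B t *m X t).
Proof.
move=> cB Bsmall.
have cM (X : R -> 'M[R]_n) : continuous X -> continuous (fun t => B t *m X t).
  move=> cX t; apply: mxcurve_continuous => i j.
  have -> : (fun s => (B s *m X s) i j) = \sum_k (fun s => B s i k * X s k j).
    by apply/funext => s; rewrite fct_sumE mxE.
  apply: continuous_sumr => k.
  by apply: continuousM; apply: mxcurve_entry_continuous; [exact: cB|exact: cX].
pose fix Xn k : R -> 'M[R]_n :=
  if k is k'.+1 then mxprimitive (fun t => B t *m Xn k' t) else fun=> 1%:M.
have cXn k : continuous (Xn k).
  by elim: k => [|k IH] /=; [move=> t; exact: cvg_cst|exact/mxprimitive_continuous/cM].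
have BX (X : R -> 'M[R]_n) c t : `|X t| <= c -> `|B t *m X t| <= 4^-1 * c.
  move=> Xc; apply: le_trans (mxnorm_mul _ _) _.
  by apply: ler_pM => //; rewrite mulr_ge0.
have Xle k t : `|Xn k t| <= 2^-1 ^+ k.
  elim: k t => [|k IH] t.
    apply: mxnorm_le => // i j; rewrite /= mxE; case: (_ == _); rewrite ?mulr1n ?normr1//.
    by rewrite mulr0n normr0.
  apply: le_trans (mxprimitive_le (cM _ (cXn k)) (fun t => BX _ _ t (IH t)) t) _.
  rewrite exprS; lra.
pose S k t := \sum_(l < k) Xn l t.
have Slim t i j : exists l, forall k, `|S k t i j - l| <= 2 * 2^-1 ^+ k.
  apply: geometric_limit => k; rewrite /S big_ord_recr/= addmxE addrAC subrr add0r.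
  exact: le_trans (ler_mxentry _ _ _) (Xle k t).
pose X t : 'M[R]_n := \matrix_(i, j) sval (cid (Slim t i j)).
have XS k t : `|S k t - X t| <= 2 * 2^-1 ^+ k.
  apply: mxnorm_le => [|i j]; first by rewrite mulr_ge0// exprn_ge0.
  rewrite addmxE oppmxE [X t i j]mxE; exact: (svalP (cid (Slim t i j))).
have cS k : continuous (S k).
  move=> t; have -> : S k = \sum_(l < k) Xn l.
    by apply/funext => s; rewrite fct_sumE.
  by apply: continuous_sumr => l; exact: cXn.
have e_small (e : R) : 0 < e -> exists k, 2 * 2^-1 ^+ k < e.
  move=> e0; have : (2^-1 ^+ k : R) @[k --> \oo] --> 0.
    by apply: cvg_expr; rewrite ger0_norm// invf_lt1// ltr1n.
  move=> /cvgrPdist_lt/(_ (e / 2)); rewrite divr_gt0// => /(_ isT)[k _ Hk].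
  exists k; have := Hk k (leqnn k); rewrite /= sub0r normrN ger0_norm ?exprn_ge0//.
  by rewrite ltr_pdivlMr// mulrC.
have cX : continuous X.
  move=> t; apply/cvgrPdist_le => e e0.
  have e4 : 0 < e / 4 by rewrite divr_gt0.
  have [k ke] := e_small _ e4.
  have /cvgrPdist_le/(_ _ e4) := cS k t; apply: filterS => s Ss.
  have -> : X t - X s = (X t - S k t) + (S k t - S k s) + (S k s - X s).
    by rewrite !addrA subrK subrK.
  apply: le_trans (ler_normD _ _) _; apply: le_trans (lerD (ler_normD _ _) (lexx _)) _.
  have a1 : `|X t - S k t| <= e / 4.
    by rewrite distrC; apply: le_trans (XS k t) (ltW ke).
  have a2 : `|S k s - X s| <= e / 4 by apply: le_trans (XS k s) (ltW ke).
  apply: le_trans (lerD (lerD a1 Ss) a2) _.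
  by move: (e : R) e0 => e' e0'; clear -e0'; lra.
(* [Y] is the integral operator applied to the limit [X]. It is differentiable by construction and
   is identified with [X] through the partial sums, so no limit is differentiated. *)
pose Y t := 1%:M + mxprimitive (fun t => B t *m X t) t.
have dY (t : R) : -1 < t < 2 -> is_derive t 1 Y (B t *m X t).
  move=> t12; have := is_deriveD (is_derive_cst (1%:M : 'M[R]_n) t 1)
    (mxprimitive_derive (cM _ cX) t12).
  by rewrite add0r.
have dS k (t : R) : -1 < t < 2 -> is_derive t 1 (S k.+1) (B t *m S k t).
  move=> t12; have -> : S k.+1 = (fun=> 1%:M) + \sum_(l < k) Xn l.+1.
    by apply/funext => s; rewrite /S big_ord_recl/= !fctE fct_sumE.
  have := is_deriveD (is_derive_cst (1%:M : 'M[R]_n) t 1)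
    (is_derive_sum (fun l : 'I_k => mxprimitive_derive (cM _ (cXn l)) t12)).
  by rewrite add0r -mulmx_sumr.
have YX t : -1 < t < 2 -> Y t = X t.
  move=> t12; apply/eqP; rewrite -subr_eq0 -normr_eq0; apply/eqP/le_anti.
  rewrite normr_ge0 andbT; apply/ler_addgt0Pl => e e0; rewrite addr0.
  have [k ke] := e_small _ e0.
  have h : `|(Y t - S k.+1 t) - (Y 0 - S k.+1 0)| <= 4^-1 * (2 * 2^-1 ^+ k) * `|t - 0|.
    have I s : Num.min 0 t <= s <= Num.max 0 t -> -1 < s < 2.
      move=> /andP[]; rewrite ge_min le_max => u1 u2.
      by move: t12; case/orP: u1; case/orP: u2; lra.
    apply: (mxcurve_mvt (X := fun t => Y t - S k.+1 t) (D := fun t => B t *m (X t - S k t))).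
    - by rewrite !mulr_ge0// exprn_ge0.
    - by move=> s /I s12; rewrite mulmxBr; exact: is_deriveB (dY _ s12) (dS k _ s12).
    - by move=> s _; apply: (BX (fun s => X s - S k s)); rewrite distrC.
  have SS0 : S k.+1 0 = 1%:M.
    by rewrite /S big_ord_recl/= big1 ?addr0// => l _; exact: mxprimitive0 (cM _ (cXn l)).
  have Y0 : Y 0 = 1%:M by rewrite /Y mxprimitive0 ?addr0//; exact: cM.
  rewrite SS0 Y0 subrr !subr0 in h.
  have -> : Y t - X t = (Y t - S k.+1 t) + (S k.+1 t - X t) by rewrite addrA subrK.
  apply: le_trans (ler_normD _ _) _.
  have t2 : `|t| <= 2 by rewrite ler_norml; move: t12; lra.
  have h2 : 4^-1 * (2 * 2^-1 ^+ k) * `|t| <= 4^-1 * (2 * 2^-1 ^+ k) * 2.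
    by apply: ler_wpM2l => //; rewrite !mulr_ge0// exprn_ge0.
  have := XS k.+1 t; rewrite exprS; move: ke h h2; clear; lra.
exists X.
  by rewrite -YX ?/Y ?mxprimitive0 ?addr0//; [exact: cM|lra].
move=> t t01; have t12 : -1 < t < 2 by move: t01; lra.
apply: (near_eq_is_derive _ (dY t t12)).
have : t \in `]-1, 2[ by rewrite in_itv.
by move=> /near_in_itvoo; apply: filterS => s; rewrite in_itv/= => /YX.
Qed.

End LinearODE.

(** * The Frobenius theorem for flat linear systems *)

Section Frobenius.
Context {R : realType} {m n : nat}.
Implicit Types (y z v w a : 'rV[R]_m) (O : set 'rV[R]_m).

Lemma closed_ball_compact a (r : R) : compact [set y : 'rV[R]_m | `|y - a| <= r].
Proof.
apply: bounded_closed_compact.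
  exists (`|a| + r); split; first exact: num_real.
  move=> e re y /= yr; apply: le_trans (ltW re).
  by rewrite -[y](subrK a) addrC; apply: le_trans (ler_normD _ _) _; rewrite lerD2l.
apply: (@closed_comp _ _ (fun y : 'rV[R]_m => `|y - a|) [set x : R | x <= r]).
  move=> y _; apply: (@continuous_comp _ _ _ (fun y : 'rV[R]_m => y - a) (fun y => `|y|)).
    exact: (cvgB cvg_id (cvg_cst _)).
  exact: norm_continuous.
exact: closed_le.
Qed.

Lemma bound_on_ball (f : 'rV[R]_m -> R) O a (r : R) : 0 <= r ->
  (forall y, `|y - a| <= r -> O y) -> Ck_on 0 O f ->
  exists2 M : R, 0 <= M & forall y, `|y - a| <= r -> `|f y| <= M.
Proof.
move=> r0 rO cf; have [|||c ca cM] := @EVT_max_rV R m (fun y => `|f y|) [set y | `|y - a| <= r].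
- by exists a => /=; rewrite subrr normr0.
- exact: closed_ball_compact.
- apply/continuous_in_subspaceT => y; rewrite inE/= => yr.
  apply: (@continuous_comp _ _ _ f (fun x : R => `|x|)); last exact: norm_continuous.
  by apply: cf; exact: rO.
- by exists `|f c| => // y yr; apply: cM; rewrite inE.
Qed.

Lemma fin_bound (I : finType) (P : I -> R -> Prop) :
  (forall i M M', M <= M' -> P i M -> P i M') ->
  (forall i, exists2 M : R, 0 <= M & P i M) -> exists2 M : R, 0 <= M & forall i, P i M.
Proof.
move=> Pmon H.
have /choice[f Hf] : forall i, exists M, 0 <= M /\ P i M by move=> i; case: (H i) => M; exists M.
exists (\sum_i f i); first by apply: sumr_ge0 => i _; exact: (Hf i).1.
move=> i; apply: Pmon (Hf i).2; rewrite (bigD1 i)//= lerDl.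
by apply: sumr_ge0 => j _; exact: (Hf j).1.
Qed.

Lemma ball_segment a y v (r c : R) : 0 <= c <= 1 -> `|y - a| <= r -> `|y + v - a| <= r ->
  `|y + c *: v - a| <= r.
Proof.
move=> /andP[c0 c1] ya yva.
have -> : y + c *: v - a = (1 - c) *: (y - a) + c *: (y + v - a).
  by rewrite [y + v - a]addrAC [X in _ = _ + X]scalerDr addrA -scalerDl subrK scale1r addrAC.
apply: le_trans (ler_normD _ _) _; rewrite !normrZ !ger0_norm ?subr_ge0//.
have -> : r = (1 - c) * r + c * r by ring.
by apply: lerD; apply: ler_wpM2l => //; rewrite subr_ge0.
Qed.

(** The remainder is bounded uniformly in the base point over a compact ball; pointwise
    differentiability would not give the quadratic defect in [radial_step]. *)
Lemma taylor_bound (f : 'rV[R]_m -> R) O a (r : R) : open O -> 0 <= r ->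
  (forall y, `|y - a| <= r -> O y) -> Ck_on 2 O f ->
  exists2 M : R, 0 <= M & forall y v, `|y - a| <= r -> `|y + v - a| <= r ->
    `|f (y + v) - f y - \sum_i v ord0 i * partial i f y| <= M * `|v| ^+ 2.
Proof.
move=> oO r0 rO [df pf].
have [M M0 HM] : exists2 M : R, 0 <= M & forall ij : 'I_m * 'I_m, forall y, `|y - a| <= r ->
    `|partial ij.1 (partial ij.2 f) y| <= M.
  apply: fin_bound => [ij M M' MM' H y /H yM|[i j]]; first exact: le_trans MM'.
  exact: (bound_on_ball r0 rO ((pf j).2 i)).
exists (m%:R * (m%:R * M)); first by rewrite !mulr_ge0.
move=> y v ya yva.
have seg (s : R) : 0 <= s <= 1 -> `|y + s *: v - a| <= r by move=> s01; exact: ball_segment.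
have [|c /andP[c0 c1] ->] := @mvt_line R m f y v; first by move=> s s01; exact/df/rO/seg.
rewrite -sumrB (eq_bigr (fun i => v ord0 i * (partial i f (y + c *: v) - partial i f y))); last first.
  by move=> i _; rewrite mulrBr.
have -> : m%:R * (m%:R * M) * `|v| ^+ 2 = m%:R * (m%:R * M * `|v|) * `|v| by ring.
apply: sum_coord_le => i.
have c01 : 0 <= c <= 1 by rewrite !ltW.
have [|d /andP[d0 d1] ->] := @mvt_line R m (partial i f) y (c *: v).
  move=> s /andP[s0 s1]; rewrite scalerA; apply: (pf i).1; apply: rO; apply: seg.
  by apply/andP; split; [rewrite mulr_ge0// ltW|rewrite mulr_ile1// ltW].
apply: le_trans (sum_coord_le (e := M) _ _) _.
  move=> k; apply: (HM (k, i)); rewrite scalerA; apply: seg.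
  by apply/andP; split; [rewrite mulr_ge0// ltW|rewrite mulr_ile1// ltW].
apply: ler_wpM2l; first by rewrite mulr_ge0.
have -> : `|c *: v| = c * `|v| by rewrite normrZ gtr0_norm.
by rewrite ler_piMl// ltW.
Qed.

Variables (A : 'I_m -> 'rV[R]_m -> 'M[R]_n) (O : set 'rV[R]_m).
Hypothesis oO : open O.
Hypothesis AC : forall k i p q, Ck_on k O (fun y => A i y p q).

Definition dmx k i y : 'M[R]_n := \matrix_(p, q) partial k (fun z => A i z p q) y.

Hypothesis Aflat : forall x i j, O x -> model_halfspace x ->
  dmx i j x - dmx j i x + A j x *m A i x - A i x *m A j x = 0.

Definition lin_mx v y : 'M[R]_n := \sum_i v ord0 i *: A i y.

Lemma norm_lin (F : 'I_m -> 'M[R]_n) v (e : R) : (forall i, `|F i| <= e) ->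
  `|\sum_i v ord0 i *: F i| <= m%:R * e * `|v|.
Proof.
move=> Fe; apply: le_trans (ler_norm_sum _ _ _) _.
rewrite -mulrA mulr_natl -[X in _ *+ X](card_ord m) -sumr_const.
apply: ler_sum => i _; rewrite normrZ mulrC.
by apply: ler_pM => //; exact: ler_coord.
Qed.

Lemma conn_bounds a (r : R) : 0 <= r -> (forall y, `|y - a| <= r -> O y) ->
  exists2 M : R, 0 <= M & [/\ forall i y, `|y - a| <= r -> `|A i y| <= M,
    forall k i y, `|y - a| <= r -> `|dmx k i y| <= M &
    forall i y v, `|y - a| <= r -> `|y + v - a| <= r ->
      `|A i (y + v) - A i y - \sum_k v ord0 k *: dmx k i y| <= M * `|v| ^+ 2].
Proof.
move=> r0 rO.
have [M1 M10 H1] : exists2 M : R, 0 <= M & forall i : 'I_m * ('I_n * 'I_n),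
    forall y, `|y - a| <= r -> `|A i.1 y i.2.1 i.2.2| <= M.
  apply: fin_bound => [? M M' MM' H y /H yM|[i [p q]]]; first exact: le_trans MM'.
  exact: (bound_on_ball r0 rO (AC 0 i p q)).
have [M2 M20 H2] : exists2 M : R, 0 <= M & forall i : 'I_m * 'I_m * ('I_n * 'I_n),
    forall y, `|y - a| <= r -> `|dmx i.1.1 i.1.2 y i.2.1 i.2.2| <= M.
  apply: fin_bound => [? M M' MM' H y /H yM|[[k i] [p q]]]; first exact: le_trans MM'.
  have [M M0 HM] := bound_on_ball r0 rO ((AC 1 i p q).2 k).
  by exists M => // y /HM; rewrite mxE.
have [M3 M30 H3] : exists2 M : R, 0 <= M & forall i : 'I_m * ('I_n * 'I_n),
    forall y v, `|y - a| <= r -> `|y + v - a| <= r ->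
    `|A i.1 (y + v) i.2.1 i.2.2 - A i.1 y i.2.1 i.2.2 -
      \sum_k v ord0 k * partial k (fun z => A i.1 z i.2.1 i.2.2) y| <= M * `|v| ^+ 2.
  apply: fin_bound => [? M M' MM' H y v yr /(H _ _ yr) yM|[i [p q]]].
    by apply: le_trans yM _; rewrite ler_wpM2r// exprn_ge0.
  exact: (taylor_bound oO r0 rO (AC 2 i p q)).
exists (M1 + M2 + M3); first by rewrite !addr_ge0.
split.
- move=> i y yr; apply: mxnorm_le => [|p q]; first by rewrite !addr_ge0.
  by apply: le_trans (H1 (i, (p, q)) _ yr) _; rewrite -addrA lerDl addr_ge0.
- move=> k i y yr; apply: mxnorm_le => [|p q]; first by rewrite !addr_ge0.
  by apply: le_trans (H2 ((k, i), (p, q)) _ yr) _; rewrite addrAC lerDr addr_ge0.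
- move=> i y v yr yvr; apply: mxnorm_le => [|p q].
    by rewrite mulr_ge0 ?exprn_ge0// !addr_ge0.
  rewrite !(addmxE, oppmxE) summxE.
  rewrite (eq_bigr (fun k => v ord0 k * partial k (fun z => A i z p q) y)); last first.
    by move=> k _; rewrite !mxE.
  apply: le_trans (H3 (i, (p, q)) _ _ yr yvr) _; rewrite ler_wpM2r// ?exprn_ge0//.
  by rewrite lerDr addr_ge0.
Qed.

Lemma lin_mxD u v y : lin_mx (u + v) y = lin_mx u y + lin_mx v y.
Proof.
by rewrite /lin_mx -big_split/=; apply: eq_bigr => i _; rewrite mxE scalerDl.
Qed.

Lemma lin_mx_flat z v c : O c -> model_halfspace c ->
  (\sum_k z ord0 k *: \sum_i v ord0 i *: dmx i k c) -
  (\sum_i v ord0 i *: \sum_k z ord0 k *: dmx k i c) +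
  lin_mx z c *m lin_mx v c - lin_mx v c *m lin_mx z c = 0.
Proof.
move=> Oc Hc.
have -> : \sum_k z ord0 k *: \sum_i v ord0 i *: dmx i k c =
    \sum_k \sum_i (z ord0 k * v ord0 i) *: dmx i k c.
  by apply: eq_bigr => k _; rewrite scaler_sumr; apply: eq_bigr => i _; rewrite scalerA.
have -> : \sum_i v ord0 i *: \sum_k z ord0 k *: dmx k i c =
    \sum_k \sum_i (z ord0 k * v ord0 i) *: dmx k i c.
  rewrite exchange_big; apply: eq_bigr => i _; rewrite scaler_sumr.
  by apply: eq_bigr => k _; rewrite scalerA mulrC.
have -> : lin_mx z c *m lin_mx v c = \sum_k \sum_i (z ord0 k * v ord0 i) *: (A k c *m A i c).
  rewrite /lin_mx mulmx_suml; apply: eq_bigr => k _; rewrite mulmx_sumr.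
  by apply: eq_bigr => i _; rewrite -scalemxAl -scalemxAr scalerA.
have -> : lin_mx v c *m lin_mx z c = \sum_k \sum_i (z ord0 k * v ord0 i) *: (A i c *m A k c).
  rewrite /lin_mx mulmx_suml exchange_big; apply: eq_bigr => i _; rewrite mulmx_sumr.
  by apply: eq_bigr => k _; rewrite -scalemxAl -scalemxAr scalerA mulrC.
rewrite -sumrB -big_split/= -sumrB; apply: big1 => k _.
rewrite -sumrB -big_split/= -sumrB; apply: big1 => i _.
by rewrite -scalerBr -scalerDr -scalerBr Aflat// scaler0.
Qed.

Section Transport.
Variables (a : 'rV[R]_m) (r M : R).
Hypothesis r_gt0 : 0 < r.
Hypothesis r_le1 : r <= 1.
Hypothesis rO : forall y, `|y - a| <= r -> O y.
Hypothesis M0 : 0 <= M.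
Hypothesis rM : n%:R * (m%:R * M * r) <= 4^-1.
Hypothesis AM : forall i y, `|y - a| <= r -> `|A i y| <= M.
Hypothesis DM : forall k i y, `|y - a| <= r -> `|dmx k i y| <= M.
Hypothesis TM : forall i y v, `|y - a| <= r -> `|y + v - a| <= r ->
  `|A i (y + v) - A i y - \sum_k v ord0 k *: dmx k i y| <= M * `|v| ^+ 2.

Let ray z (t : R) : `|z| <= r -> 0 <= t <= 1 -> `|a + t *: z - a| <= r.
Proof.
move=> zr t01; apply: ball_segment => //; first by rewrite subrr normr0 ltW.
by rewrite addrC addKr.
Qed.

Lemma lin_mx_le w y : `|y - a| <= r -> `|lin_mx w y| <= m%:R * M * `|w|.
Proof. by move=> yr; apply: norm_lin => i; exact: AM. Qed.

Lemma lin_mx_continuous w y : O y -> {for y, continuous (lin_mx w)}.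
Proof.
move=> Oy.
have -> : lin_mx w = \sum_i (fun y => w ord0 i *: A i y).
  by apply/funext => z; rewrite fct_sumE.
apply: continuous_sumr => i.
have cA : {for y, continuous (A i)} by apply: mxcurve_continuous => p q; have /= := AC 0 i p q; apply.
exact: (continuousZl_tmp cA).
Qed.

Lemma radial_ode w : `|w| <= r -> exists2 X : R -> 'M[R]_n, X 0 = 1%:M &
  forall t : R, 0 <= t <= 1 -> is_derive t 1 X (lin_mx w (a + t *: w) *m X t).
Proof.
(* Clamping the parameter keeps the coefficient continuous and small at all real times, as
   [linear_ode] requires. *)
move=> wr; pose c (t : R) := Num.max 0 (Num.min t 1).
have c01 t : 0 <= c t <= 1 by rewrite /c le_max lexx ge_max ler01 ge_min lexx orbT.
have cc : continuous c.
  move=> t; apply: (@continuous_max R R (fun=> 0) (fun s => Num.min s 1)).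
    exact: cst_continuous.
  apply: (@continuous_min R R id (fun=> 1)); last exact: cst_continuous.
  exact: cvg_id.
have [||X X0 XD] := @linear_ode R n (fun t => lin_mx w (a + c t *: w)).
- move=> t; apply: (@continuous_comp _ _ _ (fun t : R => a + c t *: w) (lin_mx w)).
    apply: cvgD; first exact: cvg_cst.
    exact: (cvgZr_tmp (cc t)).
  by apply: lin_mx_continuous; apply: rO; exact: ray.
- move=> t; apply: le_trans rM; apply: ler_wpM2l => //.
  apply: le_trans (lin_mx_le w (ray wr (c01 t))) _.
  by apply: ler_wpM2l => //; rewrite mulr_ge0.
exists X => // t t01; have := XD t t01.
by case/andP: t01 => t0 t1; rewrite /c min_l// max_r.
Qed.

(** Transport from the centre along rays gives the only candidate for a solution; that it is
    differentiable across rays is the content of [radial_step]. *)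
Lemma radial_frame : exists Phi : 'rV[R]_m -> 'M[R]_n, exists X : 'rV[R]_m -> R -> 'M[R]_n,
  forall w, `|w| <= r -> [/\ X w 0 = 1%:M, X w 1 = Phi (a + w) &
  forall t : R, 0 <= t <= 1 -> is_derive t 1 (X w) (lin_mx w (a + t *: w) *m X w t)].
Proof.
have /choice[X HX] : forall w, exists X : R -> 'M[R]_n, `|w| <= r -> X 0 = 1%:M /\
    forall t : R, 0 <= t <= 1 -> is_derive t 1 X (lin_mx w (a + t *: w) *m X t).
  move=> w; have [wr|] := boolP (`|w| <= r); last by exists (fun=> 0).
  by have [X X0 XD] := radial_ode wr; exists X.
exists (fun y => X (y - a) 1), X => w /HX[X0 XD]; split => //.
by rewrite addrC addKr.
Qed.

Lemma lin_mx_taylor w v y (t : R) : 0 <= t <= 1 ->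
  `|y - a| <= r -> `|y + t *: v - a| <= r ->
  `|lin_mx w (y + t *: v) - lin_mx w y -
    t *: \sum_k w ord0 k *: \sum_i v ord0 i *: dmx i k y| <= m%:R * M * `|v| ^+ 2 * `|w|.
Proof.
move=> /andP[t0 t1] yr yvr.
have -> : lin_mx w (y + t *: v) - lin_mx w y -
    t *: \sum_k w ord0 k *: \sum_i v ord0 i *: dmx i k y =
    \sum_k w ord0 k *: (A k (y + t *: v) - A k y - \sum_i (t *: v) ord0 i *: dmx i k y).
  rewrite scaler_sumr /lin_mx -!sumrB; apply: eq_bigr => k _.
  rewrite !scalerBr; congr (_ - _); rewrite scalerA mulrC -scalerA scaler_sumr.
  by congr (_ *: _); apply: eq_bigr => i _; rewrite scalerA mxE.
apply: le_trans (norm_lin (e := M * `|v| ^+ 2) _ _) _; last by rewrite mulrA.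
move=> k; apply: le_trans (TM k yr yvr) _; apply: ler_wpM2l => //.
rewrite normrZ (ger0_norm t0) exprMn ler_piMl ?exprn_ge0//.
by rewrite exprn_ile1.
Qed.

Lemma lin_mx_lipschitz w v y (t : R) : `|v| <= 1 -> 0 <= t <= 1 ->
  `|y - a| <= r -> `|y + t *: v - a| <= r ->
  `|lin_mx w (y + t *: v) - lin_mx w y| <= (m%:R * M + m%:R * (m%:R * M)) * `|v| * `|w|.
Proof.
move=> v1 t01 yr yvr.
have := lin_mx_taylor w t01 yr yvr; set S := _ *: \sum_k _ => H.
rewrite -[X in `|X|](subrK S) !mulrDl; apply: le_trans (ler_normD _ _) _; apply: lerD.
  apply: le_trans H _; rewrite expr2 ler_wpM2r// ler_wpM2l ?mulr_ge0//.
  by rewrite ler_piMr.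
case/andP: t01 => t0 t1.
have -> : S = \sum_k w ord0 k *: (\sum_i (t *: v) ord0 i *: dmx i k y).
  rewrite /S scaler_sumr; apply: eq_bigr => k _; rewrite scalerA mulrC -scalerA scaler_sumr.
  by congr (_ *: _); apply: eq_bigr => i _; rewrite scalerA mxE.
apply: le_trans (norm_lin (e := m%:R * M * `|v|) _ _) _; last by rewrite mulrA.
move=> k; apply: le_trans (norm_lin (e := M) _ _) _; first by move=> i; exact: DM.
by rewrite ler_wpM2l ?mulr_ge0// normrZ (ger0_norm t0) ler_piMl.
Qed.

Lemma lin_mx_ray_derive v z (t : R) : `|z| <= r -> 0 <= t <= 1 ->
  is_derive t 1 (fun s => lin_mx v (a + s *: z))
    (\sum_i v ord0 i *: \sum_k z ord0 k *: dmx k i (a + t *: z)).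
Proof.
move=> zr t01; have Oc : O (a + t *: z) by apply: rO; exact: ray.
have -> : (fun s => lin_mx v (a + s *: z)) = \sum_i v ord0 i \*: (fun s => A i (a + s *: z)).
  by apply/funext => s; rewrite fct_sumE.
apply: is_derive_sum => i; apply: is_deriveZ; apply/is_derive_mxP => p q.
have dA := (AC 1 i p q).1 _ Oc.
have := is_derive_line dA => /is_derive_eq; apply.
rewrite derive_partialE// summxE; apply: eq_bigr => k _.
by rewrite !mxE.
Qed.

(** Compares transport along the rays to z and to z + v. Flatness is used at points of the first ray
    only, so z + v may leave the half-space: this is why the frame is differentiable in the ordinary
    sense at boundary points. *)
Lemma radial_step (X X' : R -> 'M[R]_n) z v : X 0 = 1%:M -> X' 0 = 1%:M ->
  (forall t : R, 0 <= t <= 1 -> is_derive t 1 X (lin_mx z (a + t *: z) *m X t)) ->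
  (forall t : R, 0 <= t <= 1 ->
    is_derive t 1 X' (lin_mx (z + v) (a + t *: (z + v)) *m X' t)) ->
  `|z| <= r -> `|z + v| <= r -> `|v| <= 1 -> model_halfspace a -> model_halfspace (a + z) ->
  `|X' 1 - (1%:M + lin_mx v (a + z)) *m X 1| <=
    2 * (n%:R * (m%:R * M + (m%:R * M + m%:R * (m%:R * M)) +
      n%:R * (m%:R * M + m%:R * (m%:R * M)) * (m%:R * M) +
      n%:R * (m%:R * M) * (m%:R * M)) * (1 + 2 * (m%:R * M))) * `|v| ^+ 2.
Proof.
move=> X0 X'0 XD X'D zr zvr v1 Ha Haz.
set c1 := m%:R * M; set c2 := c1 + m%:R * c1.
set C := c1 + c2 + n%:R * c2 * c1 + n%:R * c1 * c1.
have c10 : 0 <= c1 by rewrite mulr_ge0.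
have c20 : 0 <= c2 by rewrite addr_ge0// mulr_ge0.
have n1 : `|1%:M : 'M[R]_n| <= 1.
  apply: mxnorm_le => // i j; rewrite mxE; case: (_ == _); rewrite ?mulr1n ?normr1//.
  by rewrite mulr0n normr0.
have small w y B : `|w| <= r -> `|y - a| <= r -> `|lin_mx w y *m B| <= 2^-1 * `|B|.
  move=> wr yr; apply: le_trans (mxnorm_mul _ _) _; apply: ler_wpM2r => //.
  apply: (@le_trans _ _ (4^-1)); last by lra.
  apply: le_trans rM; apply: ler_wpM2l => //.
  by apply: le_trans (lin_mx_le w yr) _; apply: ler_wpM2l.
have r1 : `|z| <= 1 by exact: le_trans zr r_le1.
have XB t : 0 <= t <= 1 -> `|X t| <= 1 + 2 * c1.
  move=> t01; rewrite -[X t](subrK 1%:M) addrC; apply: le_trans (ler_normD _ _) _.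
  apply: lerD => //.
  apply: (small_gronwall (E := fun t => X t - 1%:M) (D := fun t => lin_mx z (a + t *: z) *m X t)) => //.
  - move=> s s01; have := is_deriveB (XD s s01) (is_derive_cst (1%:M : 'M[R]_n) s 1).
    by rewrite subr0.
  - move=> s s01; have sr := ray zr s01.
    rewrite -{1}[X s](subrK 1%:M) mulmxDr mulmx1; apply: le_trans (ler_normD _ _) _.
    apply: lerD; first exact: small.
    by apply: le_trans (lin_mx_le z sr) _; rewrite ler_piMr.
  - by rewrite X0 subrr.
(* First-order transport from a + t z to a + t (z + v). [E] below measures its failure to intertwine
   the two solutions and obeys an inhomogeneous equation whose source [Rt] is quadratic in v by
   [transport_defect]. *)
pose P t := 1%:M + t *: lin_mx v (a + t *: z).
have PD (t : R) : 0 <= t <= 1 -> is_derive t 1 P (lin_mx v (a + t *: z) +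
    t *: \sum_i v ord0 i *: \sum_k z ord0 k *: dmx k i (a + t *: z)).
  move=> t01; have /is_derive_mxP dL := lin_mx_ray_derive v zr t01.
  apply/is_derive_mxP => p q.
  have -> : (fun s => P s p q) = cst ((1%:M : 'M[R]_n) p q) +
      id * (fun s => lin_mx v (a + s *: z) p q).
    by apply/funext => s; rewrite /P addmxE !fctE [X in _ + X]mxE.
  have := is_deriveD (is_derive_cst ((1%:M : 'M[R]_n) p q) t 1)
    (is_deriveM (is_derive_id t 1) (dL p q)).
  move=> /is_derive_eq; apply; rewrite add0r addmxE [X in _ = _ + X]mxE addrC.
  by congr (_ + _); rewrite /GRing.scale/= mulr1.
pose Rt t := (lin_mx z (a + t *: (z + v)) + lin_mx v (a + t *: (z + v))) *m P t -
  (lin_mx v (a + t *: z) + t *: \sum_i v ord0 i *: \sum_k z ord0 k *: dmx k i (a + t *: z)) -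
  P t *m lin_mx z (a + t *: z).
pose E t := X' t - P t *m X t.
pose D t := lin_mx (z + v) (a + t *: (z + v)) *m E t + Rt t *m X t.
have ED (t : R) : 0 <= t <= 1 -> is_derive t 1 E (D t).
  move=> t01; have := is_deriveB (X'D t t01) (is_derive_mulmx (PD t t01) (XD t t01)).
  move=> /is_derive_eq; apply; rewrite /D /E /Rt lin_mxD.
  rewrite !mulmxBl mulmxBr !mulmxA.
  by rewrite opprD -!addrA addKr.
have RC (t : R) : 0 <= t <= 1 -> `|Rt t| <= C * `|v| ^+ 2.
  move=> t01; case/andP: (t01) => t0 t1.
  have cr := ray zr t01.
  have Hc : model_halfspace (a + t *: z).
    move=> i i0; have := Ha i i0; have := Haz i i0; rewrite !mxE => h1 h2.
    have -> : a ord0 i + t * z ord0 i = (1 - t) * a ord0 i + t * (a ord0 i + z ord0 i) by ring.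
    by rewrite addr_ge0// mulr_ge0// subr_ge0.
  have cvE : a + t *: (z + v) = a + t *: z + t *: v by rewrite scalerDr addrA.
  have cvr : `|a + t *: z + t *: v - a| <= r by rewrite -cvE; exact: ray.
  rewrite /Rt cvE (transport_defect _ _ t (lin_mx_flat z v (rO cr) Hc)).
  have q1 := lin_mx_taylor z t01 cr cvr.
  have q2 := lin_mx_lipschitz v v1 t01 cr cvr.
  have q3 := lin_mx_lipschitz z v1 t01 cr cvr.
  have q4 := lin_mx_le v cr.
  have q5 := lin_mx_le v cvr.
  have vv : 0 <= `|v| ^+ 2 by rewrite exprn_ge0.
  rewrite /C !mulrDl; apply: le_trans (ler_normD _ _) _; apply: lerD; last first.
    rewrite normrZ (ger0_norm t0); apply: le_trans (ler_piMl _ t1) _ => //.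
    apply: le_trans (mxnorm_mul _ _) _.
    have -> : n%:R * c1 * c1 * `|v| ^+ 2 = n%:R * (c1 * `|v|) * (c1 * `|v|) by ring.
    by apply: ler_pM => //; apply: ler_wpM2l.
  apply: le_trans (ler_normD _ _) _; apply: lerD; last first.
    rewrite normrZ (ger0_norm t0); apply: le_trans (ler_piMl _ t1) _ => //.
    apply: le_trans (mxnorm_mul _ _) _.
    have -> : n%:R * c2 * c1 * `|v| ^+ 2 = n%:R * (c2 * `|v|) * (c1 * `|v|) by ring.
    apply: ler_pM => //; apply: ler_wpM2l => //.
    by apply: le_trans q3 _; rewrite ler_piMr// mulr_ge0.
  apply: le_trans (ler_normD _ _) _; apply: lerD.
    by apply: le_trans q1 _; rewrite ler_piMr// mulr_ge0.
  by apply: le_trans q2 _; rewrite -mulrDl expr2 -[leLHS]mulrA.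
have C0 : 0 <= C by rewrite /C !addr_ge0// !mulr_ge0.
have -> : X' 1 - (1%:M + lin_mx v (a + z)) *m X 1 = E 1 by rewrite /E /P !scale1r.
rewrite -mulrA; apply: (small_gronwall ED) => //; last 2 first.
- by rewrite /E /P X'0 X0 scale0r addr0 mulmx1 subrr.
- by rewrite ler01 lexx.
move=> t t01; apply: le_trans (ler_normD _ _) _; apply: lerD; first exact: small (ray zvr t01).
apply: le_trans (mxnorm_mul _ _) _.
have -> : n%:R * C * (1 + 2 * c1) * `|v| ^+ 2 = n%:R * (C * `|v| ^+ 2) * (1 + 2 * c1) by ring.
apply: ler_pM => //; last exact: XB.
by apply: ler_wpM2l => //; exact: RC.
Qed.

End Transport.

Lemma open_ball_radius a : O a -> exists2 r : R, 0 < r & forall y, `|y - a| <= r -> O y.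
Proof.
move=> Oa; have [r /= r0 rO] := (nbhs_ballP _ _).1 (open_nbhs_nbhs (conj oO Oa)).
exists (r / 2); first by rewrite divr_gt0.
move=> y yr; apply: rO; rewrite normr_ball distrC; apply: le_lt_trans yr _.
by rewrite ltr_pdivrMr// mulr_natr mulr2n ltrDl.
Qed.

Lemma frobenius a : O a -> model_halfspace a ->
  exists r : R, exists Phi : 'rV[R]_m -> 'M[R]_n,
  [/\ 0 < r, forall y, `|y - a| <= r -> O y, Phi a = 1%:M &
  forall y, `|y - a| < r -> model_halfspace y -> forall p q,
    differentiable (fun z => Phi z p q) y /\
    forall i, partial i (fun z => Phi z p q) y = (A i y *m Phi y) p q].
Proof.
move=> Oa Ha; have [r0 r00 r0O] := open_ball_radius Oa.
have [M M0 [AM0 DM0 TM0]] := conn_bounds (ltW r00) r0O.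
pose c := n%:R * (m%:R * M); have c0 : 0 <= c by rewrite !mulr_ge0.
(* The last bound gives n m M r <= 1/4, the hypothesis of [linear_ode]; adding 1 to c guards against
   c = 0. *)
pose r := Num.min (Num.min r0 1) (4 * (c + 1))^-1.
have cp : 0 < 4 * (c + 1) by rewrite mulr_gt0// ltr_wpDl.
have r_gt0 : 0 < r by rewrite !lt_min r00 ltr01 invr_gt0.
have r_le1 : r <= 1 by rewrite !ge_min lexx orbT.
have rr0 : r <= r0 by rewrite !ge_min lexx.
have rO y : `|y - a| <= r -> O y by move=> yr; apply: r0O; exact: le_trans rr0.
have rM : n%:R * (m%:R * M * r) <= 4^-1.
  rewrite mulrA -/c; apply: (@le_trans _ _ (c * (4 * (c + 1))^-1)).
    by apply: ler_wpM2l => //; rewrite !ge_min lexx !orbT.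
  by rewrite ler_pdivrMr// mulrA mulVf// mul1r lerDl.
have AM i y : `|y - a| <= r -> `|A i y| <= M by move=> yr; apply: AM0; exact: le_trans rr0.
have DM k i y : `|y - a| <= r -> `|dmx k i y| <= M.
  by move=> yr; apply: DM0; exact: le_trans rr0.
have TM i y v : `|y - a| <= r -> `|y + v - a| <= r ->
  `|A i (y + v) - A i y - \sum_k v ord0 k *: dmx k i y| <= M * `|v| ^+ 2.
  by move=> yr yvr; apply: TM0; exact: le_trans rr0.
have [Phi [X HX]] := radial_frame r_gt0 rO M0 rM AM.
exists r, Phi; split => //.
  have z0 : `|0 : 'rV[R]_m| <= r by rewrite normr0 ltW.
  have [X0 X1 XD] := HX 0 z0; rewrite addr0 in X1.
  apply/eqP; rewrite -subr_eq0 -normr_le0 -X1 -[leRHS](mulr0 2).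
  apply: (small_gronwall (E := fun t => X 0 t - 1%:M) (D := fun t => lin_mx 0 (a + t *: 0) *m X 0 t)).
  - move=> s s01; have := is_deriveB (XD s s01) (is_derive_cst (1%:M : 'M[R]_n) s 1).
    by rewrite subr0.
  - move=> s _; rewrite /lin_mx big1; last by move=> i _; rewrite mxE scale0r.
    by rewrite mul0mx normr0 addr0 mulr_ge0.
  - by rewrite X0 subrr.
  - by rewrite ler01 lexx.
move=> y yr Hy p q.
pose z := y - a; have yE : y = a + z by rewrite /z addrC subrK.
have zr : `|z| <= r by exact: ltW.
have [X0 X1 XD] := HX z zr.
set K : R := 2 * (n%:R * (m%:R * M + (m%:R * M + m%:R * (m%:R * M)) +
      n%:R * (m%:R * M + m%:R * (m%:R * M)) * (m%:R * M) +
      n%:R * (m%:R * M) * (m%:R * M)) * (1 + 2 * (m%:R * M))).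
have K0 : 0 <= K by rewrite /K !(mulr_ge0, addr_ge0).
apply/differentiable_incr => e e0.
have near_le (d : R) : 0 < d -> \forall v \near (0 : 'rV[R]_m), `|v| <= d.
  by move=> d0; exact: near0_norm_le.
have n1 := near_le 1 ltr01.
have ne : \forall v \near (0 : 'rV[R]_m), `|v| <= e / (K + 1).
  by apply: near_le; rewrite divr_gt0// ltr_wpDl.
have nr : \forall v \near (0 : 'rV[R]_m), `|v| <= r - `|z| by apply: near_le; rewrite subr_gt0.
near=> v.
have v1 : `|v| <= 1 by near: v; exact: n1.
have ve : `|v| <= e / (K + 1) by near: v; exact: ne.
have vr : `|v| <= r - `|z| by near: v; exact: nr.
have zvr : `|z + v| <= r by apply: le_trans (ler_normD _ _) _; rewrite -lerBrDl.
have [X'0 X'1 X'D] := HX _ zvr.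
have Haz : model_halfspace (a + z) by rewrite -yE.
have := radial_step r_gt0 r_le1 rO M0 rM AM DM TM X0 X'0 XD X'D zr zvr v1 Ha Haz.
rewrite -/K X1 X'1 addrA -yE => H.
have -> : Phi (y + v) p q - Phi y p q - \sum_i v ord0 i * (A i y *m Phi y) p q =
    (Phi (y + v) - (1%:M + lin_mx v y) *m Phi y) p q.
  rewrite mulmxDl mul1mx addmxE oppmxE addmxE opprD addrA; congr (_ - _).
  rewrite /lin_mx mulmx_suml summxE; apply: eq_bigr => i _.
  by rewrite -scalemxAl [RHS]mxE.
apply: le_trans (ler_mxentry _ _ _) (le_trans H _).
rewrite expr2 mulrA ler_wpM2r//; apply: le_trans (_ : (K + 1) * `|v| <= _).
  by rewrite mulrDl mul1r lerDl.
by rewrite mulrC -ler_pdivlMr// ltr_wpDl.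
Unshelve. all: by end_near. Qed.

End Frobenius.

(** * Parallel frames *)

Section LocalFrames.
Context {R : realType} {m : nat}.
Implicit Types (y z v w a : 'rV[R]_m).

(** Smoothness and invertibility hold on the whole open set, the geometric identities on the
    half-space only; invertibility in a full neighbourhood is what lets the Christoffel symbols be
    differentiated at boundary points. *)
Record cc_metric (g : 'rV[R]_m -> 'M[R]_m) (O : set 'rV[R]_m) (K : R) : Prop := CCMetric {
  cc_open : open O ;
  cc_smooth : forall k i j, Ck_on k O (fun x => g x i j) ;
  cc_unit : forall x, O x -> g x \in unitmx ;
  cc_sym : forall x, O x -> model_halfspace x -> (g x)^T = g x ;
  cc_pos : forall x, O x -> model_halfspace x ->
    forall u : 'rV[R]_m, u != 0 -> 0 < (u *m g x *m u^T) ord0 ord0 ;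
  cc_curv : forall x, O x -> model_halfspace x ->
    forall u v : 'rV[R]_m, free [:: u; v] -> sectional_curvature g x u v = K }.

Variables (g : 'rV[R]_m -> 'M[R]_m) (O : set 'rV[R]_m) (K : R).
Hypothesis h : cc_metric g O K.

Let A := conn g K.

Definition parallel_at q (U : 'rV[R]_m -> 'M[R]_(1 + m, q)) y : Prop :=
  forall i j, differentiable (fun z => U z i j) y /\
    forall k, partial k (fun z => U z i j) y = (A k y *m U y) i j.

Lemma parallel_mulr q q' (U : 'rV[R]_m -> 'M[R]_(1 + m, q)) (C : 'M[R]_(q, q')) y :
  parallel_at U y -> parallel_at (fun z => U z *m C) y.
Proof.
move=> HU i j.
have E : (fun z => (U z *m C) i j) = (fun z => \sum_s U z i s * cst (C s j) z).
  by apply/funext => z; rewrite mxE.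
rewrite E; split; first by apply: differentiable_sumM => s; [exact: (HU i s).1|exact: differentiable_cst].
move=> k; rewrite partial_sumM; last 2 first.
- by move=> s; exact: (HU i s).1.
- by move=> s; exact: differentiable_cst.
rewrite mulmxA mxE; apply: eq_bigr => s _.
by rewrite (HU i s).2 partial_cst mulr0 addr0.
Qed.

Lemma parallel_sub q (U W : 'rV[R]_m -> 'M[R]_(1 + m, q)) y :
  parallel_at U y -> parallel_at W y -> parallel_at (fun z => U z - W z) y.
Proof.
move=> HU HW i j.
have E : (fun z => (U z - W z) i j) = (fun z => U z i j) - (fun z => W z i j).
  by apply/funext => z; rewrite addmxE oppmxE.
rewrite E; split; first by apply: differentiableB; [exact: (HU i j).1|exact: (HW i j).1].
move=> k; rewrite /partial deriveB; last 2 first.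
- exact/diff_derivable/(HU i j).1.
- exact/diff_derivable/(HW i j).1.
by rewrite -!/(partial k _ _) (HU i j).2 (HW i j).2 mulmxBr addmxE oppmxE.
Qed.

Lemma parallel_chain q (U : 'rV[R]_m -> 'M[R]_(1 + m, q)) (xi : R -> 'rV[R]_m) (t : R) :
  parallel_at U (xi t) -> derivable xi t 1 ->
  is_derive t 1 (fun s => U (xi s)) (lin_mx A (derive1 xi t) (xi t) *m U (xi t)).
Proof.
move=> HU dxi; apply/is_derive_mxP => i j.
have := is_derive_chain (HU i j).1 dxi => /is_derive_eq; apply.
rewrite /lin_mx mulmx_suml summxE; apply: eq_bigr => k _.
by rewrite (HU i j).2 -scalemxAl [in RHS]mxE.
Qed.

(** Two points of the ball differ by at most 2 rho. The bound is 1/4 rather than 1/2 for the sake of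
    [form_preserved], whose equation has a term on either side. *)
Definition small_radius a (rho : R) : Prop :=
  [/\ 0 < rho, forall y, `|y - a| <= rho -> O y &
   forall w y, `|w| <= 2 * rho -> `|y - a| <= rho ->
     (1 + m)%:R * `|lin_mx A w y| <= 4^-1].

Lemma small_radius_le a rho rho' : 0 < rho' -> rho' <= rho ->
  small_radius a rho -> small_radius a rho'.
Proof.
move=> r0 rr [_ rO rS]; split => // [y yr|w y wr yr].
  by apply: rO; exact: le_trans rr.
by apply: rS; [apply: le_trans wr _; apply: ler_wpM2l|exact: le_trans rr].
Qed.

Lemma conn_smooth (k : nat) i p q : Ck_on k O (fun y => A i y p q).
Proof.
exact: (conn_Ck (cc_open h) (cc_smooth h) (cc_unit h)).
Qed.

Lemma small_radius_exists a : O a -> exists rho, small_radius a rho.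
Proof.
move=> Oa; have [r r0 rO] := open_ball_radius (cc_open h) Oa.
have [M M0 [AM _ _]] := conn_bounds (cc_open h) conn_smooth (ltW r0) rO.
pose c := (1 + m)%:R * (m%:R * M) : R.
have c0 : 0 <= c by rewrite !mulr_ge0.
have cp : 0 < 8 * (c + 1) by rewrite mulr_gt0// ltr_wpDl.
exists (Num.min r (8 * (c + 1))^-1); split.
- by rewrite lt_min r0 invr_gt0.
- by move=> y yr; apply: rO; apply: le_trans yr _; rewrite ge_min lexx.
- move=> w y wr yr; have yr' : `|y - a| <= r by apply: le_trans yr _; rewrite ge_min lexx.
  have wr' : `|w| <= 2 * (8 * (c + 1))^-1.
    by apply: le_trans wr _; apply: ler_wpM2l => //; rewrite ge_min lexx orbT.
  apply: le_trans (ler_wpM2l _ (norm_lin w (fun i => AM i y yr'))) _ => //.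
  rewrite mulrA -/c; apply: le_trans (ler_wpM2l c0 wr') _.
  by rewrite mulrA ler_pdivrMr//; lra.
Qed.

Lemma halfspace_convex (x y : 'rV[R]_m) (t : R) : 0 <= t <= 1 ->
  model_halfspace x -> model_halfspace y -> model_halfspace (x + t *: (y - x)).
Proof.
move=> /andP[t0 t1] Hx Hy i i0; have := Hx i i0; have := Hy i i0; rewrite !mxE => h1 h2.
have -> : x ord0 i + t * (y ord0 i - x ord0 i) = (1 - t) * x ord0 i + t * y ord0 i by ring.
by rewrite addr_ge0// mulr_ge0// subr_ge0.
Qed.

Lemma ball_convex_le (x z a : 'rV[R]_m) (r t : R) : 0 <= t <= 1 ->
  `|x - a| <= r -> `|z - a| <= r -> `|x + t *: (z - x) - a| <= r.
Proof. by move=> t01 xr zr; apply: ball_segment => //; rewrite [x + _]addrC subrK. Qed.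

Lemma ball_convex_lt (x z a : 'rV[R]_m) (r t : R) : 0 <= t <= 1 ->
  `|x - a| < r -> `|z - a| < r -> `|x + t *: (z - x) - a| < r.
Proof.
move=> t01 xr zr; apply: (@le_lt_trans _ _ (Num.max `|x - a| `|z - a|)); last by rewrite gt_max xr.
by apply: ball_convex_le => //; rewrite le_max lexx ?orbT.
Qed.

Section Segment.
Variables (a y0 y1 : 'rV[R]_m) (rho : R).
Hypothesis ar : small_radius a rho.
Hypothesis y0r : `|y0 - a| <= rho.
Hypothesis y1r : `|y1 - a| <= rho.

Lemma segment_in_ball (t : R) : 0 <= t <= 1 -> `|y0 + t *: (y1 - y0) - a| <= rho.
Proof. by move=> t01; exact: ball_convex_le. Qed.

Lemma segment_norm : `|y1 - y0| <= 2 * rho.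
Proof.
rewrite mulr_natl mulr2n -(subrKA a); apply: le_trans (ler_normD _ _) _.
by apply: lerD => //; rewrite distrC.
Qed.

Lemma segment_derive q (U : 'rV[R]_m -> 'M[R]_(1 + m, q)) (t : R) :
  parallel_at U (y0 + t *: (y1 - y0)) ->
  is_derive t 1 (fun s => U (y0 + s *: (y1 - y0)))
    (lin_mx A (y1 - y0) (y0 + t *: (y1 - y0)) *m U (y0 + t *: (y1 - y0))).
Proof.
move=> HU; apply/is_derive_mxP => i j.
have := is_derive_line (HU i j).1 => /is_derive_eq; apply.
rewrite derive_partialE; last exact: (HU i j).1.
rewrite /lin_mx mulmx_suml summxE; apply: eq_bigr => k _.
by rewrite (HU i j).2 -scalemxAl [in RHS]mxE.
Qed.

Lemma segment_small (t : R) : 0 <= t <= 1 ->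
  (1 + m)%:R * `|lin_mx A (y1 - y0) (y0 + t *: (y1 - y0))| <= 4^-1.
Proof.
move=> t01; case: ar => _ _; apply; [exact: segment_norm|exact: segment_in_ball].
Qed.

Lemma parallel_unique q (U : 'rV[R]_m -> 'M[R]_(1 + m, q)) :
  (forall t : R, 0 <= t <= 1 -> parallel_at U (y0 + t *: (y1 - y0))) ->
  U y0 = 0 -> U y1 = 0.
Proof.
move=> HU U0.
apply/eqP; rewrite -normr_le0 -[leRHS](mulr0 2).
have -> : U y1 = U (y0 + 1 *: (y1 - y0)) by rewrite scale1r addrC subrK.
apply: (small_gronwall (fun t t01 => segment_derive (HU t t01))); last 2 first.
- by rewrite scale0r addr0.
- by rewrite ler01 lexx.
move=> t t01; rewrite addr0; apply: le_trans (mxnorm_mul _ _) _.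
apply: ler_wpM2r => //; apply: le_trans (segment_small t01) _; lra.
Qed.

Lemma frame_form_Ck (k : nat) p q : Ck_on k O (fun y => frame_form g K y p q).
Proof.
have oO := cc_open h.
case: (split_ordP p) => p' ->; case: (split_ordP q) => q' ->.
- apply: Ck_ext (Ck_cst k ((1%:M : 'M[R]_1) p' q') oO) => // x _.
  by rewrite block_mxEul.
- by apply: Ck_ext (Ck_cst k (0 : R) oO) => // x _; rewrite block_mxEur mxE.
- by apply: Ck_ext (Ck_cst k (0 : R) oO) => // x _; rewrite block_mxEdl mxE.
- apply: Ck_ext (CkM oO (Ck_cst k K oO) (cc_smooth h k p' q')) => // x _.
  by rewrite block_mxEdr mxE.
Qed.

Hypothesis Hy0 : model_halfspace y0.
Hypothesis Hy1 : model_halfspace y1.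

Lemma frame_form_derive (t : R) : 0 <= t <= 1 -> let c := y0 + t *: (y1 - y0) in
  is_derive t 1 (fun s => frame_form g K (y0 + s *: (y1 - y0)))
    (lin_mx A (y1 - y0) c *m frame_form g K c +
     frame_form g K c *m (lin_mx A (y1 - y0) c)^T).
Proof.
move=> t01 c; apply/is_derive_mxP => p q.
have Oc : O c by case: ar => _ rO _; apply: rO; exact: segment_in_ball.
have Hc : model_halfspace c by exact: halfspace_convex.
have dN := (frame_form_Ck 1 p q).1 _ Oc.
have := is_derive_line dN => /is_derive_eq; apply.
rewrite derive_partialE// -/c /lin_mx mulmx_suml [X in _ *m X](linear_sum trmx) mulmx_sumr.
rewrite -big_split/= summxE; apply: eq_bigr => k _.
have /matrixP/(_ p q) := dframe_formE (cc_open h) (cc_smooth h) (cc_unit h) (cc_sym h) K k Oc Hc.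
rewrite mxE => ->.
by rewrite linearZ/= -scalemxAl -scalemxAr -scalerDr [RHS]mxE.
Qed.

(** The defect D of the identity satisfies D' = B D + D B^T along the segment and vanishes at its
    start. *)
Lemma form_preserved (U : 'rV[R]_m -> 'M[R]_(1 + m)) (b : 'M[R]_(1 + m)) :
  (forall t : R, 0 <= t <= 1 -> parallel_at U (y0 + t *: (y1 - y0))) ->
  U y0 *m b *m (U y0)^T = frame_form g K y0 ->
  U y1 *m b *m (U y1)^T = frame_form g K y1.
Proof.
move=> HU U0; apply/eqP; rewrite -subr_eq0 -normr_le0 -[leRHS](mulr0 2).
pose c t := y0 + t *: (y1 - y0).
pose D t := U (c t) *m b *m (U (c t))^T - frame_form g K (c t).
have -> : U y1 *m b *m (U y1)^T - frame_form g K y1 = D 1.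
  by rewrite /D /c scale1r [y0 + _]addrC subrK.
pose B t := lin_mx A (y1 - y0) (c t).
apply: (small_gronwall (D := fun t => B t *m D t + D t *m (B t)^T)).
- move=> t t01; have dU := segment_derive (HU t t01).
  have dUT : is_derive t 1 (fun s => (U (c s))^T) ((B t *m U (c t))^T).
    apply/is_derive_mxP => i j; have /is_derive_mxP/(_ j i) := dU.
    by rewrite [X in _ -> is_derive _ _ _ X]mxE; under [fun s => (U (c s))^T i j]eq_fun do rewrite mxE.
  have db : is_derive t 1 (fun=> b) (0 : 'M[R]_(1 + m)) by exact: is_derive_cst.
  have := is_deriveB (is_derive_mulmx (is_derive_mulmx dU db) dUT) (frame_form_derive t01).
  move=> /is_derive_eq; apply; rewrite mulmx0 addr0 trmx_mul /D mulmxBr mulmxBl !mulmxA.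
  by rewrite -/(c t) -/(B t) opprD addrACA.
- move=> t t01; rewrite addr0; apply: le_trans (ler_normD _ _) _.
  have BT : `|(B t)^T| <= `|B t|.
    by apply: mxnorm_le => // i j; rewrite mxE; exact: ler_mxentry.
  have sB := segment_small t01; rewrite -/(c t) -/(B t) in sB.
  have -> : 2^-1 * `|D t| = 4^-1 * `|D t| + 4^-1 * `|D t| by field.
  apply: lerD; apply: le_trans (mxnorm_mul _ _) _.
    exact: ler_wpM2r.
  rewrite mulrAC; apply: ler_wpM2r => //; apply: le_trans sB.
  exact: ler_wpM2l.
- by rewrite /D /c scale0r addr0 U0 subrr.
- by rewrite ler01 lexx.
Qed.

End Segment.

Definition local_frame (b : 'M[R]_(1 + m)) a rho (Th : 'rV[R]_m -> 'M[R]_(1 + m)) : Prop :=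
  small_radius a rho /\ forall y, `|y - a| < rho -> model_halfspace y ->
    [/\ parallel_at Th y, Th y *m b *m (Th y)^T = frame_form g K y & Th y \in unitmx].

Lemma local_frame_exists b a T : O a -> model_halfspace a -> T \in unitmx ->
  T *m b *m T^T = frame_form g K a ->
  exists rho Th, local_frame b a rho Th /\ Th a = T.
Proof.
move=> Oa Ha uT Tb.
have [rho1 sr1] := small_radius_exists Oa.
have [r [Phi [r0 rO Phia PhiD]]] := frobenius (cc_open h) conn_smooth
  (fun x i j Ox Hx => conn_flat (cc_open h) (cc_smooth h) (cc_unit h) (cc_sym h) (cc_pos h)
     (cc_curv h) i j Ox Hx) Oa Ha.
pose rho := Num.min rho1 r.
have rho0 : 0 < rho by rewrite lt_min r0 andbT; case: sr1.
have sr : small_radius a rho by apply: small_radius_le sr1 => //; rewrite ge_min lexx.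
have aa : `|a - a| <= rho by rewrite subrr normr0 ltW.
exists rho, (fun y => Phi y *m T); rewrite Phia mul1mx; split => //; split => // y yr Hy.
have par z : `|z - a| < rho -> model_halfspace z -> parallel_at (fun y => Phi y *m T) z.
  move=> zr Hz; apply: parallel_mulr => p q; apply: PhiD => //.
  by apply: lt_le_trans zr _; rewrite ge_min lexx orbT.
have seg (x z : 'rV[R]_m) : `|x - a| < rho -> `|z - a| < rho -> model_halfspace x ->
    model_halfspace z -> forall t : R, 0 <= t <= 1 ->
    parallel_at (fun y => Phi y *m T) (x + t *: (z - x)).
  move=> xr zr Hx Hz t t01; apply: par; last exact: halfspace_convex.
  exact: ball_convex_lt.
have aar : `|a - a| < rho by rewrite subrr normr0.
split; first exact: par.
  apply: (form_preserved sr aa (ltW yr) Ha Hy (seg _ _ aar yr Ha Hy)).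
  by rewrite Phia mul1mx.
(* A vector in the kernel of the frame at y gives a parallel column vanishing at y, hence at the
   centre [a], where the frame is the invertible [T]. *)
rewrite -unitmx_tr -row_free_unit -kermx_eq0 -trmx_eq0.
set k := kermx _.
have : (fun z => Phi z *m T *m k^T) a = 0.
  apply: (parallel_unique sr (ltW yr) aa (U := fun z => Phi z *m T *m k^T)).
    by move=> t t01; apply: parallel_mulr; exact: seg.
  by apply: trmx_inj; rewrite trmx_mul trmxK trmx0; exact: mulmx_ker.
rewrite Phia mul1mx => E.
by rewrite -[k^T](mulKmx uT) E mulmx0.
Qed.

Lemma lin_mxE u y : lin_mx A u y =
  block_mx (0 : 'M[R]_1) u (- K *: (g y *m u^T)) (\sum_i u ord0 i *: Gam g i y).
Proof.
apply/matrixP => a b; rewrite /lin_mx summxE.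
case: (split_ordP a) => a' ->; case: (split_ordP b) => b' ->.
- by rewrite block_mxEul mxE big1// => i _; rewrite mxE block_mxEul mxE mulr0.
- rewrite block_mxEur [in RHS](row_sum_delta u) summxE ord1; apply: eq_bigr => i _.
  by rewrite mxE block_mxEur [RHS]mxE.
- rewrite block_mxEdl mxE mxE mulr_sumr; apply: eq_bigr => i _.
  rewrite [LHS]mxE /A /conn block_mxEdl [(_ *: col _ _) _ _]mxE [col _ _ _ _]mxE [u^T _ _]mxE (ord1 b') mulrCA; congr (_ * _); rewrite mulrC.
  by congr (_ * u _ _); exact: val_inj.
- by rewrite block_mxEdr summxE; apply: eq_bigr => i _; rewrite mxE block_mxEdr [RHS]mxE.
Qed.

(** The first row of the system: the derivative of F in the direction u is u applied to the
    remaining rows. *)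
Lemma usub_lin_mx u y q (X : 'M[R]_(1 + m, q)) :
  usubmx (lin_mx A u y *m X) = row_mx 0 u *m X.
Proof. by rewrite -mul_usub_mx lin_mxE block_mxEv col_mxKu. Qed.

(** With u the velocity of a curve and [acc] its second derivative, the last block is the left side
    of the geodesic equation. So the curve is a geodesic when the second derivative of its image is
    - K |u|^2 times the image, and conversely. *)
Lemma row_lin_mx u y acc :
  row_mx 0 acc + row_mx 0 u *m lin_mx A u y =
  row_mx (- K * gdot g y u u)%:M
    (acc + \row_k \sum_i \sum_j christoffel g k i j y * u ord0 i * u ord0 j).
Proof.
have -> : row_mx 0 u *m lin_mx A u y =
    row_mx (- K * gdot g y u u)%:M (\row_k \sum_i \sum_j christoffel g k i j y * u ord0 i * u ord0 j).
  rewrite lin_mxE mul_row_block !mul0mx !add0r; congr row_mx.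
    rewrite -scalemxAr mulmxA; apply/matrixP => a b; rewrite !ord1 !mxE eqxx mulr1n.
    by congr (_ * _); rewrite /gdot mxE.
  apply/matrixP => a k; rewrite ord1 mulmx_sumr summxE !mxE.
  apply: eq_bigr => i _; rewrite -scalemxAr mxE mxE mulr_sumr; apply: eq_bigr => j _.
  have -> : Gam g i y j k = christoffel g k i j y by rewrite mxE.
  by rewrite (ord1 a) mulrA mulrC mulrA.
by rewrite add_row_mx add0r.
Qed.

Lemma curve_dev1 (Th : 'rV[R]_m -> 'M[R]_(1 + m)) (xi : R -> 'rV[R]_m) (t : R) :
  parallel_at Th (xi t) -> derivable xi t 1 ->
  is_derive t 1 (fun s => usubmx (Th (xi s))) (row_mx 0 (derive1 xi t) *m Th (xi t)).
Proof.
move=> HT dxi; have /is_derive_mxP H := parallel_chain HT dxi.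
apply/is_derive_mxP => i j; rewrite -(usub_lin_mx _ (xi t)) mxE.
by under [fun s => usubmx _ i j]eq_fun do rewrite mxE.
Qed.

Lemma curve_dev2 (Th : 'rV[R]_m -> 'M[R]_(1 + m)) (xi : R -> 'rV[R]_m) (t : R) :
  parallel_at Th (xi t) -> derivable xi t 1 -> derivable (derive1 xi) t 1 ->
  is_derive t 1 (fun s => row_mx 0 (derive1 xi s) *m Th (xi s))
    ((row_mx 0 (derive1n 2 xi t) + row_mx 0 (derive1 xi t) *m lin_mx A (derive1 xi t) (xi t))
     *m Th (xi t)).
Proof.
move=> HT dxi ddxi.
have dr : is_derive t 1 (fun s => row_mx (0 : 'M[R]_1) (derive1 xi s)) (row_mx 0 (derive1n 2 xi t)).
  have /is_derive_mxP H : is_derive t 1 (derive1 xi) (derive1n 2 xi t).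
    by rewrite derive1nS derive1n1 derive1E; exact: derivableP.
  apply/is_derive_mxP => i j; case: (split_ordP j) => k ->.
    under [fun s => row_mx _ _ i _]eq_fun do rewrite row_mxEl mxE.
    by rewrite row_mxEl mxE; exact: is_derive_cst.
  under [fun s => row_mx _ _ i _]eq_fun do rewrite row_mxEr.
  by rewrite row_mxEr; exact: H.
have := is_derive_mulmx dr (parallel_chain HT dxi) => /is_derive_eq; apply.
by rewrite mulmxDl mulmxA.
Qed.

End LocalFrames.

(** * Hyperbolas on the quadric *)

Section HyperbolicFunctions.
Context {R : realType}.
Implicit Types (th t s : R).

(** cosh (th t), and next sinh (th t) / th continued by t at th = 0, so that lines and hyperbolas
    share their formulas. *)
Definition coshk th t : R := (expR (th * t) + expR (- (th * t))) / 2.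
Definition sinhk th t : R :=
  if th == 0 then t else (expR (th * t) - expR (- (th * t))) / (2 * th).

Lemma coshk0 th : coshk th 0 = 1.
Proof. by rewrite /coshk mulr0 oppr0 expR0; field. Qed.

Lemma sinhk0 th : sinhk th 0 = 0.
Proof. by rewrite /sinhk mulr0 oppr0 expR0 subrr mul0r; case: ifP. Qed.

Lemma sinhk_id t : sinhk 0 t = t.
Proof. by rewrite /sinhk eqxx. Qed.

Lemma coshk_id t : coshk 0 t = 1.
Proof. by rewrite /coshk mul0r oppr0 expR0; field. Qed.

Lemma expR_lin_derive (c : R) t : is_derive t 1 (fun s => expR (c * s)) (c * expR (c * t)).
Proof.
have d : is_derive t 1 (fun s => c * s) c.
  have := is_deriveZ c (is_derive_id t (1 : R)) => /is_derive_eq; apply.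
  by rewrite /GRing.scale/= mulr1.
have := @is_derive1_comp _ expR (fun s => c * s) t _ _ (is_derive_expR _) d.
by move=> /is_derive_eq; apply; rewrite mulrC.
Qed.

Lemma coshk_derive th t : is_derive t 1 (coshk th) (th ^+ 2 * sinhk th t).
Proof.
have d1 := expR_lin_derive th t; have d2 := expR_lin_derive (- th) t.
have d := is_deriveM (is_deriveD d1 d2) (is_derive_cst (2^-1 : R) t 1).
have -> : coshk th = ((fun s => expR (th * s)) + (fun s => expR (- th * s))) * cst 2^-1.
  by apply/funext => s; rewrite /coshk !fctE mulNr.
move: d => /is_derive_eq; apply; rewrite scaler0 add0r /GRing.scale/=.
rewrite /sinhk; have [->|th0] := eqVneq th 0; first by rewrite oppr0 !mul0r expr0n/= addr0 mulr0 mul0r.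
by rewrite !mulNr; field.
Qed.

Lemma sinhk_derive th t : is_derive t 1 (sinhk th) (coshk th t).
Proof.
have [->|th0] := eqVneq th 0.
  rewrite coshk_id; have -> : sinhk 0 = id by apply/funext => s; rewrite sinhk_id.
  exact: is_derive_id.
have d1 := expR_lin_derive th t; have d2 := expR_lin_derive (- th) t.
have d := is_deriveM (is_deriveB d1 d2) (is_derive_cst ((2 * th)^-1 : R) t 1).
have -> : sinhk th = ((fun s => expR (th * s)) - (fun s => expR (- th * s))) * cst (2 * th)^-1.
  by apply/funext => s; rewrite /sinhk (negPf th0) !fctE mulNr.
move: d => /is_derive_eq; apply; rewrite scaler0 add0r /GRing.scale/=.
by rewrite /coshk !mulNr; field.
Qed.

Lemma coshk_sinhk th t : coshk th t ^+ 2 - th ^+ 2 * sinhk th t ^+ 2 = 1.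
Proof.
have E : expR (th * t) * expR (- (th * t)) = 1 by rewrite -expRD subrr expR0.
rewrite /coshk /sinhk; have [->|th0] := eqVneq th 0.
  by rewrite !mul0r oppr0 expR0; field.
rewrite -[RHS]E; move: (expR _) (expR _) => a b; by field.
Qed.

Lemma coshk_ge1 th t : 1 <= coshk th t.
Proof.
rewrite /coshk ler_pdivlMr// mul1r.
have E : expR (th * t) * expR (- (th * t)) = 1 by rewrite -expRD subrr expR0.
have := expR_gt0 (th * t); have := expR_gt0 (- (th * t)).
move: E; move: (expR _) (expR _) => a b ab a0 b0.
by have := sqr_ge0 (a - b); nra.
Qed.

Lemma sinhk_gt0 th t : 0 < t -> 0 < sinhk th t.
Proof.
move=> t0; have [s /andP[s0 st]] := mvt_cc t0 (fun s _ => sinhk_derive th s).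
rewrite sinhk0 !subr0 => ->; rewrite mulr_gt0//.
exact: lt_le_trans (coshk_ge1 _ _).
Qed.

Lemma coshkM (c : R) th t : coshk (c * th) t = coshk th (c * t).
Proof. by rewrite /coshk (_ : c * th * t = th * (c * t)); last ring. Qed.

Lemma sinhkM (c : R) th t : c * sinhk (c * th) t = sinhk th (c * t).
Proof.
rewrite /sinhk mulf_eq0; have [->|c0] := eqVneq c 0.
  by rewrite !mul0r mulr0 oppr0 subrr mul0r; case: ifP.
have [->|th0] /= := eqVneq th 0; first by [].
rewrite (_ : c * th * t = th * (c * t)); last by ring.
by field; rewrite th0.
Qed.

Lemma coshkN th t : coshk th (- t) = coshk th t.
Proof. by rewrite /coshk mulrN opprK addrC. Qed.

Lemma sinhkN th t : sinhk th (- t) = - sinhk th t.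
Proof. by rewrite /sinhk mulrN opprK; case: eqP => // _; rewrite -[RHS]mulNr opprB. Qed.

Lemma sinhkD th s t : sinhk th (s + t) = sinhk th s * coshk th t + coshk th s * sinhk th t.
Proof.
rewrite /coshk /sinhk; have [->|th0] := eqVneq th 0.
  by rewrite !mul0r oppr0 expR0; field.
by rewrite mulrDr opprD !expRD; field.
Qed.

End HyperbolicFunctions.

Section HyperbolaCurves.
Context {R : realType}.

Lemma near_mono (t : R) (P Q : R -> Prop) :
  (\forall s \near t, P s) -> (forall s, P s -> Q s) -> \forall s \near t, Q s.
Proof. by move=> nP PQ; exact: filterS nP. Qed.

Lemma near_near (t : R) (P : R -> Prop) :
  (\forall s \near t, P s) -> \forall s \near t, \forall u \near s, P u.
Proof. exact: nbhs_interior. Qed.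

Lemma derivable_curve_continuous (V : normedModType R) (E : R -> V) (t : R) :
  derivable E t 1 -> {for t, continuous E}.
Proof. by move=> dE; exact/differentiable_continuous/derivable1_diffP. Qed.

Lemma is_derive_scalemx p q (c : R -> R) (E : R -> 'M[R]_(p, q)) (t dc : R) DE :
  is_derive t 1 c dc -> is_derive t 1 E DE ->
  is_derive t 1 (fun s => c s *: E s) (dc *: E t + c t *: DE).
Proof.
move=> dC /is_derive_mxP dE; apply/is_derive_mxP => i j.
have -> : (fun s => (c s *: E s) i j) = c * (fun s => E s i j) :> (R -> R).
  by apply/funext => s; rewrite mxE !fctE.
have := is_deriveM dC (dE i j) => /is_derive_eq; apply.
by rewrite addmxE [in RHS]mxE [in RHS]mxE addrC; congr (_ + _); exact: mulrC.
Qed.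

Lemma is_derive_trmx p q (E : R -> 'M[R]_(p, q)) (t : R) DE :
  is_derive t 1 E DE -> is_derive t 1 (fun s => (E s)^T) DE^T.
Proof.
move=> /is_derive_mxP dE; apply/is_derive_mxP => i j.
by under [fun s => _ i j]eq_fun do rewrite mxE; rewrite mxE; exact: dE.
Qed.

Lemma derive1_near (V : normedModType R) (E E' : R -> V) (t : R) :
  (\forall s \near t, E s = E' s) -> \forall s \near t, derive1 E s = derive1 E' s.
Proof.
move=> /nbhs_interior; apply: filterS => s sE.
by rewrite !derive1E; exact: near_eq_derive.
Qed.

Lemma is_derive_near (V : normedModType R) (E E' : R -> V) (t : R) DE :
  (\forall s \near t, E s = E' s) -> is_derive t 1 E DE -> is_derive t 1 E' DE.
Proof.
move=> EE' [dE <-]; apply: DeriveDef; first exact: near_eq_derivable EE' dE.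
by apply/esym; exact: near_eq_derive.
Qed.

Variables (n : nat) (b : 'M[R]_n).
Implicit Types (E : R -> 'rV[R]_n) (s t th : R).

(** A geodesic seen in the model: the acceleration is along the position vector. The factor [lam]
    may depend on t, which makes the notion local; [hyper_const] shows that it does not. *)
Definition hyper_at E t : Prop := exists2 lam : R, 0 <= lam &
  [/\ derivable E t 1, is_derive t 1 (derive1 E) (lam *: E t),
      E t *m b *m (E t)^T = 1%:M &
      derive1 E t *m b *m (derive1 E t)^T = (- lam)%:M].

Lemma hyper_at_near E E' t : (\forall s \near t, E s = E' s) -> hyper_at E t -> hyper_at E' t.
Proof.
move=> EE' [lam lam0 [dE ddE Eb E'b]]; have dEE' := derive1_near EE'.
exists lam; first exact: lam0.
split.
- exact: near_eq_derivable EE' dE.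
- rewrite -(nbhs_singleton EE'); exact: is_derive_near dEE' ddE.
- by rewrite -(nbhs_singleton EE').
- by rewrite -(nbhs_singleton dEE').
Qed.

Lemma derivable_is_derive1 (V : normedModType R) (E : R -> V) t :
  derivable E t 1 -> is_derive t 1 E (derive1 E t).
Proof. by move=> dE; rewrite derive1E; exact: derivableP. Qed.

(** E b E^T = 1 makes E' orthogonal to E, so the derivative of E' b E'^T vanishes and [lam] is
    constant; [th] is its square root. *)
Lemma hyper_const E t0 t1 : t0 < t1 -> (forall t, t0 < t < t1 -> hyper_at E t) ->
  exists2 th : R, 0 <= th & forall t, t0 < t < t1 ->
   [/\ is_derive t 1 E (derive1 E t), is_derive t 1 (derive1 E) (th ^+ 2 *: E t) &
    derive1 E t *m b *m (derive1 E t)^T = (- th ^+ 2)%:M].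
Proof.
move=> t01 HE; pose D := derive1 E.
pose f t := (D t *m b *m (D t)^T) ord0 ord0.
have EE' t : t0 < t < t1 -> D t *m b *m (E t)^T + E t *m b *m (D t)^T = 0.
  move=> tt; have [lam _ [/derivable_is_derive1 dE _ _ _]] := HE _ tt.
  have dEb : is_derive t 1 (fun s => E s *m b) (D t *m b).
    have db : is_derive t 1 (fun=> b) (0 : 'M[R]_n) by exact: is_derive_cst.
    have := is_derive_mulmx dE db => /is_derive_eq; apply.
    by rewrite mulmx0 addr0.
  have [_ <-] := is_derive_mulmx dEb (is_derive_trmx dE).
  have cc : {near t, (fun s => E s *m b *m (E s)^T) =1 cst 1%:M}.
    have : \forall s \near t, t0 < s < t1 by exact: (@near_in_itvoo _ t0 t1 t tt).
    by apply: filterS => s /HE[? _ []].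
  by rewrite (near_eq_derive _ cc) derive_cst.
have df t : t0 < t < t1 -> is_derive t (1 : R) f 0.
  move=> tt; have [lam _ [_ dE _ _]] := HE _ tt.
  have dEb : is_derive t 1 (fun s => D s *m b) (lam *: E t *m b).
    have db : is_derive t 1 (fun=> b) (0 : 'M[R]_n) by exact: is_derive_cst.
    have := is_derive_mulmx dE db => /is_derive_eq; apply.
    by rewrite mulmx0 addr0.
  have /is_derive_mxP/(_ ord0 ord0) := is_derive_mulmx dEb (is_derive_trmx dE).
  move=> /is_derive_eq; apply.
  have -> : lam *: E t *m b *m (D t)^T + D t *m b *m (lam *: E t)^T =
    lam *: (D t *m b *m (E t)^T + E t *m b *m (D t)^T).
    by rewrite linearZ/= -!scalemxAl -scalemxAr scalerDr addrC.
  by rewrite EE'// scaler0 mxE.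
have fc s t : t0 < s < t1 -> t0 < t < t1 -> f s = f t.
  wlog st : s t / s < t.
    move=> H ss tt; case: (ltgtP s t) => [st|ts|->]; last reflexivity.
      exact: H st ss tt.
    exact/esym/(H _ _ ts tt ss).
  move=> /andP[s0 s1] /andP[t0' t1']; have [|c _] := @mvt_cc _ f (fun=> 0) s t st.
    move=> u /andP[su ut]; apply: df.
    by rewrite (lt_le_trans s0 su) (le_lt_trans ut t1').
  by rewrite mul0r => /eqP; rewrite subr_eq0 => /eqP ->.
pose s0 := (t0 + t1) / 2.
have ss : t0 < s0 < t1 by apply/andP; split; rewrite /s0; move: t01; clear; lra.
have [lam lam0 [_ _ _ lamf]] := HE _ ss.
exists (Num.sqrt lam); first exact: sqrtr_ge0.
rewrite sqr_sqrtr; last exact: lam0.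
move=> t tt.
have [mu mu0 [/derivable_is_derive1 dE dD _ muf]] := HE _ tt.
suff -> : lam = mu by split; [exact: dE|exact: dD|exact: muf].
have : f s0 = f t by exact: fc.
by rewrite /f lamf muf mxE [X in _ = X]mxE => /oppr_inj.
Qed.

Lemma coshk_derive_rev th s t : is_derive t 1 (fun u => coshk th (s - u)) (- (th ^+ 2 * sinhk th (s - t))).
Proof.
have d : is_derive t 1 (fun u : R => s - u) (-1).
  have := is_deriveB (is_derive_cst s t (1 : R)) (is_derive_id t (1 : R)) => /is_derive_eq.
  by apply; rewrite sub0r.
have := @is_derive1_comp _ (coshk th) (fun u : R => s - u) t _ _ (coshk_derive th (s - t)) d => /is_derive_eq; apply.
by rewrite mulrN1.
Qed.

Lemma sinhk_derive_rev th s t : is_derive t 1 (fun u => sinhk th (s - u)) (- coshk th (s - t)).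
Proof.
have d : is_derive t 1 (fun u : R => s - u) (-1).
  have := is_deriveB (is_derive_cst s t (1 : R)) (is_derive_id t (1 : R)) => /is_derive_eq.
  by apply; rewrite sub0r.
have := @is_derive1_comp _ (sinhk th) (fun u : R => s - u) t _ _ (sinhk_derive th (s - t)) d => /is_derive_eq; apply.
by rewrite mulrN1.
Qed.

(** With s fixed, the expression P u has zero derivative; it is E s at u = s and the right side at u
    = t. *)
Lemma hyper_solution E (D : R -> 'rV[R]_n) th t0 t1 :
  (forall t, t0 < t < t1 -> is_derive t 1 E (D t) /\ is_derive t 1 D (th ^+ 2 *: E t)) ->
  forall s t, t0 < s < t1 -> t0 < t < t1 ->
    E s = coshk th (s - t) *: E t + sinhk th (s - t) *: D t.
Proof.
move=> HE s t ss tt; pose P u := coshk th (s - u) *: E u + sinhk th (s - u) *: D u.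
have itv u : Num.min s t <= u <= Num.max s t -> t0 < u < t1.
  move: ss tt => /andP[a1 a2] /andP[a3 a4] /andP[a5 a6]; apply/andP; split.
    by apply: lt_le_trans a5; rewrite lt_min a1.
  by apply: le_lt_trans a6 _; rewrite gt_max a2.
have dP u : Num.min s t <= u <= Num.max s t -> is_derive u 1 P (0 : 'rV[R]_n).
  move=> /itv/HE[dE dD].
  have := is_deriveD (is_derive_scalemx (coshk_derive_rev th s u) dE)
                     (is_derive_scalemx (sinhk_derive_rev th s u) dD).
  move=> /is_derive_eq; apply.
  rewrite !scaleNr scalerA [sinhk _ _ * _]mulrC.
  by rewrite addrA addrK addNr.
have : `|P t - P s| <= 0 * `|t - s|.
  by apply: (mxcurve_mvt (lexx 0) dP) => u _; rewrite normr0.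
rewrite mul0r normr_le0 subr_eq0 => /eqP; rewrite /P => ->.
by rewrite subrr coshk0 sinhk0 scale1r scale0r addr0.
Qed.

End HyperbolaCurves.

(** Completeness of matrix spaces, for the Banach fixed point theorem in [frame_surjective]. *)
HB.instance Definition _ (R : realType) (p q : nat) := Complete.on 'M[R]_(p, q).

(** * Local inversion of the developing map *)

Section LocalInverse.
Context {R : realType} {m : nat}.
Variables (g : 'rV[R]_m -> 'M[R]_m) (O : set 'rV[R]_m) (K : R).
Hypothesis h : cc_metric g O K.
Implicit Types (y z v w a : 'rV[R]_m).

Lemma rsubmx_le p q1 q2 (X : 'M[R]_(p, q1 + q2)) : `|rsubmx X| <= `|X|.
Proof. by apply: mxnorm_le => // i j; rewrite mxE; exact: ler_mxentry. Qed.

Lemma rsubmxB p q1 q2 (X Y : 'M[R]_(p, q1 + q2)) : rsubmx (X - Y) = rsubmx X - rsubmx Y.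
Proof. by apply/matrixP => i j; rewrite !mxE. Qed.

Lemma lsubmx_le p q1 q2 (X : 'M[R]_(p, q1 + q2)) : `|lsubmx X| <= `|X|.
Proof. by apply: mxnorm_le => // i j; rewrite mxE; exact: ler_mxentry. Qed.

Lemma usubmx_le p1 p2 q (X : 'M[R]_(p1 + p2, q)) : `|usubmx X| <= `|X|.
Proof. by apply: mxnorm_le => // i j; rewrite mxE; exact: ler_mxentry. Qed.

Lemma row_mx0_le p q1 q2 (X : 'M[R]_(p, q2)) : `|row_mx (0 : 'M[R]_(p, q1)) X| <= `|X|.
Proof.
apply: mxnorm_le => // i j; case: (split_ordP j) => k ->.
  by rewrite row_mxEl mxE normr0.
by rewrite row_mxEr; exact: ler_mxentry.
Qed.

Lemma usubmx_mul p1 p2 q (X : 'M[R]_(p1 + p2, q)) : usubmx X = row_mx 1%:M 0 *m X.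
Proof. by rewrite -{2}(vsubmxK X) mul_row_col mul1mx mul0mx addr0. Qed.

Lemma quadric_row (S : 'M[R]_m) (x : 'M[R]_1) (u : 'rV[R]_m) :
  row_mx x u *m block_mx 1%:M 0 0 S *m (row_mx x u)^T = x *m x^T + u *m S *m u^T.
Proof. by rewrite mul_row_block !mulmx0 addr0 add0r mulmx1 tr_row_mx mul_row_col. Qed.

Lemma local_frame_le b a rho rho' (Th : 'rV[R]_m -> 'M[R]_(1 + m)) : 0 < rho' -> rho' <= rho ->
  local_frame g O K b a rho Th -> local_frame g O K b a rho' Th.
Proof.
move=> r0 rr [sr HT]; split; first exact: small_radius_le sr.
by move=> y yr; apply: HT; exact: lt_le_trans yr rr.
Qed.

Lemma parallel_continuous q (U : 'rV[R]_m -> 'M[R]_(1 + m, q)) y :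
  parallel_at g K U y -> {for y, continuous U}.
Proof.
move=> HU; apply: mxcurve_continuous => i j.
exact: differentiable_continuous (HU i j).1.
Qed.

Section UnitFrame.
Variables (b : 'M[R]_(1 + m)) (a : 'rV[R]_m) (rho : R) (Th : 'rV[R]_m -> 'M[R]_(1 + m)).
Hypotheses (HTh : local_frame g O K b a rho Th) (Ha : model_halfspace a) (Tha : Th a = 1%:M).

Let G y := usubmx (Th y).

Lemma frame_near_id : exists r : R, [/\ 0 < r, r < rho & forall y, `|y - a| <= r ->
  (1 + m)%:R * `|Th y - 1%:M| <= 2^-1].
Proof.
have [[rho0 _ _] HT] := HTh.
have aa : `|a - a| < rho by rewrite subrr normr0.
have [/parallel_continuous cT _ _] := HT a aa Ha.
have e0 : 0 < 2^-1 / (1 + m)%:R :> R by rewrite divr_gt0 ?invr_gt0 ?ltr0n.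
have /cvgrPdist_le/(_ _ e0) := cT; rewrite Tha => /nbhs_ballP[e /= ee He].
exists (Num.min (rho / 2) (e / 2)); split.
- by rewrite lt_min !divr_gt0.
- by rewrite gt_min ltr_pdivrMr// ltr_pMr// ltr1n.
- move=> y; rewrite le_min => /andP[_ ye].
  have /He : ball a e y.
    rewrite normr_ball distrC; apply: le_lt_trans ye _.
    by rewrite ltr_pdivrMr// ltr_pMr// ltr1n.
  by rewrite /= distrC ler_pdivlMr ?ltr0n// mulrC.
Qed.

Lemma frame_near_isometry (r : R) y y' : r < rho ->
  (forall y, `|y - a| <= r -> (1 + m)%:R * `|Th y - 1%:M| <= 2^-1) ->
  `|y - a| <= r -> `|y' - a| <= r -> model_halfspace y -> model_halfspace y' ->
  `|rsubmx (G y') - rsubmx (G y) - (y' - y)| <= 2^-1 * `|y' - y|.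
Proof.
move=> rr Hr yr yr' Hy Hy'; set v := y' - y.
have [_ HT] := HTh.
pose X s := rsubmx (G (y + s *: v)) - s *: v.
pose D s := rsubmx (row_mx (0 : 'M[R]_1) v *m (Th (y + s *: v) - 1%:M)).
have seg s : Num.min (0 : R) 1 <= s <= Num.max 0 1 ->
    `|y + s *: v - a| <= r /\ model_halfspace (y + s *: v).
  rewrite min_l ?max_r// => s01; split; first exact: ball_convex_le.
  exact: halfspace_convex.
have XD s : Num.min (0 : R) 1 <= s <= Num.max 0 1 -> is_derive s 1 X (D s).
  move=> /seg[sr Hs]; have [pT _ _] := HT _ (le_lt_trans sr rr) Hs.
  have /is_derive_mxP d1 := segment_derive pT.
  have dv : is_derive s (1 : R) (fun s : R => s *: v) v.
    have := is_derive_scalemx (is_derive_id s (1 : R)) (is_derive_cst (v : 'rV[R]_m) s 1).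
    by move=> /is_derive_eq; apply; rewrite scale1r scaler0 addr0.
  have dG : is_derive s 1 (fun s => rsubmx (G (y + s *: v))) (rsubmx (row_mx 0 v *m Th (y + s *: v))).
    apply/is_derive_mxP => i j; rewrite -(usub_lin_mx g K v (y + s *: v)) mxE [X in is_derive _ _ _ X]mxE.
    by under [fun s => _ i j]eq_fun do rewrite mxE [usubmx _ _ _]mxE; exact: d1.
  have := is_deriveB dG dv => /is_derive_eq; apply.
  rewrite /D mulmxBr mulmx1; by rewrite rsubmxB row_mxKr.
have -> : rsubmx (G y') - rsubmx (G y) - v = X 1 - X 0.
  by rewrite /X scale1r scale0r addr0 subr0 /v [y + _]addrC subrK addrAC.
have -> : 2^-1 * `|v| = 2^-1 * `|v| * `|(1 : R) - 0| by rewrite subr0 normr1 mulr1.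
apply: (mxcurve_mvt _ XD); first by rewrite mulr_ge0 ?invr_ge0.
move=> s /seg[sr _]; apply: le_trans (rsubmx_le _) _; apply: le_trans (mxnorm_mul _ _) _.
rewrite mulrAC; apply: ler_pM; rewrite ?mulr_ge0//; first exact: Hr.
exact: row_mx0_le.
Qed.

Lemma frame_first_row y : `|y - a| < rho -> model_halfspace y -> G y *m b *m (G y)^T = 1%:M.
Proof.
move=> yr Hy; have [_ /(_ y yr Hy)[_ E _]] := HTh.
rewrite /G usubmx_mul trmx_mul -!mulmxA [b *m _]mulmxA [Th y *m _]mulmxA [Th y *m (b *m _)]mulmxA E.
by rewrite tr_row_mx trmx1 trmx0 mulmxA mul_row_block !mulmx0 !mul0mx !addr0 mulmx1 mul_row_col mul0mx mulmx1 addr0.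
Qed.

(** The last m coordinates determine a point of the quadric up to the sign of the first one, also
    for K = 0, where the first coordinate is 1 or -1. *)
Lemma quadric_lsub (X Y : 'rV[R]_(1 + m)) : rsubmx X = rsubmx Y ->
  X *m b *m X^T = 1%:M -> Y *m b *m Y^T = 1%:M ->
  0 < lsubmx X ord0 ord0 -> 0 < lsubmx Y ord0 ord0 -> X = Y.
Proof.
have [[rho0 _ _] HT] := HTh.
have aa : `|a - a| < rho by rewrite subrr normr0.
have [_ + _] := HT a aa Ha; rewrite Tha mul1mx trmx1 mulmx1 => ->.
move: (lsubmx X) (rsubmx X) (lsubmx Y) (rsubmx Y) (hsubmxK X) (hsubmxK Y) => x u y' u' <- <- ->.
rewrite !quadric_row => <- /addIr E x0 y0; congr row_mx.
apply/matrixP => i j; rewrite !ord1; move/matrixP/(_ 0 0): E.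
rewrite !mxE !big_ord1 !mxE => /eqP; rewrite -subr_eq0 -!expr2 subr_sqr mulf_eq0 subr_eq0.
case/orP => /eqP // E; exfalso.
have : 0 < x ord0 ord0 + y' ord0 ord0 by rewrite addr_gt0.
have <- : (0 : 'I_1) = ord0 by exact: val_inj.
by rewrite addrC (_ : y' 0 0 + x 0 0 = 0) ?ltxx// -[RHS]E; congr (y' _ _ + x _ _); exact: val_inj.
Qed.

(* Contraction y |-> y - (F' y - X'), F' being the last coordinates of the first row of the frame. *)
Lemma frame_surjective (r : R) : 0 < r -> r < rho -> (forall y, `|y - a| < rho -> model_halfspace y) ->
  (forall y, `|y - a| <= r -> (1 + m)%:R * `|Th y - 1%:M| <= 2^-1) ->
  forall X : 'rV[R]_(1 + m), X *m b *m X^T = 1%:M -> `|X - G a| <= Num.min (r / 4) 2^-1 ->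
  exists2 y, `|y - a| <= r / 2 & G y = X.
Proof.
move=> r0 rr Hint Hr X Xb; rewrite le_min => /andP[XG X1].
pose T y := y - (rsubmx (G y) - rsubmx X).
pose U := [set y : 'rV[R]_m | `|y - a| <= r / 2].
have Ur y : U y -> `|y - a| <= r by move=> /= yr; apply: le_trans yr _; rewrite ler_pdivrMr// ler_pMr// ler1n.
have Uh y : U y -> model_halfspace y by move=> /Ur yr; apply: Hint; exact: le_lt_trans yr rr.
have TT y z : U y -> U z -> `|T y - T z| <= 2^-1 * `|y - z|.
  move=> Uy Uz; have := frame_near_isometry rr Hr (Ur _ Uz) (Ur _ Uy) (Uh _ Uz) (Uh _ Uy).
  rewrite -normrN; congr (_ <= _); congr (`|_|).
  rewrite /T; move: (rsubmx _) (rsubmx _) (rsubmx _) => p q s.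
  by apply/matrixP => i j; rewrite !mxE; ring.
have Ua : U a by rewrite /U/= subrr normr0 divr_ge0// ltW.
have TU : {homo T : y / U y >-> U y}.
  move=> y Uy; rewrite /U/= -(subrK (T a) (T y)) -addrA; apply: le_trans (ler_normD _ _) _.
  have -> : r / 2 = 2^-1 * (r / 2) + r / 4 by field.
  apply: lerD; first by apply: le_trans (TT _ _ Uy Ua) _; apply: ler_wpM2l; rewrite ?invr_ge0.
  apply: le_trans XG; rewrite /T -[leLHS]normrN.
  have -> : - (a - (rsubmx (G a) - rsubmx X) - a) = - rsubmx (X - G a).
    by apply/matrixP => i j; rewrite !mxE; ring.
  by rewrite normrN; exact: rsubmx_le.
have ctr : is_contraction (mkfun_fun TU).
  have h2 : (0 : R) <= 2^-1 by rewrite invr_ge0.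
  exists (NngNum h2); split; first by rewrite /= invf_lt1// ltr1n.
  by move=> [y z] [/= Uy Uz]; exact: TT.
have clU : closed U.
  apply: compact_closed; first exact: norm_hausdorff.
  exact: closed_ball_compact.
have [y Uy yE] := banach_fixed_point ctr clU (ex_intro _ a Ua).
exists y => //.
have {}yE : rsubmx (G y) = rsubmx X.
  by apply/eqP; rewrite -subr_eq0 -oppr_eq0 -(inj_eq (addrI y)) addr0 eq_sym; exact/eqP.
have half (Z : 'rV[R]_(1 + m)) : `|Z - G a| <= 2^-1 -> 0 < lsubmx Z ord0 ord0.
  move=> Z1; have : `|lsubmx (Z - G a) ord0 ord0| <= 2^-1.
    by apply: le_trans (ler_mxentry _ _ _) _; exact: le_trans (lsubmx_le _) Z1.
  rewrite /G Tha scalar_mx_block block_mxEv col_mxKu mxE addmxE oppmxE row_mxEl mxE eqxx.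
  rewrite [X in _ -> 0 < X]mxE ler_distl (_ : true%:R = 1 :> R)// => /andP[+ _]; lra.
apply: quadric_lsub => //.
- apply: frame_first_row; last exact: Uh.
  exact: le_lt_trans (Ur _ Uy) rr.
- apply: half; have -> : G y - G a = usubmx (Th y - 1%:M) by rewrite /G Tha linearB.
  apply: le_trans (usubmx_le _) _; apply: le_trans (Hr _ (Ur _ Uy)).
  by rewrite ler_peMl// ler1n.
- exact: half.
Qed.

End UnitFrame.

(** Multiplying the frame by the inverse of its value at the centre, and changing [b] accordingly,
    reduces to the case of a unit frame. *)
Lemma frame_chart b a rho Th : local_frame g O K b a rho Th ->
  (forall y, `|y - a| < rho -> model_halfspace y) ->
  exists r d C : R, [/\ 0 < r < rho, 0 < d, 0 < C,
   forall y y', `|y - a| <= r -> `|y' - a| <= r ->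
     `|y' - y| <= C * `|usubmx (Th y') - usubmx (Th y)| &
   forall X : 'rV[R]_(1 + m), X *m b *m X^T = 1%:M -> `|X - usubmx (Th a)| < d ->
     exists2 y, `|y - a| <= r / 2 & usubmx (Th y) = X].
Proof.
move=> HTh Hint; have [[rho0 srO sr] HT] := HTh.
have aa : `|a - a| < rho by rewrite subrr normr0.
have Ha := Hint _ aa; have [_ Tb uT] := HT _ aa Ha; set T := Th a in Tb uT *.
pose Q := invmx T; have uQ : Q \in unitmx by rewrite unitmx_inv.
pose Th1 y := Th y *m Q; pose b1 := T *m b *m T^T.
have HTh1 : local_frame g O K b1 a rho Th1.
  split=> // y yr Hy; have [p1 p2 p3] := HT _ yr Hy; split.
  - exact: parallel_mulr.
  - rewrite /Th1 /b1 trmx_mul !mulmxA -[Th y *m _ *m T]mulmxA mulVmx// mulmx1.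
    by rewrite -[_ *m T^T *m Q^T]mulmxA -trmx_mul mulVmx// trmx1 mulmx1.
  - by rewrite unitmx_mul p3.
have Th1a : Th1 a = 1%:M by rewrite /Th1 mulmxV.
have [r [r0 rr Hr]] := frame_near_id HTh1 Ha Th1a.
pose M := (1 + m)%:R * `|Q| : R.
have M0 : 0 < M + 1 by rewrite ltr_wpDl// mulr_ge0.
have G1 y : usubmx (Th1 y) = usubmx (Th y) *m Q by rewrite -mul_usub_mx.
have MQ (X : 'rV[R]_(1 + m)) : `|X *m Q| <= (M + 1) * `|X|.
  apply: le_trans (mxnorm_mul _ _) _; rewrite mulrAC; apply: ler_wpM2r => //.
  by rewrite lerDl.
have e0 : 0 < Num.min (r / 4) 2^-1 :> R by rewrite lt_min divr_gt0//= invr_gt0.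
exists r, (Num.min (r / 4) 2^-1 / (M + 1)), (2 * (M + 1)); split.
- by rewrite r0.
- exact: divr_gt0.
- by rewrite mulr_gt0.
- move=> y y' yr yr'.
  have Hy z : `|z - a| <= r -> model_halfspace z by move=> zr; apply: Hint; exact: le_lt_trans rr.
  have := frame_near_isometry HTh1 rr Hr yr yr' (Hy _ yr) (Hy _ yr').
  rewrite !G1 -rsubmxB -mulmxBl => I.
  have := le_trans (rsubmx_le _) (MQ (usubmx (Th y') - usubmx (Th y))).
  have := ler_normD (rsubmx ((usubmx (Th y') - usubmx (Th y)) *m Q))
     (- (rsubmx ((usubmx (Th y') - usubmx (Th y)) *m Q) - (y' - y))).
  rewrite normrN opprB addrC subrK -mulrA; move: I.
  have aux (x u z w : R) : u <= 2^-1 * x -> x <= z + u -> z <= w -> x <= 2 * w by lra.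
  exact: aux.
- move=> X Xb Xd; have [||y yr] := frame_surjective HTh1 Ha Th1a r0 rr Hint Hr (X := X *m Q).
  + by rewrite /b1 trmx_mul !mulmxA -[X *m _ *m T]mulmxA mulVmx// mulmx1
      -[_ *m T^T *m Q^T]mulmxA -trmx_mul mulVmx// trmx1 mulmx1.
  + rewrite G1 -mulmxBl; apply: le_trans (MQ _) _.
    by rewrite mulrC -ler_pdivlMr// ltW.
  + by rewrite G1 => /(can_inj (mulmxK uQ)) E; exists y.
Qed.

Lemma parallel_incr (Th : 'rV[R]_m -> 'M[R]_(1 + m)) y : parallel_at g K Th y -> forall e : R, 0 < e ->
  \forall v \near (0 : 'rV[R]_m),
    `|usubmx (Th (y + v)) - usubmx (Th y) - row_mx 0 v *m Th y| <= e * `|v|.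
Proof.
move=> HT e e0.
have n1 (j : 'I_(1 + m)) : \forall v \near (0 : 'rV[R]_m),
   `|Th (y + v) (lshift m ord0) j - Th y (lshift m ord0) j -
   \sum_k v ord0 k * (conn g K k y *m Th y) (lshift m ord0) j| <= e * `|v|.
  have [D _] := differentiable_incr (fun z => Th z (lshift m ord0) j) y
    (fun k => (conn g K k y *m Th y) (lshift m ord0) j).
  exact: D (HT (lshift m ord0) j) e e0.
have := filter_forall (nbhs_filter (0 : 'rV[R]_m)) n1; apply: filterS => v H.
apply: mxnorm_le => [|i j]; first by rewrite mulr_ge0// ltW.
rewrite (ord1 i); have := H j; congr (`|_| <= _).
rewrite -(usub_lin_mx g K v y) !addmxE !oppmxE.
rewrite /lin_mx mulmx_suml; congr (_ - _ - _); rewrite mxE; try by congr (Th _ _ _); exact: val_inj.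
rewrite summxE; apply: eq_bigr => k _; rewrite -scalemxAl [RHS]mxE.
by congr (_ * _); congr ((_ : 'M[R]_(_, _)) _ _); exact: val_inj.
Qed.

(** The Lipschitz bound of [xi] by [E] stands in for differentiability of the inverse: it turns the
    first-order expansion of the frame at [xi t] into one of [xi] itself. *)
Lemma lift_derivable (Th : 'rV[R]_m -> 'M[R]_(1 + m)) (xi : R -> 'rV[R]_m) (E : R -> 'rV[R]_(1 + m)) (t C : R) :
  0 < C -> parallel_at g K Th (xi t) -> Th (xi t) \in unitmx ->
  (\forall s \near t, `|xi s - xi t| <= C * `|E s - E t| /\ usubmx (Th (xi s)) = E s) ->
  derivable E t 1 ->
  is_derive t 1 xi (rsubmx (derive1 E t *m invmx (Th (xi t)))).
Proof.
move=> C0 HT uT nE dE; pose y := xi t; pose Q := invmx (Th y); pose E' := derive1 E t.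
suff H : (u^-1 *: ((xi \o shift t) (u *: 1) - xi t)) @[u --> 0^'] --> rsubmx (E' *m Q).
  by apply: DeriveDef; [exact: cvgP H|exact: cvg_lim H].
pose q u := u^-1 *: ((E \o shift t) (u *: 1) - E t).
have qE : q u @[u --> 0^'] --> E'.
  by rewrite /E' derive1E; exact: dE.
apply/cvgrPdist_le => e e0.
(* [e1] absorbs the norm of the inverse frame and the factor 1 + m of [mxnorm_mul]; [e2] absorbs the
   difference quotients of [xi], which are bounded by C (|E'| + 1). *)
pose e1 := e / (2 * ((1 + m)%:R * (`|Q| + 1))).
have e10 : 0 < e1 by rewrite divr_gt0// !mulr_gt0// ?ltr0n// ltr_wpDl.
pose e2 := e1 / (C * (`|E'| + 1)).
have e20 : 0 < e2 by rewrite divr_gt0// mulr_gt0// ltr_wpDl.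
have cE := derivable_curve_continuous dE.
have n0 : \forall u \near (0 : R), `|xi (u + t) - xi t| <= C * `|E (u + t) - E t| /\ usubmx (Th (xi (u + t))) = E (u + t).
  have := near_translate nE; by apply: filterS => u; rewrite [t + u]addrC.
have n1 : \forall u \near (0 : R), `|usubmx (Th (xi (u + t))) - usubmx (Th y) - row_mx 0 (xi (u + t) - y) *m Th y| <= e2 * `|xi (u + t) - y|.
  have c0 : (xi (u + t) - y) @[u --> (0 : R)] --> (0 : 'rV[R]_m).
    have c1 : (E (u + t) - E t) @[u --> (0 : R)] --> (0 : 'rV[R]_(1 + m)).
      rewrite -(subrr (E t)); apply: cvgB; last exact: cvg_cst.
      have ct : (u + t) @[u --> (0 : R)] --> t.
        by rewrite -[X in _ --> X]add0r; apply: cvgD; [exact: cvg_id|exact: cvg_cst].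
      exact: (@cvg_comp _ _ _ (fun u => u + t) E _ _ _ ct cE).
    have cE0 : (C * `|E (u + t) - E t|) @[u --> (0 : R)] --> (0 : R).
      have := cvgM (cvg_cst C) (cvg_norm c1); rewrite normr0 mulr0; exact.
    apply/norm_cvg0P; apply: (squeeze_cvgr (f := fun=> 0) (h := fun u => C * `|E (u + t) - E t|)) => //; last exact: cvg_cst.
    by apply: filterS n0 => u [-> _]; rewrite normr_ge0.
  have H := c0 _ (parallel_incr HT e20); apply: (near_mono H) => u /=.
  by rewrite [y + _]addrC subrK.
have n2 : \forall u \near 0^', `|E' - q u| <= Num.min e1 1.
  by have /cvgrPdist_le := qE; apply; rewrite lt_min e10 ltr01.
near=> u.
have h0 : u != 0 by near: u; exact: nbhs_dnbhs_neq.
have [D1 D2] : `|xi (u + t) - xi t| <= C * `|E (u + t) - E t| /\ usubmx (Th (xi (u + t))) = E (u + t).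
  by near: u; exact: nbhs_dnbhs.
have D3 : `|usubmx (Th (xi (u + t))) - usubmx (Th y) - row_mx 0 (xi (u + t) - y) *m Th y| <= e2 * `|xi (u + t) - y|.
  by near: u; exact: nbhs_dnbhs.
have : `|E' - q u| <= Num.min e1 1 by near: u; exact: n2.
rewrite le_min => /andP[D4 D5].

pose L := xi (u + t) - y.
have -> : rsubmx (E' *m Q) - u^-1 *: ((xi \o shift t) (u *: 1) - xi t) =
    rsubmx ((E' - q u + u^-1 *: (usubmx (Th (xi (u + t))) - usubmx (Th y) - row_mx 0 L *m Th y)) *m Q).
  have -> : q u = u^-1 *: (usubmx (Th (xi (u + t))) - usubmx (Th y)).
    by rewrite /q /= [u *: 1]mulr1 D2 (nbhs_singleton nE).2.
  rewrite [u^-1 *: (_ - _ *m _)]scalerBr addrA subrK mulmxBl rsubmxB; congr (_ - _).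
  rewrite -scalemxAl mulmxK// /= [u *: 1]mulr1 scale_row_mx scaler0 row_mxKr.
  by [].
have D6 : `|q u| <= `|E'| + 1.
  have := ler_normD E' (q u - E'); rewrite addrC subrK [`|q u - E'|]distrC => /le_trans; apply.
  by rewrite lerD2l.
have LQ : `|u|^-1 * `|L| <= C * (`|E'| + 1).
  apply: le_trans (ler_wpM2l _ D6); last exact: ltW.
  rewrite /q normrZ normfV mulrCA; apply: ler_wpM2l; first by rewrite invr_ge0.
  by rewrite /= [u *: 1]mulr1.
apply: le_trans (rsubmx_le _) _; apply: le_trans (mxnorm_mul _ _) _.
rewrite mulrAC.
have S1 : `|E' - q u + u^-1 *: (usubmx (Th (xi (u + t))) - usubmx (Th y) - row_mx 0 L *m Th y)| <= 2 * e1.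
  apply: le_trans (ler_normD _ _) _; rewrite mulr_natl mulr2n; apply: lerD; first exact: D4.
  rewrite normrZ normfV; have N0 : 0 <= `|u|^-1 by rewrite invr_ge0.
  apply: le_trans (ler_wpM2l N0 D3) _; rewrite mulrCA.
  apply: le_trans (ler_wpM2l (ltW e20) LQ) _.
  by rewrite /e2 divfK// gt_eqF// mulr_gt0// ltr_wpDl.
have N0 : 0 <= (1 + m)%:R * `|Q| by rewrite mulr_ge0.
apply: le_trans (ler_wpM2l N0 S1) _.
have E1 : e = (1 + m)%:R * (`|Q| + 1) * (2 * e1).
  have Q1 : `|Q| + 1 != 0 by rewrite gt_eqF// ltr_wpDl.
  rewrite /e1; move: Q1; move: (`|Q| + 1) => x x0.
  have m0 : (1 + m)%:R != 0 :> R by rewrite pnatr_eq0.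
  by move: ((1 + m)%:R) m0 => p p0; field; rewrite x0 p0.
rewrite [leRHS]E1; apply: ler_wpM2r; first by rewrite mulr_ge0// ltW.
by apply: ler_wpM2l; rewrite ?ler0n// lerDl.
Unshelve. all: by end_near. Qed.

(** Serves to differentiate the inverse frame, and with it the velocity of a lifted curve. *)
Lemma frame_Ck1 (Th : 'rV[R]_m -> 'M[R]_(1 + m)) (P : set 'rV[R]_m) i j :
  open P -> P `<=` O -> (forall y, P y -> parallel_at g K Th y) ->
  Ck_on 1 P (fun y => Th y i j).
Proof.
move=> oP PO HP; have C0 p q : Ck_on 0 P (fun y => Th y p q).
  by move=> y Py; exact: differentiable_continuous (HP y Py p q).1.
split=> [y Py|k]; first exact: (HP y Py i j).1.
apply: (@Ck_ext _ _ 0 P (fun y => \sum_s conn g K k y i s * Th y s j)) => //.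
  by move=> y Py; rewrite (HP y Py i j).2 mxE.
apply: Ck_sum => // s; apply: CkM => //.
by move=> y Py; exact: (conn_Ck (cc_open h) (cc_smooth h) (cc_unit h) K 0 k i s y (PO y Py)).
Qed.

Definition geodesic_at (xi : R -> 'rV[R]_m) (t : R) : Prop :=
  [/\ derivable xi t 1, derivable (derive1 xi) t 1 &
    forall k, (derive1n 2 xi t) ord0 k + \sum_i \sum_j christoffel g k i j (xi t) *
      (derive1 xi t) ord0 i * (derive1 xi t) ord0 j = 0].

(** The velocity is read off as the last coordinates of E' Th^-1, hence is differentiable. Comparing
    second derivatives of the first row along [xi] and of [E], the invertible frame cancels and the
    geodesic equation remains. *)
Lemma lift_geodesic b a rho Th (r C : R) (xi : R -> 'rV[R]_m) (E : R -> 'rV[R]_(1 + m)) (t : R) :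
  local_frame g O K b a rho Th -> (forall y, `|y - a| < rho -> model_halfspace y) ->
  r < rho -> 0 < C ->
  (forall y y', `|y - a| <= r -> `|y' - a| <= r ->
     `|y' - y| <= C * `|usubmx (Th y') - usubmx (Th y)|) ->
  (\forall s \near t, [/\ `|xi s - a| <= r, usubmx (Th (xi s)) = E s & hyper_at b E s]) ->
  \forall s \near t, geodesic_at xi s.
Proof.
move=> HTh Hint rr C0 inj nE; have [[rho0 srO sr] HT] := HTh.
have par y : `|y - a| <= r -> parallel_at g K Th y /\ Th y \in unitmx.
  move=> yr; have yr' := le_lt_trans yr rr; have [? _ ?] := HT _ yr' (Hint _ yr'); by split.
have d1 : \forall s \near t, is_derive s (1 : R) xi (rsubmx (derive1 E s *m invmx (Th (xi s)))).
  apply: (near_mono (near_near nE)) => s nEs.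
  have [sr1 sE [lam _ [dE _ _ _]]] := nbhs_singleton nEs.
  have [pT uT] := par _ sr1.
  apply: (lift_derivable C0 pT uT _ dE); apply: (near_mono nEs) => u [ur uE _].
  by split=> //; rewrite -uE -sE; exact: inj.
apply: (near_mono (near_near (filterI nE d1))) => s nEs.
have [[sr1 sE [lam lam0 [dE ddE Eb E'b]]] dxi] := nbhs_singleton nEs.
have dx : derivable xi s 1 by exact: ex_derive.
have [pT uT] := par _ sr1.
have ddx : derivable (derive1 xi) s 1.
  have eqx : \forall u \near s, rsubmx (derive1 E u *m invmx (Th (xi u))) = derive1 xi u.
    by apply: (near_mono nEs) => u [_ [_ <-]]; rewrite derive1E.
  apply: near_eq_derivable eqx _.
  pose P := [set y : 'rV[R]_m | `|y - a| < rho].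
  have oP : open P.
    rewrite (_ : P = ball a rho); first exact: ball_open.
    by apply/seteqP; split=> y; rewrite /P/= normr_ball distrC.
  have Pr y : P y -> `|y - a| <= rho /\ model_halfspace y by move=> Py; split; [exact: ltW|exact: Hint].
  have PO : P `<=` O by move=> y /Pr[/srO].
  have Q1 i j := Ck_invmx (n := 1 + m) (k := 1) (M := Th) i j oP
    (fun y Py => let: And3 _ _ uy := HT y Py (Hint y Py) in uy)
    (fun p q => frame_Ck1 p q oP PO (fun y Py => let: And3 py _ _ := HT y Py (Hint y Py) in py)).
  have Ps : P (xi s) by exact: le_lt_trans sr1 rr.
  have dQ : derivable (fun u => invmx (Th (xi u))) s 1.
    apply/derivable_mxP => i j; apply: ex_derive.
    exact: is_derive_chain ((Q1 i j).1 _ Ps) dx.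
  have := is_derive_mulmx ddE (derivable_is_derive1 dQ) => /is_derive_mxP dM.
  apply/derivable_mxP => i j.
  under [fun u => _ i j]eq_fun do rewrite mxE.
  exact: ex_derive.
split=> // k.
have E1 : \forall u \near s, row_mx 0 (derive1 xi u) *m Th (xi u) = derive1 E u.
  apply: (near_mono (near_near nEs)) => u nEu.
  have [[ur1 uE _] [dxu _]] := nbhs_singleton nEu.
  have EE : \forall v \near u, usubmx (Th (xi v)) = E v.
    by apply: (near_mono nEu) => v [[_ ->]].
  have [_] := is_derive_near EE (curve_dev1 (par _ ur1).1 dxu).
  by move=> <-; rewrite derive1E.
have [_] := is_derive_near E1 (curve_dev2 pT dx ddx).
have [_ ->] := ddE.
rewrite -sE usubmx_mul scalemxAl => /(can_inj (mulmxK uT)).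
rewrite row_lin_mx scale_row_mx scaler0 => /eq_row_mx[_ /matrixP/(_ ord0 k)].
by rewrite [X in X = _]mxE addmxE [X in _ + X]mxE => <-.
Qed.

(** The factor [lam] is - K |xi'|^2, nonnegative because K <= 0. *)
Lemma geodesic_hyper b a rho Th (xi : R -> 'rV[R]_m) (t : R) : K <= 0 ->
  local_frame g O K b a rho Th ->
  (\forall s \near t, [/\ `|xi s - a| < rho, model_halfspace (xi s) & geodesic_at xi s]) ->
  [/\ hyper_at b (fun s => usubmx (Th (xi s))) t,
     derive1 (fun s => usubmx (Th (xi s))) t = row_mx 0 (derive1 xi t) *m Th (xi t) &
     is_derive t 1 (fun s => row_mx 0 (derive1 xi s) *m Th (xi s))
       ((- K * gdot g (xi t) (derive1 xi t) (derive1 xi t)) *: usubmx (Th (xi t)))].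
Proof.
move=> K0 HTh nE; have [[rho0 srO sr] HT] := HTh.
have [tr1 Ht [dx ddx gx]] := nbhs_singleton nE; have [pT Tb uT] := HT _ tr1 Ht.
have E1 : \forall u \near t, row_mx 0 (derive1 xi u) *m Th (xi u) = derive1 (fun s => usubmx (Th (xi s))) u.
  apply: (near_mono nE) => u [ur Hu [dxu _ _]]; have [pu _ _] := HT _ ur Hu.
  by have [_ <-] := curve_dev1 pu dxu; rewrite derive1E.
have d2 : is_derive t 1 (fun s => row_mx 0 (derive1 xi s) *m Th (xi s))
       ((- K * gdot g (xi t) (derive1 xi t) (derive1 xi t)) *: usubmx (Th (xi t))).
  have := curve_dev2 pT dx ddx => /is_derive_eq; apply; rewrite row_lin_mx usubmx_mul scalemxAl.
  congr (_ *m _); rewrite scale_row_mx scaler0 scalemx1; congr row_mx.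
  by apply/matrixP => i k; rewrite (ord1 i) addmxE [X in _ + X]mxE gx mxE.
split => //; last by have := nbhs_singleton E1.
have Ot : O (xi t) by apply: srO; exact: ltW.
exists (- K * gdot g (xi t) (derive1 xi t) (derive1 xi t)).
  rewrite mulr_ge0 ?oppr_ge0//.
  have := @gdot_ge0 _ _ g O (cc_pos h) (xi t) (derive1 xi t) Ot Ht.
  exact.
split.
- by apply: ex_derive; exact: curve_dev1 pT dx.
- exact: is_derive_near E1 d2.
- exact: frame_first_row HTh _ tr1 Ht.
- have -> : (- (- K * gdot g (xi t) (derive1 xi t) (derive1 xi t)))%:M =
    row_mx 0 (derive1 xi t) *m frame_form g K (xi t) *m (row_mx (0 : 'M[R]_1) (derive1 xi t))^T.
    rewrite quadric_row mul0mx add0r -scalemxAr -scalemxAl mulNr opprK.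
    by apply/matrixP => i j; rewrite !(ord1 i, ord1 j) [LHS]mxE [RHS]mxE.
  by rewrite -(nbhs_singleton E1) -Tb trmx_mul !mulmxA.
Qed.

End LocalInverse.

Lemma within_near (T U : topologicalType) (A : set T) (f : T -> U) x (P : set U) :
  {within A, continuous f} -> A x -> nbhs (f x) P -> \forall z \near x, A z -> P (f z).
Proof.
move=> cf Ax nP; have H : @nbhs_subspace T A x (f @^-1` P) := cf x P nP.
by rewrite -nbhs_subspace_in in H.
Qed.

Section Charts.
Context {R : realType} {m : nat}.

Lemma Ck_sub (V : normedModType R) k (O P : set 'rV[R]_m) (f : 'rV[R]_m -> V) :
  P `<=` O -> Ck_on k O f -> Ck_on k P f.
Proof.
move=> PO; elim: k f => [|k IH] f; first by move=> fO x /PO; exact: fO.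
by move=> [fO pf]; split=> [x /PO|i]; [exact: fO|exact: IH (pf i)].
Qed.

Lemma ball_near (V : normedModType R) (y : V) (r : R) : 0 < r -> \forall z \near y, `|z - y| < r.
Proof.
by move=> r0; apply/nbhs_ballP; exists r => //= z; rewrite -ball_normE/= distrC.
Qed.

Lemma near_cont (T U : topologicalType) (f : T -> U) (t : T) (P : U -> Prop) :
  {for t, continuous f} -> nbhs (f t) P -> \forall s \near t, P (f s).
Proof. by move=> cf nP; exact: cf _ nP. Qed.

Lemma trmxZ p q (c : R) (A : 'M[R]_(p, q)) : (c *: A)^T = c *: A^T.
Proof. by apply/matrixP => i j; rewrite !mxE. Qed.

Lemma contM (T : topologicalType) (f g : T -> R) (t : T) :
  {for t, continuous f} -> {for t, continuous g} -> {for t, continuous (fun x => f x * g x)}.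
Proof. exact: cvgM. Qed.

Lemma contD (T : topologicalType) (f g : T -> R) (t : T) :
  {for t, continuous f} -> {for t, continuous g} -> {for t, continuous (fun x => f x + g x)}.
Proof. exact: cvgD. Qed.

Lemma cont_comp (T U V : topologicalType) (f : T -> U) (g : U -> V) (t : T) :
  {for t, continuous f} -> {for f t, continuous g} -> {for t, continuous (fun x => g (f x))}.
Proof. exact: continuous_comp. Qed.

Lemma cont_coord p q (i : 'I_p) (j : 'I_q) (t : 'M[R]_(p, q)) :
  {for t, continuous (fun A : 'M[R]_(p, q) => A i j)}.
Proof. exact: coord_continuous. Qed.

Lemma cont_cst (T : topologicalType) (a : R) (t : T) : {for t, continuous (fun _ : T => a)}.
Proof. exact: cvg_cst. Qed.

Lemma cont_sum (T : topologicalType) (I : Type) (r : seq I) (f : I -> T -> R) (t : T) :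
  (forall i, {for t, continuous (f i)}) -> {for t, continuous (fun x => \sum_(i <- r) f i x)}.
Proof.
move=> cf; elim: r => [|i r IH].
  by rewrite (_ : (fun x => _) = fun=> 0); [exact: cont_cst|apply/funext => x; rewrite big_nil].
rewrite (_ : (fun x => _) = fun x => f i x + \sum_(i <- r) f i x); first exact: contD.
by apply/funext => x; rewrite big_cons.
Qed.

Lemma cont_inv (T : topologicalType) (f : T -> R) (t : T) : f t != 0 ->
  {for t, continuous f} -> {for t, continuous (fun x => (f x)^-1)}.
Proof. exact: cvgV. Qed.

Lemma cont_quadratic p (g : 'M[R]_p) : continuous (fun w : 'rV[R]_p => (w *m g *m w^T) ord0 ord0).
Proof.
rewrite (_ : (fun w => _) = fun w : 'rV[R]_p => \sum_j (\sum_i w ord0 i * g i j) * w ord0 j).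
  move=> u; apply: cont_sum => j; apply: contM; last exact: cont_coord.
  by apply: cont_sum => i; apply: contM; [exact: cont_coord|exact: cont_cst].
by apply/funext => u; rewrite mxE; apply: eq_bigr => j _; rewrite [u^T _ _]mxE mxE.
Qed.

Lemma scalemx_entry p q (c : R) (A : 'M[R]_(p, q)) i j : (c *: A) i j = c * A i j.
Proof. exact: mxE. Qed.

Lemma posdef_unitmx (S : 'M[R]_m) :
  (forall u : 'rV[R]_m, u != 0 -> 0 < (u *m S *m u^T) ord0 ord0) -> S \in unitmx.
Proof.
move=> Sp; rewrite -row_free_unit -kermx_eq0; apply/negPn/negP => /rowV0Pn[u /sub_kermxP uS /Sp].
by rewrite uS mul0mx mxE ltxx.
Qed.

Lemma partial_chain (f : 'rV[R]_m -> R) (tau : 'rV[R]_m -> 'rV[R]_m) y k :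
  differentiable f (tau y) -> differentiable tau y ->
  differentiable (fun z => f (tau z)) y /\
  partial k (fun z => f (tau z)) y = \sum_a partial k (fun z => tau z ord0 a) y * partial a f (tau y).
Proof.
move=> df dtau; split; first exact: differentiable_comp.
have dl : derivable (fun s : R => tau (y + s *: delta_mx ord0 k)) 0 1.
  apply/derivable_mxP => i j; apply: ex_derive.
  apply: (is_derive_line (f := fun z => tau z i j)).
  rewrite scale0r addr0.
  by apply: (differentiable_comp (g := fun M : 'rV[R]_m => M i j)) => //; exact: differentiable_coord.
have df' : differentiable f (tau (y + 0 *: delta_mx ord0 k)) by rewrite scale0r addr0.
have dc := is_derive_chain df' dl.
have dd : differentiable (f \o tau) (y + 0 *: delta_mx ord0 k).
  by rewrite scale0r addr0; exact: differentiable_comp.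
have [_ E1] := is_derive_line dd; have [_ E2] := dc.
rewrite scale0r addr0 in E1 E2.
rewrite /partial -E1 [in LHS]E2; apply: eq_bigr => a _; congr (_ * _).
rewrite derive1E derive_mx// mxE.
have := is_derive_line (f := fun z => tau z ord0 a) (y := y) (v := delta_mx ord0 k) (s := 0).
rewrite scale0r addr0 => H; have [|_ ->//] := H.
by apply: (differentiable_comp (g := fun M : 'rV[R]_m => M ord0 a)) => //; exact: differentiable_coord.
Qed.

Definition Jac (tau : 'rV[R]_m -> 'rV[R]_m) y : 'M[R]_m :=
  \matrix_(i, a) partial i (fun z => tau z ord0 a) y.

Lemma jacobianE (tau : 'rV[R]_m -> 'rV[R]_m) y : differentiable tau y -> 'J tau y = Jac tau y.
Proof.
move=> dtau; apply/matrixP => i a; rewrite [RHS]mxE.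
have := deriveEjacobian (delta_mx ord0 i) dtau; rewrite -rowE => E.
have -> : 'J tau y i a = 'D_(delta_mx ord0 i) tau y ord0 a by rewrite E [in RHS]mxE.
rewrite derive_mx; last exact: diff_derivable.
by rewrite mxE.
Qed.

End Charts.

(** * Change of charts *)

Section ChartChange.
Context {R : realType} {m : nat}.
Variables (g1 g2 : 'rV[R]_m -> 'M[R]_m) (O1 O2 : set 'rV[R]_m) (K : R).
Hypotheses (h1 : cc_metric g1 O1 K) (h2 : cc_metric g2 O2 K).
Variables (N : set 'rV[R]_m) (tau : 'rV[R]_m -> 'rV[R]_m).
Hypotheses (oN : open N) (tauC : smooth_on N tau).
Hypothesis NO1 : forall y, N y -> O1 y /\ model_halfspace y.
Hypothesis NO2 : forall y, N y -> O2 (tau y) /\ model_halfspace (tau y).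
Hypothesis gtau : forall y, N y -> g1 y = Jac tau y *m g2 (tau y) *m (Jac tau y)^T.

Let J := Jac tau.

Lemma tau_entry k a : Ck_on k N (fun z => tau z ord0 a).
Proof. by apply: Ck_entry => //; exact: tauC. Qed.

Lemma tau_diff y : N y -> differentiable tau y.
Proof. exact: (tauC 1).1. Qed.

Lemma Jac_diff y i a : N y -> differentiable (fun z => J z i a) y.
Proof.
move=> Ny; rewrite (_ : (fun z => _) = partial i (fun z => tau z ord0 a)).
  exact: ((tau_entry 2 a).2 i).1.
by apply/funext => z; rewrite mxE.
Qed.

Definition dJac k y : 'M[R]_m := \matrix_(i, a) partial k (fun z => J z i a) y.

Lemma dJac_sym y i j a : N y -> dJac i y j a = dJac j y i a.
Proof.
move=> Ny; rewrite [LHS]mxE [RHS]mxE.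
have E k : (fun z => J z k a) = partial k (fun z => tau z ord0 a).
  by apply/funext => z; rewrite mxE.
by rewrite !E (partialC (O := N)) //; exact: tau_entry.
Qed.

Lemma Jac_unit y : N y -> J y \in unitmx.
Proof.
move=> Ny; have [y1 Hy1] := NO1 Ny; have := cc_unit h1 y1; rewrite gtau// !unitmxE !det_mulmx.
by rewrite unitrM => /andP[]; rewrite unitrM => /andP[].
Qed.

Lemma g2_diff y i j : N y -> differentiable (g2^~ i^~ j) (tau y).
Proof. by move=> /NO2[y2 _]; exact: (cc_smooth h2 1 i j).1. Qed.

Let S k y := \sum_a J y k a *: Gam g2 a (tau y).

Lemma dmetric_chain k y : N y ->
  dmetric g1 k y = dJac k y *m g2 (tau y) *m (J y)^T +
    J y *m (\sum_a J y k a *: dmetric g2 a (tau y)) *m (J y)^T +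
    J y *m g2 (tau y) *m (dJac k y)^T.
Proof.
move=> Ny; apply/matrixP => i j; rewrite mxE.
rewrite (@partial_ext _ _ _ (fun z => \sum_q (\sum_p J z i p * g2 (tau z) p q) * J z j q) N) //; last first.
  by move=> z Nz; rewrite gtau// mxE; apply: eq_bigr => q _; rewrite [(J z)^T _ _]mxE mxE.
have dg p q := partial_chain k (g2_diff p q Ny) (tau_diff Ny).
have dJg q : differentiable (fun z => \sum_p J z i p * g2 (tau z) p q) y.
  by apply: differentiable_sumM => p; [exact: Jac_diff|exact: (dg p q).1].
rewrite partial_sumM//; last by move=> q; exact: Jac_diff.
rewrite !addmxE !mxE -!big_split/=; apply: eq_bigr => q _.
rewrite partial_sumM; last 2 first.
- by move=> p; exact: Jac_diff.
- by move=> p; exact: (dg p q).1.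
rewrite !mxE; congr (_ + _).
rewrite -mulrDl; congr (_ * _); rewrite big_split/=; congr (_ + _); apply: eq_bigr => p _.
  by rewrite mxE.
rewrite (dg p q).2; congr (_ * _); rewrite summxE; apply: eq_bigr => a _.
by rewrite !mxE.
Qed.

(* The transformation law of the Christoffel symbols. *)
Lemma Gam_chain k y : N y -> Gam g1 k y *m J y = dJac k y + J y *m S k y.
Proof.
move=> Ny; have [y1 Hy1] := NO1 Ny; have [y2 Hy2] := NO2 Ny; have uJ := Jac_unit Ny.
pose D k := (dJac k y + J y *m S k y) *m invmx (J y).
suff -> : Gam g1 k y = D k by rewrite /D mulmxKV.
apply/esym; apply: (levi_civita_unique (cc_open h1) (cc_smooth h1) (cc_unit h1) (cc_sym h1) y1 Hy1) => [i j l|i].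
  have E : row j (dJac i y + J y *m S i y) = row i (dJac j y + J y *m S j y).
    have E1 : row j (dJac i y) = row i (dJac j y).
      by apply/rowP => b; rewrite [LHS]mxE [RHS]mxE; exact: dJac_sym.
    have E2 : row j (J y *m S i y) = row i (J y *m S j y); last first.
      by move: (J y *m S i y) (J y *m S j y) E2 => X Y; rewrite !linearD/= E1 => ->.
    apply/rowP => b; rewrite [LHS]mxE [RHS]mxE [LHS]mxE [RHS]mxE.
    transitivity (\sum_p \sum_a J y j p * J y i a * Gam g2 a (tau y) p b).
      apply: eq_bigr => p _; rewrite summxE mulr_sumr; apply: eq_bigr => a _.
      by rewrite scalemx_entry mulrA.
    rewrite exchange_big/=; apply: eq_bigr => p _.
    rewrite summxE mulr_sumr; apply: eq_bigr => a _.
    rewrite scalemx_entry mulrA [J y j a * _]mulrC; congr (_ * _).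
    rewrite [LHS]mxE [RHS]mxE; apply: (christoffelC (cc_open h2) (cc_smooth h2));
      try exact: (cc_unit h2); try exact: (cc_sym h2); done.
  have F k' j' : D k' j' l = (row j' (dJac k' y + J y *m S k' y) *m invmx (J y)) ord0 l.
    by rewrite -row_mul [RHS]mxE.
  by rewrite !F E.
rewrite dmetric_chain// gtau// -/(J y).
have -> : D i *m (J y *m g2 (tau y) *m (J y)^T) = (dJac i y + J y *m S i y) *m g2 (tau y) *m (J y)^T.
  by rewrite /D !mulmxA mulmxKV.
have -> : J y *m g2 (tau y) *m (J y)^T *m (D i)^T = J y *m g2 (tau y) *m (dJac i y + J y *m S i y)^T.
  by rewrite /D trmx_mul -!mulmxA [(J y)^T *m _]mulmxA -trmx_mul mulVmx// trmx1 mul1mx.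
have -> : \sum_a J y i a *: dmetric g2 a (tau y) = S i y *m g2 (tau y) + g2 (tau y) *m (S i y)^T.
  rewrite /S (linear_sum trmx) mulmx_suml mulmx_sumr -big_split/=.
  apply: eq_bigr => a _; rewrite (metric_compatible (cc_open h2) (cc_smooth h2) (cc_unit h2) (cc_sym h2))//.
  by rewrite linearZ/= -scalemxAl -scalemxAr scalerDr.
have trD (X Y : 'M[R]_m) : (X + Y)^T = X^T + Y^T by rewrite linearD.
rewrite trD trmx_mul !mulmxDl !mulmxDr !mulmxDl !mulmxA.
have ac (V : zmodType) (a b c d : V) : a + (b + c) + d = a + b + (d + c).
  by rewrite -!addrA [c + d]addrC.
exact: ac.
Qed.

(** The rows of a frame are F, d_1 F, .., d_m F: the value does not change with the chart and the
    derivatives are multiplied by the Jacobian. [B] is the derivative of [T]. *)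
Let T y : 'M[R]_(1 + m) := block_mx 1%:M 0 0 (J y).
Let B k y : 'M[R]_(1 + m) := block_mx 0 0 0 (dJac k y).

Lemma pullback_entry_derive y i j : N y -> differentiable (fun z => T z i j) y /\
  forall k, partial k (fun z => T z i j) y = B k y i j.
Proof.
move=> Ny; have cstE (c : R) : (forall z, T z i j = c) -> (forall k, B k y i j = 0) ->
    differentiable (fun z => T z i j) y /\ forall k, partial k (fun z => T z i j) y = B k y i j.
  move=> Tc B0; rewrite (_ : (fun z => _) = cst c); last exact/funext.
  by split=> [|k]; [exact: differentiable_cst|rewrite B0; exact: partial_cst].
case: (split_ordP i) cstE => i' ->; case: (split_ordP j) => j' -> cstE.
- by apply: (cstE ((1%:M : 'M[R]_1) i' j')) => z; rewrite ?block_mxEul ?mxE.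
- by apply: (cstE 0) => z; rewrite ?block_mxEur ?mxE.
- by apply: (cstE 0) => z; rewrite ?block_mxEdl ?mxE.
- rewrite (_ : (fun z => _) = (fun z => J z i' j')).
    by split=> [|k]; [exact: Jac_diff|rewrite block_mxEdr mxE].
  by apply/funext => z; rewrite block_mxEdr.
Qed.

(** The gauge transformation law of [conn]; its lower right block is [Gam_chain], its lower left one
    the transformation of the metric. *)
Lemma conn_chain k y : N y ->
  conn g1 K k y *m T y = B k y + T y *m \sum_a J y k a *: conn g2 K a (tau y).
Proof.
move=> Ny.
have -> : \sum_a J y k a *: conn g2 K a (tau y) =
    lin_mx (conn g2 K) (row k (J y)) (tau y).
  by apply: eq_bigr => a _; rewrite [row _ _ _ _]mxE.
rewrite lin_mxE /conn /T /B !mulmx_block !mulmx0 !mul0mx !addr0 !add0r !mulmx1 !mul1mx add_block_mx !add0r.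
have -> : \sum_i row k (J y) ord0 i *: Gam g2 i (tau y) = S k y.
  by apply: eq_bigr => a _; rewrite [row _ _ _ _]mxE.
rewrite -Gam_chain// -rowE; congr block_mx.
by rewrite gtau// -/(J y) -scalemxAr tr_row !colE !mulmxA.
Qed.

Lemma frame_pullback q (Th : 'rV[R]_m -> 'M[R]_(1 + m, q)) y : N y -> parallel_at g2 K Th (tau y) ->
  parallel_at g1 K (fun z => T z *m Th (tau z)) y.
Proof.
move=> Ny HT i j.
have E : (fun z => (T z *m Th (tau z)) i j) = (fun z => \sum_s T z i s * Th (tau z) s j).
  by apply/funext => z; rewrite mxE.
have dT s k := partial_chain k (HT s j).1 (tau_diff Ny).
have dT1 s : differentiable (fun z => Th (tau z) s j) y.
  exact: (differentiable_comp (tau_diff Ny) (HT s j).1).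
rewrite E; split.
  by apply: differentiable_sumM => s; [exact: (pullback_entry_derive _ _ Ny).1|exact: dT1].
move=> k; rewrite partial_sumM//; last by move=> s; exact: (pullback_entry_derive _ _ Ny).1.
rewrite mulmxA conn_chain// mulmxDl -mulmxA addmxE [X in _ = X + _]mxE [X in _ = _ + X]mxE -big_split/=.
transitivity (\sum_s B k y i s * Th (tau y) s j +
  \sum_s T y i s * ((\sum_a J y k a *: conn g2 K a (tau y)) *m Th (tau y)) s j).
  rewrite -big_split/=; apply: eq_bigr => s _; rewrite (pullback_entry_derive _ _ Ny).2; congr (_ + _ * _).
  rewrite (dT s k).2 mulmx_suml summxE; apply: eq_bigr => a _.
  by rewrite (HT s j).2 -scalemxAl [in RHS]mxE [J y k a]mxE.
by rewrite big_split.
Qed.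

Lemma frame_form_pullback y : N y ->
  T y *m frame_form g2 K (tau y) *m (T y)^T = frame_form g1 K y.
Proof.
move=> Ny; rewrite /T /frame_form tr_block_mx !mulmx_block !trmx0 trmx1 !mulmx0 !mul0mx !addr0 !add0r !mulmx1.
by rewrite gtau// -scalemxAr -scalemxAl !mul0mx.
Qed.

Lemma pullback_unit y : N y -> T y \in unitmx.
Proof. by move=> Ny; rewrite unitmxE det_ublock det1 mul1r -unitmxE Jac_unit. Qed.

End ChartChange.

(** * Developing maps *)

Section Manifold.
Context {R : realType} {m : nat}.
Hypothesis hm : (0 < m)%N.
Context {M : topologicalType}.
Variables (G : riemannian_manifold R m M) (K : R).
Hypothesis hcurv : constant_sectional_curvature G K.
Implicit Types (c d : chart G) (x z : M) (y : 'rV[R]_m).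

Let i0 : 'I_m := Ordinal hm.

Lemma halfspaceP y : model_halfspace y <-> 0 <= y ord0 i0.
Proof.
split=> [|y0 i /= ii0]; first exact.
by rewrite (_ : i = i0)//; exact: val_inj.
Qed.

(** Off the half-space the extended metric may degenerate; charts are cut down to the open set where
    it does not, so that its inverse is smooth. *)
Definition regular_set c : set 'rV[R]_m := [set y | img c y /\ metric c y \in unitmx].

Lemma chart_regular c x : dom c x -> regular_set c (chart_map c x) /\ model_halfspace (chart_map c x).
Proof.
move=> cx; have Ix := chart_map_img cx; split; last exact: Ix.2.
split; first exact: Ix.1.
by apply: posdef_unitmx; exact: metric_pos.
Qed.

Lemma param_chart c y : regular_set c y -> model_halfspace y ->
  dom c (param c y) /\ chart_map c (param c y) = y.
Proof. by move=> [Iy _] Hy; split; [exact: param_dom|exact: paramK]. Qed.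

Lemma chart_metric c : cc_metric (metric c) (regular_set c) K.
Proof.
have gC k i j : Ck_on k (img c) (fun y => metric c y i j).
  by apply: Ck_entry; [exact: img_open|exact: metric_smooth].
split.
- rewrite openE => y [Iy uy]; rewrite /interior.
  have cdet := Ck_det (k := 0) (@img_open _ _ _ _ c) (gC 0) y Iy.
  have n1 : \forall z \near y, \det (metric c z) != 0.
    have H : nbhs (\det (metric c y)) [set r : R | r != 0].
      apply: open_nbhs_nbhs; split; first exact: open_neq.
      by move: uy; rewrite unitmxE unitfE.
    exact: cdet _ H.
  have n2 : \forall z \near y, img c z by apply: open_nbhs_nbhs; split => //; exact: img_open.
  by apply: filterS2 n1 n2 => z z1 z2; split => //; rewrite unitmxE unitfE.
- by move=> k i j; apply: (Ck_sub (O := img c)) => // y [].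
- by move=> y [].
- by move=> y [Iy _] Hy; exact: (Defs.metric_sym (conj Iy Hy)).
- by move=> y [Iy _] Hy; exact: (@metric_pos _ _ _ G c y (conj Iy Hy)).
- move=> y Ry Hy u v uv; have [dy <-] := param_chart Ry Hy.
  exact: hcurv.
Qed.

Lemma chart_map_inj c x z : dom c x -> dom c z -> chart_map c x = chart_map c z -> x = z.
Proof. by move=> cx cz E; rewrite -(chart_mapK cx) -(chart_mapK cz) E. Qed.

Lemma param_near c x (P : set M) : dom c x -> nbhs x P ->
  \forall y \near chart_map c x, img c y /\ (model_halfspace y -> dom c (param c y) /\ P (param c y)).
Proof.
move=> cx nP; have Ix := chart_map_img cx.
have : nbhs (param c (chart_map c x)) P by rewrite chart_mapK.
move=> /(within_near (@param_continuous _ _ _ G c) Ix).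
move=> n1; have n2 : \forall y \near chart_map c x, img c y.
  by apply: open_nbhs_nbhs; split; [exact: img_open|exact: Ix.1].
apply: filterS2 n1 n2 => y Py Iy; split => // Hy; split; first exact: param_dom.
exact: Py.
Qed.

Lemma chart_near c x (Q : set 'rV[R]_m) : dom c x -> nbhs (chart_map c x) Q ->
  \forall z \near x, dom c z /\ Q (chart_map c z).
Proof.
move=> cx nQ; have := within_near (@chart_map_continuous _ _ _ G c) cx nQ.
move=> n1; have n2 : \forall z \near x, dom c z.
  by apply: open_nbhs_nbhs; split => //; exact: dom_open.
by apply: filterS2 n1 n2 => z Qz cz; split => //; exact: Qz.
Qed.

Definition interior_pt x := ~ manifold_boundary G x.

Lemma interior_pos c x : dom c x -> interior_pt x -> 0 < chart_map c x ord0 i0.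
Proof.
move=> cx xi; have /chart_map_img[_ /halfspaceP] := cx.
rewrite le_eqVlt => /orP[/eqP E|//]; exfalso; apply: xi; exists c; split => //.
by exists i0.
Qed.

Lemma pos_near y : 0 < y ord0 i0 -> \forall z \near y, 0 < (z : 'rV[R]_m) ord0 i0.
Proof.
move=> y0; have cy := @coord_continuous R 1 m ord0 i0 y.
have H : nbhs (y ord0 i0) [set r : R | 0 < r] by apply: open_nbhs_nbhs; split => //; exact: open_gt.
exact: cy _ H.
Qed.

Lemma pos_halfspace y : 0 < y ord0 i0 -> model_halfspace y.
Proof. by move=> /ltW/halfspaceP. Qed.

Lemma transition_jacobian c d x W tau y :
  transition_near (dom c `&` dom d) (chart_map c) (chart_map d) x W tau ->
  W y -> img c y -> model_halfspace y -> dom d (param c y) ->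
  metric c y = Jac tau y *m metric d (tau y) *m (Jac tau y)^T.
Proof.
move=> [oW Wx tauC tauE] Wy Iy Hy dy; have cy := param_dom (conj Iy Hy); have Ey := paramK (conj Iy Hy).
have tr : transition_near (dom c `&` dom d) (chart_map c) (chart_map d) (param c y) W tau.
  by split => //; rewrite Ey.
have := metric_compat cy dy tr; rewrite Ey jacobianE; last exact: (tauC 1).1.
by rewrite tauE// Ey.
Qed.

(** Invariance of the boundary. If another chart put x on the boundary, the first coordinate of the
    transition map would have a local minimum at an interior point of R^m; its derivatives would
    vanish there and the Jacobian would be singular. *)
Lemma positive_interior c x : dom c x -> 0 < chart_map c x ord0 i0 -> interior_pt x.
Proof.
move=> cx x0 [d [dx [i ii di]]]; have {ii} ii : i = i0 by exact: val_inj.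
rewrite {}ii in di; have [W [tau tr]] := transition_smooth cx dx; have [oW Wx tauC tauE] := tr.
set y := chart_map c x in x0 Wx.
have n1 : \forall z \near y, 0 <= tau z ord0 i0.
  have nd : nbhs x (dom d) by apply: open_nbhs_nbhs; split => //; exact: dom_open.
  have n2 : \forall z \near y, W z by exact: open_nbhs_nbhs.
  apply: filterS3 (param_near cx nd) (pos_near x0) n2 => z [Iz Hz] z0 Wz.
  have [cz dz] := Hz (pos_halfspace z0); have Ez := paramK (conj Iz (pos_halfspace z0)).
  have := tauE (param c z) (conj cz dz); rewrite Ez => /(_ Wz) <-.
  by have /chart_map_img[_ /halfspaceP] := dz.
have tau0 : tau y ord0 i0 = 0 by rewrite -di tauE.
have J0 k : Jac tau y k i0 = 0.
  have n3 : \forall z \near y, W z by exact: open_nbhs_nbhs.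
  have /nbhs_ballP[r /= r0 Hr] : nbhs (y : 'rV[R]_m) [set z | 0 <= tau z ord0 i0 /\ W z] by exact: filterI.
  have Hs (s : R) : s \in `]- r, r[ -> 0 <= tau (y + s *: delta_mx ord0 k) ord0 i0 /\ W (y + s *: delta_mx ord0 k).
    rewrite in_itv/= => sr; apply: Hr; rewrite -ball_normE/= opprD addrA subrr sub0r normrN normrZ.
    apply: (@le_lt_trans _ _ `|s|); last by rewrite ltr_norml.
    by rewrite -[leRHS]mulr1; apply: ler_wpM2l => //; exact: norm_delta.
  have dt (s : R) : s \in `]- r, r[ -> is_derive s (1 : R) (fun s => tau (y + s *: delta_mx ord0 k) ord0 i0)
      (partial k (fun z : 'rV[R]_m => tau z ord0 i0) (y + s *: delta_mx ord0 k)).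
    move=> /Hs[_ Ws].
    exact: (@is_derive_line _ _ (fun z : 'rV[R]_m => tau z ord0 i0) y (delta_mx ord0 k) s
      ((Ck_entry ord0 i0 oW (tauC 1)).1 _ Ws)).
  have r00 : (0 : R) \in `]- r, r[ by rewrite in_itv/= oppr_lt0 r0.
  have rr : - r <= r by apply: ltW; rewrite -subr_gt0 opprK addr_gt0.
  have [||_ D0] := @derive1_at_min R (fun s => tau (y + s *: delta_mx ord0 k) ord0 i0) (- r) r 0 rr _ r00.
  - by move=> t /dt[].
  - by move=> t /Hs[+ _]; rewrite scale0r addr0 tau0.
  by have [_] := dt 0 r00; rewrite D0 scale0r addr0 mxE => <-.
have [[Iy uy] Hy] := chart_regular cx.
have dy : dom d (param c y) by rewrite chart_mapK.
move: uy; rewrite (transition_jacobian tr Wx Iy Hy dy) unitmxE !det_mulmx unitrM => /andP[+ _].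
rewrite unitrM => /andP[uJ _]; rewrite -unitmxE in uJ.
have : invmx (Jac tau y) *m (Jac tau y *m delta_mx i0 (ord0 : 'I_1)) = 0.
  rewrite (_ : Jac tau y *m _ = 0) ?mulmx0//.
  by apply/matrixP => k l; rewrite -colE mxE J0 mxE.
rewrite mulKmx// => /matrixP/(_ i0 ord0); rewrite !mxE !eqxx => /eqP.
by rewrite oner_eq0.
Qed.

Variable b : 'M[R]_(1 + m).
Implicit Types (F : M -> 'rV[R]_(1 + m)) (gamma : R -> M).

(* F is a developing map near x. *)
Definition devel F c x : Prop := exists rho Th,
  local_frame (metric c) (regular_set c) K b (chart_map c x) rho Th /\
  forall z, dom c z -> `|chart_map c z - chart_map c x| < rho -> F z = usubmx (Th (chart_map c z)).

(** At an interior point the transition map sends a full neighbourhood in R^m into the half-space of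
    the second chart, as the pull-back of frames requires. *)
Lemma devel_change F c d x : dom c x -> dom d x -> interior_pt x -> devel F d x -> devel F c x.
Proof.
move=> cx dx xi [rho [Th [HTh FE]]]; have [W [tau tr]] := transition_smooth cx dx.
have [oW Wx tauC tauE] := tr; set a := chart_map c x in Wx *.
have [[rho0 _ _] HT] := HTh.
have ta : tau a = chart_map d x by rewrite -tauE.
have nd : nbhs x (dom d) by apply: open_nbhs_nbhs; split => //; exact: dom_open.
have n1 : \forall y \near a, W y by exact: open_nbhs_nbhs.
have n2 : \forall y \near a, `|tau y - chart_map d x| < rho.
  have ct : {for a, continuous tau} by exact: differentiable_continuous ((tauC 1).1 a Wx).
  have H : nbhs (tau a) [set y' | `|y' - chart_map d x| < rho] by rewrite ta; exact: (ball_near (chart_map d x : 'rV[R]_m) rho0).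
  exact: ct _ H.
have /nbhs_ballP[r /= r0 Hr] : nbhs a [set y | [/\ W y, `|tau y - chart_map d x| < rho,
    img c y, 0 < y ord0 i0 & dom c (param c y) /\ dom d (param c y)]].
  apply: filterS3 (filterI n1 n2) (pos_near (interior_pos cx xi)) (param_near cx nd) => y [y1 y2] y3 [y4 y5].
  by split => //; apply: y5; exact: pos_halfspace.
pose N := ball a r; have oN : open N by exact: ball_open.
have NI y : N y -> img c y /\ model_halfspace y.
  by move=> /Hr[_ _ Iy y0 _]; split => //; exact: pos_halfspace.
have tauN y : N y -> tau y = chart_map d (param c y).
  move=> Ny; have Ey := paramK (NI _ Ny); have [Wy _ _ _ [cy dy]] := Hr _ Ny.
  by have := tauE _ (conj cy dy); rewrite Ey => /(_ Wy) ->.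
have NO1 y : N y -> regular_set c y /\ model_halfspace y.
  move=> Ny; have [_ _ _ _ [cy _]] := Hr _ Ny; have := chart_regular cy.
  by rewrite paramK//; exact: NI.
have NO2 y : N y -> regular_set d (tau y) /\ model_halfspace (tau y).
  by move=> Ny; rewrite tauN//; apply: chart_regular; have [_ _ _ _ []] := Hr _ Ny.
have gt y : N y -> metric c y = Jac tau y *m metric d (tau y) *m (Jac tau y)^T.
  move=> Ny; have [Wy _ Iy y0 [cy dy]] := Hr _ Ny.
  exact: (transition_jacobian tr) (pos_halfspace y0) dy.
have tN : smooth_on N tau by move=> k; apply: Ck_sub (tauC k) => y /Hr[].
have [rho1 sr1] := small_radius_exists (chart_metric c) (chart_regular cx).1.
have sr10 : 0 < rho1 by case: sr1.
exists (Num.min rho1 r), (fun y => block_mx 1%:M 0 0 (Jac tau y) *m Th (tau y)).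
have Nr y : `|y - a| < Num.min rho1 r -> N y.
  by rewrite lt_min => /andP[_]; rewrite /N normr_ball distrC.
split; first split.
- by apply: small_radius_le sr1; rewrite ?lt_min ?sr10 ?ge_min ?lexx.
- move=> y /Nr Ny Hy; have [y1 Hy2] := NO2 _ Ny; have [_ y2 _ _ _] := Hr _ Ny.
  have [pT Tb uT] := HT _ y2 Hy2; split.
  + exact: (frame_pullback (chart_metric c) (chart_metric d) oN tN NO1 NO2 gt).
  + rewrite trmx_mul -(frame_form_pullback K gt)//.
    by rewrite -Tb !mulmxA.
  + by rewrite unitmx_mul uT (pullback_unit (chart_metric c) NO1 gt).
- move=> z cz /Nr Nz; have [Wz z2 _ _ [_ dz]] := Hr _ Nz; rewrite chart_mapK// in dz.
  rewrite tauN// chart_mapK// FE//; last by move: z2; rewrite tauN// chart_mapK.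
  by rewrite -mul_usub_mx block_mxEv col_mxKu -usubmx_mul.
Qed.

Lemma devel_near F c x : dom c x -> devel F c x -> \forall z \near x, dom c z /\ devel F c z.
Proof.
move=> cx [rho [Th [[[rho0 srO sr] HT] FE]]].
have r2 : 0 < rho / 2 by rewrite divr_gt0.
apply: filterS (chart_near cx (ball_near (chart_map c x) r2)) => z [cz zr]; split => //.
have tri (y : 'rV[R]_m) : `|y - chart_map c x| <= `|y - chart_map c z| + `|chart_map c z - chart_map c x|.
  exact: ler_distD.
have rr : rho = rho / 2 + rho / 2 by field.
exists (rho / 2), Th; split; first split.
- split => // [y yr|w y wr yr].
    by apply: srO; apply: le_trans (tri y) _; rewrite [leRHS]rr lerD// ltW.
  apply: sr; first by apply: le_trans wr _; rewrite ler_pM2l// ler_pdivrMr// ler_pMr// ler1n.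
  by apply: le_trans (tri y) _; rewrite [leRHS]rr lerD// ltW.
- move=> y yr; apply: HT; apply: le_lt_trans (tri y) _.
  by rewrite [ltRHS]rr ltrD.
- move=> z' cz' z'r; apply: FE => //; apply: le_lt_trans (tri _) _.
  by rewrite [ltRHS]rr ltrD.
Qed.

(** Keeps the frame at x, which converts between tangent vectors at x and linear functionals on the
    model. *)
Definition devel_at (T : 'M[R]_(1 + m)) F c x : Prop := exists rho Th,
  [/\ local_frame (metric c) (regular_set c) K b (chart_map c x) rho Th, Th (chart_map c x) = T &
  forall z, dom c z -> `|chart_map c z - chart_map c x| < rho -> F z = usubmx (Th (chart_map c z))].

Lemma devel_atP F c x : devel F c x <-> exists T, devel_at T F c x.
Proof.
split=> [[rho [Th [HTh FE]]]|[T [rho [Th [HTh _ FE]]]]]; last by exists rho, Th.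
by exists (Th (chart_map c x)), rho, Th.
Qed.

Lemma devel_exists c x (T : 'M[R]_(1 + m)) : dom c x -> T \in unitmx ->
  T *m b *m T^T = frame_form (metric c) K (chart_map c x) ->
  exists2 F, devel_at T F c x & F x = usubmx T.
Proof.
move=> cx uT Tb; have [Rx Hx] := chart_regular cx.
have [rho [Th [HTh ThT]]] := local_frame_exists (chart_metric c) Rx Hx uT Tb.
exists (fun z => usubmx (Th (chart_map c z))); last by rewrite ThT.
by exists rho, Th.
Qed.

Lemma devel_at_ext T F F' c x : dom c x -> (\forall z \near x, F z = F' z) ->
  devel_at T F c x -> devel_at T F' c x.
Proof.
move=> cx nF [rho [Th [HTh ThT FE]]]; have rho0 : 0 < rho by case: HTh => -[].
have /nbhs_ballP[r /= r0 Hr] := param_near cx nF.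
exists (Num.min rho r), Th; split => //.
  by apply: local_frame_le HTh; rewrite ?lt_min ?rho0// ge_min lexx.
move=> z cz; rewrite lt_min => /andP[z1 z2]; rewrite -FE//.
have [|_ H] := Hr (chart_map c z); first by rewrite normr_ball distrC.
by have [_] := H (chart_regular cz).2; rewrite chart_mapK.
Qed.

Lemma devel_near_cont F c x (e : R) : dom c x -> devel F c x -> 0 < e -> \forall z \near x, `|F z - F x| < e.
Proof.
move=> cx [rho [Th [[[rho0 srO sr] HT] FE]]] e0; set a := chart_map c x in FE HT.
have aa : `|a - a| < rho by rewrite subrr normr0.
have [pT _ _] := HT a aa (chart_regular cx).2.
have n1 := near_cont (parallel_continuous pT) (ball_near (Th a) e0).
apply: filterS (chart_near cx (filterI n1 (ball_near a rho0))) => z [cz [z1 z2]].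
rewrite !FE//; apply: le_lt_trans z1.
by rewrite -linearB; exact: usubmx_le.
Qed.

Definition geod_near c gamma (t : R) : Prop := \forall s \near t,
  dom c (gamma s) /\ geodesic_at (metric c) (fun u => chart_map c (gamma u)) s.

Lemma geod_continuous c gamma (t : R) : geod_near c gamma t -> {for t, continuous gamma}.
Proof.
move=> gn; have [ct [dt _ _]] := nbhs_singleton gn; move=> P nP.
have cxi := derivable_curve_continuous dt.
have n1 := cxi _ (param_near ct nP).
have n2 : \forall s \near t, [set s | [/\ dom c (gamma s) & P (param c (chart_map c (gamma s)))]] s.
  apply: (near_mono (filterI gn n1)) => s [[cs _] [_ Hs]]; split; first exact: cs.
  by have /chart_regular[_ /Hs[]] := cs.
by apply: (near_mono n2) => s [cs]; rewrite chart_mapK.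
Qed.

Hypothesis K0 : K <= 0.

Lemma devel_quadric F c x : dom c x -> devel F c x -> F x *m b *m (F x)^T = 1%:M.
Proof.
move=> cx [rho [Th [HTh FE]]]; have rho0 : 0 < rho by case: HTh => -[].
have xx : `|chart_map c x - chart_map c x| < rho by rewrite subrr normr0.
by rewrite FE//; apply: frame_first_row HTh _ xx (chart_regular cx).2.
Qed.

Lemma devel_hyper F c gamma (t : R) : devel F c (gamma t) -> geod_near c gamma t ->
  hyper_at b (F \o gamma) t.
Proof.
move=> [rho [Th [HTh FE]]] gn; have rho0 : 0 < rho by case: HTh => -[].
have [ct [dt _ _]] := nbhs_singleton gn.
have cxi := derivable_curve_continuous dt.
have n1 := cxi _ (ball_near (chart_map c (gamma t)) rho0).
have n2 : \forall s \near t, [/\ dom c (gamma s), `|chart_map c (gamma s) - chart_map c (gamma t)| < rho &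
    geodesic_at (metric c) (fun u => chart_map c (gamma u)) s].
  by apply: (near_mono (filterI gn n1)) => s [[cs gs] sr]; split; [exact: cs|exact: sr|exact: gs].
have n3 : \forall s \near t, [/\ `|chart_map c (gamma s) - chart_map c (gamma t)| < rho,
    model_halfspace (chart_map c (gamma s)) & geodesic_at (metric c) (fun u => chart_map c (gamma u)) s].
  by apply: (near_mono n2) => s [cs sr gs]; split; [exact: sr|exact: (chart_regular cs).2|exact: gs].
have [H _ _] := geodesic_hyper (chart_metric c) K0 HTh n3.
by apply: hyper_at_near H; apply: (near_mono n2) => s [cs sr _] /=; rewrite FE.
Qed.

(** [Gi] is a local inverse of F. Its continuity is asked relative to the quadric, where all values
    of F lie. *)
Lemma devel_chart F c x : dom c x -> interior_pt x -> devel F c x ->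
  exists (e : R) (U : set M) (Gi : 'rV[R]_(1 + m) -> M), [/\ 0 < e, nbhs x U,
    forall z, U z -> [/\ dom c z, interior_pt z & devel F c z],
    forall z z', U z -> U z' -> F z = F z' -> z = z' &
    forall X, X *m b *m X^T = 1%:M -> `|X - F x| < e -> [/\ U (Gi X), F (Gi X) = X &
      forall P : set M, nbhs (Gi X) P -> \forall Y \near X, Y *m b *m Y^T = 1%:M -> P (Gi Y)]].
Proof.
move=> cx xi dF; have [rho [Th [HTh FE]]] := dF; set a := chart_map c x in HTh FE.
have [[rho0 srO sr] HT] := HTh.
have nU0 := filterI (devel_near cx dF) (filter_forall (nbhs_filter x) (fun _ : 'I_1 => devel_near cx dF)).
have [_ Hx] := chart_regular cx; have Ix := chart_map_img cx.
have /nbhs_ballP[r1 /= r10 Hr1] : nbhs a [set y | [/\ img c y, 0 < y ord0 i0,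
   dom c (param c y) & devel F c (param c y)]].
  apply: filterS2 (param_near cx (devel_near cx dF)) (pos_near (interior_pos cx xi)) => y [Iy Hy] y0.
  by have [_ [? ?]] := Hy (pos_halfspace y0); split.
pose rho1 := Num.min rho r1.
have rho10 : 0 < rho1 by rewrite lt_min rho0.
have HTh1 : local_frame (metric c) (regular_set c) K b a rho1 Th.
  by apply: local_frame_le HTh; rewrite // ge_min lexx.
have Hr y : `|y - a| < rho1 -> [/\ img c y, 0 < y ord0 i0, dom c (param c y) & devel F c (param c y)].
  by rewrite lt_min => /andP[_ yr]; apply: Hr1; rewrite normr_ball distrC.
have Hint y : `|y - a| < rho1 -> model_halfspace y by move=> /Hr[_ /pos_halfspace].
have [r [e [C [/andP[r0 rr] e0 C0 inj surj]]]] := frame_chart HTh1 Hint.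
have Fx : F x = usubmx (Th a) by rewrite FE// subrr normr0.
have Fp y : `|y - a| < rho1 -> F (param c y) = usubmx (Th y).
  move=> yr; have [Iy y0 cy _] := Hr _ yr; have Ey := paramK (conj Iy (pos_halfspace y0)).
  by rewrite FE// Ey//; apply: lt_le_trans yr _; rewrite ge_min lexx.
have : {Gi0 : 'rV[R]_(1 + m) -> 'rV[R]_m & forall X : 'rV[R]_(1 + m), X *m b *m X^T = 1%:M ->
   `|X - F x| < e -> `|Gi0 X - a| <= r / 2 /\ usubmx (Th (Gi0 X)) = X}.
  apply: (@choice _ _ (fun (X : 'rV[R]_(1 + m)) y => X *m b *m X^T = 1%:M ->
   `|X - F x| < e -> `|y - a| <= r / 2 /\ usubmx (Th y) = X)) => X.
  have [[Xb Xe]|H] := pselect (X *m b *m X^T = 1%:M /\ `|X - F x| < e).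
    by rewrite Fx in Xe; have [y y1 y2] := surj _ Xb Xe; exists y.
  by exists a => ? ?; case: H.
move=> [Gi0 HGi0].
have r2 : r / 2 < r by rewrite ltr_pdivrMr// ltr_pMr// ltr1n.
have rr1 y : `|y - a| <= r -> `|y - a| < rho1 by move=> yr; exact: le_lt_trans rr.
exists e, [set z | dom c z /\ `|chart_map c z - a| < r], (fun X => param c (Gi0 X)); split => //.
- exact: chart_near cx (ball_near a r0).
- move=> z [cz /ltW/rr1 zr]; have [_ z0 _] := Hr _ zr; rewrite chart_mapK// => dz; split => //.
  exact: positive_interior z0.
- move=> z z' [cz zr] [cz' zr'] E; apply: (chart_map_inj cz cz').
  have := inj _ _ (ltW zr) (ltW zr').
  rewrite -(Fp _ (rr1 _ (ltW zr))) -(Fp _ (rr1 _ (ltW zr'))) !chart_mapK// E subrr normr0 mulr0 normr_le0.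
  by rewrite subr_eq0 => /eqP.
- move=> X Xb Xe; have [Xr XE] := HGi0 _ Xb Xe.
  have Xr1 := rr1 _ (ltW (le_lt_trans Xr r2)); have [Iy y0 cy _] := Hr _ Xr1.
  split; [|by rewrite Fp|move=> P nP].
    by split => //; rewrite paramK//; [exact: le_lt_trans r2|split => //; exact: pos_halfspace].
  have Ey := paramK (conj Iy (pos_halfspace y0)).
  have := param_near cy nP; rewrite Ey => /nbhs_ballP[d /= d0 Hd].
  have n1 : \forall Y \near X, `|Y - F x| < e.
    have := ball_near X (_ : 0 < e - `|X - F x|); rewrite subr_gt0 => /(_ Xe).
    apply: filterS => Y Ye; apply: le_lt_trans (ler_distD X _ _) _.
    by rewrite -ltrBrDr.
  have n2 : \forall Y \near X, `|Y - X| < d / C by apply: ball_near; exact: divr_gt0.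
  apply: filterS2 n1 n2 => Y Ye Yd Yb; have [Yr YE] := HGi0 _ Yb Ye.
  have Yr1 := rr1 _ (ltW (le_lt_trans Yr r2)).
  have := inj _ _ (ltW (le_lt_trans Xr r2)) (ltW (le_lt_trans Yr r2)); rewrite XE YE => I.
  have [|_ HP] := Hd (Gi0 Y).
    rewrite normr_ball distrC; apply: le_lt_trans I _.
    by rewrite mulrC -ltr_pdivlMr.
  exact: (HP (Hint _ Yr1)).2.
Qed.

(** Converse of [devel_hyper]. Continuity of [gamma] keeps it in the chart ball, where
    [lift_geodesic] applies. *)
Lemma hyper_geod F c gamma (t : R) : dom c (gamma t) -> interior_pt (gamma t) -> devel F c (gamma t) ->
  {for t, continuous gamma} -> (\forall s \near t, hyper_at b (F \o gamma) s) -> geod_near c gamma t.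
Proof.
move=> cx xi dF cg nh; have [rho [Th [HTh FE]]] := dF; set a := chart_map c (gamma t) in HTh FE.
have rho0 : 0 < rho by case: HTh => -[].
have /nbhs_ballP[r1 /= r10 Hr1] := pos_near (interior_pos cx xi).
pose rho1 := Num.min rho r1.
have rho10 : 0 < rho1 by rewrite lt_min rho0.
have HTh1 : local_frame (metric c) (regular_set c) K b a rho1 Th.
  by apply: local_frame_le HTh; rewrite // ge_min lexx.
have Hint (y : 'rV[R]_m) : `|y - a| < rho1 -> model_halfspace y.
  by rewrite lt_min => /andP[_ yr]; apply: pos_halfspace; apply: Hr1; rewrite normr_ball distrC.
have [r [e [C [/andP[r0 rr] e0 C0 inj surj]]]] := frame_chart HTh1 Hint.
have n1 := near_cont cg (chart_near cx (ball_near a r0)).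
have n2 : \forall s \near t, [/\ `|chart_map c (gamma s) - a| <= r,
    usubmx (Th (chart_map c (gamma s))) = (F \o gamma) s & hyper_at b (F \o gamma) s].
  apply: (near_mono (filterI n1 nh)) => s [[cs sr] hs]; split; [exact: ltW sr| |exact: hs].
  rewrite /= FE; [reflexivity|exact: cs|].
  by apply: lt_trans sr _; apply: lt_le_trans rr _; rewrite ge_min lexx.
have n3 := lift_geodesic (chart_metric c) HTh1 Hint rr C0 inj n2.
by apply: (near_mono (filterI n1 n3)) => s [[cs _] gs]; split; [exact: cs|exact: gs].
Qed.

End Manifold.

Section GeodesicCharts.
Context {R : realType} {m : nat}.
Hypothesis hm : (0 < m)%N.
Context {M : topologicalType}.
Variables (G : riemannian_manifold R m M) (K : R).
Hypothesis hcurv : constant_sectional_curvature G K.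
Hypothesis K0 : K <= 0.

(** The image in the model does not depend on the chart: a geodesic in one chart is a hyperbola in
    the model, hence a geodesic in the other chart. *)
Lemma geod_change (c d : chart G) (gamma : R -> M) (t : R) : dom c (gamma t) -> dom d (gamma t) ->
  interior_pt G (gamma t) -> geod_near c gamma t -> geod_near d gamma t.
Proof.
move=> cx dx xi gn.
have [] := @devel_exists _ _ _ G K hcurv (frame_form (metric c) K (chart_map c (gamma t))) c (gamma t) 1%:M cx (unitmx1 _ _).
  by rewrite mul1mx trmx1 mulmx1.
move=> F dFT _; have dF : devel K (frame_form (metric c) K (chart_map c (gamma t))) F c (gamma t) by apply: (iffRL (devel_atP _ _ _ _ _)); exists 1%:M; exact: dFT.
have cg := geod_continuous gn.
have n1 := near_cont cg (devel_near cx dF).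
apply: (hyper_geod hm hcurv dx xi (devel_change hm hcurv dx cx xi dF) cg).
apply: (near_mono (filterI n1 (near_near gn))) => s [[cs ds] gs].
by apply: devel_hyper ds gs.
Qed.

End GeodesicCharts.

(** * The exponential map of the model *)

Section ModelExp.
Context {R : realType} {m : nat}.
Variables (g0 : 'M[R]_m) (K : R).
Hypothesis K0 : K <= 0.
Hypothesis g0p : forall u : 'rV[R]_m, u != 0 -> 0 < (u *m g0 *m u^T) ord0 ord0.
Implicit Types (w u : 'rV[R]_m) (X : 'rV[R]_(1 + m)) (t : R).

(** sqrt (- K) times the length for [g0]: the parameter th of the hyperbola with initial velocity
    w. *)
Definition speed w : R := Num.sqrt (- K * (w *m g0 *m w^T) ord0 ord0).

Definition model_form : 'M[R]_(1 + m) := block_mx 1%:M 0 0 (K *: g0).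

(** The exponential map of the quadric at the point (1, 0). *)
Definition model_exp w : 'rV[R]_(1 + m) := row_mx (coshk (speed w) 1)%:M (sinhk (speed w) 1 *: w).

(** Since cosh th + sinh th = e^th, the logarithm recovers th from the first coordinate and the
    length of the rest; the rest is then divided by sinh th / th. *)
Definition model_log X : 'rV[R]_m :=
  (sinhk (ln (lsubmx X ord0 ord0 + speed (rsubmx X))) 1)^-1 *: rsubmx X.

Lemma g0_ge0 w : 0 <= (w *m g0 *m w^T) ord0 ord0.
Proof.
have [->|/g0p/ltW//] := eqVneq w 0; by rewrite mul0mx mul0mx mxE.
Qed.

Lemma speed_sqr w : speed w ^+ 2 = - K * (w *m g0 *m w^T) ord0 ord0.
Proof. by rewrite sqr_sqrtr// mulr_ge0 ?oppr_ge0// g0_ge0. Qed.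

Lemma speed_ge0 w : 0 <= speed w.
Proof. exact: sqrtr_ge0. Qed.

Lemma speedZ t w : speed (t *: w) = `|t| * speed w.
Proof.
rewrite /speed trmxZ -!scalemxAl -scalemxAr scalerA scalemx_entry mulrCA.
by rewrite sqrtrM ?sqr_ge0// -expr2 sqrtr_sqr.
Qed.

Lemma coshk_abs th t : coshk `|th| t = coshk th t.
Proof.
have [_|_] := ger0P th => //; rewrite -mulN1r coshkM mulN1r coshkN; reflexivity.
Qed.

Lemma sinhk_abs th t : sinhk `|th| t = sinhk th t.
Proof.
have [_|_] := ger0P th => //; apply: oppr_inj; rewrite -mulN1r -[in LHS](mulN1r th) sinhkM mulN1r sinhkN; reflexivity.
Qed.

Lemma model_exp_ray t w : model_exp (t *: w) = row_mx (coshk (speed w) t)%:M (sinhk (speed w) t *: w).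
Proof.
have E : `|t| * speed w = `|t * speed w| by rewrite normrM (ger0_norm (speed_ge0 w)).
rewrite /model_exp speedZ E coshk_abs sinhk_abs coshkM mulr1 scalerA; congr row_mx.
by rewrite mulrC sinhkM mulr1.
Qed.

Lemma model_exp_quadric w : model_exp w *m model_form *m (model_exp w)^T = 1%:M.
Proof.
rewrite quadric_row; apply/matrixP => i j; rewrite !(ord1 i, ord1 j) addmxE.
rewrite trmxZ -!scalemxAl -!scalemxAr -!scalemxAl tr_scalar_mx -scalar_mxM.
have -> : (1%:M : 'M[R]_1) 0 0 = 1 by rewrite mxE.
rewrite [X in X + _]mxE !scalemx_entry eqxx mulr1n.
have := coshk_sinhk (speed w) 1; rewrite speed_sqr.
have -> : (0 : 'I_1) = ord0 by exact: val_inj.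
move: ((w *m g0 *m w^T) ord0 ord0) (coshk _ _) (sinhk _ _) => q c s; clear; lra.
Qed.

Lemma model_exp_derive w s : is_derive s (1 : R) (fun s => model_exp (s *: w))
  (row_mx (speed w ^+ 2 * sinhk (speed w) s)%:M (coshk (speed w) s *: w)).
Proof.
have -> : (fun s => model_exp (s *: w)) = (fun s => row_mx (coshk (speed w) s)%:M (sinhk (speed w) s *: w)).
  by apply/funext => u; exact: model_exp_ray.
apply/is_derive_mxP => i j; case: (split_ordP j) => k ->.
  under [fun s => row_mx _ _ i _]eq_fun do rewrite row_mxEl (ord1 i) (ord1 k) mxE mulr1n.
  by rewrite row_mxEl (ord1 i) (ord1 k) mxE mulr1n; exact: coshk_derive.
under [fun s => row_mx _ _ i _]eq_fun do rewrite row_mxEr mxE.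
rewrite row_mxEr mxE.
have := is_deriveM (sinhk_derive (speed w) s) (is_derive_cst (w i k) s (1 : R)).
by move=> /is_derive_eq; apply; rewrite scaler0 add0r /GRing.scale/= mulrC.
Qed.

Lemma model_exp_hyper w t : hyper_at model_form (fun s => model_exp (s *: w)) t.
Proof.
pose D s : 'rV[R]_(1 + m) := row_mx (speed w ^+ 2 * sinhk (speed w) s)%:M (coshk (speed w) s *: w).
have dE (s : R) : is_derive s (1 : R) (fun s => model_exp (s *: w)) (D s) by exact: model_exp_derive.
have E' : derive1 (fun s => model_exp (s *: w)) = D.
  by apply/funext => s; rewrite derive1E; have [] := dE s.
have dD (s : R) : is_derive s (1 : R) D (speed w ^+ 2 *: model_exp (s *: w)).
  rewrite model_exp_ray scale_row_mx; apply/is_derive_mxP => i j; case: (split_ordP j) => k ->.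
    rewrite (_ : (fun s => D s i _) = (fun s => speed w ^+ 2 * sinhk (speed w) s)); last first.
      by apply/funext => u; rewrite /D row_mxEl (ord1 i) (ord1 k) mxE mulr1n.
    rewrite row_mxEl mxE (ord1 i) (ord1 k) mxE mulr1n.
    have := is_deriveZ (speed w ^+ 2) (sinhk_derive (speed w) s).
    by move=> /is_derive_eq; apply.
  rewrite (_ : (fun s => D s i _) = (fun s => coshk (speed w) s * w i k)); last first.
    by apply/funext => u; rewrite /D row_mxEr mxE.
  rewrite row_mxEr mxE mxE.
  have := is_deriveM (coshk_derive (speed w) s) (is_derive_cst (w i k) s (1 : R)).
  by move=> /is_derive_eq; apply; rewrite scaler0 add0r /GRing.scale/= mulrCA [w i k * _]mulrC mulrCA.
exists (speed w ^+ 2); first exact: sqr_ge0.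
split; rewrite ?E'.
- by have [] := dE t.
- exact: dD.
- exact: model_exp_quadric.
- rewrite quadric_row; apply/matrixP => i j; rewrite !(ord1 i, ord1 j) addmxE.
  rewrite trmxZ -!scalemxAl -!scalemxAr -!scalemxAl tr_scalar_mx -scalar_mxM.
  rewrite [RHS]mxE [X in X + _]mxE !scalemx_entry eqxx !mulr1n.
  have := coshk_sinhk (speed w) t.
  have -> : coshk (speed w) t * (coshk (speed w) t * (K * (w *m g0 *m w^T) 0 0)) =
     - (coshk (speed w) t ^+ 2 * speed w ^+ 2).
    rewrite speed_sqr; have -> : (0 : 'I_1) = ord0 by exact: val_inj.
    by ring.
  move: (speed w) (coshk _ _) (sinhk _ _) => th c s; clear => H.
  have -> : c ^+ 2 = 1 + th ^+ 2 * s ^+ 2 by lra.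
  ring.
Qed.

Lemma speed_continuous : continuous speed.
Proof.
move=> w; have c1 : {for w, continuous (fun w : 'rV[R]_m => - K * (w *m g0 *m w^T) ord0 ord0)}.
  by apply: contM; [exact: cont_cst|exact: cont_quadratic].
exact: (cont_comp c1 (@sqrt_continuous R _)).
Qed.

Lemma coshk1_continuous : continuous (fun th : R => coshk th 1).
Proof.
move=> th; rewrite (_ : (fun th => _) = coshk 1); last first.
  by apply/funext => s; rewrite -[in LHS](mulr1 s) coshkM mulr1.
by apply: derivable_curve_continuous; have [] := coshk_derive 1 th.
Qed.

Lemma sinhk1_continuous : continuous (fun th : R => sinhk th 1).
Proof.
have E s : s * sinhk s 1 = sinhk 1 s by have := sinhkM s 1 1; rewrite !mulr1.
move=> th; have [->|th0] := eqVneq th 0; last first.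
  have n1 : \forall s \near th, s^-1 * sinhk 1 s = sinhk s 1.
    have n0 : \forall s \near th, s != 0 by apply: open_nbhs_nbhs; split => //; exact: open_neq.
    by apply: (near_mono n0) => s s0; rewrite -E mulKf.
  have c1 : {for th, continuous (fun s : R => s^-1 * sinhk 1 s)}.
    apply: cvgM; first exact: cvgV.
    by apply: derivable_curve_continuous; have [] := sinhk_derive 1 th.
  rewrite /continuous_at -(nbhs_singleton n1).
  by apply: cvg_trans c1; exact: near_eq_cvg.
(* At th = 0 the function is defined by cases. Since it is sinh th / th elsewhere, its continuity at
   0 is the derivative of sinh there. *)
have [d1 d2] := sinhk_derive 1 (0 : R).
have H : (h^-1 *: ((sinhk 1 \o shift 0) (h *: (1 : R)) - sinhk 1 0)) @[h --> 0^'] --> 'D_1 (sinhk 1) 0 := d1.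
rewrite d2 coshk0 sinhk0 in H.
have S0 : sinhk 0 1 = 1 :> R by rewrite sinhk_id.
apply/continuous_withinNx; rewrite S0; apply: cvg_trans H; apply: near_eq_cvg.
have n0 : \forall h \near (0 : R)^', h != 0 by exact: nbhs_dnbhs_neq.
apply: filterS n0 => h h0; rewrite subr0 /= addr0 [h *: 1]mulr1 -E.
by rewrite /GRing.scale/= mulKf.
Qed.

Lemma model_exp_continuous : continuous model_exp.
Proof.
move=> w; apply: mxcurve_continuous => i j; rewrite (ord1 i); case: (split_ordP j) => k ->.
  rewrite (_ : (fun s => _) = (fun s => coshk (speed s) 1)); last first.
    by apply/funext => s; rewrite /model_exp row_mxEl (ord1 k) mxE mulr1n.
  exact: (cont_comp (@speed_continuous w) (@coshk1_continuous _)).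
rewrite (_ : (fun s => _) = (fun s => sinhk (speed s) 1 * s ord0 k)); last first.
  by apply/funext => s; rewrite /model_exp row_mxEr mxE.
apply: contM; last exact: cont_coord.
exact: (cont_comp (@speed_continuous w) (@sinhk1_continuous _)).
Qed.

Lemma sinhk1_gt0 th : 0 < sinhk th 1 :> R.
Proof. exact: sinhk_gt0. Qed.

Lemma sinhk_mul1 th : th * sinhk th 1 = (expR th - expR (- th)) / 2 :> R.
Proof.
rewrite /sinhk; have [->|th0] := eqVneq th 0; first by rewrite mul0r oppr0 expR0 subrr mul0r.
by rewrite mulr1; field.
Qed.

Lemma model_expK w : model_log (model_exp w) = w.
Proof.
rewrite /model_log /model_exp row_mxKl row_mxKr mxE mulr1n speedZ (gtr0_norm (sinhk1_gt0 _)).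
rewrite [sinhk _ _ * speed w]mulrC sinhk_mul1 {1}/coshk !mulr1.
have -> : (expR (speed w) + expR (- speed w)) / 2 + (expR (speed w) - expR (- speed w)) / 2 = expR (speed w).
  by field.
by rewrite expRK scalerA mulVf ?scale1r// gt_eqF// sinhk1_gt0.
Qed.

Lemma model_logK X : X *m model_form *m X^T = 1%:M -> 0 < lsubmx X ord0 ord0 ->
  model_exp (model_log X) = X.
Proof.
rewrite -(hsubmxK X) row_mxKl quadric_row => /matrixP/(_ ord0 ord0).
set u := rsubmx X; set x := lsubmx X; rewrite addmxE -scalemxAr -scalemxAl scalemx_entry.
rewrite mxE big_ord1 [x^T _ _]mxE [RHS]mxE eqxx mulr1n => E x0.
have E2 : x ord0 ord0 ^+ 2 - speed u ^+ 2 = 1.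
  by rewrite speed_sqr -[RHS]E expr2; congr (x _ _ * x _ _ + _); rewrite ?mulNr ?opprK//; exact: val_inj.
move: E2; set a := x ord0 ord0 in x0 *; set s := speed u => E2; have s0 : 0 <= s := speed_ge0 u.
have as0 : 0 < a + s by rewrite ltr_wpDr.
rewrite /model_log row_mxKl row_mxKr -/u -/s -/a; set th := ln (a + s).
have e1 : expR th = a + s by rewrite lnK.
have e2 : expR (- th) = a - s.
  rewrite expRN e1; apply: (mulfI (lt0r_neq0 as0)); rewrite mulfV ?lt0r_neq0// -E2; ring.
have S0 := sinhk1_gt0 th.
have ths : th * sinhk th 1 = s by rewrite sinhk_mul1 e1 e2; field.
have sp : speed ((sinhk th 1)^-1 *: u) = th.
  rewrite speedZ -/s -ths normfV (gtr0_norm S0) mulrCA mulVf ?mulr1// gt_eqF//.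
rewrite /model_exp sp scalerA mulfV ?scale1r ?gt_eqF//; congr row_mx.
have -> : coshk th 1 = a by rewrite /coshk !mulr1 e1 e2; field.
by apply/matrixP => i j; rewrite !(ord1 i, ord1 j) mxE mulr1n; congr (x _ _); exact: val_inj.
Qed.

Lemma model_log_continuous X : 0 < lsubmx X ord0 ord0 -> {for X, continuous model_log}.
Proof.
move=> X0; have c0 : {for X, continuous (fun X : 'rV[R]_(1 + m) => lsubmx X ord0 ord0)}.
  rewrite (_ : (fun X => _) = (fun X : 'rV[R]_(1 + m) => X ord0 (lshift m ord0))).
    exact: coord_continuous.
  by apply/funext => Y; rewrite mxE.
have c1 : {for X, continuous (fun X : 'rV[R]_(1 + m) => rsubmx X : 'rV[R]_m)}.
  apply: mxcurve_continuous => i j; rewrite (ord1 i).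
  rewrite (_ : (fun X => _) = (fun X : 'rV[R]_(1 + m) => X ord0 (rshift 1 j))).
    exact: coord_continuous.
  by apply/funext => Y; rewrite mxE.
have c2 : {for X, continuous (fun X : 'rV[R]_(1 + m) => lsubmx X ord0 ord0 + speed (rsubmx X))}.
  by apply: contD; [exact: c0|exact: (cont_comp c1 (@speed_continuous _))].
have X1 : 0 < lsubmx X ord0 ord0 + speed (rsubmx X) by rewrite ltr_wpDr// speed_ge0.
have c3 := cont_comp c2 (continuous_ln X1).
have c4 := cont_comp c3 (@sinhk1_continuous _).
apply: mxcurve_continuous => i j.
rewrite (_ : (fun X => _) = (fun X : 'rV[R]_(1 + m) =>
  (sinhk (ln (lsubmx X ord0 ord0 + speed (rsubmx X))) 1)^-1 * rsubmx X i j)); last first.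
  by apply/funext => Y; rewrite /model_log mxE.
apply: contM; first by apply: cont_inv; [rewrite gt_eqF// sinhk1_gt0|exact: c4].
rewrite (_ : (fun x => _) = (fun X : 'rV[R]_(1 + m) => X i (rshift 1 j))); first exact: cont_coord.
by apply/funext => Y; rewrite mxE.
Qed.

End ModelExp.

(** * Geodesic arcs *)

Section Affine.
Context {R : realType}.
Implicit Types (t s : R).

Lemma near_right t (P : R -> Prop) : (\forall s \near t, P s) -> \forall s \near t^'+, P s.
Proof. by move=> nP; apply: filterS nP. Qed.

Lemma near_all t (P : R -> Prop) : (forall s, P s) -> \forall s \near t, P s.
Proof. by move=> H; apply/nbhs_ballP; exists 1 => //= s _; exact: H. Qed.

Lemma derive1n2 (V : normedModType R) (f : R -> V) : derive1n 2 f = derive1 (derive1 f).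
Proof. by rewrite derive1nS derive1n1. Qed.

Lemma near_affine (a e : R) t (P : R -> Prop) : (\forall u \near (a * t + e), P u) ->
  \forall s \near t, P (a * s + e).
Proof.
move=> nP; have c1 : {for t, continuous (fun s : R => a * s + e)}.
  by apply: contD; [apply: contM; [exact: cont_cst|exact: cvg_id]|exact: cont_cst].
exact: near_cont c1 nP.
Qed.

Lemma is_derive_affine p' q' (X : R -> 'M[R]_(p', q')) (a e : R) t : derivable X (a * t + e) 1 ->
  is_derive t 1 (fun s => X (a * s + e)) (a *: derive1 X (a * t + e)).
Proof.
move=> /derivable_is_derive1/is_derive_mxP dX; apply/is_derive_mxP => i j.
have d : is_derive t 1 (fun s : R => a * s + e) a.
  have := is_deriveD (is_deriveZ a (is_derive_id t (1 : R))) (is_derive_cst e t (1 : R)).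
  by move=> /is_derive_eq; apply; rewrite addr0 /GRing.scale/= mulr1.
have := @is_derive1_comp _ (fun u => X u i j) (fun s : R => a * s + e) t _ _ (dX i j) d.
by move=> /is_derive_eq; apply; rewrite scalemx_entry mulrC.
Qed.

Lemma geodesic_affine (m : nat) (xi : R -> 'rV[R]_m) (a e : R) t :
  (\forall u \near (a * t + e), derivable xi u 1 /\ derivable (derive1 xi) u 1) ->
  [/\ derivable (fun s => xi (a * s + e)) t 1, derivable (derive1 (fun s => xi (a * s + e))) t 1,
   derive1 (fun s => xi (a * s + e)) t = a *: derive1 xi (a * t + e) &
   derive1n 2 (fun s => xi (a * s + e)) t = a ^+ 2 *: derive1n 2 xi (a * t + e)].
Proof.
move=> H; have [d1 d2] := nbhs_singleton H.
have [D1 D1E] := is_derive_affine d1.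
have E : \forall s \near t, a *: derive1 xi (a * s + e) = derive1 (fun s => xi (a * s + e)) s.
  apply: (near_mono (near_affine H)) => s [ds _].
  by have [_ <-] := is_derive_affine ds; rewrite derive1E.
have d2' := is_derive_scalemx (is_derive_cst a t (1 : R)) (is_derive_affine d2).
have [D2 D2E] := is_derive_near E d2'.
split; [exact: D1|exact: D2|by rewrite derive1E|].
rewrite !derive1n2 [LHS]derive1E D2E scale0r add0r.
by rewrite scalerA expr2.
Qed.

End Affine.

Section Arcs.
Context {R : realType} {m : nat}.
Hypothesis hm : (0 < m)%N.
Context {M : topologicalType}.
Variables (G : riemannian_manifold R m M).
Implicit Types (c d : chart G) (x z p q : M) (y : 'rV[R]_m) (gamma : R -> M) (t s : R).

Lemma geodesic_at_near (g : 'rV[R]_m -> 'M[R]_m) (xi xi' : R -> 'rV[R]_m) t :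
  (\forall s \near t, xi s = xi' s) -> geodesic_at g xi t -> geodesic_at g xi' t.
Proof.
move=> E [d1 d2 gx]; have E' := derive1_near E.
have E2 : derive1n 2 xi t = derive1n 2 xi' t.
  by rewrite !derive1n2; exact: (nbhs_singleton (derive1_near E')).
split; [exact: near_eq_derivable E d1|exact: near_eq_derivable E' d2|move=> k].
by rewrite -E2 -(nbhs_singleton E) -(nbhs_singleton E').
Qed.

(** The local clause of [geodesic_arc] with the curve [xi] exposed: at the end points of an arc,
    derivatives and the initial velocity are those of [xi]. *)
Definition arc_lift c gamma t (xi : R -> 'rV[R]_m) : Prop := \forall s \near t,
  [/\ derivable xi s 1, derivable (derive1 xi) s 1 &
    0 <= s <= 1 -> [/\ dom c (gamma s), chart_map c (gamma s) = xi s &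
      forall k, (derive1n 2 xi s) ord0 k + \sum_i \sum_j christoffel (metric c) k i j (xi s) *
              (derive1 xi s) ord0 i * (derive1 xi s) ord0 j = 0]].

Definition arc_at c gamma t : Prop := exists xi, arc_lift c gamma t xi.

Lemma near_itv t : 0 < t < 1 -> \forall s \near t, 0 < s < 1.
Proof. by move=> tt; exact: (@near_in_itvoo _ 0 1 t tt). Qed.

Lemma arc_geod c gamma t : 0 < t < 1 -> arc_at c gamma t -> geod_near c gamma t.
Proof.
move=> tt [xi H]; have H1 : \forall s \near t, 0 < s < 1 /\ [/\ derivable xi s 1, derivable (derive1 xi) s 1 &
    0 <= s <= 1 -> [/\ dom c (gamma s), chart_map c (gamma s) = xi s &
      forall k, (derive1n 2 xi s) ord0 k + \sum_i \sum_j christoffel (metric c) k i j (xi s) *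
              (derive1 xi s) ord0 i * (derive1 xi s) ord0 j = 0]] by exact: filterI (near_itv tt) H.
apply: (near_mono (near_near H1)) => s Hs.
have [/andP[s0 s1] [d1 d2 H2]] := nbhs_singleton Hs.
have [cs sE gs] : [/\ dom c (gamma s), chart_map c (gamma s) = xi s & forall k, (derive1n 2 xi s) ord0 k + \sum_i \sum_j christoffel (metric c) k i j (xi s) *
              (derive1 xi s) ord0 i * (derive1 xi s) ord0 j = 0] by apply: H2; rewrite !ltW.
split; first exact: cs.
have E : \forall u \near s, xi u = chart_map c (gamma u).
  apply: (near_mono Hs) => u [/andP[u0 u1] [_ _ Hu]].
  by have [|_ ->] := Hu; rewrite // !ltW.
by apply: geodesic_at_near E _; split; [exact: d1|exact: d2|exact: gs].
Qed.

Lemma geod_arc c gamma t : geod_near c gamma t -> arc_at c gamma t.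
Proof.
move=> H; exists (fun s => chart_map c (gamma s)).
by apply: (near_mono H) => s [cs [d1 d2 gs]]; split; [exact: d1|exact: d2|move=> _; split; [exact: cs|reflexivity|exact: gs]].
Qed.

Lemma arc_near_eq c gamma gamma' t : (\forall s \near t, 0 <= s <= 1 -> gamma s = gamma' s) ->
  arc_at c gamma t -> arc_at c gamma' t.
Proof.
move=> E [xi H]; exists xi; apply: (near_mono (filterI E H)) => s [Es [d1 d2 Hs]].
split; [exact: d1|exact: d2|move=> s01].
by rewrite -Es//; exact: Hs.
Qed.

Lemma arc_cont c gamma t (P : set M) : 0 <= t <= 1 -> arc_at c gamma t -> nbhs (gamma t) P ->
  \forall s \near t, 0 <= s <= 1 -> P (gamma s).
Proof.
move=> t01 [xi H] nP; have [d1 _ Ht] := nbhs_singleton H; have [ct tE _] := Ht t01.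
have n1 := param_near ct nP; rewrite tE in n1.
have n2 := near_cont (derivable_curve_continuous d1) n1.
apply: (near_mono (filterI n2 H)) => s [[_ Ps] [_ _ Hs]] s01; have [cs sE _] := Hs s01.
have [] := Ps; first by rewrite -sE; exact: (chart_regular cs).2.
by rewrite -sE chart_mapK.
Qed.

Lemma arc_lift_affine c gamma (a e : R) t xi : (\forall s \near t, 0 <= s <= 1 -> 0 <= a * s + e <= 1) ->
  arc_lift c gamma (a * t + e) xi ->
  arc_lift c (fun s => gamma (a * s + e)) t (fun s => xi (a * s + e)).
Proof.
move=> nae H; apply: (near_mono (filterI nae (near_affine (near_near H)))) => s [ae Hs].
have Hs' : \forall u \near (a * s + e), derivable xi u 1 /\ derivable (derive1 xi) u 1.
  by apply: (near_mono Hs) => u [d1 d2 _]; split; [exact: d1|exact: d2].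
have [d1 d2 E1 E2] := geodesic_affine Hs'.
split; [exact: d1|exact: d2|move=> s01].
have [_ _ Hu] := nbhs_singleton Hs; have [cu uE gu] := Hu (ae s01).
split; [exact: cu|exact: uE|move=> k].
rewrite E1 E2 scalemx_entry.
transitivity (a ^+ 2 * ((derive1n 2 xi (a * s + e)) ord0 k + \sum_i \sum_j christoffel (metric c) k i j (xi (a * s + e)) *
              (derive1 xi (a * s + e)) ord0 i * (derive1 xi (a * s + e)) ord0 j)).
  rewrite mulrDr; congr (_ + _); rewrite mulr_sumr; apply: eq_bigr => i _.
  rewrite mulr_sumr; apply: eq_bigr => j _; rewrite !scalemx_entry.
  move: (christoffel _ _ _ _ _) (derive1 xi _ _ i) (derive1 xi _ _ j) => C u v; ring.
by rewrite gu mulr0.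
Qed.

Lemma arc_affine gamma p q (a e : R) : (forall s, 0 <= s <= 1 -> 0 <= a * s + e <= 1) ->
  geodesic_arc G gamma p q ->
  geodesic_arc G (fun s => gamma (a * s + e)) (gamma e) (gamma (a + e)).
Proof.
move=> ae [_ _ H]; split; rewrite ?mulr0 ?mulr1 ?add0r//.
move=> c t t01 ct; have [xi Hxi] := H c _ (ae _ t01) ct.
exists (fun s => xi (a * s + e)); apply: arc_lift_affine Hxi.
by apply: near_all => s; exact: ae.
Qed.

Lemma lift_velocity gamma xi : arc_lift (chart_at G (gamma 0)) gamma 0 xi ->
  initial_velocity G gamma (derive1 xi 0).
Proof.
move=> H; have [d1 _ H0] := nbhs_singleton H.
have H01 : 0 <= (0 : R) <= 1 by rewrite lexx ler01.
have [_ E0 _] := H0 H01.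
have D : (h^-1 *: ((xi \o shift 0) (h *: (1 : R)) - xi 0)) @[h --> 0^'] --> 'D_1 xi 0 := d1.
have D2 := cvg_dnbhs_at_right D.
rewrite /initial_velocity derive1E; apply: cvg_trans D2; apply: near_eq_cvg.
near=> h.
have h0 : 0 < h by near: h; exact: nbhs_right_gt.
have h1 : h < 1 by near: h; exact: nbhs_right_lt.
have [_ _ Hh] : [/\ derivable xi h 1, derivable (derive1 xi) h 1 &
    0 <= h <= 1 -> [/\ dom (chart_at G (gamma 0)) (gamma h), chart_map (chart_at G (gamma 0)) (gamma h) = xi h &
      forall k, (derive1n 2 xi h) ord0 k + \sum_i \sum_j christoffel (metric (chart_at G (gamma 0))) k i j (xi h) *
              (derive1 xi h) ord0 i * (derive1 xi h) ord0 j = 0]].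
  by near: h; exact: (near_right H).
have [|_ -> _] := Hh; first by rewrite !ltW.
by rewrite E0 /= addr0 [h *: 1]mulr1.
Unshelve. all: by end_near. Qed.

Lemma velocity_unique gamma gamma' w w' : (forall t, 0 <= t <= 1 -> gamma t = gamma' t) ->
  initial_velocity G gamma w -> initial_velocity G gamma' w' -> w = w'.
Proof.
move=> E; have E0 : gamma 0 = gamma' 0 by apply: E; rewrite lexx ler01.
rewrite /initial_velocity -E0 => Hw Hw'.
have H2 : t^-1 *: (chart_map (chart_at G (gamma 0)) (gamma t) -
    chart_map (chart_at G (gamma 0)) (gamma 0)) @[t --> 0^'+] --> w'.
  apply: cvg_trans Hw'; apply: near_eq_cvg; near=> h.
  have h0 : 0 < h by near: h; exact: nbhs_right_gt.
  have h1 : h < 1 by near: h; exact: nbhs_right_lt.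
  by have -> : gamma h = gamma' h by apply: E; rewrite !ltW.
exact: (cvg_unique _ Hw H2).
Unshelve. all: by end_near. Qed.

Lemma arc_lift_exists gamma p q c t : geodesic_arc G gamma p q -> 0 <= t <= 1 ->
  dom c (gamma t) -> exists xi, arc_lift c gamma t xi.
Proof. by move=> [_ _ H] t01 ct; exact: H. Qed.

Lemma arc_velocity gamma p q : geodesic_arc G gamma p q -> exists xi w,
  [/\ arc_lift (chart_at G p) gamma 0 xi, derive1 xi 0 = w & initial_velocity G gamma w].
Proof.
move=> H; have [g0 _ _] := H; have H01 : 0 <= (0 : R) <= 1 by rewrite lexx ler01.
have [|xi Hxi] := arc_lift_exists H H01 (c := chart_at G p); first by rewrite g0; exact: chart_atP.
exists xi, (derive1 xi 0); split => //.
by apply: lift_velocity; rewrite g0.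
Qed.

Hypothesis hconvex : convex_manifold G.

Lemma arc_interior gamma p q t : p <> q -> geodesic_arc G gamma p q -> 0 < t < 1 ->
  interior_pt G (gamma t).
Proof. by move=> pq Hg tt; have [_ _ H] := hconvex pq; exact: (H _ Hg). Qed.

Lemma arc_unique gamma gamma' p q : p <> q -> geodesic_arc G gamma p q -> geodesic_arc G gamma' p q ->
  forall t, 0 <= t <= 1 -> gamma t = gamma' t.
Proof. by move=> pq; have [_ H _] := hconvex pq; exact: H. Qed.

Lemma itv_affine (a e : R) : 0 <= e <= 1 -> 0 <= a + e <= 1 -> forall s, 0 <= s <= 1 -> 0 <= a * s + e <= 1.
Proof. move=> /andP[e0 e1] /andP[a0 a1] s /andP[s0 s1]; apply/andP; split; nra. Qed.

(* If gamma came back to p at time t, uniqueness would give gamma (f s) = gamma s for the affine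
   map f sending [0, 1] to [t, 1]; iterating f, gamma would be p at times tending to 1. *)
Lemma arc_no_return gamma p q t : p <> q -> geodesic_arc G gamma p q -> 0 < t <= 1 -> gamma t <> p.
Proof.
move=> pq H /andP[t0]; have [g0 g1 Hat] := H.
rewrite le_eqVlt => /orP[/eqP ->|t1 E]; first by rewrite g1 => /esym.
have tae : forall s, 0 <= s <= 1 -> 0 <= (1 - t) * s + t <= 1.
  by apply: itv_affine; rewrite ?subrK ?ler01 ?lexx// !ltW.
have := arc_affine tae H; rewrite E subrK g1 => H'.
have U := arc_unique pq H' H.
have u0 : 0 <= 1 - t by rewrite subr_ge0 ltW.
have u1 : 1 - t <= 1 by rewrite gerBl ltW.
have Hn n : gamma (1 - (1 - t) ^+ n) = p.
  elim: n => [|n IH]; first by rewrite expr0 subrr.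
  have r0 : 0 <= (1 - t) ^+ n by exact: exprn_ge0.
  have r1 : (1 - t) ^+ n <= 1 by exact: exprn_ile1.
  rewrite -IH -(U (1 - (1 - t) ^+ n)); last by rewrite subr_ge0 r1/= gerBl.
  by congr gamma; rewrite exprS; ring.
have H11 : 0 <= (1 : R) <= 1 by rewrite lexx ler01.
have [xi Hxi] := Hat (chart_at G q) 1 H11 (ltac:(by rewrite g1; exact: chart_atP)).
have nP : nbhs (gamma 1) (~` [set p]).
  apply: open_nbhs_nbhs; split; last by rewrite g1 => /esym.
  apply: closed_openC; apply: accessible_closed_set1; apply: hausdorff_accessible.
  exact: (atlas_hausdorff G).
have /nbhs_ballP[r /= r0 Hr] := arc_cont H11 (ex_intro _ xi Hxi) nP.
have [n nr] : exists n, (1 - t) ^+ n < r.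
  have /cvgrPdist_lt/(_ _ r0) : (fun n => (1 - t) ^+ n) @ \oo --> (0 : R).
    by apply: cvg_expr; rewrite ger0_norm ?subr_ge0 ?ltW// gtrBl.
  move=> [N _ /(_ N)]; rewrite /= => /(_ (leqnn N)); rewrite sub0r normrN => Hn'.
  by exists N; apply: le_lt_trans Hn'; exact: ler_norm.
have q0 : 0 <= (1 - t) ^+ n by exact: exprn_ge0.
have q1 : (1 - t) ^+ n <= 1 by exact: exprn_ile1.
apply: (Hr (1 - (1 - t) ^+ n)) (Hn n).
- by rewrite -ball_normE/= opprB addrC subrK ger0_norm.
- by rewrite subr_ge0 q1/= gerBl.
Qed.

End Arcs.

Section OneSidedLimit.
Context {R : realType}.

Lemma near_eq_lim (V : normedModType R) (E1 E2 : R -> V) (t0 t1 : R) (l1 l2 : V) : t0 < t1 ->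
  (forall t, t0 < t < t1 -> E1 t = E2 t) ->
  (forall e : R, 0 < e -> \forall s \near t1, s < t1 -> `|E1 s - l1| < e) ->
  (forall e : R, 0 < e -> \forall s \near t1, s < t1 -> `|E2 s - l2| < e) -> l1 = l2.
Proof.
move=> t01 EE H1 H2; apply/eqP; rewrite -subr_eq0 -normr_le0; apply/ler_addgt0Pl => e e0; rewrite addr0.
have e2 : 0 < e / 2 by rewrite divr_gt0.
have /nbhs_ballP[r /= r0 Hr] : nbhs t1 [set s | (s < t1 -> `|E1 s - l1| < e / 2) /\ (s < t1 -> `|E2 s - l2| < e / 2)].
  exact: filterI (H1 _ e2) (H2 _ e2).
pose s := Num.max ((t0 + t1) / 2) (t1 - r / 2).
have s1 : s < t1.
  by rewrite gt_max; apply/andP; split; [move: t01|move: r0]; clear; lra.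
have s0 : t0 < s by rewrite lt_max; apply/orP; left; move: t01; clear; lra.
have sr : ball t1 r s.
  have H : t1 - r / 2 <= s by rewrite le_max lexx orbT.
  rewrite -ball_normE/= ger0_norm ?subr_ge0 ?(ltW s1)//; move: r0 H; clear; move: s => s; lra.
have [/(_ s1) b1 /(_ s1) b2] := Hr s sr.
have -> : l1 - l2 = (E2 s - l2) - (E1 s - l1) by rewrite EE ?s0// opprB [RHS]addrC addrA subrK.
apply: ltW; apply: le_lt_trans (ler_normB _ _) _; rewrite [ltRHS](_ : e = e / 2 + e / 2); last by field.
exact: ltrD.
Qed.

End OneSidedLimit.

(** * Uniqueness and gluing of frames *)

Section FrameGluing.
Context {R : realType} {m : nat}.
Variables (g : 'rV[R]_m -> 'M[R]_m) (O : set 'rV[R]_m) (K : R).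
Hypothesis h : cc_metric g O K.
Implicit Types (a y : 'rV[R]_m).

Lemma local_frame_shift b a rho Th y : local_frame g O K b a rho Th -> `|y - a| < rho ->
  local_frame g O K b y (rho - `|y - a|) Th.
Proof.
move=> [[rho0 srO sr] HT] yr.
have tri (z : 'rV[R]_m) : `|z - a| <= `|z - y| + `|y - a| by exact: ler_distD.
have r0 : 0 < rho - `|y - a| by rewrite subr_gt0.
split; first split => // [z zr|w z wr zr].
- by apply: srO; apply: le_trans (tri z) _; rewrite -lerBrDr.
- apply: sr; last by apply: le_trans (tri z) _; rewrite -lerBrDr.
  by apply: le_trans wr _; rewrite ler_pM2l// gerBl.
- by move=> z zr; apply: HT; apply: le_lt_trans (tri z) _; rewrite -ltrBrDr.
Qed.

(** Parallel frames differ by a right factor C = Th(y)^-1 Xi(y), constant by [parallel_unique]. C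
    also carries one form to the other, so Th C has the range of the first frame and the form of the
    second. *)
Lemma local_frame_glue b b1 a rho rho1 (Th Xi : 'rV[R]_m -> 'M[R]_(1 + m)) y :
  local_frame g O K b1 a rho Th -> local_frame g O K b y rho1 Xi ->
  `|y - a| < rho -> model_halfspace y ->
  exists C : 'M[R]_(1 + m), local_frame g O K b a rho (fun z => Th z *m C) /\
    \forall z \near y, model_halfspace z -> Xi z = Th z *m C.
Proof.
move=> HTh HXi ya Hy; have [[rho0 srO sr] HT] := HTh; have [sr1 HX] := HXi.
have rho10 : 0 < rho1 by case: sr1.
have yy : `|y - y| < rho1 by rewrite subrr normr0.
have [pT Tb uT] := HT y ya Hy; have [pX Xb uX] := HX y yy Hy.
set T := Th y in Tb uT; set X := Xi y in Xb uX.
have [C TC] : exists C, T *m C = X by exists (invmx T *m X); rewrite mulKVmx.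
have Cb : C *m b *m C^T = b1.
  have E : T *m (C *m b *m C^T) *m T^T = T *m b1 *m T^T.
    transitivity (T *m C *m b *m (T *m C)^T); first by rewrite trmx_mul !mulmxA.
    by rewrite TC Xb Tb.
  have := congr1 (fun Z => invmx T *m Z *m invmx T^T) E.
  by rewrite !mulmxA !mulVmx// !mul1mx -![_ *m T^T *m _]mulmxA mulmxV ?unitmx_tr// !mulmx1.
have uC : C \in unitmx by move: uX; rewrite -TC unitmx_mul => /andP[].
exists C; split.
  split=> // z zr Hz; have [p1 p2 p3] := HT z zr Hz; split.
  - exact: parallel_mulr.
  - by rewrite trmx_mul !mulmxA -[Th z *m C *m b]mulmxA -[Th z *m _ *m C^T]mulmxA Cb.
  - by rewrite unitmx_mul p3.
pose r := Num.min rho1 (rho - `|y - a|).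
have r0 : 0 < r by rewrite lt_min rho10 subr_gt0.
have sry : small_radius g O K y r by apply: small_radius_le sr1 => //; rewrite ge_min lexx.
apply: filterS (ball_near y r0) => z zr Hz.
apply/eqP; rewrite -subr_eq0; apply/eqP.
have y0 : `|y - y| <= r by rewrite subrr normr0 ltW.
apply: (parallel_unique sry y0 (ltW zr) (U := fun z => Xi z - Th z *m C)); last by rewrite -/X -/T TC subrr.
move=> t t01; set v := y + t *: (z - y).
have vr : `|v - y| < r by apply: ball_convex_lt => //; rewrite subrr normr0.
have Hv : model_halfspace v by exact: halfspace_convex.
move: vr; rewrite lt_min => /andP[v1 v2]; apply: parallel_sub; first by have [] := HX v v1 Hv.
apply: parallel_mulr; have [] // := HT v _ Hv.
by apply: le_lt_trans (ler_distD y _ _) _; rewrite -ltrBrDr.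
Qed.

(** The other rows are the derivatives of the first, so F alone determines its frame. *)
Lemma usub_parallel_eq0 q (U : 'rV[R]_m -> 'M[R]_(1 + m, q)) y : parallel_at g K U y ->
  (\forall z \near y, usubmx (U z) = 0) -> U y = 0.
Proof.
move=> pU U0; have Hrow k : row_mx (0 : 'M[R]_1) (delta_mx ord0 k : 'rV[R]_m) *m U y = 0.
  apply/matrixP => i j; rewrite -(usub_lin_mx g K _ y) mxE [RHS]mxE.
  transitivity (partial k (fun z => U z (lshift m i) j) y).
    rewrite (pU (lshift m i) j).2 /lin_mx mulmx_suml summxE (bigD1 k)//= big1 ?addr0.
      have -> : (delta_mx ord0 k : 'rV[R]_m) ord0 k = 1 by rewrite mxE !eqxx.
      by rewrite scale1r.
    move=> l lk; have -> : (delta_mx ord0 k : 'rV[R]_m) ord0 l = 0 by rewrite mxE (negPf lk) andbF.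
    by rewrite scale0r mul0mx mxE.
  rewrite /partial (@near_eq_derive _ _ _ _ (cst 0) _ (delta_mx ord0 k)) ?derive_cst//.
  by apply: filterS U0 => z /matrixP/(_ i j); rewrite mxE [X in _ = X -> _]mxE.
rewrite -(vsubmxK (U y)) (nbhs_singleton U0).
suff -> : dsubmx (U y) = 0 by rewrite col_mx0.
apply/row_matrixP => k; have := Hrow k.
by rewrite -{1}(vsubmxK (U y)) mul_row_col mul0mx add0r -rowE row0.
Qed.

End FrameGluing.

Section FrameConstant.
Context {R : realType} {m : nat}.
Hypothesis hm : (0 < m)%N.
Context {M : topologicalType}.
Variables (G : riemannian_manifold R m M) (K : R).
Hypothesis hcurv : constant_sectional_curvature G K.
Variables (b b1 : 'M[R]_(1 + m)) (F : M -> 'rV[R]_(1 + m)) (c : chart G).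
Variables (a : 'rV[R]_m) (rho : R) (Th : 'rV[R]_m -> 'M[R]_(1 + m)).
Hypothesis HTh : local_frame (metric c) (regular_set c) K b1 a rho Th.

Let good_at (z : M) := [/\ dom c z, interior_pt G z, `|chart_map c z - a| < rho & devel K b F c z].
Let agree C (z : M) := \forall y \near z, F y = usubmx (Th (chart_map c y) *m C).

Lemma agree_exists z : good_at z -> exists C, local_frame (metric c) (regular_set c) K b a rho (fun y => Th y *m C) /\ agree C z.
Proof.
move=> [cz zi zr [rho1 [Xi [HXi FE]]]]; have rho10 : 0 < rho1 by case: HXi => -[].
have [C [HC HE]] := local_frame_glue HTh HXi zr (chart_regular cz).2.
exists C; split => //; apply: filterS (chart_near cz (filterI HE (ball_near (chart_map c z) rho10))) => y [cy [yE yr]].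
by rewrite FE// yE//; exact: (chart_regular cy).2.
Qed.

Lemma agree_unique z C C' : good_at z -> agree C z -> agree C' z -> C = C'.
Proof.
move=> [cz zi zr _] A1 A2; have [_ HT] := HTh.
have [pT _ uT] := HT _ zr (chart_regular cz).2.
apply/eqP; rewrite -subr_eq0; apply/eqP.
have p2 := parallel_mulr (C - C') pT.
have H0 : Th (chart_map c z) *m (C - C') = 0.
  apply: (usub_parallel_eq0 p2).
  apply: filterS2 (param_near cz (filterI A1 A2)) (pos_near (interior_pos hm cz zi)) => y [Iy Hy] y0.
  have Hy' := pos_halfspace y0; have [cy [a1 a2]] := Hy Hy'.
  rewrite mulmxBr linearB/=; rewrite (paramK (conj Iy Hy')) in a1 a2.
  by rewrite -a1 -a2 subrr.
by rewrite -[LHS](mulKmx uT) H0 mulmx0.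
Qed.

(** By [agree_unique] the factor is locally constant along [sigma], so its derivative vanishes on
    the whole interval. *)
Lemma agree_constant (sigma : R -> M) (t0 t1 : R) : t0 < t1 ->
  (forall t, t0 < t < t1 -> good_at (sigma t) /\ {for t, continuous sigma}) ->
  exists C, local_frame (metric c) (regular_set c) K b a rho (fun y => Th y *m C) /\
    forall t, t0 < t < t1 -> agree C (sigma t).
Proof.
move=> t01 H.
have : forall t, exists C, t0 < t < t1 -> local_frame (metric c) (regular_set c) K b a rho (fun y => Th y *m C) /\ agree C (sigma t).
  move=> t; have [tt|tt] := pselect (t0 < t < t1); last by exists 0 => /tt.
  by have [C HC] := agree_exists (H _ tt).1; exists C.
move=> /choice[C HC].
have loc t : t0 < t < t1 -> \forall s \near t, C t = C s.
  move=> tt; have [gt ct] := H _ tt; have [_ At] := HC _ tt.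
  have nA : \forall y \near sigma t, agree (C t) y by exact: nbhs_interior.
  have n1 := near_cont ct nA.
  have n2 : \forall s \near t, t0 < s < t1 by exact: (@near_in_itvoo _ t0 t1 t tt).
  apply: (near_mono (filterI n1 n2)) => s [As ss].
  exact: agree_unique (H _ ss).1 As (HC _ ss).2.
have dC t : t0 < t < t1 -> is_derive t (1 : R) C (0 : 'M[R]_(1 + m)).
  by move=> tt; apply: is_derive_near (loc _ tt) _; exact: is_derive_cst.
pose u := (t0 + t1) / 2; have uu : t0 < u < t1 by rewrite /u; apply/andP; split; move: t01; lra.
exists (C u); split; first exact: (HC _ uu).1.
move=> t tt; have -> : C u = C t; last exact: (HC _ tt).2.
apply/eqP; rewrite -subr_eq0 -normr_le0.
have -> : 0 = 0 * `|u - t| by rewrite mul0r.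
apply: (mxcurve_mvt (D := fun=> 0)) => // [s|s _]; last by rewrite normr0.
move: uu tt => /andP[u0 u1] /andP[v0 v1] /andP[s0 s1]; apply: dC; apply/andP; split.
  by apply: lt_le_trans s0; rewrite lt_min v0.
by apply: le_lt_trans s1 _; rewrite gt_max v1.
Qed.

End FrameConstant.

Section ModelRays.
Context {R : realType} {m : nat}.
Variables (g0 : 'M[R]_m) (K : R).
Implicit Types (w u : 'rV[R]_m) (t s e : R).

Lemma model_exp0 : model_exp g0 K 0 = row_mx 1%:M 0.
Proof.
have := model_exp_ray g0 K 0 (0 : 'rV[R]_m); rewrite scale0r => ->.
by rewrite coshk0 scaler0.
Qed.

Lemma model_ray_continuous w t : {for t, continuous (fun s : R => model_exp g0 K (s *: w))}.
Proof. by apply: derivable_curve_continuous; have [] := model_exp_derive g0 K w t. Qed.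

Lemma model_ray_close w e : 0 < e -> exists2 d, 0 < d & forall t w', `|t - 1| < d -> `|w' - w| < d ->
  `|model_exp g0 K (t *: w') - model_exp g0 K w| < e.
Proof.
move=> e0; have n1 : \forall u \near w, `|model_exp g0 K u - model_exp g0 K w| < e.
  exact: near_cont (@model_exp_continuous _ _ g0 K w) (ball_near (model_exp g0 K w) e0).
have /nbhs_ballP[r /= r0 Hr] := n1.
have nw : 0 <= `|w| by exact: normr_ge0.
pose d := Num.min 1 (r / (`|w| + 3)).
have w3 : 0 < `|w| + 3 by rewrite ltr_wpDl.
have d0 : 0 < d by rewrite lt_min ltr01 divr_gt0.
exists d => // t w' td wd; apply: Hr; rewrite -ball_normE/= distrC.
have -> : t *: w' - w = t *: (w' - w) + (t - 1) *: w.
  by rewrite scalerBr scalerBl scale1r addrA subrK.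
apply: le_lt_trans (ler_normD _ _) _; rewrite !normrZ.
have t2 : `|t| <= 2.
  rewrite -[t](subrK 1); apply: le_trans (ler_normD _ _) _; rewrite normr1.
  have : d <= 1 by rewrite ge_min lexx.
  by move: td; lra.
have dr : d * (`|w| + 3) <= r by rewrite -ler_pdivlMr// ge_min lexx orbT.
have a0 := normr_ge0 (w' - w); have b0 := normr_ge0 (t - 1); have c0 := normr_ge0 t.
move: td wd t2 dr a0 b0 c0 nw d0; move: `|t - 1| `|w' - w| `|t| `|w| => x y z v; clear.
nra.
Qed.

End ModelRays.

Section RealInduction.
Context {R : realType}.

(** At the infimum of the failures the first hypothesis gives P, and the second excludes failures
    just after it. *)
Lemma real_induction (P : R -> Prop) :
  (forall t, 0 <= t <= 1 -> (forall s, 0 <= s < t -> P s) -> P t) ->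
  (forall t, 0 <= t <= 1 -> P t -> \forall s \near t, 0 <= s <= 1 -> P s) ->
  forall t, 0 <= t <= 1 -> P t.
Proof.
move=> H1 H2 t t01; apply: contrapT => nPt.
pose B : set R := [set s | 0 <= s <= 1 /\ ~ P s].
have Bt : B t by [].
have lbB : lbound B 0 by move=> s [/andP[]].
have hB : has_inf B by split; [exists t|exists 0].
set i := inf B.
have i0 : 0 <= i by apply: lb_le_inf => //; exists t.
have it : i <= t by apply: (ge_inf (ex_intro _ 0 lbB)).
have i01 : 0 <= i <= 1 by rewrite i0/= (le_trans it)//; case/andP: t01.
have Pi : P i.
  apply: H1 => // s /andP[s0 si]; apply: contrapT => nPs.
  have : i <= s.
    apply: (ge_inf (ex_intro _ 0 lbB)); split=> //; rewrite s0/= (le_trans (ltW si))//.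
    by case/andP: i01.
  by rewrite leNgt si.
have /nbhs_ballP[r /= r0 Hr] := H2 i i01 Pi.
have [s [s01 nPs] si] := inf_adherent r0 hB.
have is_ : i <= s by apply: (ge_inf (ex_intro _ 0 lbB)).
apply: nPs; apply: Hr s01; rewrite -ball_normE/= distrC ger0_norm ?subr_ge0//.
by rewrite ltrBlDl.
Qed.

End RealInduction.

Section ArcGlue.
Context {R : realType} {m : nat} {M : topologicalType}.
Variables (G : riemannian_manifold R m M).

Lemma sub_arc_velocity gamma p q w (t : R) : geodesic_arc G gamma p q -> initial_velocity G gamma w ->
  0 <= t <= 1 -> initial_velocity G (fun s => gamma (t * s + 0)) (t *: w).
Proof.
move=> H Hw t01; have [xi [w' [Hxi xiw Hw']]] := arc_velocity H.
have g0 : gamma 0 = p by have [] := H.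
have <- : w' = w by exact: velocity_unique (fun _ _ => erefl) Hw' Hw.
have nae : \forall s \near (0 : R), 0 <= s <= 1 -> 0 <= t * s + 0 <= 1.
  apply: near_all => s s01; apply: itv_affine => //; by rewrite ?lexx ?ler01 ?addr0.
have H1 := @arc_lift_affine _ _ _ G (chart_at G p) gamma t 0 0 xi nae.
rewrite mulr0 addr0 in H1; have {}H1 := H1 Hxi.
have Hc : arc_lift (chart_at G (gamma (t * 0 + 0))) (fun s => gamma (t * s + 0)) 0 (fun s => xi (t * s + 0)).
  by rewrite mulr0 addr0 g0; exact: H1.
have := lift_velocity Hc.
have [d1 _ _] := nbhs_singleton Hxi.
have d1' : derivable xi (t * 0 + 0) 1 by rewrite mulr0 addr0.
by have [_ dE] := is_derive_affine d1'; rewrite derive1E dE mulr0 addr0 xiw.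
Qed.

(** [gamma1] is run at speed 1 / t2 on [0, t2]. Agreement just before t2 makes the junction smooth:
    near t2 the glued curve is [gamma2] on both sides. *)
Lemma arc_glue gamma1 gamma2 p (t2 : R) : 0 < t2 < 1 -> geodesic_arc G gamma1 p (gamma2 t2) ->
  (\forall s \near (1 : R), s <= 1 -> gamma1 s = gamma2 (t2 * s)) ->
  (forall t (c : chart G), t2 <= t <= 1 -> dom c (gamma2 t) -> arc_at c gamma2 t) ->
  geodesic_arc G (fun s => if s <= t2 then gamma1 (t2^-1 * s) else gamma2 s) p (gamma2 1).
Proof.
move=> /andP[t0 t1] [g0 g1 H1] E H2.
have t2n : t2 != 0 by rewrite gt_eqF.
split.
- by rewrite ltW// mulr0.
- by rewrite leNgt t1.
move=> c t /andP[t_0 t_1]; have [tlt|tgt|teq] := ltgtP t t2 => ct.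
- have t2i : 0 <= t2^-1 * t <= 1.
    by rewrite mulr_ge0 ?invr_ge0 ?(ltW t0)//= ler_pdivrMl// mulr1 ltW.
  have [xi Hxi] := H1 c _ t2i ct.
  apply: (@arc_near_eq _ _ _ G c (fun s => gamma1 (t2^-1 * s + 0))).
    have n1 : \forall s \near t, s < t2 by exact: lt_nbhsl.
    by apply: (near_mono n1) => s st _; rewrite addr0 (ltW st).
  exists (fun s => xi (t2^-1 * s + 0)); apply: arc_lift_affine; last by rewrite addr0.
  have n1 : \forall s \near t, s < t2 by exact: lt_nbhsl.
  apply: (near_mono n1) => s st /andP[s0 _].
  by rewrite addr0 mulr_ge0 ?invr_ge0 ?(ltW t0)//= ler_pdivrMl// mulr1 ltW.
- apply: (@arc_near_eq _ _ _ G c gamma2); last by apply: H2; rewrite // t_1 ltW.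
  have n1 : \forall s \near t, t2 < s by exact: lt_nbhsr.
  by apply: (near_mono n1) => s st _; rewrite leNgt st.
- move: ct; rewrite teq mulVf// g1 => ct.
  apply: (@arc_near_eq _ _ _ G c gamma2); last by apply: H2; rewrite ?lexx ?ltW.
  have E' : \forall s \near (t2^-1 * t2 + 0), s <= 1 -> gamma1 s = gamma2 (t2 * s).
    by rewrite mulVf// addr0.
  apply: (near_mono (near_affine E')) => s Es _; rewrite addr0 in Es; case: ifPn => // st.
  by rewrite Es ?mulVKf// ler_pdivrMl// mulr1.
Qed.

End ArcGlue.

Section NearPick.
Context {R : realType}.

Lemma near_pick_right (t : R) (P : R -> Prop) : (\forall s \near t, P s) -> exists2 s, t < s < t + 1 & P s.
Proof.
move=> /nbhs_ballP[r /= r0 Hr].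
have [s1 s2] : t < t + Num.min r 1 / 2 < t + 1 /\ Num.min r 1 / 2 < r.
  have : 0 < Num.min r 1 by rewrite lt_min r0 ltr01.
  have : Num.min r 1 <= r by rewrite ge_min lexx.
  have : Num.min r 1 <= 1 by rewrite ge_min lexx orbT.
  move: (Num.min r 1) => v; clear -r0 => H1 H2 H3; split; last by lra.
  by apply/andP; split; lra.
exists (t + Num.min r 1 / 2) => //; apply: Hr; rewrite -ball_normE/=.
rewrite opprD addrA subrr sub0r normrN ger0_norm//.
by rewrite divr_ge0// le_min (ltW r0) ler01.
Qed.

Lemma near_pick_left (t : R) (P : R -> Prop) : (\forall s \near t, P s) -> exists2 s, t - 1 < s < t & P s.
Proof.
move=> H; have H' : \forall s \near - t, P (-1 * s + 0).
  by apply: (near_affine (a := -1) (e := 0)); rewrite mulN1r opprK addr0.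
have [s /andP[s1 s2] Ps] := near_pick_right H'; exists (- s); last by move: Ps; rewrite mulN1r addr0.
by apply/andP; split; move: s1 s2; clear; lra.
Qed.

Lemma pick_below (p q r x : R) : p < x -> q < x -> r < x -> exists t, [/\ p < t, q < t, r < t & t < x].
Proof.
move=> px qx rx; pose v := Num.max p (Num.max q r).
have vx : v < x by rewrite !gt_max px qx rx.
have pv : p <= v by rewrite le_max lexx.
have qv : q <= v by rewrite !le_max lexx orbT.
have rv : r <= v by rewrite !le_max lexx !orbT.
exists ((v + x) / 2); split; move: vx pv qv rv; clear; move: v => v; lra.
Qed.

End NearPick.

Lemma devel_continuous (R : realType) (m : nat) (M : topologicalType) (G : riemannian_manifold R m M) (K : R)
  (b : 'M[R]_(1 + m)) F (c : chart G) y : dom c y -> devel K b F c y -> {for y, continuous F}.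
Proof.
move=> cy dF; apply/cvgrPdist_lt => e e0.
by apply: filterS (devel_near_cont cy dF e0) => z; rewrite distrC.
Qed.

(** * The developing map based at an interior point *)

Section Development.
Context {R : realType} {m : nat}.
Hypothesis hm : (0 < m)%N.
Context {M : topologicalType}.
Variables (G : riemannian_manifold R m M) (K : R).
Hypothesis hcurv : constant_sectional_curvature G K.
Hypothesis K0 : K <= 0.
Hypothesis hconvex : convex_manifold G.
Variable x0 : M.
Hypothesis hx0 : interior_pt G x0.
Implicit Types (c d : chart G) (x y z : M) (w : 'rV[R]_m) (t s e : R).

Let g0 := metric (chart_at G x0) (chart_map (chart_at G x0) x0).
Let b := model_form g0 K.

Let g0p (u : 'rV[R]_m) : u != 0 -> 0 < (u *m g0 *m u^T) ord0 ord0.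
Proof. by move=> u0; apply: metric_pos => //; apply: chart_map_img; exact: chart_atP. Qed.

(** Convexity speaks of distinct points only, so the base point gets velocity 0 by definition. *)
Definition velocity_to y w : Prop := (y = x0 /\ w = 0) \/
  (y <> x0 /\ exists2 gamma, geodesic_arc G gamma x0 y & initial_velocity G gamma w).

Definition log_to y : 'rV[R]_m := xget 0 (velocity_to y).

(** Defined outright along the geodesics from [x0], so that no path has to be chosen. What remains
    to be proved is that it is a developing map around each point, which is [good]. *)
Definition dev y : 'rV[R]_(1 + m) := model_exp g0 K (log_to y).

Lemma log_toP y : velocity_to y (log_to y).
Proof.
apply: xgetPex; have [->|yx] := pselect (y = x0); first by exists 0; left.
have [[gamma H] _ _] := hconvex (fun E : x0 = y => yx (esym E)).
have [xi [w [_ _ Hw]]] := arc_velocity H.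
by exists w; right; split=> //; exists gamma.
Qed.

Lemma log_to_arc gamma y w : y <> x0 -> geodesic_arc G gamma x0 y -> initial_velocity G gamma w ->
  log_to y = w.
Proof.
move=> yx H Hw; have [[yx' _]|[_ [gamma' H' Hw']]] := log_toP y; first by case: (yx yx').
exact: velocity_unique (arc_unique hconvex (fun E => yx (esym E)) H' H) Hw' Hw.
Qed.

Lemma log_to_base : log_to x0 = 0.
Proof. by have [[]|[]] := log_toP x0. Qed.

Lemma log_to_sub gamma y w t : y <> x0 -> geodesic_arc G gamma x0 y -> initial_velocity G gamma w ->
  0 <= t <= 1 -> log_to (gamma t) = t *: w.
Proof.
move=> yx H Hw t01; have [g00 _ _] := H.
have [->|tn] := eqVneq t 0; first by rewrite g00 log_to_base scale0r.
have tp : 0 < t <= 1 by case/andP: t01 => t0 ->; rewrite lt_def tn t0.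
have gx := arc_no_return hconvex (fun E => yx (esym E)) H tp.
apply: (log_to_arc gx _ (sub_arc_velocity H Hw t01)).
have := @arc_affine _ _ _ G gamma x0 y t 0 _ H.
rewrite g00 addr0; apply => s s01; apply: itv_affine => //; by rewrite ?lexx ?ler01 ?addr0.
Qed.

Lemma dev_arc gamma y w t : y <> x0 -> geodesic_arc G gamma x0 y -> initial_velocity G gamma w ->
  0 <= t <= 1 -> dev (gamma t) = model_exp g0 K (t *: w).
Proof. by move=> *; rewrite /dev (@log_to_sub gamma y w). Qed.

Lemma log_to_dev y : log_to y = model_log g0 K (dev y).
Proof. by rewrite model_expK. Qed.

Definition good y : Prop := devel K b dev (chart_at G y) y.

Lemma good_devel c y : dom c y -> interior_pt G y -> good y -> devel K b dev c y.
Proof. by move=> cy yi; apply: devel_change => //; exact: chart_atP. Qed.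

Lemma devel_good c y : dom c y -> interior_pt G y -> devel K b dev c y -> good y.
Proof. by move=> cy yi; apply: devel_change => //; exact: chart_atP. Qed.

Lemma good_near y : interior_pt G y -> good y -> \forall z \near y, interior_pt G z -> good z.
Proof.
move=> yi gy; apply: filterS (devel_near (chart_atP G y) gy) => z [cz dz] zi.
exact: devel_good dz.
Qed.

(** Model rays pulled back through the local inverse are geodesics of M; this is the source of
    geodesics to nearby points. *)
Lemma ray_geod F (U : set M) c (Gi : 'rV[R]_(1 + m) -> M) Y e w t :
  (forall z, U z -> [/\ dom c z, interior_pt G z & devel K b F c z]) ->
  (forall X, X *m b *m X^T = 1%:M -> `|X - Y| < e -> [/\ U (Gi X), F (Gi X) = X &
    forall P : set M, nbhs (Gi X) P -> \forall Y \near X, Y *m b *m Y^T = 1%:M -> P (Gi Y)]) ->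
  `|model_exp g0 K (t *: w) - Y| < e -> forall d, dom d (Gi (model_exp g0 K (t *: w))) ->
  geod_near d (fun s => Gi (model_exp g0 K (s *: w))) t.
Proof.
move=> HU HG te d dt; have qd s : model_exp g0 K (s *: w) *m b *m (model_exp g0 K (s *: w))^T = 1%:M.
  exact: model_exp_quadric.
have rc := @model_ray_continuous _ _ g0 K w.
have ne : \forall s \near t, `|model_exp g0 K (s *: w) - Y| < e.
  have oB : \forall X \near model_exp g0 K (t *: w), `|X - Y| < e.
    have e' : 0 < e - `|model_exp g0 K (t *: w) - Y| by rewrite subr_gt0.
    apply: filterS (ball_near _ e') => X HX.
    by apply: le_lt_trans (ler_distD (model_exp g0 K (t *: w)) _ _) _; rewrite -ltrBrDr.
  exact: near_cont (rc t) oB.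
have [Ut _ Gc] := HG _ (qd t) te; have [ct it dt'] := HU _ Ut.
have cg : {for t, continuous (fun s => Gi (model_exp g0 K (s *: w)))}.
  move=> P nP; apply: (near_mono (near_cont (rc t) (Gc P nP))) => s; apply; exact: qd.
apply: (geod_change hm hcurv K0 ct dt it).
apply: (hyper_geod hm hcurv ct it dt' cg).
apply: (near_mono (near_near ne)) => s ns.
apply: hyper_at_near (model_exp_hyper K0 g0p w s).
apply: (near_mono ns) => u nu; have [_ E _] := HG _ (qd u) nu.
by rewrite /= E.
Qed.

Lemma lsub_near (X : 'rV[R]_(1 + m)) : 0 < lsubmx X ord0 ord0 -> \forall Y \near X, 0 < lsubmx (Y : 'rV[R]_(1 + m)) ord0 ord0.
Proof.
rewrite mxE => X0; have := near_cont (@cont_coord R _ _ ord0 (lshift m ord0) X) (open_nbhs_nbhs (conj (@open_gt R 0) X0)).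
by apply: filterS => Y; rewrite [lsubmx Y _ _]mxE.
Qed.

Lemma dev_base : dev x0 = row_mx 1%:M 0.
Proof. by rewrite /dev log_to_base model_exp0. Qed.

(** A local developing map F0 with frame 1 at [x0] exists. For z close to [x0] the pulled-back ray
    to F0 z is a geodesic from [x0] to z, hence the one that defines [dev z], and its initial
    velocity is the logarithm of F0 z. *)
Lemma good_base : good x0.
Proof.
have c0 := chart_atP G x0; pose c := chart_at G x0.
have T1 : (1%:M : 'M[R]_(1 + m)) *m b *m (1%:M)^T = frame_form (metric c) K (chart_map c x0).
  by rewrite mul1mx trmx1 mulmx1.
have [F0 F0at F0E] := devel_exists hcurv c0 (unitmx1 _ _) T1.
have F0d : devel K b F0 c x0 by apply/devel_atP; exists 1%:M.
have {}F0E : F0 x0 = row_mx 1%:M 0 by rewrite F0E (scalar_mx_block 1 m) block_mxEv col_mxKu.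
have [e [U [Gi [e0 nU HU Uinj HG]]]] := devel_chart hm c0 hx0 F0d.
have E0 : model_exp g0 K 0 = F0 x0 by rewrite model_exp0.
have [d dp Hd] := @model_ray_close _ _ g0 K 0 e e0.
have F0c := devel_continuous c0 F0d.
have Fx0 : 0 < lsubmx (F0 x0) ord0 ord0 by rewrite F0E row_mxKl mxE.
(* Half of [d], since rays are followed for t in (-1, 2) in order to have two-sided derivatives at 0
   and 1. *)
have nlog : \forall z \near x0, `|model_log g0 K (F0 z)| < d / 2.
  have lc := cont_comp F0c (model_log_continuous (g0 := g0) (K := K) Fx0).
  have E00 : model_log g0 K (F0 x0) = 0 by rewrite -E0 model_expK.
  have d2 : 0 < d / 2 by rewrite divr_gt0.
  by have := near_cont lc (ball_near (model_log g0 K (F0 x0)) d2); rewrite E00; apply: filterS => z; rewrite subr0.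
suff nE : \forall z \near x0, F0 z = dev z by apply/devel_atP; exists 1%:M; exact: devel_at_ext nE F0at.
apply: filterS (filterI nU (filterI nlog (near_cont F0c (lsub_near Fx0)))) => z [Uz [zlog z0]].
have [->|zx] := pselect (z = x0); first by rewrite F0E dev_base.
have [cz zi dz] := HU z Uz.
set w := model_log g0 K (F0 z) in zlog.
have wE : model_exp g0 K w = F0 z by apply: model_logK => //; exact: devel_quadric dz.
have close t : -1 < t < 2 -> `|model_exp g0 K (t *: w) - F0 x0| < e.
  move=> t12; have := Hd 1 (t *: w); rewrite scale1r E0; apply; first by rewrite subrr normr0.
  rewrite subr0 normrZ; have : `|t| <= 2 by rewrite ler_norml; move: t12; lra.
  move=> t2; have tw : `|t| * `|w| <= 2 * `|w| by rewrite ler_wpM2r.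
  by apply: le_lt_trans tw _; rewrite mulrC -ltr_pdivlMr.
pose gam t := Gi (model_exp g0 K (t *: w)).
have qd t : model_exp g0 K (t *: w) *m b *m (model_exp g0 K (t *: w))^T = 1%:M.
  exact: (model_exp_quadric K0 g0p).
have Ug t : -1 < t < 2 -> U (gam t) /\ F0 (gam t) = model_exp g0 K (t *: w).
  by move=> tt; have [? ? _] := HG _ (qd t) (close t tt).
have l0 : -1 < (0 : R) < 2 by rewrite ltrN10 ltr0n.
have l1 : -1 < (1 : R) < 2 by rewrite ltr1n andbT; lra.
have g_0 : gam 0 = x0.
  by apply: Uinj; [exact: (Ug 0 l0).1|exact: nbhs_singleton nU|rewrite (Ug 0 l0).2 scale0r E0].
have g_1 : gam 1 = z.
  by apply: Uinj; [exact: (Ug 1 l1).1|exact: Uz|rewrite (Ug 1 l1).2 scale1r wE].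
have Hg t d' : -1 < t < 2 -> dom d' (gam t) -> geod_near d' gam t.
  by move=> tt dt; exact: (ray_geod HU HG (close t tt)).
have Harc : geodesic_arc G gam x0 z.
  split=> // d' t /andP[t0 t1] dt; apply: geod_arc; apply: Hg => //.
  by apply/andP; split; [move: t0|move: t1]; lra.
have g0c : dom c (gam 0) by rewrite g_0.
have [_ [d1 _ _]] := nbhs_singleton (Hg 0 c l0 g0c).
have Hlift : arc_lift (chart_at G (gam 0)) gam 0 (fun s => chart_map c (gam s)).
  rewrite g_0; apply: (near_mono (Hg 0 c l0 g0c)) => s [cs [d1' d2' gs]]; split; [exact: d1'|exact: d2'|].
  by move=> _; split; [exact: cs|reflexivity|exact: gs].
have Hv := lift_velocity Hlift.
(* The initial velocity: the frame at [x0] is 1, so F0 along the curve has derivative (0, xi'(0)) at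
   time 0, while the model ray has derivative (0, w). *)
have [rho [Th [[[rho0 _ _] HTh] Th1 FE]]] := F0at.
have Cx : `|chart_map c (gam 0) - chart_map c x0| < rho by rewrite g_0 subrr normr0.
have [pT _ _] := HTh _ Cx (chart_regular g0c).2.
have D1 := curve_dev1 pT d1.
have D2 := model_exp_derive g0 K w 0.
have nE : \forall s \near (0 : R), usubmx (Th (chart_map c (gam s))) = model_exp g0 K (s *: w).
  have nc := near_cont (derivable_curve_continuous d1) (ball_near (chart_map c (gam 0)) rho0).
  have n0 : \forall s \near (0 : R), -1 < s < 2 by exact: (@near_in_itvoo _ (-1) 2 0 l0).
  apply: (near_mono (filterI n0 (filterI nc (Hg 0 c l0 g0c)))) => s [ss [bs [cs _]]].
  by rewrite g_0 in bs; rewrite -(FE (gam s) cs bs); exact: (Ug s ss).2.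
have D3 := is_derive_near nE D1.
have [_ E1] := D2; have [_ E2] := D3; move: E2; rewrite E1 g_0 Th1 mulmx1 coshk0 scale1r.
move=> /eq_row_mx[_ wE'].
rewrite -wE' in Hv.
by rewrite /dev (log_to_arc zx Harc Hv) wE.
Qed.

(** The extension step. A frame around y, normalized to agree with [dev] on the last part of the
    arc, gives a developing map F past y. For z near y, the end of the model ray to F z is pulled
    back and glued to the arc from [x0] to a point short of z; the result is an arc from [x0] to z,
    so by uniqueness its velocity defines [dev z], and [dev] equals F near y. *)
Lemma good_step gamma y w : interior_pt G y -> y <> x0 -> geodesic_arc G gamma x0 y ->
  initial_velocity G gamma w -> (forall t, 0 <= t < 1 -> good (gamma t)) -> good y.
Proof.
move=> yi yx Hg Hw Hgood; have cy := chart_atP G y; set c := chart_at G y in cy.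
have [_ g1 Hat] := Hg.
have xy : x0 <> y by move=> E; exact: yx (esym E).
have [Ry Hy] := chart_regular cy.
have T1 : (1%:M : 'M[R]_(1 + m)) *m frame_form (metric c) K (chart_map c y) *m (1%:M)^T = frame_form (metric c) K (chart_map c y).
  by rewrite mul1mx trmx1 mulmx1.
have [rho [Th [HTh _]]] := local_frame_exists (chart_metric hcurv c) Ry Hy (unitmx1 _ _) T1.
have rho0 : 0 < rho by have [[]] := HTh.
have i11 : 0 <= (1 : R) <= 1 by rewrite ler01 lexx.
have cg1 : dom c (gamma 1) by rewrite g1.
have A1 := Hat c 1 i11 cg1.
have near1 (P : set M) : nbhs y P -> \forall s \near (1 : R), 0 <= s <= 1 -> P (gamma s).
  by move=> nP; apply: (arc_cont i11 A1); rewrite g1.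
have /nbhs_ballP[r /= r0 Hr] := near1 _ (chart_near cy (ball_near (chart_map c y) rho0)).
pose s0 := Num.max (1 / 2) (1 - r).
have s01 : s0 < 1 by rewrite gt_max ltrBlDr ltrDl r0 andbT; lra.
have s0p : 0 < s0 by rewrite lt_max; apply/orP; left; lra.
have s0r s : s0 < s < 1 -> dom c (gamma s) /\ `|chart_map c (gamma s) - chart_map c y| < rho.
  move=> /andP[ss s1]; apply: Hr; last by rewrite (ltW s1) (ltW (lt_trans s0p ss)).
  rewrite -ball_normE/= ger0_norm ?subr_ge0 ?(ltW s1)//; move: ss; rewrite gt_max => /andP[_].
  by lra.
have s00 s : s0 < s < 1 -> 0 < s < 1 by move=> /andP[ss ->]; rewrite (lt_trans s0p ss).
have gint s : s0 < s < 1 -> interior_pt G (gamma s) by move=> /s00 ss; exact: (arc_interior hconvex xy Hg ss).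
(* At the points gamma t with t < 1 near 1, [dev] is already a developing map, so it is the first
   row of Th C with a single C. *)
have [|C [HC HCt]] := agree_constant (b := b) (F := dev) (sigma := gamma) hm HTh s01.
  move=> t tt; have [ct rt] := s0r t tt; have tt' := s00 t tt; have it := gint t tt; split.
    split=> //; apply: good_devel => //; apply: Hgood.
    by case/andP: tt' => t0 ->; rewrite (ltW t0).
  apply: (@geod_continuous _ _ _ G c); apply: arc_geod => //; apply: Hat => //.
  by case/andP: tt' => t0 t1; rewrite !ltW.
pose F z := usubmx (Th (chart_map c z) *m C).
have dF : devel K b F c y by exists rho, (fun v : 'rV[R]_m => Th v *m C).
have devg s : 0 <= s <= 1 -> dev (gamma s) = model_exp g0 K (s *: w) by move=> ss; exact: (dev_arc yx Hg Hw ss).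
have Fy : F y = model_exp g0 K w.
  apply: (near_eq_lim (E1 := F \o gamma) (E2 := fun s => model_exp g0 K (s *: w)) s01).
  - move=> t tt; rewrite -devg; first by rewrite /= (nbhs_singleton (HCt t tt)).
    by case/andP: (s00 t tt) => t0 t1; rewrite !ltW.
  - move=> e e0; have n0 : \forall s \near (1 : R), 0 < s by exact: lt_nbhsr.
    apply: (near_mono (filterI n0 (near1 _ (devel_near_cont cy dF e0)))) => s [sp Hs] s1.
    by apply: Hs; rewrite !ltW.
  - move=> e e0; have := near_cont (@model_ray_continuous _ _ g0 K w 1) (ball_near (model_exp g0 K (1 *: w)) e0).
    by rewrite scale1r => n1; apply: (near_mono n1) => s.
have [e [U [Gi [e0 nU HU Uinj HG]]]] := devel_chart hm cy yi dF.
have [d dp Hd] := @model_ray_close _ _ g0 K w e e0.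
have /nbhs_ballP[r' /= r'0 Hr'] := near1 _ (nbhs_interior nU).
(* The junction time, so close to 1 that gamma t2 lies in the domain U of the local inverse and that
   rays to points near F y stay in its range on [t2, 1]. *)
have [t2 [t2s t2d t2r t21]] : exists t2, [/\ s0 < t2, 1 - d < t2, 1 - r' < t2 & t2 < 1].
  by apply: pick_below; rewrite ?s01// gtrBl ?dp// r'0.
have tt2 : s0 < t2 < 1 by rewrite t2s.
have t20 : 0 < t2 < 1 by exact: s00.
have t201 : 0 <= t2 <= 1 by case/andP: t20 => u0 u1; rewrite !ltW.
have nUt2 : nbhs (gamma t2) U.
  apply: Hr'; last exact: t201.
  rewrite -ball_normE/= ger0_norm ?subr_ge0 ?(ltW t21)//; move: t2r; lra.
have gx2 : gamma t2 <> x0 by apply: (arc_no_return hconvex xy Hg); case/andP: t20 => -> /ltW ->.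
have opx z : z <> x0 -> \forall z' \near z, z' <> x0.
  move=> zx; apply: open_nbhs_nbhs; split=> //.
  apply: closed_openC; apply: accessible_closed_set1; apply: hausdorff_accessible.
  exact: (atlas_hausdorff G).
pose N0 z := dev z = F z /\ U z.
have nN0 : \forall z \near gamma t2, N0 z by apply: filterI => //; exact: HCt.
have qd u : model_exp g0 K u *m b *m (model_exp g0 K u)^T = 1%:M.
  exact: (model_exp_quadric K0 g0p).
have close2 : `|model_exp g0 K (t2 *: w) - F y| < e.
  rewrite Fy; apply: Hd; last by rewrite subrr normr0.
  by rewrite distrC ger0_norm ?subr_ge0 ?(ltW t21)//; move: t2d; lra.
have [Ug2 Fg2 Gc2] := HG _ (qd _) close2.
have g2E : Gi (model_exp g0 K (t2 *: w)) = gamma t2.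
  apply: Uinj => //; first exact: nbhs_singleton nUt2.
  by rewrite Fg2 -devg//; have [] := nbhs_singleton nN0.
have Fc := devel_continuous cy dF.
have Fyp : 0 < lsubmx (F y) ord0 ord0 by rewrite Fy row_mxKl mxE mulr1n; apply: lt_le_trans (coshk_ge1 _ _).
have lc : {for y, continuous (fun z => model_log g0 K (F z))} by exact: cont_comp Fc (model_log_continuous Fyp).
have lE : model_log g0 K (F y) = w by rewrite Fy model_expK.
(* By continuity of [Gi], the point at time t2 of the ray to F z stays away from [x0] and in the
   region where [dev] and F agree. *)
have nN : \forall z \near y, (\forall z' \near Gi (model_exp g0 K (t2 *: model_log g0 K (F z))), N0 z') /\
    Gi (model_exp g0 K (t2 *: model_log g0 K (F z))) <> x0.
  have n1 : \forall z' \near Gi (model_exp g0 K (t2 *: w)), (\forall z'' \near z', N0 z'') /\ z' <> x0.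
    by rewrite g2E; apply: filterI; [exact: nbhs_interior|exact: opx].
  have c2 : {for model_log g0 K (F y), continuous (fun u => model_exp g0 K (t2 *: u))}.
    apply: (@cont_comp _ _ _ (fun u : 'rV[R]_m => t2 *: u) (model_exp g0 K)); last exact: model_exp_continuous.
    exact: scaler_continuous.
  have n2 := Gc2 _ n1; rewrite -lE in n2.
  by have := near_cont (cont_comp lc c2) n2; apply: filterS => z; apply; exact: qd.
suff nE : \forall z \near y, F z = dev z.
  apply: (devel_good cy yi); move/devel_atP: dF => [T HT].
  by apply/devel_atP; exists T; exact: devel_at_ext nE HT.
have nlog : \forall z \near y, `|model_log g0 K (F z) - w| < d.
  by have := near_cont lc (ball_near (model_log g0 K (F y)) dp); rewrite lE.
apply: filterS (filterI (filterI nU (opx y yx)) (filterI (filterI nN nlog) (near_cont Fc (lsub_near Fyp)))) => z.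
move=> [[Uz zx] [[[nz1 z1x] zlog] z0]]; have [cz zi dz] := HU z Uz.
set wz := model_log g0 K (F z) in nz1 z1x zlog.
have wE : model_exp g0 K wz = F z by apply: model_logK => //; exact: devel_quadric dz.
pose gam t := Gi (model_exp g0 K (t *: wz)).
have close t : t2 <= t <= 1 -> `|model_exp g0 K (t *: wz) - F y| < e.
  move=> /andP[t2t t1]; rewrite Fy; apply: Hd => //.
  by rewrite distrC ger0_norm ?subr_ge0//; move: t2t t2d; lra.
have Ug t : t2 <= t <= 1 -> U (gam t) /\ F (gam t) = model_exp g0 K (t *: wz).
  by move=> tt; have [? ? _] := HG _ (qd _) (close t tt).
have l1 : t2 <= (1 : R) <= 1 by apply/andP; split; [exact: ltW|exact: lexx].
have l2 : t2 <= t2 <= 1 by rewrite lexx ltW.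
have g_1 : gam 1 = z.
  by apply: Uinj; [exact: (Ug 1 l1).1|exact: Uz|rewrite (Ug 1 l1).2 scale1r wE].
have Harc2 t d' : t2 <= t <= 1 -> dom d' (gam t) -> arc_at d' gam t.
  by move=> tt dt; apply: geod_arc; exact: (ray_geod HU HG (close t tt)).
have [N0z1 _] := nbhs_singleton nz1.
have logz1 : log_to (gam t2) = t2 *: wz.
  by rewrite log_to_dev N0z1 (Ug t2 l2).2 model_expK.
have [[z1x' _]|[_ [eta Heta Hv]]] := log_toP (gam t2); first by case: (z1x z1x').
rewrite logz1 in Hv.
have [_ eta1 eta_at] := Heta.
have ct2 : dom c (gam t2) by have [] := HU _ (Ug t2 l2).1.
have gamc : {for t2, continuous gam}.
  exact: (geod_continuous (ray_geod HU HG (close t2 l2) ct2)).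
(* The arc [eta] from [x0] to the junction point and the pulled-back ray have the same image under F
   just before the junction, and F is injective on U. *)
have Eeta : \forall s \near (1 : R), s <= 1 -> eta s = gam (t2 * s).
  have ceta : dom c (eta 1) by rewrite eta1.
  have n1 : \forall s \near (1 : R), 0 <= s <= 1 -> N0 (eta s).
    by apply: (arc_cont i11 (eta_at c 1 i11 ceta)); rewrite eta1.
  have n2 : \forall s \near (1 : R), N0 (gam (t2 * s)).
    have n3 : \forall u \near (t2 * 1 + 0), N0 (gam u).
      by rewrite mulr1 addr0; exact: near_cont gamc nz1.
    by apply: (near_mono (near_affine n3)) => s; rewrite addr0.
  have n4 : \forall s \near (1 : R), 0 < s by exact: lt_nbhsr.
  have n5 : \forall s \near (1 : R), `|model_exp g0 K ((t2 * s) *: wz) - F y| < e.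
    have c5 : {for (1 : R), continuous (fun s : R => model_exp g0 K ((t2 * s) *: wz))}.
      have -> : (fun s : R => model_exp g0 K ((t2 * s) *: wz)) = (fun s : R => model_exp g0 K (s *: (t2 *: wz))).
        by apply/funext => s; rewrite scalerA mulrC.
      exact: model_ray_continuous.
    have e' : 0 < e - `|model_exp g0 K ((t2 * 1) *: wz) - F y| by rewrite subr_gt0 mulr1 close.
    have n6 : \forall s \near (1 : R), `|model_exp g0 K ((t2 * s) *: wz) - model_exp g0 K ((t2 * 1) *: wz)| < e - `|model_exp g0 K ((t2 * 1) *: wz) - F y|.
      by have := near_cont c5 (ball_near (model_exp g0 K ((t2 * 1) *: wz)) e').
    apply: (near_mono n6) => s Hs.
    by apply: le_lt_trans (ler_distD (model_exp g0 K ((t2 * 1) *: wz)) _ _) _; rewrite -ltrBrDr.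
  apply: (near_mono (filterI (filterI n1 n2) (filterI n4 n5))) => s [[Hs1 [_ Us2]] [sp Hs5]] s1.
  have s01' : 0 <= s <= 1 by rewrite (ltW sp).
  have [Es1 Us1] := Hs1 s01'.
  apply: Uinj => //; rewrite -Es1; have [_ -> _] := HG _ (qd _) Hs5.
  by rewrite (dev_arc z1x Heta Hv s01') scalerA mulrC.
have Hz := arc_glue t20 Heta Eeta Harc2.
set zeta := (fun s => _) in Hz; rewrite g_1 in Hz.
have [xi [w' [_ _ Hw']]] := arc_velocity Hz.
have zt2 : zeta t2 = gam t2 by rewrite /zeta lexx mulVf ?eta1// gt_eqF//; case/andP: t20.
have t2n : t2 != 0 by rewrite gt_eqF//; case/andP: t20.
(* At time t2 the glued arc is at the junction point, whose logarithm is t2 wz. *)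
have w'E : w' = wz.
  by apply: (scalerI t2n); rewrite -(log_to_sub zx Hz Hw' t201) zt2 logz1.
by rewrite /dev (log_to_arc zx Hz Hw') w'E wE.
Qed.

Lemma good_interior y : interior_pt G y -> good y.
Proof.
move=> yi; have [->|yx] := pselect (y = x0); first exact: good_base.
have [[/yx//]|[_ [gamma Hg Hw]]] := log_toP y.
have [g0' g1 Hat] := Hg; have xy : x0 <> y by move=> E; exact: yx (esym E).
have gi t : 0 <= t <= 1 -> interior_pt G (gamma t).
  case/andP; rewrite le_eqVlt => /predU1P[<-|t0]; first by rewrite g0'.
  rewrite le_eqVlt => /predU1P[->|t1]; first by rewrite g1.
  by apply: (arc_interior hconvex xy Hg); rewrite t0.
rewrite -g1; apply: (real_induction (P := fun t => good (gamma t))); last by rewrite ler01 lexx.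
- move=> t t01 IH; have [->|tn] := eqVneq t 0; first by rewrite g0'; exact: good_base.
  have tp : 0 < t <= 1 by case/andP: t01 => t0 ->; rewrite lt_def tn t0.
  have gx := arc_no_return hconvex xy Hg tp.
  have Ha : geodesic_arc G (fun s => gamma (t * s + 0)) x0 (gamma t).
    have := @arc_affine _ _ _ G gamma x0 y t 0 _ Hg.
    rewrite g0' addr0; apply => s s01; apply: itv_affine => //; by rewrite ?lexx ?ler01 ?addr0.
  apply: (good_step (gi t t01) gx Ha (sub_arc_velocity Hg Hw t01)) => s /andP[s0 s1].
  apply: IH; rewrite addr0; case/andP: tp => tp _.
  by rewrite mulr_ge0 ?(ltW tp)//= gtr_pMr.
- move=> t t01 gt; have [xi Hxi] := Hat _ t t01 (chart_atP G (gamma t)).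
  have n1 := arc_cont t01 (ex_intro _ xi Hxi) (good_near (gi t t01) gt).
  by apply: (near_mono n1) => s Hs s01; exact: Hs s01 (gi s s01).
Qed.

(** Around a boundary point no local inverse is available. The points of a chart ball with positive
    first coordinate form a convex set, on which [dev] is given by one frame; at a boundary point z
    the two agree as limits along the arc from [x0], whose interior avoids the boundary. *)
Lemma good_all y : good y.
Proof.
have cy := chart_atP G y; set c := chart_at G y in cy.
have [Ry Hy] := chart_regular cy; set a := chart_map c y in Ry Hy.
have T1 : (1%:M : 'M[R]_(1 + m)) *m frame_form (metric c) K a *m (1%:M)^T = frame_form (metric c) K a.
  by rewrite mul1mx trmx1 mulmx1.
have [rho [Th [HTh _]]] := local_frame_exists (chart_metric hcurv c) Ry Hy (unitmx1 _ _) T1.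
have [[rho0 srO _] _] := HTh.
pose i0 : 'I_m := Ordinal hm.
pose pos z := [/\ dom c z, 0 < chart_map c z ord0 i0 & `|chart_map c z - a| < rho].
have ga z : pos z -> [/\ dom c z, interior_pt G z, `|chart_map c z - a| < rho & devel K b dev c z].
  move=> [cz pz zr]; have zi := positive_interior cz pz.
  by split=> //; apply: good_devel => //; exact: good_interior.
(* A point of the ball with positive first coordinate, from which the others are reached by
   segments. *)
pose v0 : 'rV[R]_m := a + (rho / 2) *: delta_mx ord0 i0.
have v0p : 0 < v0 ord0 i0.
  rewrite addmxE scalemx_entry; have -> : (delta_mx ord0 i0 : 'rV[R]_m) ord0 i0 = 1 by rewrite mxE !eqxx.
  by rewrite mulr1 ltr_wpDl ?divr_gt0//; apply/(halfspaceP hm).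
have v0r : `|v0 - a| < rho.
  rewrite addrC addKr normrZ ger0_norm ?divr_ge0 ?(ltW rho0)//.
  have : `|delta_mx ord0 i0 : 'rV[R]_m| <= 1.
    by apply: mxnorm_le => // i j; rewrite mxE; case: (_ && _); rewrite ?normr0 ?normr1 ?ler01.
  have := normr_ge0 (delta_mx ord0 i0 : 'rV[R]_m); move: (`|_|) => u u0 u1.
  apply: (@le_lt_trans _ _ (rho / 2)); first by rewrite ger_pMr// divr_gt0.
  by rewrite ltr_pdivrMr// mulr_natr mulr2n ltrDl.
move: v0 v0p v0r => v0 v0p v0r.
have param_pos (v : 'rV[R]_m) : 0 < v ord0 i0 -> `|v - a| < rho -> pos (param c v) /\ chart_map c (param c v) = v.
  move=> vp vr; have [|cv vE] := param_chart _ (pos_halfspace vp) (c := c); first exact: srO (ltW vr).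
  by split=> //; split; rewrite ?vE.
have [pz0 z0E] := param_pos v0 v0p v0r.
have [C [HC A0]] := agree_exists HTh (ga _ pz0).
have agreeC z : pos z -> \forall x \near z, dev x = usubmx (Th (chart_map c x) *m C).
  move=> pz; have [cz zp zr] := pz.
  have [Cz [_ Az]] := agree_exists HTh (ga _ pz).
  pose v t := v0 + t *: (chart_map c z - v0).
  have vpos t : 0 <= t <= 1 -> 0 < v t ord0 i0 /\ `|v t - a| < rho.
    move=> t01; split; last exact: ball_convex_lt.
    rewrite addmxE scalemx_entry addmxE oppmxE; move: v0p zp t01.
    move: (v0 ord0 i0) (chart_map c z ord0 i0) => p q p0 q0 /andP[t0 t1]; nra.
  pose sig t := param c (v t).
  have sigP t (t01 : 0 <= t <= 1) : pos (sig t) /\ chart_map c (sig t) = v t.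
    by apply: param_pos; have [] := vpos t t01.
  have vc t : {for t, continuous v}.
    apply: mxcurve_continuous => i j.
    rewrite (_ : (fun s => _) = (fun s : R => v0 i j + s * (chart_map c z - v0) i j)).
      by apply: contD; [exact: cont_cst|apply: contM; [exact: cvg_id|exact: cont_cst]].
    by apply/funext => s; rewrite /v [LHS]mxE; congr (_ + _); rewrite [LHS]mxE.
  have sigc t : 0 <= t <= 1 -> {for t, continuous sig}.
    move=> t01 P nP; have [[ct _ _] E] := sigP t t01.
    have n1 := param_near ct nP; rewrite E in n1.
    have n1' : nbhs (v t) [set u : 'rV[R]_m | (img c u /\ (model_halfspace u -> dom c (param c u) /\ P (param c u))) /\
        0 < u ord0 (Ordinal hm)].
      by apply: filterI n1 (pos_near _); have [] := vpos t t01.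
    have n2 := near_cont (vc t) n1'.
    by apply: (near_mono n2) => s [[_ Hs] sp]; have [] := Hs (pos_halfspace sp).
  have [|C1 [_ HC1]] := agree_constant (b := b) (F := dev) (sigma := sig) (t0 := 0) (t1 := 1) hm HTh ltr01.
    move=> t /andP[t0 t1]; have t01 : 0 <= t <= 1 by rewrite !ltW.
    by split; [apply: ga; exact: (sigP t t01).1|exact: sigc].
  have l0 : 0 <= (0 : R) <= 1 by rewrite lexx ler01.
  have l1 : 0 <= (1 : R) <= 1 by rewrite lexx ler01.
  have s0 : sig 0 = param c v0 by rewrite /sig /v scale0r addr0.
  have s1 : sig 1 = z by rewrite /sig /v scale1r addrC subrK chart_mapK.
  have [t tt At] : exists2 t, 0 < t < 1 & \forall x \near sig t, dev x = usubmx (Th (chart_map c x) *m C).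
    have n0 : \forall t \near (0 : R), \forall x \near sig t, dev x = usubmx (Th (chart_map c x) *m C).
      have H : nbhs (sig 0) [set x' | \forall x \near x', dev x = usubmx (Th (chart_map c x) *m C)].
        by rewrite s0; exact: nbhs_interior A0.
      exact: near_cont (sigc 0 l0) H.
    by have [t tt At] := near_pick_right n0; exists t => //; move: tt; rewrite add0r.
  have [u uu Au] : exists2 u, 0 < u < 1 & \forall x \near sig u, dev x = usubmx (Th (chart_map c x) *m Cz).
    have n1 : \forall t \near (1 : R), \forall x \near sig t, dev x = usubmx (Th (chart_map c x) *m Cz).
      have H : nbhs (sig 1) [set x' | \forall x \near x', dev x = usubmx (Th (chart_map c x) *m Cz)].
        by rewrite s1; exact: nbhs_interior Az.
      exact: near_cont (sigc 1 l1) H.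
    by have [u uu Au] := near_pick_left n1; exists u => //; move: uu; rewrite subrr.
  have pt s : 0 < s < 1 -> pos (sig s) by move=> /andP[a0 a1]; apply: (sigP s _).1; rewrite !ltW.
  have -> : C = Cz; last exact: Az.
  rewrite (agree_unique hm HTh (ga _ (pt t tt)) At (HC1 t tt)).
  exact: (agree_unique hm HTh (ga _ (pt u uu)) (HC1 u uu) Au).
pose F z := usubmx (Th (chart_map c z) *m C).
exists rho, (fun v : 'rV[R]_m => Th v *m C); split=> // z cz zr.
have [zi|zi] := pselect (interior_pt G z).
  by apply: (nbhs_singleton (agreeC z _)); split=> //; exact: interior_pos.
have zx : z <> x0 by move=> E; apply: zi; rewrite E.
have [[/zx//]|[_ [gamma Hg Hw]]] := log_toP z.
have [_ g1 Hat] := Hg; have xz : x0 <> z by move=> E; exact: zx (esym E).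
have dF : devel K b F c z.
  exists (rho - `|chart_map c z - a|), (fun v : 'rV[R]_m => Th v *m C); split=> //.
  exact: local_frame_shift HC zr.
have i11 : 0 <= (1 : R) <= 1 by rewrite ler01 lexx.
have cg1 : dom c (gamma 1) by rewrite g1.
have A1 := Hat c 1 i11 cg1.
have near1 (P : set M) : nbhs z P -> \forall s \near (1 : R), 0 <= s <= 1 -> P (gamma s).
  by move=> nP; apply: (arc_cont i11 A1); rewrite g1.
have zr' : 0 < rho - `|chart_map c z - a| by rewrite subr_gt0.
have /nbhs_ballP[r /= r0 Hr] := near1 _ (chart_near cz (ball_near (chart_map c z) zr')).
pose s0 := Num.max (1 / 2) (1 - r).
have s01 : s0 < 1 by rewrite gt_max ltrBlDr ltrDl r0 andbT; lra.
have s0p : 0 < s0 by rewrite lt_max; apply/orP; left; lra.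
apply: (near_eq_lim (E1 := dev \o gamma) (E2 := F \o gamma) s01).
- move=> t /andP[t0 t1]; have tp : 0 < t by exact: lt_trans s0p t0.
  have [ct tr] : dom c (gamma t) /\ `|chart_map c (gamma t) - chart_map c z| < rho - `|chart_map c z - a|.
    apply: Hr; last by rewrite !ltW.
    rewrite -ball_normE/= ger0_norm ?subr_ge0 ?(ltW t1)//; move: t0; rewrite gt_max => /andP[_].
    by lra.
  apply: (nbhs_singleton (agreeC (gamma t) _)); split=> //.
    by apply: interior_pos => //; apply: (arc_interior hconvex xz Hg); rewrite tp.
  by apply: le_lt_trans (ler_distD (chart_map c z) _ _) _; rewrite -ltrBrDr.
- move=> e e0; have n1 := near_cont (@model_ray_continuous _ _ g0 K (log_to z) 1) (ball_near (model_exp g0 K (1 *: log_to z)) e0).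
  have n0 : \forall s \near (1 : R), 0 < s by exact: lt_nbhsr.
  apply: (near_mono (filterI n0 n1)) => s [sp Hs] s1.
  have ss : 0 <= s <= 1 by rewrite !ltW.
  by rewrite /= (dev_arc zx Hg Hw ss); move: Hs; rewrite scale1r.
- move=> e e0; have n0 : \forall s \near (1 : R), 0 < s by exact: lt_nbhsr.
  apply: (near_mono (filterI n0 (near1 _ (devel_near_cont cz dF e0)))) => s [sp Hs] s1.
  by apply: Hs; rewrite !ltW.
Qed.

End Development.

Section CurveContinuity.
Context {R : realType}.

Lemma scalemx_continuous p q (f : R -> R) (A : R -> 'M[R]_(p, q)) (t : R) :
  {for t, continuous f} -> {for t, continuous A} -> {for t, continuous (fun s => f s *: A s)}.
Proof. by move=> cf cA; apply: cvgZ. Qed.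

Lemma mulmx_continuous p q r (A : R -> 'M[R]_(p, q)) (B : R -> 'M[R]_(q, r)) (t : R) :
  {for t, continuous A} -> {for t, continuous B} -> {for t, continuous (fun s => A s *m B s)}.
Proof.
move=> cA cB; apply: mxcurve_continuous => i j.
rewrite (_ : (fun s => _) = (fun s => \sum_k A s i k * B s k j)); last by apply/funext => s; rewrite mxE.
apply: cont_sum => k; apply: contM.
  exact: (cont_comp cA (@cont_coord R _ _ i k (A t))).
exact: (cont_comp cB (@cont_coord R _ _ k j (B t))).
Qed.

Lemma cont_right_const (V : normedModType R) (P : R -> V) (l : V) (t : R) : {for t, continuous P} ->
  (\forall u \near t, t < u -> P u = l) -> P t = l.
Proof.
move=> cP H; apply/eqP; rewrite -subr_eq0 -normr_le0; apply/ler_addgt0Pl => e e0; rewrite addr0.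
have n1 : \forall u \near t, `|P u - P t| < e by have := near_cont cP (ball_near (P t) e0).
have [u /andP[tu _] [Hu Hu']] := near_pick_right (filterI n1 H).
by rewrite -(Hu' tu) distrC ltW.
Qed.

End CurveContinuity.

(** * Development from an arbitrary point *)

Section ArcFrame.
Context {R : realType} {m : nat}.
Hypothesis hm : (0 < m)%N.
Context {M : topologicalType}.
Variables (G : riemannian_manifold R m M) (K : R).
Hypothesis hcurv : constant_sectional_curvature G K.
Hypothesis K0 : K <= 0.
Hypothesis hconvex : convex_manifold G.
Variables (b : 'M[R]_(1 + m)) (F : M -> 'rV[R]_(1 + m)).
Hypothesis HF : forall y, devel K b F (chart_at G y) y.

Definition gram (x : M) : 'M[R]_m := metric (chart_at G x) (chart_map (chart_at G x) x).

Lemma gram_pos x (u : 'rV[R]_m) : u != 0 -> 0 < (u *m gram x *m u^T) ord0 ord0.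
Proof. by move=> u0; apply: metric_pos => //; apply: chart_map_img; exact: chart_atP. Qed.

(** The values of [gamma] at negative times mean nothing, so the hyperbola is solved on (0, 1), and
    its position and velocity at 0 are found as right limits by means of the lift [xi]. This works
    at boundary points x as well. *)
Lemma arc_frame x T gamma y w (s : R) : x <> y -> devel_at K b T F (chart_at G x) x ->
  geodesic_arc G gamma x y -> initial_velocity G gamma w -> 0 < s <= 1 ->
  F (gamma s) = model_exp (gram x) K (s *: w) *m T.
Proof.
move=> xy HT Hg Hw; have cx := chart_atP G x; set c := chart_at G x in HT cx *.
have [g00 g1 Hat] := Hg.
have [xi [w' [Hxi xiw Hw']]] := arc_velocity Hg.
have {w' Hw'}xiw : derive1 xi 0 = w by rewrite xiw; exact: velocity_unique (fun _ _ => erefl) Hw' Hw.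
have [rho [Th [HTh ThT FE]]] := HT.
have [[rho0 _ _] Hth] := HTh; set a := chart_map c x in HTh Hth ThT FE rho0.
have [d1 d2 Hxi0] := nbhs_singleton Hxi.
have i00 : 0 <= (0 : R) <= 1 by rewrite lexx ler01.
have [_ xi0 _] := Hxi0 i00; rewrite g00 -/c -/a in xi0.
have aa : `|a - a| < rho by rewrite subrr normr0.
have [pT Tb uT] := Hth a aa (chart_regular cx).2.
rewrite ThT in Tb uT.
pose E := F \o gamma.
have hypE t : 0 < t < 1 -> hyper_at b E t.
  move=> tt; apply: (devel_hyper hcurv K0 (HF (gamma t))).
  apply: arc_geod => //; apply: Hat; last exact: chart_atP.
  by case/andP: tt => t0 t1; rewrite !ltW.
have [th th0 HE] := hyper_const ltr01 hypE.
have Hsol s' t := hyper_solution (fun u uu => let: And3 a1 a2 _ := HE u uu in conj a1 a2) (s := s') (t := t).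
pose A u := usubmx (Th (xi u)).
pose B u : 'rV[R]_(1 + m) := row_mx 0 (derive1 xi u) *m Th (xi u).
have n1 : \forall u \near (0 : R), `|xi u - a| < rho.
  by have := near_cont (derivable_curve_continuous d1) (ball_near (xi 0) rho0); rewrite -xi0.
have n2 : \forall u \near (0 : R), u < 1 by exact: lt_nbhsl.
have nE : \forall u \near (0 : R), 0 < u -> u < 1 /\ E u = A u.
  apply: (near_mono (filterI n2 (filterI n1 Hxi))) => u [u1 [ur [_ _ Hu]]] u0; split=> //.
  have uu : 0 <= u <= 1 by rewrite !ltW.
  by have [cu uE _] := Hu uu; rewrite /E /A/= FE ?uE.
have nE' : \forall u \near (0 : R), 0 < u -> derive1 E u = B u.
  apply: (near_mono (filterI (near_near nE) (filterI n2 (filterI n1 Hxi)))) => u [nu [u1 [ur [d1u _ Hu]]]] u0.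
  have uu : 0 <= u <= 1 by rewrite !ltW.
  have [cu uE _] := Hu uu.
  have Hxu : model_halfspace (xi u) by rewrite -uE; exact: (chart_regular cu).2.
  have [pu _ _] := Hth _ ur Hxu.
  have np : \forall v \near u, 0 < v by exact: lt_nbhsr.
  have nAE : \forall v \near u, A v = E v.
    by apply: (near_mono (filterI np nu)) => v [v0 /(_ v0)[_ ->]].
  have [_ dE'] := is_derive_near nAE (curve_dev1 pu d1u).
  by rewrite derive1E dE'.
have cTh : {for 0, continuous (fun u => Th (xi u))}.
  apply: (cont_comp (derivable_curve_continuous d1)); rewrite -xi0; exact: parallel_continuous pT.
have cA : {for 0, continuous A}.
  apply: mxcurve_continuous => i j.
  rewrite (_ : (fun s => _) = (fun s => (Th (xi s)) (lshift m i) j)); last by apply/funext => u; rewrite /A [LHS]mxE.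
  exact: (cont_comp cTh (@cont_coord R _ _ _ _ _)).
have cB : {for 0, continuous B}.
  apply: mulmx_continuous cTh.
  apply: mxcurve_continuous => i j; have c2 := derivable_curve_continuous d2.
  case: (split_ordP j) => k ->.
    by rewrite (_ : (fun s => _) = fun=> 0); [exact: cont_cst|apply/funext => u; rewrite row_mxEl mxE].
  rewrite (_ : (fun s => _) = (fun s => derive1 xi s i k)); last by apply/funext => u; rewrite row_mxEr.
  exact: (cont_comp c2 (@cont_coord R _ _ _ _ _)).
have A0 : A 0 = usubmx T by rewrite /A -xi0 ThT.
have B0 : B 0 = row_mx 0 w *m T by rewrite /B -xi0 ThT xiw.
(* th^2 = - E' b E'^T on (0, 1), and its limit at 0 is - K |w|^2 because T b T^T = [frame_form]. *)
have thw : th = speed (gram x) K w.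
  have cQ : {for 0, continuous (fun u => B u *m b *m (B u)^T)}.
    apply: mulmx_continuous; first by apply: mulmx_continuous cB _; exact: cvg_cst.
    apply: mxcurve_continuous => i j.
    rewrite (_ : (fun s => _) = (fun s => B s j i)); last by apply/funext => u; rewrite mxE.
    exact: (cont_comp cB (@cont_coord R _ _ _ _ _)).
  have EQ : B 0 *m b *m (B 0)^T = (- th ^+ 2)%:M.
    apply: (cont_right_const cQ).
    apply: (near_mono (filterI n2 nE')) => u [u1 Eu] u0; rewrite -(Eu u0).
    by have [|_ _] := HE u; rewrite ?u0.
  apply/eqP; rewrite -(eqrXn2 (n := 2))// ?speed_ge0//; apply/eqP.
  rewrite speed_sqr//; last exact: gram_pos.
  move: EQ; rewrite B0 trmx_mul !mulmxA -[_ *m T *m b]mulmxA -[_ *m (T *m b) *m T^T]mulmxA Tb.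
  rewrite /frame_form tr_row_mx mul_row_block mul_row_col !mul0mx mulmx0 !add0r trmx0 mulmx0 add0r.
  rewrite -/(gram x) -scalemxAr -scalemxAl => /matrixP/(_ ord0 ord0).
  rewrite scalemx_entry [RHS]mxE eqxx mulr1n => Eq; have -> : th ^+ 2 = - - th ^+ 2 by rewrite opprK.
  by rewrite -Eq mulNr.
have main t : 0 < t < 1 -> F (gamma t) = model_exp (gram x) K (t *: w) *m T.
  (* For small u > 0, P u is F (gamma t) by [hyper_solution]; [A] and [B] continue E and E' to u =
     0. *)
  move=> tt; pose P u := coshk th (t - u) *: A u + sinhk th (t - u) *: B u.
  have dl : is_derive (0 : R) 1 (fun u : R => t - u) (-1).
    have := is_deriveB (is_derive_cst t (0 : R) (1 : R)) (is_derive_id (0 : R) (1 : R)).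
    by move=> /is_derive_eq; apply; rewrite sub0r.
  have cl : {for (0 : R), continuous (fun u : R => t - u)}.
    by apply: cvgB; [exact: cvg_cst|exact: cvg_id].
  have cc u : {for u, continuous (coshk th)}.
    by apply/differentiable_continuous/derivable1_diffP; have [] := coshk_derive th u.
  have cs u : {for u, continuous (sinhk th)}.
    by apply/differentiable_continuous/derivable1_diffP; have [] := sinhk_derive th u.
  have cP : {for 0, continuous P}.
    apply: (@cvgD _ 'rV[R]_(1 + m)).
      exact: (scalemx_continuous (cont_comp cl (cc _)) cA).
    exact: (scalemx_continuous (cont_comp cl (cs _)) cB).
  have <- : P 0 = F (gamma t).
    apply: (cont_right_const cP).
    apply: (near_mono (filterI nE nE')) => u [Eu Eu'] u0.
    have [u1 EA] := Eu u0; rewrite /P -EA -(Eu' u0) -[RHS]/(E t).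
    by rewrite -(Hsol t u)// u0.
  rewrite /P subr0 A0 B0 model_exp_ray -thw.
  by rewrite -{1 2 3}(vsubmxK T) col_mxKu !mul_row_col mul0mx add0r mul_scalar_mx -scalemxAl.
case/andP=> s0; rewrite le_eqVlt => /predU1P[->|s1]; last by apply: main; rewrite s0.
apply: (near_eq_lim (E1 := E) (E2 := fun t => model_exp (gram x) K (t *: w) *m T) ltr01 main).
- have i11 : 0 <= (1 : R) <= 1 by rewrite ler01 lexx.
  have A1 := Hat (chart_at G (gamma 1)) 1 i11 (chart_atP G (gamma 1)).
  move=> e e0; have n0 : \forall s \near (1 : R), 0 < s by exact: lt_nbhsr.
  have n3 := arc_cont i11 A1 (devel_near_cont (chart_atP G (gamma 1)) (HF (gamma 1)) e0).
  apply: (near_mono (filterI n0 n3)) => u [u0 Hu] u1.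
  by apply: Hu; rewrite !ltW.
- move=> e e0; have c1 : {for (1 : R), continuous (fun t : R => model_exp (gram x) K (t *: w) *m T)}.
    by apply: mulmx_continuous; [exact: model_ray_continuous|exact: cvg_cst].
  have n3 := near_cont c1 (ball_near (model_exp (gram x) K (1 *: w) *m T) e0).
  exact: (near_mono n3).
Qed.

End ArcFrame.

(** * Half-spaces and Helly's theorem *)

Section Cone.
Context {R : realType} {m : nat}.
Hypothesis hm : (0 < m)%N.
Context {M : ptopologicalType}.
Variables (G : riemannian_manifold R m M) (K : R).
Hypothesis hcurv : constant_sectional_curvature G K.
Hypothesis K0 : K <= 0.
Hypothesis hconvex : convex_manifold G.
Variables (b : 'M[R]_(1 + m)) (F : M -> 'rV[R]_(1 + m)) (T : M -> 'M[R]_(1 + m)).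
Hypothesis HT : forall y, devel_at K b (T y) F (chart_at G y) y.
Hypothesis HF1 : forall y, 1 <= lsubmx (F y) ord0 ord0.
Implicit Types (x y z : M) (l : 'cV[R]_(1 + m)) (w v : 'rV[R]_m).

Let HF y : devel K b F (chart_at G y) y.
Proof. by apply/devel_atP; exists (T y). Qed.

Lemma frame_facts x : [/\ T x \in unitmx, T x *m b *m (T x)^T = block_mx 1%:M 0 0 (K *: gram G x) &
  usubmx (T x) = F x].
Proof.
have [rho [Th [[[rho0 _ _] Hth] ThT FE]]] := HT x; have cx := chart_atP G x.
have aa : `|chart_map (chart_at G x) x - chart_map (chart_at G x) x| < rho by rewrite subrr normr0.
have [_ Tb uT] := Hth _ aa (chart_regular cx).2.
by rewrite ThT in Tb uT; split=> //; rewrite FE// ThT.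
Qed.

Definition value l y : R := (F y *m l) ord0 ord0.

(** The functional that vanishes at F x and takes the value g(w, v) on the image of a tangent vector
    w: the rows of [T x] are F x and the images of the coordinate vectors. *)
Definition normal x v : 'cV[R]_(1 + m) := invmx (T x) *m col_mx 0 (gram G x *m v^T).

Lemma value_normal_base x v : value (normal x v) x = 0.
Proof.
rewrite /value /normal mulmxA; have [uT _ <-] := frame_facts x.
have -> : usubmx (T x) = row_mx 1%:M 0 *m T x by rewrite -{2}(vsubmxK (T x)) mul_row_col mul1mx mul0mx addr0.
by rewrite mulmxK// mul_row_col mulmx0 mul0mx addr0 mxE.
Qed.

Lemma arc_value x y w gamma (t : R) : x <> y -> geodesic_arc G gamma x y -> initial_velocity G gamma w ->
  0 < t <= 1 -> F (gamma t) = coshk (speed (gram G x) K w) t *: F x +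
    sinhk (speed (gram G x) K w) t *: (row_mx 0 w *m T x).
Proof.
move=> xy Hg Hw tt; rewrite (arc_frame hcurv K0 HF xy (HT x) Hg Hw tt) model_exp_ray.
have [_ _ <-] := frame_facts x.
by rewrite -{1 3}(vsubmxK (T x)) !mul_row_col mul0mx add0r mul_scalar_mx -scalemxAl.
Qed.

Lemma value_normal_arc x y w v gamma : x <> y -> geodesic_arc G gamma x y -> initial_velocity G gamma w ->
  value (normal x v) y = sinhk (speed (gram G x) K w) 1 * tangent_dot G x w v.
Proof.
move=> xy Hg Hw; have [_ g1 _] := Hg; have H := value_normal_base x v; rewrite /value in H.
have l1 : 0 < (1 : R) <= 1 by rewrite ltr01 lexx.
rewrite /value -g1 (arc_value xy Hg Hw l1) mulmxDl -!scalemxAl addmxE !scalemx_entry H mulr0 add0r.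
have [uT _ _] := frame_facts x.
by rewrite /normal mulmxA mulmxK// mul_row_col mul0mx add0r mulmxA.
Qed.

Lemma tangent_dotC x v w : tangent_dot G x v w = tangent_dot G x w v.
Proof.
have gT : (gram G x)^T = gram G x by apply: Defs.metric_sym; apply: chart_map_img; exact: chart_atP.
rewrite /tangent_dot /gdot; have -> : v *m gram G x *m w^T = (w *m gram G x *m v^T)^T.
  by rewrite !trmx_mul trmxK gT mulmxA.
by rewrite [LHS]mxE.
Qed.

Lemma tangent_dot_ge0 x w : 0 <= tangent_dot G x w w.
Proof. by apply: g0_ge0; exact: gram_pos. Qed.

Lemma tangent_norm_ge0 x w : 0 <= tangent_norm G x w.
Proof. exact: sqrtr_ge0. Qed.

Lemma tangent_cauchy_schwarz x w v : unit_tangent G x v -> `|tangent_dot G x w v| <= tangent_norm G x w.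
Proof.
move=> v1; rewrite /tangent_norm -sqrtr_sqr ler_wsqrtr//.
have vv : tangent_dot G x v v = 1 by rewrite -[LHS]sqr_sqrtr ?tangent_dot_ge0// -/(tangent_norm G x v) v1 expr1n.
pose s := tangent_dot G x w v; have := tangent_dot_ge0 x (w - s *: v).
rewrite /tangent_dot /gdot -/(gram G x) mulmxBl.
have -> : (w - s *: v)^T = w^T - s *: v^T by apply/matrixP => i j; rewrite !mxE.
rewrite mulmxBl !mulmxBr -!scalemxAl -!scalemxAr !addmxE !oppmxE.
rewrite !addmxE !oppmxE !scalemx_entry.
rewrite -![(_ *m gram G x *m _) ord0 ord0]/(tangent_dot G x _ _) vv (tangent_dotC x v w) -/s => H.
by move: H; lra.
Qed.

Lemma acos_le_pihalf (u : R) : -1 <= u <= 1 -> (acos u <= pi / 2) = (0 <= u).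
Proof.
move=> u1; have cu : cos (acos u) = u by exact: acosK.
have a0 : 0 <= acos u by exact: acos_ge0.
have ap : acos u <= pi by exact: acos_lepi.
have p0 : 0 < pi :> R by exact: pi_gt0.
apply/idP/idP => [H|].
  by rewrite -cu; apply: cos_ge0_pihalf; rewrite H andbT (le_trans _ a0)// lerNl oppr0 divr_ge0// ltW.
rewrite leNgt => /negP H; rewrite leNgt; apply/negP => H2; apply: H.
rewrite -cu -(@cos_pihalf R) ltr_cos// in_itv/= ?a0 ?ap//.
by rewrite divr_ge0 ?(ltW p0)//= ler_pdivrMr// mulr_natr mulr2n lerDl ltW.
Qed.

(** At the end of the arc with initial velocity w the functional is a positive multiple of g(w, v),
    so its sign is that of the cosine of the angle. *)
Lemma half_spaceE x v : unit_tangent G x v -> half_space G x v = [set y | 0 <= value (normal x v) y].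
Proof.
move=> v1; have key y w gamma : x <> y -> geodesic_arc G gamma x y -> initial_velocity G gamma w ->
    (tangent_angle G x w v <= pi / 2) = (0 <= value (normal x v) y).
  move=> xy Hg Hw; rewrite (value_normal_arc v xy Hg Hw) pmulr_rge0 ?sinhk1_gt0//.
  have cs := tangent_cauchy_schwarz w v1; have w0 := tangent_norm_ge0 x w.
  (* For w of length 0 the quotient is 0 and the angle pi / 2, which agrees with the value 0 of the
     functional. *)
  rewrite /tangent_angle v1 mulr1; move: cs; have [->|wn] := eqVneq (tangent_norm G x w) 0.
    by rewrite normr_le0 => /eqP ->; rewrite mul0r acos0 !lexx.
  have wp : 0 < tangent_norm G x w by rewrite lt_def wn.
  move=> cs; rewrite acos_le_pihalf; first by rewrite pmulr_lge0// invr_gt0.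
  by rewrite -ler_norml normrM normfV (ger0_norm w0) ler_pdivrMr// mul1r.
apply/seteqP; split => y /=.
  have [->|yx] := pselect (y = x); first by rewrite value_normal_base.
  by move=> [//|[gamma [w [Hg Hw]]]]; rewrite (key y w gamma)// => E; exact: yx.
have [->|yx] := pselect (y = x); first by left.
have xy : x <> y by move=> E; exact: yx.
have [[gamma Hg] _ _] := hconvex xy; have [xi [w [_ _ Hw]]] := arc_velocity Hg.
by rewrite -(key y w gamma)// => Ha; right; exists gamma, w.
Qed.

Lemma normalZ x (s : R) v : normal x (s *: v) = s *: normal x v.
Proof.
rewrite /normal scalemxAr; congr (_ *m _).
by rewrite trmxZ -scalemxAr scale_col_mx scaler0.
Qed.

Lemma normal_neq0 x v : unit_tangent G x v -> normal x v != 0.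
Proof.
move=> v1; apply/eqP => H; have [uT _ _] := frame_facts x.
have E : col_mx 0 (gram G x *m v^T) = (0 : 'cV[R]_(1 + m)) by rewrite -(mulKVmx uT (col_mx _ _)) -/(normal x v) H mulmx0.
have E2 : gram G x *m v^T = 0 by have := congr1 dsubmx E; rewrite col_mxKd => ->; apply/matrixP => i j; rewrite !mxE.
have := v1; rewrite /unit_tangent/= /tangent_norm /tangent_dot /gdot -mulmxA -/(gram G x) E2 mulmx0 mxE sqrtr0.
by move=> /esym/eqP; rewrite oner_eq0.
Qed.

(** Any hyperplane of the model through F x thus cuts M in half-spaces at x; v is recovered by
    inverting the frame and the metric. *)
Lemma exists_normal x l : l != 0 -> value l x = 0 ->
  exists v s, [/\ unit_tangent G x v, 0 < s & normal x v = s *: l].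
Proof.
move=> l0 lx; have [uT _ Fx] := frame_facts x.
pose t := T x *m l; have t0 : t != 0.
  by apply: contra l0 => /eqP H; rewrite -(mulKmx uT l) -/t H mulmx0.
have ut : usubmx t = 0.
  rewrite /t usubmx_mul mulmxA -usubmx_mul Fx; apply/matrixP => i j; rewrite (ord1 i) (ord1 j) [RHS]mxE -lx /value.
  by congr ((_ *m _) _ _); exact: val_inj.
have ug : gram G x \in unitmx by apply: posdef_unitmx => u; exact: gram_pos.
pose v := (invmx (gram G x) *m dsubmx t)^T.
have gv : gram G x *m v^T = dsubmx t by rewrite trmxK mulKVmx.
have lE : normal x v = l by rewrite /normal gv -ut vsubmxK mulKmx.
have v0 : v != 0.
  by apply: contra t0 => /eqP H; rewrite -(vsubmxK t) ut -gv H trmx0 mulmx0 col_mx0.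
have nv : 0 < tangent_norm G x v by rewrite sqrtr_gt0; exact: gram_pos.
exists ((tangent_norm G x v)^-1 *: v), (tangent_norm G x v)^-1.
split; [|by rewrite invr_gt0|by rewrite normalZ lE].
rewrite /unit_tangent/= /tangent_norm /tangent_dot /gdot trmxZ -!scalemxAl -scalemxAr !scalemx_entry.
rewrite mulrA sqrtrM ?mulr_ge0 ?invr_ge0 ?sqrtr_ge0//.
by rewrite -expr2 sqrtr_sqr ger0_norm ?invr_ge0 ?sqrtr_ge0// mulVf// gt_eqF.
Qed.

(** On the geodesic from x to y, sinhk th 1 F(gamma t) = sinhk th (1 - t) F x + sinhk th t F y, and
    the ratio of the two weights takes every positive value. *)
Lemma cone2 x y (p q : R) : 0 <= p -> 0 <= q -> exists z (s : R), 0 <= s /\ s *: F z = p *: F x + q *: F y.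
Proof.
move=> p0 q0; have [<-|xy] := pselect (x = y).
  by exists x, (p + q); rewrite addr_ge0// scalerDl.
have [->|pn] := eqVneq p 0; first by exists y, q; rewrite scale0r add0r.
have [->|qn] := eqVneq q 0; first by exists x, p; rewrite scale0r addr0.
have {}p0 : 0 < p by rewrite lt_def pn.
have {}q0 : 0 < q by rewrite lt_def qn.
have [[gamma Hg] _ _] := hconvex xy; have [xi [w [_ _ Hw]]] := arc_velocity Hg.
set th := speed (gram G x) K w.
(* At a zero of h the weights of F x and F y are in the ratio p : q. *)
pose h t := sinhk th t * p - sinhk th (1 - t) * q.
have hc : continuous h.
  have dl (t : R) : {for t, continuous (fun u : R => 1 - u)} by apply: cvgB; [exact: cvg_cst|exact: cvg_id].
  have cs u : {for u, continuous (sinhk th)} by apply: derivable_curve_continuous; have [] := sinhk_derive th u.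
  move=> t; apply: cvgB; (apply: cvgM; last exact: cvg_cst); first exact: cs.
  exact: (cont_comp (dl t) (cs _)).
have S1 : 0 < sinhk th 1 by exact: sinhk1_gt0.
have [t /andP[t0 t1] ht] : exists2 t, 0 <= t <= 1 & h t = 0.
  have [||t] := @IVT R h 0 1 0 (@ler01 R); last by rewrite in_itv/=; exists t.
    by apply: continuous_subspaceT.
  have -> : h 0 = - (sinhk th 1 * q) by rewrite /h sinhk0 mul0r sub0r subr0.
  have -> : h 1 = sinhk th 1 * p by rewrite /h subrr sinhk0 mul0r subr0.
  have hp : 0 < sinhk th 1 * p by exact: mulr_gt0.
  have hq : 0 < sinhk th 1 * q by exact: mulr_gt0.
  by rewrite ge_min le_max oppr_le0 (ltW hp) (ltW hq) orbT.
have tn : t != 0.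
  apply/eqP => E; move: ht; rewrite E /h sinhk0 mul0r sub0r subr0 => /eqP.
  by rewrite oppr_eq0 mulf_eq0 !gt_eqF.
have tp : 0 < t <= 1 by rewrite lt_def tn t0.
have St : 0 < sinhk th t by apply: sinhk_gt0; case/andP: tp.
have St' : sinhk th (1 - t) = sinhk th t * p / q.
  by apply: (mulIf qn); rewrite divfK//; move: ht => /eqP; rewrite subr_eq0 => /eqP ->.
have FyE : F y = coshk th 1 *: F x + sinhk th 1 *: (row_mx 0 w *m T x).
  have [_ g1 _] := Hg; rewrite -{1}g1; apply: (arc_value xy Hg Hw).
  by rewrite ltr01 lexx.
pose s := sinhk th 1 * q / sinhk th t.
exists (gamma t), s; split; first by rewrite divr_ge0 ?(ltW St)// mulr_ge0 ?(ltW q0)// (ltW S1).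
rewrite (arc_value xy Hg Hw tp) FyE -/th !scalerDr !scalerA addrA; congr (_ + _); last first.
  by congr (_ *: _); rewrite /s; field; rewrite gt_eqF.
rewrite -scalerDl; congr (_ *: _); rewrite /s.
have : sinhk th (1 - t) = sinhk th 1 * coshk th t - coshk th 1 * sinhk th t.
  by rewrite sinhkD sinhkN coshkN; ring.
rewrite St' => E; have Stn : sinhk th t != 0 by rewrite gt_eqF.
have E2 : sinhk th 1 * coshk th t * q = sinhk th t * p + coshk th 1 * sinhk th t * q.
  have -> : sinhk th 1 * coshk th t = sinhk th t * p / q + coshk th 1 * sinhk th t by rewrite E; ring.
  by field.
apply: (mulIf Stn); rewrite mulrDl mulrAC divfK// mulrAC E2; ring.
Qed.

Lemma cone_sum (I : Type) (r : seq I) (P : pred I) (a : I -> R) (y : I -> M) : (forall i, P i -> 0 <= a i) ->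
  exists z (s : R), 0 <= s /\ s *: F z = \sum_(i <- r | P i) a i *: F (y i).
Proof.
move=> a0; elim: r => [|i r [z [s [s0 E]]]]; first by exists point, 0; rewrite big_nil scale0r.
rewrite big_cons; case: ifP => Pi; last by exists z, s.
have [z' [s' [s'0 E']]] := cone2 (y i) z (a0 i Pi) s0.
by exists z', s'; split=> //; rewrite E' E.
Qed.

Lemma valueZ l (s : R) y : (s *: F y *m l) ord0 ord0 = s * value l y.
Proof. by rewrite -scalemxAl scalemx_entry. Qed.

Lemma value_sum l (I : Type) (r : seq I) (P : pred I) (a : I -> R) (y : I -> M) :
  ((\sum_(i <- r | P i) a i *: F (y i)) *m l) ord0 ord0 = \sum_(i <- r | P i) a i * value l (y i).
Proof. by rewrite mulmx_suml summxE; apply: eq_bigr => i _; exact: valueZ. Qed.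

(* Helly's theorem by Radon's argument: a linear relation between the vectors [F (y j)] splits
   into two equal positive combinations, and these are multiples of some [F z]. *)
Lemma helly (Q : 'cV[R]_(1 + m) -> Prop) :
  (forall k (l : 'I_k -> 'cV[R]_(1 + m)), (k <= 1 + m)%N -> (forall i, Q (l i)) ->
    exists y, forall i, 0 <= value (l i) y) ->
  forall k (l : 'I_k -> 'cV[R]_(1 + m)), (forall i, Q (l i)) -> exists y, forall i, 0 <= value (l i) y.
Proof.
move=> H0; elim=> [|k IH] l Ql; first by exists point => -[].
have [km|km] := leqP k.+1 (1 + m); first exact: H0.
(* [y j] lies in all the half-spaces except possibly the j-th. *)
have /choice[y Hy] j : exists y, forall i, i != j -> 0 <= value (l i) y.
  have [y Hy] := IH (fun i => l (lift j i)) (fun i => Ql _).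
  exists y => i; rewrite eq_sym => ij; have [i' -> _] := unlift_some ij; exact: Hy.
pose Y : 'M[R]_(k.+1, 1 + m) := \matrix_j F (y j).
(* More than 1 + m vectors in a space of dimension 1 + m: this is where the Helly number comes
   from. *)
have kY : kermx Y != 0.
  rewrite kermx_eq0; apply/negP => /eqP rY; have := rank_leq_col Y.
  by rewrite rY leqNgt km.
have /rowV0Pn[a /sub_kermxP aY a0] := kY.
have sumE : \sum_j a ord0 j *: F (y j) = 0.
  by rewrite -[RHS]aY mulmx_sum_row; apply: eq_bigr => j _; rewrite rowK.
pose P j := 0 < a ord0 j; pose N j := a ord0 j < 0.
have PN : \sum_(j | P j) a ord0 j *: F (y j) = \sum_(j | N j) (- a ord0 j) *: F (y j).
  apply/eqP; rewrite -subr_eq0 -sumrN; apply/eqP; rewrite -[RHS]sumE [RHS](bigID P)/=; congr (_ + _).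
  rewrite big_mkcond [RHS]big_mkcond; apply: eq_bigr => j _; rewrite /P /N.
  by case: (ltgtP (a ord0 j) 0) => [_|_|->]; rewrite ?scaleNr ?opprK ?scale0r.
have [z [s [s0 zE]]] := @cone_sum _ (index_enum 'I_k.+1) P (a ord0) y (fun j Pj => ltW Pj).
have zE' : s *: F z = \sum_(j | N j) (- a ord0 j) *: F (y j) by rewrite zE PN.
pose e : 'cV[R]_(1 + m) := col_mx 1%:M 0.
have ve x : value e x = lsubmx (F x) ord0 ord0.
  by rewrite /value -[F x in LHS]hsubmxK mul_row_col mulmx1 mulmx0 addr0.
have vep x : 0 < value e x by rewrite ve; apply: lt_le_trans (HF1 x).
have [j aj] : exists j, a ord0 j != 0.
  apply: contrapT => H; move: a0 => /eqP; apply; apply/matrixP => i j; rewrite (ord1 i) [RHS]mxE.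
  by apply/eqP; apply: contrapT => /negP aj; apply: H; exists j; move: aj; have -> : (0 : 'I_1) = ord0 by exact: val_inj.
(* The pole functional [e] is positive on F(M), so a nontrivial nonnegative combination cannot
   vanish; with s = 0 the point z would carry no information. *)
have sp : 0 < s.
  rewrite -(pmulr_lgt0 _ (vep z)) -valueZ.
  have [jp|jn] := ltP 0 (a ord0 j).
    rewrite zE value_sum (bigD1 j)//= ltr_pwDl ?mulr_gt0//.
    by apply: sumr_ge0 => i /andP[Pi _]; rewrite mulr_ge0 ?(ltW Pi)// ltW.
  have {}jn : N j by rewrite /N lt_def eq_sym aj.
  rewrite zE' value_sum (bigD1 j)//= ltr_pwDl ?mulr_gt0 ?oppr_gt0//.
  by apply: sumr_ge0 => i /andP[Pi _]; rewrite mulr_ge0 ?oppr_ge0 ?(ltW Pi)// ltW.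
(* If the coefficient of i is positive, [y i] does not occur in the combination over N, which
   therefore lies in the i-th half-space; otherwise the one over P does. *)
exists z => i; rewrite -(pmulr_rge0 _ sp) -valueZ.
have [ip|ip] := ltP 0 (a ord0 i).
  rewrite zE' value_sum; apply: sumr_ge0 => i' Ni'; rewrite mulr_ge0 ?oppr_ge0 ?(ltW Ni')//.
  by apply: Hy; apply: contraTneq Ni' => <-; rewrite /N -leNgt ltW.
rewrite zE value_sum; apply: sumr_ge0 => i' Pi'; rewrite mulr_ge0 ?(ltW Pi')//.
by apply: Hy; apply: contraTneq Pi' => <-; rewrite /P -leNgt.
Qed.

End Cone.

(** * Volume *)

Section BorelSets.
Context {R : realType} {T : ptopologicalType}.

Lemma borel_open (O : set T) : open O -> measurable (O : set (borel T)).
Proof. by move=> oO; exact: sub_sigma_algebra. Qed.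

Lemma borel_closed (C : set T) : closed C -> measurable (C : set (borel T)).
Proof.
move=> cC; rewrite -(setCK C); apply: (@measurableC _ (borel T)).
by apply: borel_open; exact: closed_openC.
Qed.

Lemma borel_continuous_fun (D : set (borel T)) (f : T -> R) : measurable D ->
  (forall x, D x -> {for x, continuous f}) -> measurable_fun D (f : borel T -> R).
Proof.
move=> mD cf; apply: (measurability _ (measurable_realfun.RGenOInfty.measurableE R)).
move=> _ [_ [x ->] <-].
pose O : set T := [set y | nbhs y (f @^-1` [set z | x < z])].
have -> : D `&` f @^-1` `]x, +oo[%classic = D `&` O.
  apply/seteqP; split => y [Dy /= Hy]; split=> //.
    apply: (cf y Dy); apply: open_nbhs_nbhs; split; first exact: open_gt.
    by move: Hy; rewrite in_itv/= andbT.
  by have := nbhs_singleton Hy; rewrite in_itv/= andbT.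
apply: (@measurableI _ (borel T)) => //; apply: borel_open.
by rewrite openE => y Oy; rewrite /interior; exact: nbhs_interior.
Qed.

End BorelSets.

Section Boxes.
Context {R : realType} {m : nat}.
Implicit Types (a b y u : 'rV[R]_m).

Definition box a b : set 'rV[R]_m := [set y | forall i, a ord0 i <= y ord0 i <= b ord0 i].

Definition boxes : set (set 'rV[R]_m) := [set X | exists a b, X = box a b].

Lemma box_closed a b : closed (box a b).
Proof.
have -> : box a b = \bigcap_(i in [set: 'I_m]) ((fun y : 'rV[R]_m => y ord0 i) @^-1` `[a ord0 i, b ord0 i]%classic).
  apply/seteqP; split => y /= H i; first by move=> _ /=; rewrite in_itv/=; exact: H.
  by have := H i I; rewrite /= in_itv.
apply: closed_bigI => i _; apply: preimage_closed; last exact: interval_closed.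
by move=> y _; exact: coord_continuous.
Qed.

Lemma box_setI a b a' b' : box a b `&` box a' b' =
  box (\row_i Num.max (a ord0 i) (a' ord0 i)) (\row_i Num.min (b ord0 i) (b' ord0 i)).
Proof.
apply/seteqP; split => y; first by move=> [H1 H2] i; rewrite !mxE ge_max le_min; have /andP[-> ->] := H1 i; have /andP[-> ->] := H2 i.
move=> H; split=> i; have := H i; rewrite !mxE ge_max le_min => /andP[/andP[h1 h2] /andP[h3 h4]].
  by rewrite h1.
by rewrite h2.
Qed.

Lemma box_norm a (r : R) : 0 <= r -> box (a - const_mx r) (a + const_mx r) = [set y | `|y - a| <= r].
Proof.
move=> r0; apply/seteqP; split => y /= H.
  apply: mxnorm_le => // i j; rewrite (ord1 i); have := H j.
  rewrite !mxE ler_norml; have -> : (0 : 'I_1) = ord0 by exact: val_inj.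
  by move: (y ord0 j) (a ord0 j) => p q; lra.
move=> j; have : `|(y - a) ord0 j| <= r by apply: le_trans H; exact: ler_mxentry.
rewrite !mxE ler_norml; by move: (y ord0 j) (a ord0 j) => p q; lra.
Qed.

(** An open set is the union of the countably many boxes with rational centre and radius 1 / (n + 1)
    that it contains, enumerated by [unpickle]. *)
Lemma open_boxes (O : set 'rV[R]_m) : open O -> <<s boxes >> O.
Proof.
move=> oO; pose B (k : nat) : set 'rV[R]_m :=
  if @unpickle ('rV[rat]_m * nat)%type k is Some (q, n) then
    let X := box (map_mx ratr q - const_mx (n.+1%:R^-1)) (map_mx ratr q + const_mx (n.+1%:R^-1)) in
    if pselect (X `<=` O) then X else set0
  else set0.
have -> : O = \bigcup_k B k.
  apply/seteqP; split => [y Oy|y [k _]]; last first.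
    rewrite /B; case: unpickle => // -[q n]; by case: pselect => //= H /H.
  have /nbhs_ballP[r /= r0 Hr] := open_nbhs_nbhs (conj oO Oy).
  pose n := Num.bound (2 / r); pose e : R := n.+1%:R^-1.
  have e0 : 0 < e by rewrite invr_gt0.
  have er : e + e < r.
    have : 2 / r < n.+1%:R.
      by apply: lt_trans (archi_boundP _) _; rewrite ?divr_ge0 ?(ltW r0)// ltr_nat.
    rewrite ltr_pdivrMr// mulrC -ltr_pdivrMr// => H; by rewrite -mulr2n -mulr_natl.
  have /choice[q Hq] i : exists q : rat, y ord0 i - e < ratr q < y ord0 i + e.
    have [|q Hq] := @rat_in_itvoo R (y ord0 i - e) (y ord0 i + e); last by exists q; rewrite in_itv in Hq.
    by rewrite ltrBlDr -addrA ltrDl addr_gt0.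
  pose Q : 'rV[rat]_m := \row_i q i.
  have yQ : `|y - map_mx ratr Q| <= e.
    apply: mxnorm_le => [|i j]; first exact: ltW.
    rewrite (ord1 i) !mxE ler_norml; have := Hq j; have -> : (0 : 'I_1) = ord0 by exact: val_inj.
    by move: (y ord0 j) (ratr _) => p p' /andP[]; lra.
  exists (pickle (Q, n)) => //; rewrite /B pickleK /= box_norm ?invr_ge0//.
  case: pselect => // H; exfalso; apply: H => z /= zQ; apply: Hr; rewrite -ball_normE/=.
  have := ler_distD (map_mx ratr Q) y z; rewrite (distrC (map_mx ratr Q) z); move: yQ zQ er; rewrite -/e; lra.
apply: sigma_algebra_bigcup => k; rewrite /B; case: unpickle => [[q n]|]; last exact: sigma_algebra0.
case: pselect => _ /=; last exact: sigma_algebra0.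
by apply: sub_sigma_algebra; exists (map_mx ratr q - const_mx (n.+1%:R^-1)), (map_mx ratr q + const_mx (n.+1%:R^-1)).
Qed.

Lemma borel_boxes : @measurable _ (borel 'rV[R]_m) = <<s boxes >>.
Proof.
apply/seteqP; split.
  by apply: smallest_sub; [exact: smallest_sigma_algebra|exact: open_boxes].
apply: smallest_sub; first exact: smallest_sigma_algebra.
by move=> _ [a [b ->]]; apply: borel_closed; exact: box_closed.
Qed.

Section Lebesgue.
Variable lambda : {measure set (borel 'rV[R]_m) -> \bar R}.
Hypothesis hl : is_lebesgue lambda.

Lemma box_finite a b : (lambda (box a b) < +oo)%E.
Proof.
have [ab|ab] := pselect (forall i, a ord0 i <= b ord0 i); first by rewrite (hl ab) ltry.
have -> : box a b = set0; last by rewrite measure0.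
by apply/seteqP; split => // y H; apply: ab => i; have /andP[h1 h2] := H i; exact: le_trans h2.
Qed.

Lemma shift_measurable u : measurable_fun setT ((fun y => y + u) : borel 'rV[R]_m -> borel 'rV[R]_m).
Proof.
apply: (measurability _ (erefl : @measurable _ (borel 'rV[R]_m) = <<s (@open 'rV[R]_m) >>)).
move=> _ [W oW <-]; rewrite setTI; apply: borel_open.
have : continuous (fun y : 'rV[R]_m => y + u).
  move=> y; apply: (@mxcurve_continuous R 'rV[R]_m) => i j.
  rewrite (_ : (fun s : 'rV[R]_m => _) = (fun s => s i j + u i j)); last by apply/funext => s; rewrite mxE.
  by apply: contD; [exact: cont_coord|exact: cont_cst].
by move=> /continuousP; exact.
Qed.

(** Boxes are stable under intersection and generate the Borel sets, and both measures agree on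
    them; a box with inconsistent bounds is empty, and so is its translate. *)
Lemma lebesgue_shift u (N : set 'rV[R]_m) : measurable (N : set (borel 'rV[R]_m)) ->
  lambda ((fun y => y + u) @^-1` N) = lambda N.
Proof.
move=> mN; pose mu := pushforward lambda ((fun y => y + u) : borel 'rV[R]_m -> borel 'rV[R]_m).
pose mu' : {measure set (borel 'rV[R]_m) -> \bar R} :=
  measure_function_pushforward__canonical__measure_function_Measure lambda (shift_measurable u).
pose g k : set 'rV[R]_m := box (- const_mx k%:R) (const_mx k%:R).
change (mu' N = lambda N); apply/esym.
apply: (@measure_unique _ R (borel 'rV[R]_m) boxes g borel_boxes _ _ _ lambda mu' _ _ N mN) => //.
- by move=> _ _ [a [b ->]] [a' [b' ->]]; rewrite box_setI; eexists; eexists.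
- by move=> k; eexists; eexists.
- apply/seteqP; split=> // y _; exists (Num.bound `|y|) => // i.
  have := ltW (archi_boundP (normr_ge0 y)); have := ler_mxentry y ord0 i; rewrite !mxE => h1 h2.
  by have := le_trans h1 h2; rewrite ler_norml.
- move=> _ [a [b ->]]; change (lambda (box a b) = lambda ((fun y => y + u) @^-1` box a b)); apply/esym.
  have -> : (fun y => y + u) @^-1` box a b = box (a - u) (b - u).
    by apply/seteqP; split => y /= H i; have := H i; rewrite !mxE lerBlDr lerBrDr.
  have [ab|ab] := pselect (forall i, a ord0 i <= b ord0 i); last first.
    have E c : box (a - c) (b - c) = set0.
      apply/seteqP; split => // y H; apply: ab => i; have := H i; rewrite !mxE => /andP[h1 h2].
      by have := le_trans h1 h2; rewrite lerD2r.
    by have := E 0; rewrite !subr0 => ->; rewrite E.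
  rewrite (hl ab) (@hl (a - u) (b - u)); last by move=> i; rewrite !mxE lerD2r.
  by congr (_%:E); apply: eq_bigr => i _; rewrite !mxE; ring.
- by move=> k; exact: box_finite.
Qed.

(* The translates of N by the multiples of u in (0, d) are disjoint and lie in a bounded set. *)
Lemma null_of_transverse (N : set 'rV[R]_m) u (d r : R) : measurable (N : set (borel 'rV[R]_m)) ->
  0 < d -> (forall y, N y -> `|y| <= r) ->
  (forall y s, N y -> 0 < s < d -> ~ N (y + s *: u)) -> lambda N = 0%E.
Proof.
(* Distinct shifts in (0, d), whose positive differences also lie in (0, d). *)
move=> mN d0 Nr HN; pose s (k : nat) : R := d / k.+2%:R.
have sk k : 0 < s k by rewrite divr_gt0.
have sd k : s k < d by rewrite ltr_pdivrMr// -[ltLHS]mulr1 ltr_pM2l// ltr1n.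
have smono i j : (i < j)%N -> s j < s i by move=> ij; rewrite ltr_pM2l// ltf_pV2 ?posrE// ltr_nat.
pose N' k := (fun y => y + s k *: u) @^-1` N.
have mN' k : measurable (N' k : set (borel 'rV[R]_m)).
  by rewrite -[N' k]setTI; exact: (shift_measurable (s k *: u)).
have tN : trivIset setT N'.
  have H i j y : (i < j)%N -> N' i y -> N' j y -> False.
    move=> ij Hi Hj; apply: (HN _ (s i - s j) Hj).
      by rewrite subr_gt0 smono//= (le_lt_trans _ (sd i))// gerBl ltW.
    by rewrite -addrA -scalerDl [s j + _]addrC subrK.
  apply/trivIsetP => i j _ _; rewrite neq_ltn => /orP[] ij; apply/seteqP; split => // y [Hi Hj].
    exact: (H i j y).
  exact: (H j i y).
pose C := box (- const_mx (r + d * `|u|)) (const_mx (r + d * `|u|)).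
have mC : measurable (C : set (borel 'rV[R]_m)) by apply: borel_closed; exact: box_closed.
have N'C k : N' k `<=` C.
  move=> y /Nr Hy i; rewrite !mxE -ler_norml; apply: le_trans (ler_mxentry _ _ _) _.
  rewrite -[y](addrK (s k *: u)); apply: le_trans (ler_normB _ _) _; apply: lerD => //.
  by rewrite normrZ ger0_norm ?(ltW (sk k))// ler_wpM2r// ltW.
have bound n : ((lambda N) *+ n <= lambda C)%E.
  have -> : ((lambda N) *+ n = lambda (\big[setU/set0]_(i < n) N' i))%E.
    rewrite measure_bigsetU//.
    rewrite (eq_bigr (fun=> lambda N)); last by move=> i _; exact: lebesgue_shift.
    by rewrite sumr_const card_ord.
  apply: le_measure; rewrite ?inE//; first exact: bigsetU_measurable.
  by rewrite -bigcup_mkord => y [i _]; exact: N'C.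
have fC : (lambda C < +oo)%E by exact: box_finite.
have NC : (lambda N < +oo)%E by apply: le_lt_trans (bound 1%N) fC.
have N0 : (0 <= lambda N)%E by exact: measure_ge0.
have fN : lambda N \is a fin_num by rewrite ge0_fin_numE.
have fC' : lambda C \is a fin_num by rewrite ge0_fin_numE.
have {}bound n : fine (lambda N) *+ n <= fine (lambda C).
  by rewrite -lee_fin EFin_natmul fineK// fineK.
apply/eqP; rewrite eq_le N0 andbT leNgt -(fineK fN) lte_fin; apply/negP => Np.
have := archi_boundP (divr_ge0 (fine_ge0 (measure_ge0 lambda C)) (ltW Np)).
by rewrite ltr_pdivrMr// mulr_natl ltNge bound.
Qed.

End Lebesgue.
End Boxes.

Section PosdefDet.
Context {R : realType} {m : nat}.

Lemma det_continuous (X : R -> 'M[R]_m) (t : R) : {for t, continuous X} -> {for t, continuous (fun s => \det (X s))}.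
Proof.
move=> cX; have key (r : seq 'I_m) (p : 'I_m -> 'I_m) : {for t, continuous (fun s => \prod_(i <- r) X s i (p i))}.
  elim: r => [|i r IH].
    by rewrite (_ : (fun x => _) = fun=> 1); [exact: cont_cst|apply/funext => x; rewrite big_nil].
  rewrite (_ : (fun x => _) = (fun x => X x i (p i) * \prod_(j <- r) X x j (p j))); last first.
    by apply/funext => x; rewrite big_cons.
  apply: contM IH; exact: (cont_comp cX (@cont_coord R _ _ i (p i) (X t))).
by apply: cont_sum => s; apply: contM; [exact: cont_cst|exact: key].
Qed.

(* Along the segment from 1 to S the determinant cannot vanish. *)
Lemma posdef_det_gt0 (S : 'M[R]_m) :
  (forall u : 'rV[R]_m, u != 0 -> 0 < (u *m S *m u^T) ord0 ord0) -> 0 < \det S.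
Proof.
move=> Sp; pose X (t : R) : 'M[R]_m := t *: S + (1 - t) *: 1%:M.
have Xu t : 0 <= t <= 1 -> \det (X t) != 0.
  move=> /andP[t0 t1]; have : X t \in unitmx; last by rewrite unitmxE unitfE.
  apply: posdef_unitmx => u u0.
  rewrite mulmxDr mulmxDl -!scalemxAr mulmx1 -!scalemxAl addmxE !scalemx_entry.
  have uu : 0 < (u *m u^T) ord0 ord0.
    rewrite mxE; have [k uk] : exists k, u ord0 k != 0.
      apply: contrapT => H; move: u0 => /eqP; apply; apply/matrixP => i k; rewrite (ord1 i) [RHS]mxE.
      apply/eqP; apply: contrapT => /negP uk; apply: H; exists k; move: uk.
      by have -> : (0 : 'I_1) = ord0 by exact: val_inj.
    rewrite (bigD1 k)//= mxE ltr_pwDl//; first by rewrite -expr2 exprn_even_gt0.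
    by apply: sumr_ge0 => j _; rewrite mxE -expr2 sqr_ge0.
  have := Sp u u0; move: ((u *m S *m u^T) ord0 ord0) ((u *m u^T) ord0 ord0) uu => p q q0 p0.
  have [->|tn] := eqVneq t 0; first by rewrite mul0r subr0 mul1r add0r.
  have tp : 0 < t by rewrite lt_def tn.
  by rewrite ltr_pwDl ?mulr_gt0// mulr_ge0 ?subr_ge0// ltW.
have cX t : {for t, continuous X}.
  apply: mxcurve_continuous => i j.
  rewrite (_ : (fun s => _) = (fun s : R => s * S i j + (1 - s) * (1%:M : 'M[R]_m) i j)); last first.
    by apply/funext => s; rewrite /X [LHS]mxE; congr (_ + _); rewrite [LHS]mxE.
  apply: contD; apply: contM; try exact: cont_cst; first exact: cvg_id.
  by apply: cvgB; [exact: cvg_cst|exact: cvg_id].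
have X1 : X 1 = S by rewrite /X subrr scale0r addr0 scale1r.
have X0 : X 0 = 1%:M by rewrite /X subr0 scale0r add0r scale1r.
rewrite ltNge; apply/negP => S0.
have [||t tt Ht] := @IVT R (fun t => \det (X t)) 0 1 0 (@ler01 R).
- by apply: continuous_subspaceT => t; exact: det_continuous.
- by rewrite X0 X1 det1 ge_min le_max S0 ler01 !orbT.
- by move: tt; rewrite in_itv/= => tt; have := Xu t tt; rewrite Ht eqxx.
Qed.

End PosdefDet.

Section CompactCover.
Context {M : ptopologicalType}.

(** Passes from a local property to the whole of a compact space through a finite subcover. Where
    the union step needs measurability, openness of the set is made part of P. *)
Lemma compact_open_ind (P : set M -> Prop) : compact [set: M] ->
  (forall x, exists2 O, open O /\ O x & P O) -> P set0 -> (forall A B, P A -> P B -> P (A `|` B)) ->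
  P [set: M].
Proof.
move=> cM HP P0 PU; have /choice[f Hf] x : exists O, (open O /\ O x) /\ P O.
  by have [W HW PW] := HP x; exists W.
move: cM; rewrite compact_cover => /(_ M setT f)[|x _|D' _ D'c].
- by move=> x _; exact: (Hf x).1.1.
- by exists x => //; exact: (Hf x).1.2.
have H (s : seq M) : P (fun z => exists2 y, y \in s & f y z).
  elim: s => [|y s IH].
    by rewrite (_ : (fun z => _) = set0)//; apply/seteqP; split => // z [y].
  rewrite (_ : (fun z => _) = f y `|` (fun z => exists2 y, y \in s & f y z)).
    by apply: PU => //; exact: (Hf y).2.
  apply/seteqP; split => z.
    by move=> [y']; rewrite inE => /predU1P[->|y's] Hz; [left|right; exists y'].
  by move=> [Hz|[y' y's Hz]]; [exists y; rewrite // inE eqxx|exists y'; rewrite // inE y's orbT].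
rewrite (_ : [set: M] = (fun z => exists2 y, y \in finmap.enum_fset D' & f y z)); first exact: H.
by apply/seteqP; split => // z _; have [y yD fy] := D'c z I; exists y.
Qed.

End CompactCover.

Section Volume.
Context {R : realType} {m : nat}.
Hypothesis hm : (0 < m)%N.
Context {M : ptopologicalType}.
Variables (G : riemannian_manifold R m M).
Variable vol : {measure set (borel M) -> \bar R}.
Variable lambda : {measure set (borel 'rV[R]_m) -> \bar R}.
Hypothesis hl : is_lebesgue lambda.
Hypothesis hvolE : forall (c : chart G) (B : set (borel M)), measurable B -> B `<=` dom c ->
  vol B = (\int[lambda]_(y in chart_map c @` B) (Num.sqrt (\det (metric c y)))%:E)%E.
Implicit Types (c : chart G) (x z : M) (y v u : 'rV[R]_m).

Lemma halfspace_closed : closed (@model_halfspace R m).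
Proof.
have -> : @model_halfspace R m = (fun y : 'rV[R]_m => y ord0 (Ordinal hm)) @^-1` [set r | 0 <= r].
  by apply/seteqP; split => y /= /(halfspaceP hm).
apply: preimage_closed; last exact: closed_ge.
by move=> y _; exact: coord_continuous.
Qed.

Lemma chart_image_open c (O : set M) : open O -> O `<=` dom c ->
  measurable (chart_map c @` O : set (borel 'rV[R]_m)).
Proof.
move=> oO Oc; pose W : set 'rV[R]_m := [set v | nbhs v [set v' | img c v' /\
  (model_halfspace v' -> dom c (param c v') /\ O (param c v'))]].
have -> : chart_map c @` O = W `&` model_halfspace.
  apply/seteqP; split => v.
    move=> [x Ox <-]; split; last exact: (chart_regular (Oc _ Ox)).2.
    by apply: param_near; [exact: Oc|exact: open_nbhs_nbhs].
  move=> [/nbhs_singleton[Iv Hv] hv]; have [dv Ov] := Hv hv.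
  by exists (param c v) => //; rewrite paramK.
apply: (@measurableI _ (borel 'rV[R]_m)); last by apply: borel_closed; exact: halfspace_closed.
by apply: borel_open; rewrite openE => v Wv; exact: nbhs_interior Wv.
Qed.

(** Images of arbitrary Borel sets are avoided: injectivity of the chart writes this one as a
    difference of images of open sets. *)
Lemma chart_image_borel c (O C : set M) : open O -> O `<=` dom c -> closed C ->
  measurable (chart_map c @` (O `&` C) : set (borel 'rV[R]_m)).
Proof.
move=> oO Oc cC.
have -> : chart_map c @` (O `&` C) = chart_map c @` O `\` chart_map c @` (O `&` ~` C).
  apply/seteqP; split => v.
    move=> [x [Ox Cx] <-]; split; first by exists x.
    by move=> [z [Oz Cz] E]; apply: Cz; rewrite (chart_map_inj (Oc _ Oz) (Oc _ Ox) E).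
  by move=> [[x Ox <-] H]; exists x => //; split=> //; apply: contrapT => nC; apply: H; exists x.
apply: (@measurableD _ (borel 'rV[R]_m)); first exact: chart_image_open.
apply: chart_image_open; last by move=> x [/Oc].
by apply: openI => //; exact: closed_openC.
Qed.

Lemma density_continuous c y : img c y -> {for y, continuous (fun v => Num.sqrt (\det (metric c v)))}.
Proof.
move=> Iy; have gC k i j : Ck_on k (img c) (fun y => metric c y i j).
  by apply: Ck_entry; [exact: img_open|exact: metric_smooth].
have cdet := Ck_det (k := 0) (@img_open _ _ _ _ c) (gC 0%N) y Iy.
exact: (cont_comp cdet (@sqrt_continuous R _)).
Qed.

Lemma density_measurable c (D : set (borel 'rV[R]_m)) : measurable D -> D `<=` img c ->
  measurable_fun D ((fun y : 'rV[R]_m => (Num.sqrt (\det (metric c y)))%:E) : borel 'rV[R]_m -> \bar R).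
Proof.
move=> mD Dc; apply/measurable_EFinP; apply: borel_continuous_fun => // y /Dc.
exact: density_continuous.
Qed.

Lemma density_gt0 c x : dom c x -> 0 < Num.sqrt (\det (metric c (chart_map c x))).
Proof. by move=> cx; rewrite sqrtr_gt0; apply: posdef_det_gt0 => u; apply: metric_pos; exact: chart_map_img. Qed.

(** Taken as an interior so that openness is immediate; [chart_ballP] shows that nothing is lost. *)
Definition chart_ball c x (r : R) : set M := [set z | \forall z' \near z, dom c z' /\ `|chart_map c z' - chart_map c x| < r].

Lemma chart_ball_open c x r : open (chart_ball c x r).
Proof. by rewrite openE => z Hz; exact: nbhs_interior Hz. Qed.

Lemma chart_ballP c x r z : chart_ball c x r z <-> dom c z /\ `|chart_map c z - chart_map c x| < r.
Proof.
split=> [/nbhs_singleton//|[cz zr]].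
apply: (chart_near cz (Q := fun v => `|v - chart_map c x| < r)).
have r' : 0 < r - `|chart_map c z - chart_map c x| by rewrite subr_gt0.
apply: filterS (ball_near (chart_map c z) r') => v Hv.
by apply: le_lt_trans (ler_distD (chart_map c z) _ _) _; rewrite -ltrBrDr.
Qed.

Lemma chart_ball_dom c x r : chart_ball c x r `<=` dom c.
Proof. by move=> z /chart_ballP[]. Qed.

Lemma chart_ball_center c x r : dom c x -> 0 < r -> chart_ball c x r x.
Proof. by move=> cx r0; apply/chart_ballP; rewrite subrr normr0. Qed.

(** In a small chart ball the density is bounded and the image lies in a box. *)
Lemma volume_locally_finite x : exists2 O, open O /\ O x & (vol O < +oo)%E.
Proof.
have cx := chart_atP G x; set c := chart_at G x in cx; set a := chart_map c x.
have Ia : img c a by have [] := chart_map_img cx.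
pose C := Num.sqrt (\det (metric c a)) + 1.
have n1 : \forall v \near a, img c v /\ `|Num.sqrt (\det (metric c v)) - Num.sqrt (\det (metric c a))| < 1.
  apply: filterI; first by apply: open_nbhs_nbhs; split => //; exact: img_open.
  by have := near_cont (density_continuous Ia) (ball_near (Num.sqrt (\det (metric c a))) (@ltr01 R)).
have /nbhs_ballP[r /= r0 Hr] := n1.
have {}Hr v : `|v - a| < r -> img c v /\ Num.sqrt (\det (metric c v)) <= C.
  move=> vr; have [|Iv Hv] := Hr v; first by rewrite -ball_normE/= distrC.
  by split=> //; move: Hv; rewrite ltr_norml /C => /andP[_]; lra.
pose O := chart_ball c x r; have oO := @chart_ball_open c x r.
exists O; first by split=> //; exact: chart_ball_center.
have Oc := @chart_ball_dom c x r.
have mD : measurable (chart_map c @` O : set (borel 'rV[R]_m)) by exact: chart_image_open.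
have Dr v : (chart_map c @` O) v -> `|v - a| < r by move=> [z /chart_ballP[_ zr] <-].
rewrite (hvolE (borel_open oO) Oc).
have C0 : 0 <= C by rewrite addr_ge0// sqrtr_ge0.
apply: (@le_lt_trans _ _ (\int[lambda]_(y in chart_map c @` O) (cst C%:E y))%E).
  apply: ge0_le_integral => //.
  - by apply: density_measurable => // v /Dr/Hr[].
  - by move=> v /Dr/Hr[_ H]; rewrite lee_fin.
rewrite integral_cst//.
have fb := box_finite hl (a - const_mx r) (a + const_mx r).
have lb : (lambda (chart_map c @` O) <= lambda (box (a - const_mx r) (a + const_mx r)))%E.
  apply: le_measure; rewrite ?inE//; first by apply: borel_closed; exact: box_closed.
  by rewrite box_norm ?(ltW r0)// => v /Dr /ltW.
have fb2 : lambda (chart_map c @` O) \is a fin_num by rewrite ge0_fin_numE ?measure_ge0// (le_lt_trans lb).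
by rewrite -(fineK fb2) -EFinM ltry.
Qed.

Lemma volume_finite : compact [set: M] -> (vol [set: M] < +oo)%E.
Proof.
move=> cM; suff [] : open [set: M] /\ (vol [set: M] < +oo)%E by [].
apply: (compact_open_ind (P := fun A : set M => open A /\ (vol A < +oo)%E) cM).
- by move=> x; have [W [oW Wx] vW] := volume_locally_finite x; exists W.
- by split; [exact: open0|rewrite measure0 ltry].
- move=> A B [oA vA] [oB vB]; split; first exact: openU.
  apply: (@le_lt_trans _ _ (vol A + vol B)%E); last by rewrite lte_add_pinfty.
  exact: measureU2 (borel_open oA) (borel_open oB).
Qed.

(** Near an interior point the chart image contains a full box, on which the density is bounded
    below. *)
Lemma volume_pos x : interior_pt G x -> (0 < vol [set: M])%E.
Proof.
move=> xi; have cx := chart_atP G x; set c := chart_at G x in cx; set a := chart_map c x.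
have Ia : img c a by have [] := chart_map_img cx.
have ap := interior_pos hm cx xi; rewrite -/a in ap.
pose q := Num.sqrt (\det (metric c a)); have q0 : 0 < q by exact: density_gt0.
have q2 : 0 < q / 2 by rewrite divr_gt0.
have n1 : \forall v \near a, (img c v /\ `|Num.sqrt (\det (metric c v)) - q| < q / 2) /\ model_halfspace v.
  apply: filterI; first apply: filterI.
  - by apply: open_nbhs_nbhs; split => //; exact: img_open.
  - by have := near_cont (density_continuous Ia) (ball_near q q2).
  - by apply: filterS (pos_near ap) => v; exact: pos_halfspace.
have /nbhs_ballP[r /= r0 Hr] := n1.
have {}Hr v : `|v - a| < r -> [/\ img c v, model_halfspace v & q / 2 <= Num.sqrt (\det (metric c v))].
  move=> vr; have [|[Iv Hv] hv] := Hr v; first by rewrite -ball_normE/= distrC.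
  by split=> //; move: Hv; rewrite ltr_norml => /andP[+ _]; lra.
pose O := chart_ball c x r; have oO := @chart_ball_open c x r.
have Oc := @chart_ball_dom c x r.
have mD : measurable (chart_map c @` O : set (borel 'rV[R]_m)) by exact: chart_image_open.
have Dr v : (chart_map c @` O) v -> `|v - a| < r by move=> [z /chart_ballP[_ zr] <-].
pose r2 := r / 2; have r20 : 0 < r2 by rewrite divr_gt0.
pose B := box (a - const_mx r2) (a + const_mx r2).
have mB : measurable (B : set (borel 'rV[R]_m)) by apply: borel_closed; exact: box_closed.
have BO : B `<=` chart_map c @` O.
  rewrite /B box_norm ?(ltW r20)// => v /= vr; have vr' : `|v - a| < r.
    by apply: le_lt_trans vr _; rewrite /r2 ltr_pdivrMr// mulr_natr mulr2n ltrDl.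
  have [Iv hv _] := Hr v vr'; have pv := param_dom (conj Iv hv).
  by exists (param c v); rewrite ?paramK//; apply/chart_ballP; rewrite paramK.
have lB : (0 < lambda B)%E.
  rewrite (@hl (a - const_mx r2) (a + const_mx r2)); last by move=> i; rewrite !mxE lerD2l ge0_cp// ltW.
  by rewrite lte_fin prodr_gt0// => i _; rewrite !mxE; move: (a ord0 i) => p; lra.
have vO : ((q / 2)%:E * lambda B <= vol O)%E.
  rewrite (hvolE (borel_open oO) Oc) -(integral_cst lambda mB).
  have mf : measurable_fun (chart_map c @` O : set (borel 'rV[R]_m))
      ((fun y : 'rV[R]_m => (Num.sqrt (\det (metric c y)))%:E) : borel 'rV[R]_m -> \bar R).
    by apply: density_measurable => // v /Dr/Hr[].
  have mfB : measurable_fun (B : set (borel 'rV[R]_m))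
      ((fun y : 'rV[R]_m => (Num.sqrt (\det (metric c y)))%:E) : borel 'rV[R]_m -> \bar R).
    by apply: density_measurable => // v /BO/Dr/Hr[].
  apply: (@le_trans _ _ (\int[lambda]_(y in B) (Num.sqrt (\det (metric c y)))%:E)%E).
    apply: ge0_le_integral => //.
    - by move=> v _; rewrite lee_fin ltW.
    - by move=> v /BO/Dr/Hr[_ _ H]; rewrite lee_fin.
  by apply: ge0_subset_integral => //.
apply: lt_le_trans (_ : (vol O <= _)%E); last first.
  by apply: le_measure; rewrite ?inE//; exact: borel_open.
by apply: lt_le_trans vO; rewrite mule_gt0.
Qed.

End Volume.

Section NullCut.
Context {R : realType} {m : nat}.
Hypothesis hm : (0 < m)%N.
Context {M : ptopologicalType}.
Variables (G : riemannian_manifold R m M) (K : R).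
Hypothesis hcurv : constant_sectional_curvature G K.
Variables (b : 'M[R]_(1 + m)) (F : M -> 'rV[R]_(1 + m)) (T : M -> 'M[R]_(1 + m)).
Hypothesis HT : forall y, devel_at K b (T y) F (chart_at G y) y.
Variable vol : {measure set (borel M) -> \bar R}.
Variable lambda : {measure set (borel 'rV[R]_m) -> \bar R}.
Hypothesis hl : is_lebesgue lambda.
Hypothesis hvolE : forall (c : chart G) (B : set (borel M)), measurable B -> B `<=` dom c ->
  vol B = (\int[lambda]_(y in chart_map c @` B) (Num.sqrt (\det (metric c y)))%:E)%E.
Implicit Types (x y z : M) (l : 'cV[R]_(1 + m)).

Lemma value_continuous l : continuous (value F l).
Proof.
move=> y; rewrite /value (_ : (fun y => _) = (fun y => \sum_k F y ord0 k * l k ord0)); last first.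
  by apply/funext => z; rewrite mxE.
have dF : devel K b F (chart_at G y) y by apply/devel_atP; exists (T y).
apply: cont_sum => k; apply: contM; last exact: cont_cst.
exact: (cont_comp (devel_continuous (chart_atP G y) dF) (@cont_coord R _ _ ord0 k (F y))).
Qed.

Lemma cut_zero_closed l : closed [set y | value F l y = 0].
Proof.
by apply: (@preimage_closed _ _ _ [set r : R | r = 0]); [move=> y _; exact: value_continuous|exact: closed_eq].
Qed.

(** If the functional vanishes at F x, it does not vanish on all derivatives of F there, since the
    frame is invertible. Along a direction u in which it increases, lines meet the zero set at most
    once near x, and [null_of_transverse] applies. *)
Lemma cut_null_near l x : l != 0 ->
  exists2 O, open O /\ O x & vol (O `&` [set y | value F l y = 0]) = 0%E.
Proof.
move=> l0; have [vx|vx] := eqVneq (value F l x) 0; last first.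
  exists [set y | value F l y != 0].
    split=> //; apply: (@open_comp _ _ (value F l) [set r : R | r != 0]); last exact: open_neq.
    by move=> y _; exact: value_continuous.
  rewrite (_ : _ `&` _ = set0) ?measure0//; apply/seteqP; split => // y [/= H H'].
  by move: H; rewrite H' eqxx.
have cx := chart_atP G x; have [uT _ TF] := frame_facts HT x.
have [rho [Th [[[rho0 srO _] Hth] ThT FE]]] := HT x.
set c := chart_at G x in cx *; set a := chart_map c x in ThT FE srO Hth rho0.
(* The derivative of the functional at x in the direction u. *)
pose k0 (u : 'rV[R]_m) := (row_mx 0 u *m T x *m l) ord0 ord0.
have [u ku] : exists u, 0 < k0 u.
  have [u ku] : exists u, k0 u != 0.
    apply: contrapT => H; move: l0 => /eqP; apply; rewrite -(mulKmx uT l).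
    suff -> : T x *m l = 0 by rewrite mulmx0.
    rewrite -(vsubmxK (T x *m l)) usubmx_mul mulmxA -usubmx_mul TF.
    have -> : F x *m l = 0.
      apply/matrixP => i j; rewrite (ord1 i) (ord1 j) [RHS]mxE -vx /value.
      by congr ((_ *m _) _ _); exact: val_inj.
    suff -> : dsubmx (T x *m l) = 0 by rewrite col_mx0.
    apply/matrixP => i j; rewrite [RHS]mxE; apply/eqP; apply: contrapT => /negP Hi; apply: H.
    exists (delta_mx ord0 i); rewrite /k0 -mulmxA -[T x *m l]vsubmxK mul_row_col mul0mx add0r -rowE mxE.
    by move: Hi; rewrite (ord1 j); have -> : (0 : 'I_1) = ord0 by exact: val_inj.
  have [k_p|k_n|kz] := ltgtP (k0 u) 0; [|by exists u|by rewrite kz eqxx in ku].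
  exists (- u); rewrite /k0 (_ : row_mx 0 (- u) = - row_mx 0 u); last by rewrite opp_row_mx oppr0.
  by rewrite !mulNmx oppmxE oppr_gt0.
pose d (v : 'rV[R]_m) := (row_mx 0 u *m Th v *m l) ord0 ord0.
have aa : `|a - a| < rho by rewrite subrr normr0.
have [pT _ _] := Hth a aa (chart_regular cx).2.
have dc : {for a, continuous d}.
  rewrite /d (_ : (fun v : 'rV[R]_m => _) = (fun v => \sum_j (\sum_i (row_mx 0 u) ord0 i * Th v i j) * l j ord0)); last first.
    by apply/funext => v; rewrite mxE; apply: eq_bigr => j _; rewrite mxE.
  apply: cont_sum => j; apply: contM; last exact: cont_cst.
  apply: cont_sum => i; apply: contM; first exact: cont_cst.
  exact: (cont_comp (parallel_continuous pT) (@cont_coord R _ _ i j (Th a))).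
have da : 0 < d a by rewrite /d ThT.
have n1 : \forall v \near a, 0 < d v by have := near_cont dc (open_nbhs_nbhs (conj (@open_gt R 0) da)).
have /nbhs_ballP[r1 /= r10 Hr1] := n1.
pose r := Num.min rho r1; have r0 : 0 < r by rewrite lt_min rho0.
have Hr v : `|v - a| < r -> `|v - a| < rho /\ 0 < d v.
  rewrite lt_min => /andP[vr vr1]; split=> //; apply: Hr1; by rewrite -ball_normE/= distrC.
pose O := chart_ball c x r; have oO := @chart_ball_open _ _ _ _ c x r.
have Oc := @chart_ball_dom _ _ _ _ c x r.
exists O; first by split=> //; exact: chart_ball_center.
set H := [set y | value F l y = 0]; have cH : closed H by exact: cut_zero_closed.
have mN : measurable (chart_map c @` (O `&` H) : set (borel 'rV[R]_m)) by exact: chart_image_borel.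
have NP v : (chart_map c @` (O `&` H)) v ->
    [/\ `|v - a| < r, model_halfspace v, regular_set c v & (usubmx (Th v) *m l) ord0 ord0 = 0].
  move=> [z [/chart_ballP[cz zr] Hz] <-]; have [Rz hz] := chart_regular cz.
  by split=> //; rewrite -FE//; have [] := Hr _ zr.
have N0 : lambda (chart_map c @` (O `&` H)) = 0%E.
  apply: (null_of_transverse hl (u := u) (d := 1) (r := `|a| + r)) => //.
    by move=> v /NP[vr _ _ _]; rewrite -[v](subrK a) addrC; apply: le_trans (ler_normD _ _) _; rewrite lerD2l ltW.
  move=> v s /NP[vr hv _ v0] /andP[s0 _] /NP[wr hw _ w0].
  pose xi (t : R) := v + t *: (s *: u); pose f (t : R) : R := (usubmx (Th (xi t)) *m l) ord0 ord0.
  have xiE t : xi t = v + t *: (v + s *: u - v) by rewrite /xi addrAC subrr add0r.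
  have dxi t : is_derive t (1 : R) xi (s *: u).
    apply/is_derive_mxP => i j; rewrite (_ : (fun t => _) = (fun t => v i j + t * (s *: u) i j)); last first.
      by apply/funext => t'; rewrite /xi [LHS]mxE; congr (_ + _); rewrite [LHS]mxE.
    have := is_deriveD (is_derive_cst (v i j) t (1 : R)) (is_deriveM (is_derive_id t (1 : R)) (is_derive_cst ((s *: u) i j) t (1 : R))).
    by move=> /is_derive_eq; apply; rewrite add0r scaler0 add0r /GRing.scale/= mulr1.
  have xP t : 0 <= t <= 1 -> `|xi t - a| < r /\ model_halfspace (xi t).
    by move=> t01; rewrite xiE; split; [exact: ball_convex_lt|exact: halfspace_convex].
  have df (t : R) : 0 <= t <= 1 -> is_derive t (1 : R) f (s * d (xi t)).
    move=> t01; have [xr hx] := xP t t01; have [xrho _] := Hr _ xr; have [pt _ _] := Hth _ xrho hx.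
    have [dx1 dx2] := dxi t; have D1 := curve_dev1 pt dx1.
    have dl := is_derive_cst l t (1 : R).
    have /is_derive_mxP/(_ ord0 ord0) := is_derive_mulmx D1 dl.
    move=> /is_derive_eq; apply; rewrite mulmx0 addr0 derive1E dx2.
    rewrite (_ : row_mx 0 (s *: u) = s *: row_mx 0 u); last by rewrite scale_row_mx scaler0.
    by rewrite -!scalemxAl scalemx_entry.
  have [t tt||t tt E] := @MVT R f (fun t => s * d (xi t)) 0 1 ltr01.
  - by apply: df; move: tt; rewrite in_itv/= => /andP[t0 t1]; rewrite !ltW.
  - apply: continuous_in_subspaceT => t; rewrite inE/= in_itv/= => t01.
    by apply: derivable_curve_continuous; have [] := df t t01.
  move: E; rewrite /f (_ : xi 0 = v); last by rewrite /xi scale0r addr0.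
  rewrite (_ : xi 1 = v + s *: u); last by rewrite /xi scale1r.
  rewrite v0 w0 subrr subr0 mulr1 => /esym/eqP; rewrite mulf_eq0 gt_eqF//= => /eqP dz.
  have t01 : 0 <= t <= 1 by move: tt; rewrite in_itv/= => /andP[t0 t1]; rewrite !ltW.
  by have [_] := Hr _ (xP t t01).1; rewrite dz ltxx.
have mOH : measurable (O `&` H : set (borel M)).
  by apply: (@measurableI _ (borel M)); [exact: borel_open|exact: borel_closed].
have OHc : O `&` H `<=` dom c by move=> y [/Oc].
rewrite (hvolE mOH OHc).
apply: null_set_integral => //; apply: density_measurable => // v /NP[vr _ [Iv _] _]; exact: Iv.
Qed.

Lemma cut_null l : compact [set: M] -> l != 0 -> vol [set y | value F l y = 0] = 0%E.
Proof.
move=> cM l0; set H := [set y | _]; have mH : measurable (H : set (borel M)).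
  by apply: borel_closed; exact: cut_zero_closed.
suff [_] : open [set: M] /\ vol ([set: M] `&` H) = 0%E by rewrite setTI.
apply: (compact_open_ind (P := fun A : set M => open A /\ vol (A `&` H) = 0%E) cM).
- by move=> x; have [W [oW Wx] W0] := cut_null_near x l0; exists W.
- by split; [exact: open0|rewrite set0I measure0].
- move=> A B [oA A0] [oB B0]; split; first exact: openU.
  rewrite setIUl; apply: null_set_setU => //; apply: (@measurableI _ (borel M)) => //; exact: borel_open.
Qed.

End NullCut.

Section CompactMinimum.
Context {R : realType} {T : topologicalType}.

(** Asks for lower semicontinuity only: the function maximized in the fair-cut index is a minimum
    over v, known to be semicontinuous by [cut_upper_near]. *)
Lemma compact_minimum (S : set T) (f : T -> R) (B : R) : compact S -> S !=set0 ->
  (forall x, S x -> B <= f x) ->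
  (forall x c, S x -> c < f x -> \forall y \near x, S y -> c < f y) ->
  exists2 x, S x & forall y, S y -> f x <= f y.
Proof.
move=> cS [x1 Sx1] fB lsc; apply: contrapT => H.
pose i := inf (f @` S).
have hi : has_inf (f @` S) by split; [exists (f x1), x1|exists B => _ [x Sx <-]; exact: fB].
have fi x : S x -> i <= f x by move=> Sx; apply: (ge_inf hi.2); exists x.
have ilt x : S x -> i < f x.
  move=> Sx; rewrite lt_def fi// andbT; apply/eqP => E; apply: H; exists x => // y Sy.
  by rewrite E; exact: fi.
have P0 : Filter i^'+ by exact: at_right_proper_filter.
have /compact_near_coveringP/(_ R i^'+ (fun t x => S x -> t < f x)) := cS.
have HP x : S x -> \forall x' \near x & t \near i^'+, S x' -> t < f x'.
  move=> Sx; have c1 : i < (i + f x) / 2 < f x by have := ilt x Sx; lra.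
  case/andP: c1 => c1 c3; exists ([set y | S y -> (i + f x) / 2 < f y], [set t | t < (i + f x) / 2]).
    by split; [exact: lsc|exact: nbhs_right_lt].
  by move=> [y t] /= [Hy Ht] Sy; exact: lt_trans Ht (Hy Sy).
move=> /(_ _ HP) nt.
have [t [it tS]] : exists t, i < t /\ forall x, S x -> t < f x.
  near i^'+ => t; exists t; split; first by near: t; exact: nbhs_right_gt.
  have H' : S `<=` (fun x => S x -> t < f x) by near: t; exact: nt.
  by move=> x Hx; exact: (H' x Hx Hx).
by have := lb_le_inf hi.1 (fun _ '(ex_intro2 x Sx E) => eq_ind _ (fun z => t <= z) (ltW (tS x Sx)) _ E); rewrite leNgt it.
Unshelve. all: by end_near. Qed.

End CompactMinimum.

(** * The fair-cut index *)

Section FairCutIndex.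
Context {R : realType} {m : nat}.
Hypothesis hm : (0 < m)%N.
Context {M : ptopologicalType}.
Variables (G : riemannian_manifold R m M) (K : R).
Hypothesis hcurv : constant_sectional_curvature G K.
Hypothesis K0 : K <= 0.
Hypothesis hconvex : convex_manifold G.
Hypothesis hcompact : compact [set: M].
Variables (b : 'M[R]_(1 + m)) (F : M -> 'rV[R]_(1 + m)) (T : M -> 'M[R]_(1 + m)).
Hypothesis HT : forall y, devel_at K b (T y) F (chart_at G y) y.
Hypothesis HF1 : forall y, 1 <= lsubmx (F y) ord0 ord0.
Variable vol : {measure set (borel M) -> \bar R}.
Variable lambda : {measure set (borel 'rV[R]_m) -> \bar R}.
Hypothesis hl : is_lebesgue lambda.
Hypothesis hvolE : forall (c : chart G) (B : set (borel M)), measurable B -> B `<=` dom c ->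
  vol B = (\int[lambda]_(y in chart_map c @` B) (Num.sqrt (\det (metric c y)))%:E)%E.
Hypothesis hpos : (0 < vol [set: M])%E.
Implicit Types (x y z : M) (l : 'cV[R]_(1 + m)) (v u : 'rV[R]_m).

Definition volr (A : set M) : R := fine (vol A).

Definition above l (c : R) : set M := [set y | c <= value F l y].

Lemma above_measurable l c : measurable (above l c : set (borel M)).
Proof.
apply: borel_closed; apply: (@preimage_closed _ _ (value F l) [set r : R | c <= r]); last exact: closed_ge.
by move=> y _; exact: (value_continuous HT).
Qed.

Lemma volume_fin (A : set M) : measurable (A : set (borel M)) -> vol A \is a fin_num.
Proof.
move=> mA; rewrite ge0_fin_numE ?measure_ge0//.
apply: le_lt_trans (volume_finite hm hl hvolE hcompact).
by apply: le_measure; rewrite ?inE//; exact: measurableT.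
Qed.

Lemma volrE (A : set M) : measurable (A : set (borel M)) -> vol A = (volr A)%:E.
Proof. by move=> mA; rewrite fineK// volume_fin. Qed.

Lemma volr_ge0 (A : set M) : 0 <= volr A.
Proof. by apply: fine_ge0; exact: measure_ge0. Qed.

Lemma volr_le (A B : set M) : measurable (A : set (borel M)) -> measurable (B : set (borel M)) ->
  A `<=` B -> volr A <= volr B.
Proof. by move=> mA mB AB; rewrite -lee_fin -!volrE//; apply: le_measure; rewrite ?inE. Qed.

Lemma volr_gt0 : 0 < volr [set: M].
Proof. by rewrite -lte_fin -volrE//; exact: measurableT. Qed.

Lemma volr_setI (A B : set M) : measurable (A : set (borel M)) -> measurable (B : set (borel M)) ->
  volr A + volr B - volr [set: M] <= volr (A `&` B).
Proof.
move=> mA mB; have mI : measurable (A `&` B : set (borel M)) by exact: (@measurableI _ (borel M)).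
have mU : measurable (A `|` B : set (borel M)) by exact: (@measurableU _ (borel M)).
have fA : (vol A < +oo)%E by rewrite volrE// ltry.
have AB : vol (A `|` B) = (vol A + vol B - vol (A `&` B))%E by exact: measureUfinl.
have : volr (A `|` B) <= volr [set: M] by apply: volr_le => //; exact: measurableT.
by move: AB; rewrite (volrE mU) (volrE mA) (volrE mB) (volrE mI) => /(congr1 fine)/= ->; lra.
Qed.

Lemma volr_setC (A : set M) : measurable (A : set (borel M)) -> volr (~` A) = volr [set: M] - volr A.
Proof.
move=> mA; have mC : measurable (~` A : set (borel M)) by exact: (@measurableC _ (borel M)).
have : vol (A `|` ~` A) = (vol A + vol (~` A))%E by apply: measureU => //; exact: setICr.
rewrite setUv.
have mT : measurable ([set: M] : set (borel M)) by exact: measurableT.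
by rewrite (volrE mA) (volrE mC) (volrE mT) -EFinD => -[->]; lra.
Qed.

Lemma above_anti l (c c' : R) : c <= c' -> above l c' `<=` above l c.
Proof. by move=> cc y; exact: le_trans. Qed.

(** The sets where the functional is at least - 1 / (n + 1) decrease to [above l 0], and the volume
    is finite. *)
Lemma volr_above_outer l (c : R) : volr (above l 0) < c -> exists2 d, 0 < d & volr (above l (- d)) < c.
Proof.
move=> Hc; pose U n := above l (- n.+1%:R^-1).
have UE : above l 0 = \bigcap_n U n.
  apply/seteqP; split => y Hy; first by move=> n _; apply: le_trans Hy; rewrite oppr_le0 invr_ge0.
  rewrite /above/= leNgt; apply/negP => y0; have n0 : 0 < - value F l y by rewrite oppr_gt0.
  pose n := Num.bound (- value F l y)^-1.
  have : (- value F l y)^-1 < n.+1%:R.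
    by apply: lt_trans (archi_boundP _) _; rewrite ?invr_ge0 ?(ltW n0)// ltr_nat.
  rewrite -ltf_pV2 ?posrE ?invr_gt0// invrK => H.
  by have := Hy n I; rewrite /U/above/= leNgt ltrNr H.
have mU n : measurable (U n : set (borel M)) by exact: above_measurable.
have : (vol \o U) @ \oo --> vol (\bigcap_n U n).
  apply: (@nonincreasing_cvg_mu _ (borel M)) => //.
  - by rewrite volrE// ltry.
  - by rewrite -UE; exact: above_measurable.
  - move=> i j ij; apply/subsetPset; apply: above_anti; rewrite lerN2 lef_pV2 ?posrE//.
    by rewrite ler_nat.
rewrite -UE => cU.
have nb : nbhs (vol (above l 0)) [set z | (z < c%:E)%E].
  apply: open_nbhs_nbhs; split; first exact: open_ereal_lt_ereal.
  by rewrite /= volrE ?lte_fin//; exact: above_measurable.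
have [N _ /(_ N (leqnn N))] := cU _ nb; rewrite /= volrE// lte_fin => HN.
by exists N.+1%:R^-1 => //; rewrite invr_gt0.
Qed.

Lemma volr_above_inner l (c : R) : c < volr [set y | 0 < value F l y] -> exists2 d, 0 < d & c < volr (above l d).
Proof.
move=> Hc; pose U n := above l (n.+1%:R^-1).
have UE : [set y | 0 < value F l y] = \bigcup_n U n.
  apply/seteqP; split => y /=; last first.
    by move=> [n _]; rewrite /U/above/=; apply: lt_le_trans; rewrite invr_gt0.
  move=> y0; pose n := Num.bound (value F l y)^-1.
  have H : (value F l y)^-1 < n.+1%:R.
    by apply: lt_trans (archi_boundP _) _; rewrite ?invr_ge0 ?(ltW y0)// ltr_nat.
  by exists n => //; move: H; rewrite -ltf_pV2 ?posrE ?invr_gt0// invrK => /ltW.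
have mU n : measurable (U n : set (borel M)) by exact: above_measurable.
have mU' : measurable (\bigcup_n U n : set (borel M)) by exact: (@bigcupT_measurable _ (borel M)).
have : (vol \o U) @ \oo --> vol (\bigcup_n U n).
  apply: (@nondecreasing_cvg_mu _ (borel M)) => //.
  move=> i j ij; apply/subsetPset; apply: above_anti; rewrite lef_pV2 ?posrE//.
  by rewrite ler_nat.
move=> cU; rewrite UE in Hc.
have nb : nbhs (vol (\bigcup_n U n)) [set z | (c%:E < z)%E].
  apply: open_nbhs_nbhs; split; first exact: open_ereal_gt_ereal.
  by rewrite /= volrE ?lte_fin.
have [N _ /(_ N (leqnn N))] := cU _ nb; rewrite /= volrE// lte_fin => HN.
by exists N.+1%:R^-1 => //; rewrite invr_gt0.
Qed.

Lemma volr_positive l : l != 0 -> volr [set y | 0 < value F l y] = volr (above l 0).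
Proof.
move=> l0; have mP : measurable ([set y | 0 < value F l y] : set (borel M)).
  apply: borel_open; apply: (@open_comp _ _ (value F l) [set r : R | 0 < r]); last exact: open_gt.
  by move=> y _; exact: (value_continuous HT).
have mZ : measurable ([set y | value F l y = 0] : set (borel M)).
  by apply: borel_closed; exact: (cut_zero_closed HT).
rewrite /volr; have -> : above l 0 = [set y | 0 < value F l y] `|` [set y | value F l y = 0].
  apply/seteqP; split => y; rewrite /above/=.
    by rewrite le_eqVlt => /predU1P[->|]; [right|left].
  by move=> [/ltW//|->]; exact: lexx.
have PZ : [set y | 0 < value F l y] `&` [set y | value F l y = 0] = set0.
  by apply/seteqP; split => // y [/= + E]; rewrite E ltxx.
set P := [set y | 0 < value F l y] in mP PZ *; set Z := [set y | value F l y = 0] in mZ PZ *.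
have -> : vol (P `|` Z) = (vol P + vol Z)%E by exact: (measureU vol mP mZ PZ).
by rewrite (cut_null hm HT hl hvolE hcompact l0) adde0.
Qed.

Lemma frame_bounded : exists2 B : R, 0 < B & forall y, `|F y| <= B.
Proof.
have [B HB] : exists B : R, forall y, [set: M] y -> `|F y| <= B.
  apply: (compact_open_ind (P := fun A => exists B : R, forall y, A y -> `|F y| <= B) hcompact).
  - move=> x; have dF : devel K b F (chart_at G x) x by apply/devel_atP; exists (T x).
    have n1 := devel_near_cont (chart_atP G x) dF (@ltr01 R).
    exists [set z | nbhs z [set z' | `|F z' - F x| < 1]].
      by split=> //; rewrite openE => z Hz; exact: nbhs_interior Hz.
    exists (1 + `|F x|) => y /nbhs_singleton/= Hy.
    by rewrite -[F y](subrK (F x)); apply: le_trans (ler_normD _ _) _; rewrite lerD2r ltW.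
  - by exists 0.
  - move=> A A' [B HB] [B' HB']; exists (Num.max B B') => y [/HB|/HB'] H; rewrite le_max H ?orbT//.
exists (B + 1); last by move=> y; apply: le_trans (HB y I) _; rewrite lerDl.
by rewrite ltr_wpDl//; apply: le_trans (HB point I).
Qed.

(** F is bounded on M, so a small change of the functional changes all its values uniformly. *)
Lemma value_close l (d : R) : 0 < d -> \forall l' \near l, forall y, `|value F l' y - value F l y| <= d.
Proof.
move=> d0; have [B B0 HB] := frame_bounded.
have C0 : 0 < (1 + m)%:R * B by rewrite mulr_gt0.
have e0 : 0 < d / ((1 + m)%:R * B) by rewrite divr_gt0.
apply: filterS (ball_near l e0) => l' Hl y.
rewrite /value -oppmxE -addmxE -mulmxBr; apply: le_trans (ler_mxentry _ _ _) _.
apply: le_trans (mxnorm_mul _ _) _.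
have H1 : (1 + m)%:R * `|F y| <= (1 + m)%:R * B by rewrite ler_wpM2l.
apply: le_trans (ler_wpM2r _ H1) _; first exact: normr_ge0.
by rewrite mulrC -ler_pdivlMr// ltW.
Qed.

(** A sandwich between [above l (- d)] and [above l d']. The inner approximation reaches the open
    half-space only; [volr_positive], that is the nullity of the cut, closes the gap. *)
Lemma volr_above_near l (e : R) : l != 0 -> 0 < e ->
  \forall l' \near l, `|volr (above l' 0) - volr (above l 0)| < e.
Proof.
move=> l0 e0.
have [d d0 Hd] : exists2 d, 0 < d & volr (above l (- d)) < volr (above l 0) + e.
  by apply: volr_above_outer; rewrite ltrDl.
have [d' d'0 Hd'] : exists2 d, 0 < d & volr (above l 0) - e < volr (above l d).
  by apply: volr_above_inner; rewrite volr_positive// gtrBl.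
apply: filterS (filterI (value_close l d0) (value_close l d'0)) => l' [H H'].
have m0 := above_measurable l' 0.
have h1 : volr (above l' 0) <= volr (above l (- d)).
  apply: volr_le => //; first exact: above_measurable.
  by move=> y; rewrite /above/=; have := H y; rewrite ler_norml; lra.
have h2 : volr (above l d') <= volr (above l' 0).
  apply: volr_le => //; first exact: above_measurable.
  by move=> y; rewrite /above/=; have := H' y; rewrite ler_norml; lra.
by rewrite ltr_norml; apply/andP; split; lra.
Qed.

Lemma aboveZ l (s : R) : 0 < s -> above (s *: l) 0 = above l 0.
Proof.
move=> s0; apply/seteqP; split => y; rewrite /above/= /value -scalemxAr scalemx_entry.
  by rewrite pmulr_rge0.
by move=> H; rewrite pmulr_rge0.
Qed.

Lemma cut_ratioE x v : unit_tangent G x v -> cut_ratio G vol x v = volr (above (normal G T x v) 0) / volr [set: M].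
Proof. by move=> v1; rewrite /cut_ratio (half_spaceE hcurv K0 hconvex HT v1). Qed.

Lemma tangent_norm_gt0 x u : u != 0 -> 0 < tangent_norm G x u.
Proof. by move=> u0; rewrite sqrtr_gt0; exact: gram_pos. Qed.

Lemma tangent_normZ x (s : R) u : 0 <= s -> tangent_norm G x (s *: u) = s * tangent_norm G x u.
Proof.
move=> s0; rewrite /tangent_norm /tangent_dot /gdot trmxZ -!scalemxAl -scalemxAr !scalemx_entry.
by rewrite mulrA sqrtrM ?mulr_ge0// -expr2 sqrtr_sqr ger0_norm.
Qed.

Lemma unit_normalize x u : u != 0 -> unit_tangent G x ((tangent_norm G x u)^-1 *: u).
Proof.
move=> u0; have n0 := tangent_norm_gt0 x u0.
by rewrite /unit_tangent/= tangent_normZ ?invr_ge0 ?(ltW n0)// mulVf// gt_eqF.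
Qed.

Lemma volr_normal_scale x u : u != 0 ->
  volr (above (normal G T x u) 0) = volr (above (normal G T x ((tangent_norm G x u)^-1 *: u)) 0).
Proof. by move=> u0; rewrite normalZ aboveZ// invr_gt0 tangent_norm_gt0. Qed.

Lemma normal_nonzero x u : u != 0 -> normal G T x u != 0.
Proof.
move=> u0; have := normal_neq0 HT (unit_normalize x u0).
by apply: contra => /eqP H; rewrite normalZ H scaler0.
Qed.

Lemma normal_continuous x : continuous (normal G T x).
Proof.
move=> u; apply: (@mxcurve_continuous R 'rV[R]_m) => i j.
rewrite (_ : (fun u => _) = (fun u : 'rV[R]_m => \sum_k invmx (T x) i k * (col_mx 0 (gram G x *m u^T)) k j)); last first.
  by apply/funext => w; rewrite mxE.
apply: cont_sum => k; apply: contM; first exact: cont_cst.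
case: (split_ordP k) => k' ->.
  rewrite (_ : (fun u => _) = fun=> 0); first exact: cont_cst.
  by apply/funext => w; rewrite col_mxEu mxE.
rewrite (_ : (fun u => _) = (fun u : 'rV[R]_m => \sum_q gram G x k' q * u j q)); last first.
  by apply/funext => w; rewrite col_mxEd mxE; apply: eq_bigr => q _; rewrite [X in _ * X]mxE.
by apply: cont_sum => q; apply: contM; [exact: cont_cst|exact: cont_coord].
Qed.

(** The minimum is taken over the unit sphere of the maximum norm, whose compactness is immediate;
    the half-space depends on the direction of u only, so rescaling to unit tangent vectors loses
    nothing. *)
Lemma cut_minimum x : exists a, is_minimum [set cut_ratio G vol x v | v in unit_tangent G x] a.
Proof.
pose S : set 'rV[R]_m := [set u | `|u| = 1].
have cS : compact S.
  apply: bounded_closed_compact.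
    by exists 1; split => // r r1 u /= ->; exact: ltW.
  by apply: (@preimage_closed _ _ (fun u : 'rV[R]_m => `|u|) [set r : R | r = 1]); [move=> u _; exact: norm_continuous|exact: closed_eq].
pose w := fun u => volr (above (normal G T x u) 0).
have nz u : S u -> u != 0 by move=> Su; rewrite -normr_eq0 Su oner_eq0.
have normS u : u != 0 -> S (`|u|^-1 *: u).
  by move=> u0; rewrite /S/= normrZ ger0_norm ?invr_ge0// mulVf// normr_eq0.
have S0 : S !=set0.
  exists (`|(delta_mx ord0 (Ordinal hm) : 'rV[R]_m)|^-1 *: delta_mx ord0 (Ordinal hm)); apply: normS.
  apply/eqP => /matrixP/(_ ord0 (Ordinal hm)); rewrite !mxE !eqxx => /eqP; by rewrite oner_eq0.
have [|u c Su cu|u Su Hu] := compact_minimum cS S0 (f := w) (B := 0).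
- by move=> u _; exact: volr_ge0.
- have e0 : 0 < w u - c by rewrite subr_gt0.
  have n1 := near_cont (@normal_continuous x u) (volr_above_near (normal_nonzero x (nz u Su)) e0).
  by apply: filterS n1 => u' + _; rewrite -/(w u') -/(w u) ltr_norml; lra.
have V0 := volr_gt0.
exists (w u / volr [set: M]); split.
  exists ((tangent_norm G x u)^-1 *: u); first exact: unit_normalize (nz u Su).
  rewrite cut_ratioE; last exact: unit_normalize (nz u Su).
  by rewrite /w (volr_normal_scale x (nz u Su)).
move=> _ [v v1 <-]; rewrite cut_ratioE// ler_pM2r ?invr_gt0//.
have v0 : v != 0.
  apply/eqP => E; move: v1; rewrite E /unit_tangent/= /tangent_norm /tangent_dot /gdot !mul0mx mxE sqrtr0.
  by move=> /esym/eqP; rewrite oner_eq0.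
apply: le_trans (Hu _ (normS v v0)) _.
by rewrite /w normalZ aboveZ// invr_gt0 normr_gt0.
Qed.

Let e0 : 'cV[R]_(1 + m) := col_mx 1%:M 0.

Lemma value_pole y : value F e0 y = lsubmx (F y) ord0 ord0.
Proof. by rewrite /value -[F y in LHS]hsubmxK mul_row_col mulmx1 mulmx0 addr0. Qed.

Lemma value_pole_gt0 y : 0 < value F e0 y.
Proof. by rewrite value_pole; apply: lt_le_trans (HF1 y). Qed.

Lemma value_sub l l' (s : R) y : value F (l - s *: l') y = value F l y - s * value F l' y.
Proof. by rewrite /value mulmxBr -scalemxAr addmxE oppmxE scalemx_entry. Qed.

(* Tilting a half-space through x towards the pole makes it pass through nearby points. *)
Lemma cut_upper_near x v (c : R) : unit_tangent G x v -> cut_ratio G vol x v < c ->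
  \forall x' \near x, exists2 v', unit_tangent G x' v' & cut_ratio G vol x' v' < c.
Proof.
move=> v1; rewrite cut_ratioE//; have V0 := volr_gt0; rewrite ltr_pdivrMr// => Hc.
have l0 := normal_neq0 HT v1; set l := normal G T x v in Hc l0.
pose L x' := l - (value F l x' / value F e0 x') *: e0.
have lx : value F l x = 0 by exact: value_normal_base.
have Lx : L x = l by rewrite /L lx mul0r scale0r subr0.
have cL : {for x, continuous L}.
  apply: (@mxcurve_continuous R M) => i j.
  rewrite (_ : (fun u : M => _) = (fun x' : M => l i j + - e0 i j * (value F l x' * (value F e0 x')^-1))); last first.
    by apply/funext => x'; rewrite /L [LHS]mxE; congr (_ + _); rewrite [LHS]mxE [X in - X]mxE; ring.
  apply: contD; first exact: cont_cst.
  apply: contM; first exact: cont_cst.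
  apply: contM; first exact: (value_continuous HT).
  by apply: cont_inv; [rewrite gt_eqF// value_pole_gt0|exact: (value_continuous HT)].
have n1 : \forall l' \near L x, volr (above l' 0) < c * volr [set: M] /\ l' != 0.
  rewrite Lx; apply: filterI; last first.
    have nl : 0 < `|l| by rewrite normr_gt0.
    apply: filterS (ball_near l nl) => l'; apply: contraTneq => ->.
    by rewrite sub0r normrN ltxx.
  have ee : 0 < c * volr [set: M] - volr (above l 0) by rewrite subr_gt0.
  by apply: filterS (volr_above_near l0 ee) => l'; rewrite ltr_norml; lra.
apply: filterS (near_cont cL n1) => x' [Hx' L0].
have Lx' : value F (L x') x' = 0 by rewrite value_sub divfK ?subrr// gt_eqF// value_pole_gt0.
have [v' [s [v'1 s0 E]]] := exists_normal HT L0 Lx'.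
by exists v' => //; rewrite cut_ratioE// E aboveZ// ltr_pdivrMr.
Qed.

Let big l := m%:R / (m%:R + 1) * volr [set: M] < volr (above l 0).

(** Each complement has relative volume less than 1 / (m + 1), so at most m + 1 of them cannot cover
    M. *)
Lemma big_meet k (l : 'I_k -> 'cV[R]_(1 + m)) : (k <= 1 + m)%N -> (forall i, big (l i)) ->
  exists y, forall i, 0 <= value F (l i) y.
Proof.
move=> km Hl; have V0 := volr_gt0; set V := volr [set: M] in V0.
have [k0|k0] := posnP k; first by exists point => -[i ik]; exfalso; move: ik; rewrite k0.
have m1 : 0 < m%:R + 1 :> R by rewrite ltr_wpDl.
pose I (r : seq 'I_k) : set M := [set y | forall i, i \in r -> 0 <= value F (l i) y].
have H (r : seq 'I_k) : measurable (I r : set (borel M)) /\ V - \sum_(i <- r) (V - volr (above (l i) 0)) <= volr (I r).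
  elim: r => [|i r [mI IH]].
    have -> : I [::] = setT by apply/seteqP; split.
    by rewrite big_nil subr0; split; [exact: measurableT|exact: lexx].
  have -> : I (i :: r) = above (l i) 0 `&` I r.
    apply/seteqP; split => y Hy.
      by split=> [|j jr]; apply: Hy; rewrite inE ?eqxx ?jr ?orbT.
    by move=> j; rewrite inE => /predU1P[->|jr]; [exact: Hy.1|exact: Hy.2].
  have mA := above_measurable (l i) 0; split; first exact: (@measurableI _ (borel M)).
  by rewrite big_cons; have := volr_setI mA mI; rewrite -/V; move: IH; lra.
have [_ Hv] := H (index_enum 'I_k).
have lt1 i : V - volr (above (l i) 0) < V / (m%:R + 1).
  have := Hl i; rewrite /big -/V.
  have -> : m%:R / (m%:R + 1) * V = V - V / (m%:R + 1) :> R by field; rewrite gt_eqF.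
  lra.
have sumlt : \sum_i (V - volr (above (l i) 0)) < V.
  apply: (@lt_le_trans _ _ (\sum_(i < k) V / (m%:R + 1))).
    apply: ltr_sum => //; apply/hasP; exists (Ordinal k0) => //; exact: mem_index_enum.
  rewrite sumr_const card_ord -[leLHS]mulr_natr mulrAC ler_pdivrMr// ler_pM2l//.
  by rewrite natr1 -[m.+1]add1n ler_nat.
have Vp : 0 < volr (I (index_enum 'I_k)) by apply: lt_le_trans Hv; rewrite subr_gt0.
have [y Hy] : I (index_enum 'I_k) !=set0.
  by apply/set0P/eqP => E; move: Vp; rewrite E /volr measure0 ltxx.
by exists y => i; apply: Hy; exact: mem_index_enum.
Qed.

(** Otherwise finitely many complements of big half-spaces cover M by compactness, against
    [helly]. *)
Lemma center_exists : exists x, forall l, big l -> 0 <= value F l x.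
Proof.
apply: contrapT => H.
have [s [sb Hs]] : exists s : seq 'cV[R]_(1 + m), (forall l, l \in s -> big l) /\
    forall y, [set: M] y -> exists2 l, l \in s & value F l y < 0.
  apply: (compact_open_ind (P := fun A => exists s : seq 'cV[R]_(1 + m), (forall l, l \in s -> big l) /\
    forall y, A y -> exists2 l, l \in s & value F l y < 0) hcompact).
  - move=> x; have [l lb lx] : exists2 l, big l & value F l x < 0.
      apply: contrapT => Hx; apply: H; exists x => l lb; rewrite leNgt; apply/negP => lx.
      by apply: Hx; exists l.
    exists [set y | value F l y < 0].
      split=> //; apply: (@open_comp _ _ (value F l) [set r : R | r < 0]); last exact: open_lt.
      by move=> y _; exact: (value_continuous HT).
    exists [:: l]; split; first by move=> l'; rewrite inE => /eqP ->.
    by move=> y Hy; exists l; rewrite // inE.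
  - by exists [::].
  - move=> A B [s [sb Hs]] [s' [s'b Hs']]; exists (s ++ s'); split.
      by move=> l; rewrite mem_cat => /orP[/sb|/s'b].
    by move=> y [/Hs|/Hs'] [l ls ly]; exists l; rewrite // mem_cat ls ?orbT.
have [||y Hy] := @helly _ _ _ _ _ hcurv K0 hconvex _ _ _ HT HF1 big _ (size s) (fun i => nth 0 s i).
- by move=> k l km Hl; exact: big_meet.
- by move=> i; apply: sb; exact: mem_nth.
have [l ls] := Hs y I; rewrite ltNge => /negP; apply.
by have := Hy (Ordinal (ltac:(by rewrite index_mem) : (index l s < size s)%N)); rewrite /= nth_index.
Qed.

(** A light half-space at x has a heavy open complement, most of which is still contained in {l >=
    d} for some d > 0. Subtracting d / B times the pole functional, with B a bound of F, keeps l
    nonnegative on this set and makes it negative at x. *)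
Lemma center_cut : exists x, forall v, unit_tangent G x v -> 1 / (m%:R + 1) <= cut_ratio G vol x v.
Proof.
have V0 := volr_gt0; set V := volr [set: M] in V0.
have m1 : 0 < m%:R + 1 :> R by rewrite ltr_wpDl.
have [x Hx] := center_exists; exists x => v v1; rewrite leNgt; apply/negP.
rewrite cut_ratioE// -/V ltr_pdivrMr// => Hv; set n := normal G T x v in Hv.
have nx : value F n x = 0 by exact: value_normal_base.
pose l := - n; have lE y : value F l y = - value F n y by rewrite /value mulmxN oppmxE.
have Hl : m%:R / (m%:R + 1) * V < volr [set y | 0 < value F l y].
  have -> : [set y | 0 < value F l y] = ~` above n 0.
    by apply/seteqP; split => y; rewrite /above/= lE oppr_gt0 ltNge => /negP.
  rewrite volr_setC; last exact: above_measurable.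
  have -> : m%:R / (m%:R + 1) * V = V - 1 / (m%:R + 1) * V :> R by field; rewrite gt_eqF.
  by rewrite -/V; move: Hv; lra.
have [d d0 Hd] := volr_above_inner Hl.
have [B B0 HB] := frame_bounded.
have Hb : big (l - (d / B) *: e0).
  apply: lt_le_trans Hd _; apply: volr_le; [exact: above_measurable|exact: above_measurable|].
  move=> y; rewrite /above/= value_sub subr_ge0; apply: le_trans.
  have : value F e0 y <= B.
    rewrite value_pole mxE; apply: le_trans (ler_norm _) _.
    by apply: le_trans (ler_mxentry _ _ _) (HB y).
  by move=> H; rewrite mulrAC ler_pdivrMr// ler_pM2l.
have := Hx _ Hb; rewrite value_sub lE nx oppr0 sub0r oppr_ge0 leNgt.
by rewrite mulr_gt0 ?divr_gt0// value_pole_gt0.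
Qed.

(** The minimum over v is upper semicontinuous in x by [cut_upper_near], so it attains its maximum,
    which is at least its value at the point of [center_cut]. *)
Lemma fair_cut_index_bound : exists phi : R, is_fair_cut_index G vol phi /\ 1 / (m%:R + 1) <= phi.
Proof.
have /choice[f Hf] := cut_minimum.
have V0 := volr_gt0.
have f1 x : f x <= 1.
  have [[v v1 <-] _] := Hf x; rewrite cut_ratioE// ler_pdivrMr// mul1r.
  by apply: volr_le; [exact: above_measurable|exact: measurableT|].
have [||x c _ cx|x0 _ Hx0] := compact_minimum hcompact (f := fun x => - f x) (B := -1).
- by exists point.
- by move=> x _; rewrite lerN2.
- have [[v v1 E] _] := Hf x; have Hc : cut_ratio G vol x v < - c by rewrite E ltrNr.
  apply: filterS (cut_upper_near v1 Hc) => y [v' v'1 Hv'] _; rewrite ltrNr; apply: le_lt_trans Hv'.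
  by have [_] := Hf y; apply; exists v'.
exists (f x0); split.
  exists f; split=> //; split; first by exists x0.
  by move=> _ [x _ <-]; rewrite -lerN2; exact: Hx0.
have [xc Hc] := center_cut; have [[v v1 E] _] := Hf xc.
by apply: (@le_trans _ _ (f xc)); [rewrite -E; exact: Hc|rewrite -lerN2; exact: Hx0].
Qed.

End FairCutIndex.

Section InteriorPoint.
Context {R : realType} {m : nat}.
Hypothesis hm : (0 < m)%N.
Context {M : topologicalType}.
Variables (G : riemannian_manifold R m M).

(** Moving a little along the first coordinate direction of a chart leaves the boundary. *)
Lemma interior_point_exists (x : M) : exists x0, interior_pt G x0.
Proof.
have cx := chart_atP G x; set c := chart_at G x in cx.
have [_ ha] := chart_regular cx; set a := chart_map c x in ha.
have [Ia _] := chart_map_img cx; rewrite -/a in Ia.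
pose e : 'rV[R]_m := delta_mx ord0 (Ordinal hm).
have ce : {for (0 : R), continuous (fun t : R => a + t *: e)}.
  apply: mxcurve_continuous => i j.
  rewrite (_ : (fun s => _) = (fun s : R => a i j + s * e i j)).
    by apply: contD; [exact: cont_cst|apply: contM; [exact: cvg_id|exact: cont_cst]].
  by apply/funext => s; rewrite [LHS]mxE; congr (_ + _); rewrite [LHS]mxE.
have nI : nbhs (a + 0 *: e) (img c).
  by rewrite scale0r addr0; apply: open_nbhs_nbhs; split => //; exact: img_open.
have [t /andP[t0 _] It] := near_pick_right (near_cont ce nI).
have vp : 0 < (a + t *: e) ord0 (Ordinal hm).
  rewrite addmxE scalemx_entry (_ : e ord0 _ = 1); last by rewrite mxE !eqxx.
  by rewrite mulr1 ltr_wpDl//; apply/(halfspaceP hm).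
have hv := pos_halfspace vp; have pv := param_dom (conj It hv).
by exists (param c (a + t *: e)); apply: (positive_interior (hm := hm) pv); rewrite paramK.
Qed.

End InteriorPoint.

Theorem theorem3 (R : realType) (m : nat) (hm : (0 < m)%N)
    (M : ptopologicalType) (G : riemannian_manifold R m M)
    (vol : {measure set (borel M) -> \bar R})
    (hvol : is_riemannian_volume G vol)
    (hcompact : compact [set: M])
    (hconvex : convex_manifold G)
    (K : R) (hK : K <= 0) (hcurv : constant_sectional_curvature G K) :
  exists phi : R, is_fair_cut_index G vol phi /\ 1 / (m%:R + 1) <= phi.
Proof.
have [lambda hl hvolE] := hvol.
have [x0 hx0] := interior_point_exists hm G point.
have /choice[T HT] y := (devel_atP _ _ _ _ _).1 (good_all hm hcurv hK hconvex hx0 y).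
apply: (fair_cut_index_bound hm hcurv hK hconvex hcompact HT _ hl hvolE).
  by move=> y; rewrite row_mxKl mxE mulr1n; exact: coshk_ge1.
exact: (volume_pos hm hl hvolE hx0).
Qed.
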